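(* Let $p$ be an odd prime and $\Gamma$ a non-trivial group of order $p^n$ for some natural number $n$. For $R\in\{\mathbb{Z},\mathbb{Z}_p\}$ with fraction field $Q$, set $\mathrm{DT}(R[\Gamma]):=K_0(R[\Gamma],Q[\Gamma])_{\rm tor}$. Then: (i) the exponent of $\mathrm{DT}(\mathbb{Z}[\Gamma])$ is divisible by $p-1$ and divides $(1-1/p)|\Gamma|$; (ii) writing $\Xi(\Gamma)$ for the set of normal subgroups of $\Gamma$ that are kernels of irreducible (complex) characters of $\Gamma$, the exponent of the kernel of the diagonal projection map $\mathrm{DT}(\mathbb{Z}[\Gamma])\to\bigoplus_{\Delta\in\Xi(\Gamma)}\mathrm{DT}(\mathbb{Z}[\Gamma/\Delta])$ divides $|\Gamma|/p$; (iii) claims (i) and (ii) remain valid if $\mathbb{Z}$ is replaced by $\mathbb{Z}_p$ (and $\mathbb{Q}$ by $\mathbb{Q}_p$).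
   Context: For a finite group $\Gamma$, a Dedekind domain $R$ of characteristic zero with fraction field $Q$, $K_0(R[\Gamma],Q[\Gamma])$ denotes the relative algebraic $K_0$-group of the ring inclusion $R[\Gamma]\subseteq Q[\Gamma]$: it is generated by triples $[P,\phi,P']$ with $P,P'$ finitely generated projective $R[\Gamma]$-modules and $\phi:Q\otimes_R P\cong Q\otimes_R P'$ a $Q[\Gamma]$-module isomorphism, subject to the usual relations. The subscript ''tor'' denotes the torsion subgroup. For a normal subgroup $\Delta$, the projection map $\mathrm{DT}(R[\Gamma])\to\mathrm{DT}(R[\Gamma/\Delta])$ is induced by $[P,\phi,P']\mapsto[R[\Gamma/\Delta]\otimes_{R[\Gamma]}P,\ \mathrm{id}\otimes\phi,\ R[\Gamma/\Delta]\otimes_{R[\Gamma]}P']$. *)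

(* Defs.v *)
From HB Require Import structures.
From mathcomp Require Import all_boot all_order all_algebra all_fingroup.
From mathcomp Require Import all_solvable all_field all_character.
From mathcomp Require Import boolp.

Set Implicit Arguments.
Unset Strict Implicit.
Unset Printing Implicit Defensive.

Import GRing.Theory.
Local Open Scope ring_scope.
Local Open Scope quotient_scope.

Definition gring (R : nzRingType) (gT : finGroupType) : Type := {ffun gT -> R}.

Section GroupRing.
Variables (R : nzRingType) (gT : finGroupType).
Local Notation RG := (gring R gT).

HB.instance Definition _ := GRing.Zmodule.on RG.

Implicit Types x y z : RG.

Definition gring_one : RG := [ffun g : gT => (g == 1%g)%:R : R].
Definition gring_mul x y : RG :=
  [ffun g : gT => \sum_(h : gT) (x : {ffun _ -> R}) h
                                * (y : {ffun _ -> R}) (h^-1 * g)%g].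

Lemma gringDE x y g : (x + y : {ffun _ -> R}) g = x g + y g.
Proof. by rewrite ffunE. Qed.

Lemma gring_mulA : associative gring_mul.
Proof.
move=> x y z; apply/ffunP=> g; rewrite !ffunE.
under eq_bigr => h _ do rewrite ffunE mulr_sumr.
under [RHS]eq_bigr => k _ do rewrite ffunE mulr_suml.
rewrite [RHS]exchange_big /=; apply: eq_bigr => h _.
rewrite (reindex_inj (mulgI (h^-1)%g)) /=; apply: eq_bigr => k _.
by rewrite mulrA invMg invgK -mulgA mulKVg.
Qed.

Lemma gring_mul1l : left_id gring_one gring_mul.
Proof.
move=> x; apply/ffunP=> g; rewrite ffunE (bigD1 1%g) //= ffunE eqxx mul1r.
rewrite invg1 mul1g big1 ?addr0 // => h /negPf h1.
by rewrite ffunE h1 mul0r.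
Qed.

Lemma gring_mul1r : right_id gring_one gring_mul.
Proof.
move=> x; apply/ffunP=> g; rewrite ffunE (bigD1 g) //= ffunE mulVg eqxx mulr1.
rewrite big1 ?addr0 // => h /negPf hg.
by rewrite ffunE -eq_mulVg1 hg mulr0.
Qed.

Lemma gring_mulDl : left_distributive gring_mul +%R.
Proof.
move=> x y z; apply/ffunP=> g; rewrite !ffunE -big_split; apply: eq_bigr => h _.
by rewrite ffunE mulrDl.
Qed.

Lemma gring_mulDr : right_distributive gring_mul +%R.
Proof.
move=> x y z; apply/ffunP=> g; rewrite !ffunE -big_split; apply: eq_bigr => h _.
by rewrite ffunE mulrDr.
Qed.

Lemma gring_1neq0 : gring_one != 0.
Proof.
by apply/eqP=> /ffunP/(_ 1%g); rewrite !ffunE eqxx; apply/eqP; rewrite oner_eq0.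
Qed.

HB.instance Definition _ := GRing.Zmodule_isNzRing.Build RG
  gring_mulA gring_mul1l gring_mul1r gring_mulDl gring_mulDr gring_1neq0.

Lemma gringME x y g :
  (x * y : {ffun _ -> R}) g = \sum_(h : gT) x h * y (h^-1 * g)%g.
Proof. by rewrite ffunE. Qed.

Lemma gring1E g : (1 : RG) g = (g == 1%g)%:R.
Proof. by rewrite ffunE. Qed.

End GroupRing.

Section CoefMap.
Variables (R S : nzRingType) (f : {rmorphism R -> S}) (gT : finGroupType).

Definition gring_map (x : gring R gT) : gring S gT := [ffun g : gT => f (x g)].

Lemma gring_map_zmod : zmod_morphism gring_map.
Proof. by move=> x y; apply/ffunP=> g; rewrite !ffunE raddfB. Qed.

Lemma gring_map_monoid : monoid_morphism gring_map.
Proof.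
split=> [|x y]; apply/ffunP=> g; rewrite !ffunE ?rmorph_nat //.
by rewrite rmorph_sum; apply: eq_bigr => h _; rewrite rmorphM !ffunE.
Qed.

HB.instance Definition _ :=
  GRing.isZmodMorphism.Build (gring R gT) (gring S gT) gring_map gring_map_zmod.
HB.instance Definition _ :=
  GRing.isMonoidMorphism.Build (gring R gT) (gring S gT) gring_map
    gring_map_monoid.
End CoefMap.

Section QuotMap.
Variables (R : nzRingType) (gT : finGroupType) (D : {group gT}).

Definition gring_proj (nD : (D <| [set: gT])%g) (x : gring R gT) :
    gring R (coset_of D) :=
  [ffun c : coset_of D => \sum_(g : gT | coset D g == c) x g].

Variable nD : (D <| [set: gT])%g.

Lemma gring_proj_zmod : zmod_morphism (gring_proj nD).
Proof.
move=> x y; apply/ffunP=> c; rewrite !ffunE -sumrB; apply: eq_bigr => g _.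
by rewrite !ffunE.
Qed.

Lemma gring_proj_monoid : monoid_morphism (gring_proj nD).
Proof.
have nDT g : g \in 'N(D)%g by apply: (subsetP (normal_norm nD)); rewrite inE.
split=> [|x y]; apply/ffunP=> c.
  rewrite !ffunE; case: eqP => [->|c1].
    rewrite (bigD1 1%g) /= ?morph1 // ffunE eqxx big1 ?addr0 //.
    by move=> g /andP[_ /negPf g1]; rewrite ffunE g1.
  rewrite big1 // => g /eqP gc; rewrite ffunE; case: eqP => // g1.
  by case: c1; rewrite -gc g1 morph1.
rewrite !ffunE.
under eq_bigr => g _ do rewrite ffunE.
rewrite exchange_big /= (partition_big (coset D) predT) //=.
apply: eq_bigr => d _; rewrite !ffunE mulr_suml; apply: eq_bigr => h /eqP hd.
rewrite mulr_sumr (reindex_inj (mulgI h)) /=.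
apply: eq_big => k; last by rewrite mulKg.
by rewrite morphM //= hd (can2_eq (mulKg d) (mulKVg d)).
Qed.

HB.instance Definition _ :=
  GRing.isZmodMorphism.Build (gring R gT) (gring R (coset_of D)) (gring_proj nD)
    gring_proj_zmod.
HB.instance Definition _ :=
  GRing.isMonoidMorphism.Build (gring R gT) (gring R (coset_of D))
    (gring_proj nD) gring_proj_monoid.
End QuotMap.

Lemma gring_map_proj (R S : nzRingType) (f : {rmorphism R -> S})
    (gT : finGroupType) (D : {group gT}) (nD : (D <| [set: gT])%g) (x : gring R gT) :
  gring_map f (gring_proj nD x) = gring_proj nD (gring_map f x).
Proof.
apply/ffunP=> c; rewrite !ffunE rmorph_sum.
by apply: eq_bigr => g _; rewrite ffunE.
Qed.

Section Modules.
Variable A : pzRingType.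

Definition fin_gen (P : lmodType A) : Prop :=
  exists (n : nat) (e : 'I_n -> P),
    forall x : P, exists c : 'I_n -> A, x = \sum_i c i *: e i.

Definition projective (P : lmodType A) : Prop :=
  forall (M N : lmodType A) (g : {linear M -> N}) (h : {linear P -> N}),
    (forall y, exists x, g x = y) -> exists k : {linear P -> M}, g \o k =1 h.

Record fgproj := FGProj {
  fgproj_mod :> lmodType A;
  fgproj_fin_gen : fin_gen fgproj_mod;
  fgproj_projective : projective fgproj_mod
}.

Definition short_exact (M N L : lmodType A)
    (i : {linear M -> N}) (q : {linear N -> L}) : Prop :=
  [/\ injective i, forall y, q y = 0 <-> (exists x, i x = y)
    & forall z, exists y, q y = z].

End Modules.
Arguments fgproj_projective {A} f.
Arguments fgproj_fin_gen {A} f.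

(* The tensor product B (x)_A P for a ring morphism f : A -> B and a left
   A-module P, where B is a right A-module through f.  A sequence of pairs
   stands for the sum of the corresponding pure tensors. *)
Section BaseChange.
Variables (A B : pzRingType) (f : {rmorphism A -> B}) (P : lmodType A).

Inductive tens_eq : seq (B * P) -> seq (B * P) -> Prop :=
| tens_refl s : tens_eq s s
| tens_sym s t : tens_eq s t -> tens_eq t s
| tens_trans t s u : tens_eq s t -> tens_eq t u -> tens_eq s u
| tens_cat s s' t t' :
    tens_eq s s' -> tens_eq t t' -> tens_eq (s ++ t) (s' ++ t')
| tens_catC s t : tens_eq (s ++ t) (t ++ s)
| tens_opp b x : tens_eq [:: (b, x); (- b, x)] [::]
| tens_addl b b' x : tens_eq [:: (b + b', x)] [:: (b, x); (b', x)]
| tens_addr b x x' : tens_eq [:: (b, x + x')] [:: (b, x); (b, x')]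
| tens_bal b a x : tens_eq [:: (b * f a, x)] [:: (b, a *: x)].

Definition tens_eqb : rel (seq (B * P)) := fun s t => `[< tens_eq s t >].

Lemma tens_eqb_refl : reflexive tens_eqb.
Proof. by move=> s; apply/asboolP/tens_refl. Qed.
Lemma tens_eqb_sym : symmetric tens_eqb.
Proof. by move=> s t; apply/asboolP/asboolP; apply: tens_sym. Qed.
Lemma tens_eqb_trans : transitive tens_eqb.
Proof.
move=> t s u /asboolP st /asboolP tu; apply/asboolP; exact: tens_trans st tu.
Qed.

Canonical tens_equiv := EquivRel tens_eqb tens_eqb_refl tens_eqb_sym
                                 tens_eqb_trans.

Definition tens : Type := {eq_quot tens_equiv}.
HB.instance Definition _ := Choice.on tens.

Definition tens_of (s : seq (B * P)) : tens := \pi_({eq_quot tens_equiv}) s.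
Definition tens_rep (x : tens) : seq (B * P) :=
  generic_quotient.repr (x : {eq_quot tens_equiv}).

Lemma tens_repK : cancel tens_rep tens_of.
Proof. by move=> x; rewrite /tens_of /tens_rep reprK. Qed.

Lemma tens_ofP s t : tens_of s = tens_of t <-> tens_eq s t.
Proof.
rewrite /tens_of; split=> [/eqmodP/asboolP //|st].
by apply/eqmodP/asboolP.
Qed.

Lemma tens_rep_of s : tens_eq (tens_rep (tens_of s)) s.
Proof. by apply/tens_ofP; rewrite tens_repK. Qed.

Lemma tensW (K : tens -> Prop) : (forall s, K (tens_of s)) -> forall x, K x.
Proof. by move=> Ks x; rewrite -(tens_repK x). Qed.

Definition tscale_seq (c : B) (s : seq (B * P)) :=
  [seq (c * u.1, u.2) | u <- s].

Lemma tscale_seq_eq c s t :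
  tens_eq s t -> tens_eq (tscale_seq c s) (tscale_seq c t).
Proof.
elim=> {s t} /=.
- by move=> s; apply: tens_refl.
- by move=> s t _; apply: tens_sym.
- by move=> t s u _ ? _; apply: tens_trans.
- by move=> s s' t t' _ ? _ ?; rewrite /tscale_seq !map_cat; apply: tens_cat.
- by move=> s t; rewrite /tscale_seq !map_cat; apply: tens_catC.
- by move=> b x; rewrite mulrN; apply: tens_opp.
- by move=> b b' x; rewrite mulrDr; apply: tens_addl.
- by move=> b x x'; apply: tens_addr.
- by move=> b a x; rewrite mulrA; apply: tens_bal.
Qed.

Definition tadd (x y : tens) := tens_of (tens_rep x ++ tens_rep y).
Definition tzero := tens_of [::].
Definition tscale (c : B) (x : tens) := tens_of (tscale_seq c (tens_rep x)).
Definition topp (x : tens) := tscale (-1) x.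

Lemma taddE s t : tadd (tens_of s) (tens_of t) = tens_of (s ++ t).
Proof. by apply/tens_ofP/tens_cat; apply: tens_rep_of. Qed.

Lemma tscaleE c s : tscale c (tens_of s) = tens_of (tscale_seq c s).
Proof. by apply/tens_ofP/tscale_seq_eq/tens_rep_of. Qed.

Lemma taddA : associative tadd.
Proof.
elim/tensW=> s; elim/tensW=> t; elim/tensW=> u.
by rewrite !taddE catA.
Qed.
Lemma taddC : commutative tadd.
Proof.
elim/tensW=> s; elim/tensW=> t; rewrite !taddE.
by apply/tens_ofP/tens_catC.
Qed.
Lemma tadd0 : left_id tzero tadd.
Proof. by elim/tensW=> s; rewrite taddE. Qed.
Lemma taddN : left_inverse tzero topp tadd.
Proof.
elim/tensW=> s; rewrite /topp tscaleE taddC taddE; apply/tens_ofP.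
elim: s => [|[b x] s IHs] /=; first exact: tens_refl.
rewrite mulN1r; set u := (b, x); set v := (- b, x).
apply: (tens_trans (t := [:: u; v] ++ (s ++ tscale_seq (-1) s))).
  rewrite -[u :: _]/([:: u] ++ _) -[[:: u; v] ++ _]/([:: u] ++ (_ :: _)).
  apply: tens_cat; first exact: tens_refl.
  rewrite -cat1s -[v :: (_ ++ _)]/(([:: v] ++ _) ++ _) !catA.
  by apply: tens_cat; [apply: tens_catC | apply: tens_refl].
by rewrite -[[::]]/([::] ++ [::]); apply: tens_cat => //; apply: tens_opp.
Qed.

HB.instance Definition _ := GRing.isZmodule.Build tens taddA taddC tadd0 taddN.

Lemma tens_of_cat s t : tens_of (s ++ t) = tens_of s + tens_of t.
Proof. by rewrite -taddE. Qed.

Lemma tscaleA b c x : tscale b (tscale c x) = tscale (b * c) x.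
Proof.
elim/tensW: x => s; rewrite !tscaleE /tscale_seq -map_comp; congr tens_of.
by apply: eq_map => u /=; rewrite mulrA.
Qed.
Lemma tscale1 : left_id 1 tscale.
Proof.
elim/tensW=> s; rewrite tscaleE /tscale_seq -[s in RHS]map_id; congr tens_of.
by apply: eq_map => -[b x] /=; rewrite mul1r.
Qed.
Lemma tscaleDr : right_distributive tscale +%R.
Proof.
move=> c; elim/tensW=> s; elim/tensW=> t.
by rewrite -tens_of_cat !tscaleE -tens_of_cat /tscale_seq map_cat.
Qed.
Lemma tscaleDl x : {morph tscale^~ x : b c / b + c}.
Proof.
move=> b c; elim/tensW: x => s; rewrite !tscaleE.
elim: s => [|[d x] s IHs] /=; first by rewrite -tens_of_cat.
rewrite -cat1s -[in RHS]cat1s -[(c * d, x) :: _]cat1s !tens_of_cat IHs.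
rewrite mulrDl; have /tens_ofP -> := tens_addl (b * d) (c * d) x.
by rewrite -cat1s tens_of_cat addrACA.
Qed.

HB.instance Definition _ :=
  GRing.Zmodule_isLmodule.Build B tens tscaleA tscale1 tscaleDr tscaleDl.

Definition tpure (b : B) (x : P) : tens := tens_of [:: (b, x)].

Lemma tpureDl x : {morph tpure^~ x : b c / b + c}.
Proof. by move=> b c; rewrite -tens_of_cat; apply/tens_ofP/tens_addl. Qed.
Lemma tpureDr b : {morph tpure b : x y / x + y}.
Proof. by move=> x y; rewrite -tens_of_cat; apply/tens_ofP/tens_addr. Qed.
Lemma tpure_bal b a x : tpure (b * f a) x = tpure b (a *: x).
Proof. exact/tens_ofP/tens_bal. Qed.
Lemma tpureZ c b x : c *: tpure b x = tpure (c * b) x.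
Proof. exact: tscaleE. Qed.
Lemma tpure1 b x : tpure b x = b *: tpure 1 x.
Proof. by rewrite tpureZ mulr1. Qed.
Lemma tpure1Z a x : tpure 1 (a *: x) = f a *: tpure 1 x.
Proof. by rewrite -tpure_bal tpureZ mul1r mulr1. Qed.

Lemma tpure0r b : tpure b 0 = 0.
Proof.
rewrite tpure1 -[X in tpure 1 X](scale0r 0) tpure1Z rmorph0.
by rewrite scale0r scaler0.
Qed.

Lemma tens_ofE s : tens_of s = \sum_(u <- s) tpure u.1 u.2.
Proof.
elim: s => [|[b x] s IHs]; first by rewrite big_nil.
by rewrite big_cons -IHs -cat1s tens_of_cat.
Qed.

Lemma tens_ind (K : tens -> Prop) :
    K 0 -> (forall x y, K x -> K y -> K (x + y)) ->
    (forall b x, K (tpure b x)) ->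
  forall x, K x.
Proof.
move=> K0 KD Kp; elim/tensW => s; rewrite tens_ofE.
by elim/big_ind: _ => // -[b x] _; apply: Kp.
Qed.

(* The B-linear map b (x) x |-> b *: h x for an f-semilinear h. *)
Section Lift.
Variables (M : lmodType B) (h : P -> M).
Hypothesis hD : {morph h : x y / x + y}.
Hypothesis hZ : forall a x, h (a *: x) = f a *: h x.

Definition tlift_seq (s : seq (B * P)) : M := \sum_(u <- s) u.1 *: h u.2.

Lemma tlift_seq_eq s t : tens_eq s t -> tlift_seq s = tlift_seq t.
Proof.
rewrite /tlift_seq; elim=> {s t} //=.
- by move=> t s u _ -> _ ->.
- by move=> s s' t t' _ e1 _ e2; rewrite !big_cat /= e1 e2.
- by move=> s t; rewrite !big_cat /= addrC.
- by move=> b x; rewrite !big_cons !big_nil addr0 /= scaleNr subrr.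
- by move=> b b' x; rewrite !big_cons !big_nil !addr0 /= scalerDl.
- by move=> b x x'; rewrite !big_cons !big_nil !addr0 /= hD scalerDr.
- by move=> b a x; rewrite !big_cons !big_nil !addr0 /= hZ scalerA.
Qed.

Definition tlift_fun (x : tens) : M := tlift_seq (tens_rep x).

Lemma tlift_funE s : tlift_fun (tens_of s) = tlift_seq s.
Proof. exact/tlift_seq_eq/tens_rep_of. Qed.

Lemma tlift_linear : linear tlift_fun.
Proof.
move=> c; elim/tensW=> s; elim/tensW=> t.
rewrite [_ *: _]tscaleE -tens_of_cat !tlift_funE /tlift_seq big_cat /=.
rewrite scaler_sumr big_map; congr (_ + _); apply: eq_bigr => u _ /=.
by rewrite scalerA.
Qed.

Definition tlift : {linear tens -> M} :=
  HB.pack tlift_fun (GRing.isLinear.Build B tens M *:%R tlift_fun tlift_linear).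

Lemma tliftE b x : tlift (tpure b x) = b *: h x.
Proof. by rewrite /= tlift_funE /tlift_seq big_cons big_nil addr0. Qed.

End Lift.

Lemma tens_linear_ext (M : lmodType B) (g h : {linear tens -> M}) :
  (forall x, g (tpure 1 x) = h (tpure 1 x)) -> g =1 h.
Proof.
move=> gh; elim/tens_ind => [|x y gx gy|b x]; first by rewrite !linear0.
  by rewrite !linearD gx gy.
by rewrite tpure1 !linearZ_LR gh.
Qed.

End BaseChange.

Section BaseChangeMap.
Variables (A B : pzRingType) (f : {rmorphism A -> B}).

Section Map.
Variables (P P' : lmodType A) (g : {linear P -> P'}).

Fact tmapD : {morph (fun x => tpure f 1 (g x)) : x y / x + y}.
Proof. by move=> x y; rewrite linearD tpureDr. Qed.
Fact tmapZ a x : tpure f 1 (g (a *: x)) = f a *: tpure f 1 (g x).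
Proof. by rewrite linearZ_LR tpure1Z. Qed.

Definition tmap : {linear tens f P -> tens f P'} := tlift tmapD tmapZ.

Lemma tmapE b x : tmap (tpure f b x) = tpure f b (g x).
Proof. by rewrite tliftE -tpure1. Qed.
End Map.

Lemma tens_fin_gen (P : lmodType A) : fin_gen P -> fin_gen (tens f P).
Proof.
case=> n [e He]; exists n, (fun i => tpure f 1 (e i)).
elim/tens_ind=> [|x y [c ->] [d ->]|b x].
- by exists (fun=> 0); rewrite big1 // => i _; rewrite scale0r.
- exists (fun i => c i + d i); rewrite -big_split; apply: eq_bigr => i _.
  by rewrite scalerDl.
- have [c ->] := He x; exists (fun i => b * f (c i)).
  rewrite tpure1 (big_morph _ (tpureDr f 1) (tpure0r f P 1)).
  rewrite scaler_sumr; apply: eq_bigr => i _.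
  by rewrite tpure1Z scalerA.
Qed.

End BaseChangeMap.

Definition restr (A B : pzRingType) (f : {rmorphism A -> B}) (M : lmodType B)
  : Type := M.

Section Restriction.
Variables (A B : pzRingType) (f : {rmorphism A -> B}) (M : lmodType B).

HB.instance Definition _ := GRing.Zmodule.on (restr f M).

Definition restr_scale (a : A) (x : restr f M) : restr f M := f a *: (x : M).

Fact restr_scaleA a b x :
  restr_scale a (restr_scale b x) = restr_scale (a * b) x.
Proof. by rewrite /restr_scale scalerA rmorphM. Qed.
Fact restr_scale1 : left_id 1 restr_scale.
Proof. by move=> x; rewrite /restr_scale rmorph1 scale1r. Qed.
Fact restr_scaleDr : right_distributive restr_scale +%R.
Proof. by move=> a x y; rewrite /restr_scale scalerDr. Qed.
Fact restr_scaleDl x : {morph restr_scale^~ x : a b / a + b}.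
Proof. by move=> a b; rewrite /restr_scale rmorphD scalerDl. Qed.

HB.instance Definition _ := GRing.Zmodule_isLmodule.Build A (restr f M)
  restr_scaleA restr_scale1 restr_scaleDr restr_scaleDl.
End Restriction.

Section BaseChangeProj.
Variables (A B : pzRingType) (f : {rmorphism A -> B}).

Lemma tens_projective (P : lmodType A) : projective P -> projective (tens f P).
Proof.
move=> prP M N g h g_surj.
pose gr : restr f M -> restr f N := g.
have gr_lin : linear gr.
  by move=> a x y; rewrite /gr linearD; congr (_ + _); exact: linearZ_LR.
pose hr : P -> restr f N := fun x => h (tpure f 1 x).
have hr_lin : linear hr.
  move=> a x y; rewrite /hr tpureDr linearD; congr (_ + _).
  by rewrite tpure1Z linearZ_LR.
pose grL : {linear restr f M -> restr f N} :=
  HB.pack gr (GRing.isLinear.Build A (restr f M) (restr f N) *:%R gr gr_lin).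
pose hrL : {linear P -> restr f N} :=
  HB.pack hr (GRing.isLinear.Build A P (restr f N) *:%R hr hr_lin).
have [k Hk] := prP _ _ grL hrL g_surj.
pose k' : P -> M := k.
have kD : {morph k' : x y / x + y} by move=> x y; apply: linearD.
have kZ a x : k' (a *: x) = f a *: k' x by apply: linearZ_LR.
exists (tlift kD kZ).
apply: (tens_linear_ext (g := g \o tlift kD kZ)) => x.
have e : tlift kD kZ (tpure f 1 x) = k' x by rewrite tliftE scale1r.
exact: etrans (congr1 g e) (Hk x).
Qed.

Definition fgproj_tens (P : fgproj A) : fgproj B :=
  FGProj (tens_fin_gen f (fgproj_fin_gen P))
         (tens_projective (fgproj_projective P)).
End BaseChangeProj.

Section RelativeK0.
Variables (A B : pzRingType) (f : {rmorphism A -> B}).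

Record rel_triple := RelTriple {
  rt_src : fgproj A;
  rt_tgt : fgproj A;
  rt_map : {linear tens f rt_src -> tens f rt_tgt};
  rt_bij : bijective rt_map
}.

Definition rel_exact (T1 T2 T3 : rel_triple) : Prop :=
  exists (i : {linear rt_src T1 -> rt_src T2})
         (q : {linear rt_src T2 -> rt_src T3})
         (i' : {linear rt_tgt T1 -> rt_tgt T2})
         (q' : {linear rt_tgt T2 -> rt_tgt T3}),
    [/\ short_exact i q, short_exact i' q',
        rt_map T2 \o tmap f i =1 tmap f i' \o rt_map T1
      & rt_map T3 \o tmap f q =1 tmap f q' \o rt_map T2].

Definition rel_comp (P P' P'' : fgproj A)
    (phi : {linear tens f P -> tens f P'}) (phi_bij : bijective phi)
    (psi : {linear tens f P' -> tens f P''}) (psi_bij : bijective psi) :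
    rel_triple :=
  @RelTriple P P'' (psi \o phi : {linear _ -> _}) (bij_comp psi_bij phi_bij).

(* Elements of K_0(A, B) are represented by formal sums of signed generators
   (the boolean true is a minus sign), and equality in K_0(A, B) is the
   relation relK0_eq.  The set of generators is as large as lmodType A, so that
   the quotient cannot carry a zmodType structure. *)
Definition relK0 : Type := seq (bool * rel_triple).

Inductive relK0_eq : relK0 -> relK0 -> Prop :=
| relK0_refl s : relK0_eq s s
| relK0_sym s t : relK0_eq s t -> relK0_eq t s
| relK0_trans t s u : relK0_eq s t -> relK0_eq t u -> relK0_eq s u
| relK0_cat s s' t t' :
    relK0_eq s s' -> relK0_eq t t' -> relK0_eq (s ++ t) (s' ++ t')
| relK0_catC s t : relK0_eq (s ++ t) (t ++ s)
| relK0_opp T : relK0_eq [:: (false, T); (true, T)] [::]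
| relK0_exact T1 T2 T3 :
    rel_exact T1 T2 T3 ->
    relK0_eq [:: (false, T2)] [:: (false, T1); (false, T3)]
| relK0_comp (P P' P'' : fgproj A)
    (phi : {linear tens f P -> tens f P'}) (phi_bij : bijective phi)
    (psi : {linear tens f P' -> tens f P''}) (psi_bij : bijective psi) :
    relK0_eq [:: (false, rel_comp phi_bij psi_bij)]
             [:: (false, RelTriple phi_bij); (false, RelTriple psi_bij)].

Definition relK0_zero : relK0 := [::].
Definition relK0_add (x y : relK0) : relK0 := x ++ y.
Definition relK0_neg (x : relK0) : relK0 := [seq (~~ u.1, u.2) | u <- x].
Definition relK0_muln (m : nat) (x : relK0) : relK0 :=
  iter m (relK0_add x) relK0_zero.

Lemma relK0_addN x : relK0_eq (relK0_add x (relK0_neg x)) relK0_zero.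
Proof.
rewrite /relK0_add; elim: x => [|w x IHx] /=; first exact: relK0_refl.
have wN : relK0_eq [:: w; (~~ w.1, w.2)] [::].
  case: w => [[] T] /=; last exact: relK0_opp.
  exact: relK0_trans (relK0_catC [:: (true, T)] [:: (false, T)]) (relK0_opp T).
apply: (relK0_trans (t := [:: w; (~~ w.1, w.2)] ++ (x ++ relK0_neg x))).
  rewrite -[w :: _]/([:: w] ++ _) -[[:: w; _] ++ _]/([:: w] ++ (_ :: _)).
  apply: relK0_cat; first exact: relK0_refl.
  rewrite -cat1s -[_ :: (_ ++ _)]/(([:: _] ++ _) ++ _) !catA.
  by apply: relK0_cat; [apply: relK0_catC | apply: relK0_refl].
by rewrite /relK0_zero -[[::]]/([::] ++ [::]); apply: relK0_cat.
Qed.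

Definition relK0_tor (x : relK0) : Prop :=
  exists2 m, (0 < m)%N & relK0_eq (relK0_muln m x) relK0_zero.

(* S is meant to be (the underlying set of) a subgroup of K_0(A, B). *)
Definition kills (S : relK0 -> Prop) (m : nat) : Prop :=
  forall x, S x -> relK0_eq (relK0_muln m x) relK0_zero.

Definition is_exponent (S : relK0 -> Prop) (e : nat) : Prop :=
  [/\ (0 < e)%N, kills S e & forall m, (0 < m)%N -> kills S m -> (e <= m)%N].

End RelativeK0.

Section RelativeK0Map.
Variables (A B A' B' : pzRingType).
Variables (f : {rmorphism A -> B}) (f' : {rmorphism A' -> B'}).
Variables (u : {rmorphism A -> A'}) (v : {rmorphism B -> B'}).
Hypothesis sq : forall a, f' (u a) = v (f a).

(* The canonical v-semilinear map
   B (x)_A P -> B' (x)_A' (A' (x)_A P), b (x) x |-> v b (x) (1 (x) x). *)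
Section Canonical.
Variable P : lmodType A.
Let h (x : P) : restr v (tens f' (tens u P)) := tpure f' 1 (tpure u 1 x).

Fact bc_canD : {morph h : x y / x + y}.
Proof. by move=> x y; rewrite /h !tpureDr. Qed.
Fact bc_canZ a x : h (a *: x) = f a *: h x.
Proof. by rewrite /h !tpure1Z sq. Qed.

Definition bc_can : tens f P -> tens f' (tens u P) := tlift bc_canD bc_canZ.

Lemma bc_canE b x : bc_can (tpure f b x) = v b *: tpure f' 1 (tpure u 1 x).
Proof. by rewrite /bc_can tliftE. Qed.

Lemma bc_can_add : {morph bc_can : x y / x + y}.
Proof. by move=> x y; apply: linearD. Qed.

Lemma bc_can_scale b x : bc_can (b *: x) = v b *: bc_can x.
Proof. exact: linearZ_LR. Qed.

Lemma bc_can0 : bc_can 0 = 0.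
Proof. exact: linear0. Qed.
End Canonical.

(* For phi : B (x)_A P -> B (x)_A P', the map id (x) phi from
   B' (x)_A' (A' (x)_A P) = B' (x)_B (B (x)_A P) to
   B' (x)_A' (A' (x)_A P') = B' (x)_B (B (x)_A P'). *)
Section Map.
Variables (P P' : lmodType A) (phi : {linear tens f P -> tens f P'}).

Let h (x : P) : restr f' (tens f' (tens u P')) :=
  bc_can (phi (tpure f 1 x)).

Fact bc_map1D : {morph h : x y / x + y}.
Proof. by move=> x y; rewrite /h tpureDr linearD bc_can_add. Qed.
Fact bc_map1Z a x : h (a *: x) = u a *: h x.
Proof. by rewrite /h tpure1Z linearZ_LR bc_can_scale -sq. Qed.

Definition bc_map1 : tens u P -> tens f' (tens u P') := tlift bc_map1D bc_map1Z.

Fact bc_mapD : {morph bc_map1 : x y / x + y}.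
Proof. by move=> x y; apply: linearD. Qed.
Fact bc_mapZ a x : bc_map1 (a *: x) = f' a *: bc_map1 x.
Proof. exact: linearZ_LR. Qed.

Definition bc_map : {linear tens f' (tens u P) -> tens f' (tens u P')} :=
  tlift bc_mapD bc_mapZ.

Lemma bc_mapE x :
  bc_map (tpure f' 1 (tpure u 1 x)) = bc_can (phi (tpure f 1 x)).
Proof. by rewrite tliftE scale1r /bc_map1 tliftE scale1r. Qed.

Lemma bc_map_can t : bc_map (bc_can t) = bc_can (phi t).
Proof.
elim/tens_ind: t => [|x y ex ey|b x]; first by rewrite bc_can0 !linear0 bc_can0.
  by rewrite linearD !bc_can_add linearD ex ey.
by rewrite bc_canE (tpure1 f b) !linearZ_LR bc_can_scale bc_mapE.
Qed.
End Map.

Lemma tens2_ext (P : lmodType A) (M : lmodType B')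
    (g h : {linear tens f' (tens u P) -> M}) :
  (forall x, g (tpure f' 1 (tpure u 1 x)) = h (tpure f' 1 (tpure u 1 x))) ->
  g =1 h.
Proof.
move=> gh; apply: tens_linear_ext; elim/tens_ind => [|x y ex ey|a x].
- by rewrite tpure0r !linear0.
- by rewrite tpureDr !linearD ex ey.
by rewrite (tpure1 _ a) !tpure1Z !linearZ_LR gh.
Qed.

Lemma bc_map_bij (P P' : lmodType A) (phi : {linear tens f P -> tens f P'}) :
  bijective phi -> bijective (bc_map phi).
Proof.
case=> psi phiK psiK.
have psi_lin : linear psi.
  by move=> b x y; apply: (can_inj phiK); rewrite psiK linearP !psiK.
pose psiL : {linear tens f P' -> tens f P} :=
  HB.pack psi (GRing.isLinear.Build B _ _ *:%R psi psi_lin).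
have canE (Q : lmodType A) (x : Q) :
    bc_can (tpure f 1 x) = tpure f' 1 (tpure u 1 x).
  by rewrite bc_canE rmorph1 scale1r.
have phiE t : psiL (phi t) = t by exact: phiK.
have psiE t : phi (psiL t) = t by exact: psiK.
exists (bc_map psiL).
  apply: (tens2_ext (g := bc_map psiL \o bc_map phi) (h := idfun)) => x.
  suff: bc_map psiL (bc_map phi (tpure f' 1 (tpure u 1 x)))
        = tpure f' 1 (tpure u 1 x) by [].
  by rewrite bc_mapE bc_map_can phiE canE.
apply: (tens2_ext (g := bc_map phi \o bc_map psiL) (h := idfun)) => x.
suff: bc_map phi (bc_map psiL (tpure f' 1 (tpure u 1 x)))
      = tpure f' 1 (tpure u 1 x) by [].
by rewrite bc_mapE bc_map_can psiE canE.
Qed.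

Definition rel_triple_map (T : rel_triple f) : rel_triple f' :=
  @RelTriple A' B' f' (fgproj_tens u (rt_src T)) (fgproj_tens u (rt_tgt T))
    (bc_map (rt_map T)) (bc_map_bij (rt_bij T)).

Definition relK0_map (x : relK0 f) : relK0 f' :=
  [seq (w.1, rel_triple_map w.2) | w <- x].

End RelativeK0Map.

(* relK0_map is well defined on K_0. *)
Section RelativeK0MapEq.

Lemma linear_eqP (R : pzRingType) (M N : lmodType R) (g h : {linear M -> N}) :
  g =1 h -> g = h.
Proof.
case: g => g [[g1] [g2]]; case: h => h [[h1] [h2]] /= gh.
have {gh}e : g = h by apply/funext => x; apply: gh.
case: _ / e in h1 h2 *.
by rewrite (Prop_irrelevance g1 h1) (Prop_irrelevance g2 h2).
Qed.

Lemma rel_triple_eq (A B : pzRingType) (f : {rmorphism A -> B})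
    (P P' : fgproj A) (phi psi : {linear tens f P -> tens f P'})
    (phi_bij : bijective phi) (psi_bij : bijective psi) :
  phi =1 psi -> RelTriple phi_bij = RelTriple psi_bij.
Proof.
move=> /linear_eqP e; case: _ / e in psi_bij *.
by rewrite (Prop_irrelevance phi_bij psi_bij).
Qed.

Lemma short_exact_tens (A B : pzRingType) (f : {rmorphism A -> B})
    (M N L : lmodType A) (i : {linear M -> N}) (q : {linear N -> L}) :
  projective L -> short_exact i q -> short_exact (tmap f i) (tmap f q).
Proof.
move=> prL [i_inj iq q_surj].
have [s qs] := prL _ _ q (idfun : {linear L -> L}) q_surj.
have {}qs z : q (s z) = z by exact: qs.
have sec y : exists x, i x = y - s (q y) by apply/iq; rewrite linearB qs subrr.
pose r y := projT1 (cid (sec y)).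
have ir y : i (r y) = y - s (q y) by rewrite /r; case: cid.
have r_lin : linear r.
  move=> a x y; apply: i_inj.
  rewrite [RHS]linearP !ir [q _]linearP [s _]linearP scalerBr.
  by rewrite opprD addrACA.
pose rL : {linear N -> M} :=
  HB.pack r (GRing.isLinear.Build A _ _ *:%R r r_lin).
have ri x : rL (i x) = x.
  have qi0 : q (i x) = 0 by apply/iq; exists x.
  by apply: i_inj; rewrite [LHS]ir qi0 linear0 subr0.
have qi x : q (i x) = 0 by apply/iq; exists x.
have dec y : y = i (rL y) + s (q y) by rewrite [i _]ir subrK.
have riT t : tmap f rL (tmap f i t) = t.
  apply: (tens_linear_ext (g := tmap f rL \o tmap f i) (h := idfun)) => x.
  suff: tmap f rL (tmap f i (tpure f 1 x)) = tpure f 1 x by [].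
  by rewrite !tmapE ri.
have qiT t : tmap f q (tmap f i t) = 0.
  apply: (tens_linear_ext (g := tmap f q \o tmap f i) (h := \0)) => x.
  suff: tmap f q (tmap f i (tpure f 1 x)) = 0 by [].
  by rewrite !tmapE qi tpure0r.
have qsT t : tmap f q (tmap f s t) = t.
  apply: (tens_linear_ext (g := tmap f q \o tmap f s) (h := idfun)) => x.
  suff: tmap f q (tmap f s (tpure f 1 x)) = tpure f 1 x by [].
  by rewrite !tmapE qs.
have decT t : tmap f i (tmap f rL t) + tmap f s (tmap f q t) = t.
  elim/tens_ind: t => [|x y ex ey|b x].
  - by rewrite !linear0 addr0.
  - by rewrite !linearD addrACA ex ey.
  by rewrite !tmapE -tpureDr -dec.
split; first exact: can_inj riT.
  move=> y; split=> [qy|[x <-]]; last exact: qiT.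
  by exists (tmap f rL y); rewrite -[RHS]decT qy linear0 addr0.
by move=> z; exists (tmap f s z); apply: qsT.
Qed.

Variables (A B A' B' : pzRingType).
Variables (f : {rmorphism A -> B}) (f' : {rmorphism A' -> B'}).
Variables (u : {rmorphism A -> A'}) (v : {rmorphism B -> B'}).
Hypothesis sq : forall a, f' (u a) = v (f a).

Lemma bc_map_tmap (P1 P1' P2 P2' : lmodType A)
    (phi1 : {linear tens f P1 -> tens f P1'})
    (phi2 : {linear tens f P2 -> tens f P2'})
    (i : {linear P1 -> P2}) (i' : {linear P1' -> P2'}) :
  phi2 \o tmap f i =1 tmap f i' \o phi1 ->
  bc_map sq phi2 \o tmap f' (tmap u i) =1
    tmap f' (tmap u i') \o bc_map sq phi1.
Proof.
move=> e.
have can_nat t : tmap f' (tmap u i') (bc_can sq t) = bc_can sq (tmap f i' t).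
  elim/tens_ind: t => [|x y ex ey|b x].
  - by rewrite linear0 !bc_can0 linear0.
  - by rewrite linearD !bc_can_add linearD ex ey.
  by rewrite tmapE !bc_canE linearZ_LR !tmapE.
apply: (tens2_ext (g := bc_map sq phi2 \o tmap f' (tmap u i))
                  (h := tmap f' (tmap u i') \o bc_map sq phi1)) => x.
suff: bc_map sq phi2 (tmap f' (tmap u i) (tpure f' 1 (tpure u 1 x)))
   = tmap f' (tmap u i') (bc_map sq phi1 (tpure f' 1 (tpure u 1 x))) by [].
rewrite !tmapE !bc_mapE can_nat; congr (bc_can sq _).
by rewrite -tmapE; apply: e.
Qed.

Lemma bc_map_comp (P P' P'' : lmodType A)
    (phi : {linear tens f P -> tens f P'})
    (psi : {linear tens f P' -> tens f P''}) :
  bc_map sq (psi \o phi) =1 bc_map sq psi \o bc_map sq phi.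
Proof.
apply: (tens2_ext (h := bc_map sq psi \o bc_map sq phi)) => x.
suff: bc_map sq (psi \o phi) (tpure f' 1 (tpure u 1 x))
   = bc_map sq psi (bc_map sq phi (tpure f' 1 (tpure u 1 x))) by [].
by rewrite !bc_mapE bc_map_can.
Qed.

Lemma relK0_map_eq (x y : relK0 f) :
  relK0_eq x y -> relK0_eq (relK0_map sq x) (relK0_map sq y).
Proof.
rewrite /relK0_map; elim=> {x y} /=.
- by move=> s; apply: relK0_refl.
- by move=> s t _; apply: relK0_sym.
- by move=> t s w _ ? _; apply: relK0_trans.
- by move=> s s' t t' _ ? _ ?; rewrite !map_cat; apply: relK0_cat.
- by move=> s t; rewrite !map_cat; apply: relK0_catC.
- by move=> T; apply: relK0_opp.
- move=> T1 T2 T3 [i [q [i' [q' [ex ex' e e']]]]]; apply: relK0_exact.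
  exists (tmap u i), (tmap u q), (tmap u i'), (tmap u q'); split.
  + exact: short_exact_tens (fgproj_projective _) ex.
  + exact: short_exact_tens (fgproj_projective _) ex'.
  + exact: bc_map_tmap e.
  + exact: bc_map_tmap e'.
- move=> P P' P'' phi phi_bij psi psi_bij.
  have -> : rel_triple_map sq (rel_comp phi_bij psi_bij) =
      rel_comp (P := fgproj_tens u P) (P' := fgproj_tens u P')
        (P'' := fgproj_tens u P'') (bc_map_bij sq phi_bij)
        (bc_map_bij sq psi_bij).
    exact/rel_triple_eq/bc_map_comp.
  exact: relK0_comp.
Qed.

End RelativeK0MapEq.

Fact modz_dvdm (m d e : int) :
  (d %| e)%Z -> ((m %% e)%Z %% d)%Z = (m %% d)%Z.
Proof.
case/dvdzP=> k ek; rewrite [in RHS](divz_eq m e).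
by rewrite [X in _ * X + _]ek mulrA modzMDl.
Qed.

(* The inverse limit of the rings Z/p^n, an element of Z/p^n being represented
   by its remainder modulo p^n. *)
Record padic_int (p : nat) (p_pr : prime p) := PadicInt {
  padic_rem : nat -> int;
  padic_remP : forall n, padic_rem n = (padic_rem n.+1 %% (p ^ n)%N)%Z
}.

Section PadicInt.
Variables (p : nat) (p_pr : prime p).
Local Notation Zp := (padic_int p_pr).
Local Notation q n := ((p ^ n)%N : int).

HB.instance Definition _ := gen_eqMixin Zp.
HB.instance Definition _ := gen_choiceMixin Zp.

Implicit Types x y z : Zp.

Lemma padicP x y : padic_rem x =1 padic_rem y -> x = y.
Proof.
case: x y => [x hx] [y hy] /= /funext xy; case: _ / xy in hy *.
by rewrite (Prop_irrelevance hx hy).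
Qed.

Lemma padic_remK x n : (padic_rem x n %% q n)%Z = padic_rem x n.
Proof. by rewrite padic_remP modz_mod. Qed.

Lemma padic_mk_subproof (s : nat -> int) :
    (forall n, (s n %% q n)%Z = (s n.+1 %% q n)%Z) ->
  forall n, (s n %% q n)%Z = ((s n.+1 %% q n.+1)%Z %% q n)%Z.
Proof.
move=> hs n; rewrite hs.
by rewrite expnS PoszM modz_dvdm // dvdz_mull.
Qed.

Definition padic_mk s hs : Zp := PadicInt p_pr (padic_mk_subproof (s := s) hs).

Lemma padic_mod x n : (padic_rem x n %% q n)%Z = (padic_rem x n.+1 %% q n)%Z.
Proof. by rewrite {1}padic_remP modz_mod. Qed.

Lemma padic_modD x m n : (padic_rem x n %% q n)%Z = (padic_rem x (m + n) %% q n)%Z.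
Proof.
elim: m => // m IHm; rewrite IHm addSn (padic_remP x (m + n)) modz_dvdm //.
by rewrite expnD PoszM dvdz_mull.
Qed.

Definition padic_zero := padic_mk (s := fun=> 0) (fun=> erefl).
Definition padic_one := padic_mk (s := fun=> 1) (fun=> erefl).

Fact padic_add_subproof x y n :
  ((padic_rem x n + padic_rem y n)%R %% q n)%Z =
  ((padic_rem x n.+1 + padic_rem y n.+1)%R %% q n)%Z.
Proof.
by rewrite -modzDml padic_mod modzDml -modzDmr padic_mod modzDmr.
Qed.
Definition padic_add x y := padic_mk (padic_add_subproof x y).

Fact padic_opp_subproof x n :
  ((- padic_rem x n) %% q n)%Z = ((- padic_rem x n.+1) %% q n)%Z.
Proof. by rewrite -modzNm padic_mod modzNm. Qed.
Definition padic_opp x := padic_mk (padic_opp_subproof x).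

Fact padic_mul_subproof x y n :
  ((padic_rem x n * padic_rem y n)%R %% q n)%Z =
  ((padic_rem x n.+1 * padic_rem y n.+1)%R %% q n)%Z.
Proof.
by rewrite -modzMml padic_mod modzMml -modzMmr padic_mod modzMmr.
Qed.
Definition padic_mul x y := padic_mk (padic_mul_subproof x y).

Fact padic_addA : associative padic_add.
Proof.
by move=> x y z; apply: padicP => n /=; rewrite modzDml modzDmr addrA.
Qed.
Fact padic_addC : commutative padic_add.
Proof. by move=> x y; apply: padicP => n /=; rewrite addrC. Qed.
Fact padic_add0 : left_id padic_zero padic_add.
Proof. by move=> x; apply: padicP => n /=; rewrite modzDml add0r padic_remK. Qed.
Fact padic_addN : left_inverse padic_zero padic_opp padic_add.
Proof. by move=> x; apply: padicP => n /=; rewrite modzDml addNr. Qed.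

HB.instance Definition _ :=
  GRing.isZmodule.Build Zp padic_addA padic_addC padic_add0 padic_addN.

Fact padic_mulA : associative padic_mul.
Proof.
by move=> x y z; apply: padicP => n /=; rewrite modzMml modzMmr mulrA.
Qed.
Fact padic_mulC : commutative padic_mul.
Proof. by move=> x y; apply: padicP => n /=; rewrite mulrC. Qed.
Fact padic_mul1 : left_id padic_one padic_mul.
Proof. by move=> x; apply: padicP => n /=; rewrite modzMml mul1r padic_remK. Qed.
Fact padic_mulDl : left_distributive padic_mul +%R.
Proof.
move=> x y z; apply: padicP => n /=.
by rewrite modzMml modzDml modzDmr mulrDl.
Qed.
Fact padic_1neq0 : padic_one != 0.
Proof.
apply/eqP=> /(congr1 (@padic_rem _ _))/(congr1 (@^~ 1%N)) /=.
by rewrite expn1 mod0z modz_small // ltz_nat prime_gt1.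
Qed.

HB.instance Definition _ := GRing.Zmodule_isComNzRing.Build Zp
  padic_mulA padic_mulC padic_mul1 padic_mulDl padic_1neq0.

Definition padic_unit : pred Zp := fun x => `[< exists y, y * x = 1 >].
Definition padic_inv x : Zp :=
  if pselect (exists y, y * x = 1) is left h then projT1 (cid h) else x.

Fact padic_mulV : {in padic_unit, left_inverse 1 padic_inv *%R}.
Proof.
move=> x /asboolP ux; rewrite /padic_inv.
by case: pselect => // h; case: cid.
Qed.
Fact padic_unitP x y : y * x = 1 -> padic_unit x.
Proof. by move=> yx; apply/asboolP; exists y. Qed.
Fact padic_invN : {in [predC padic_unit], padic_inv =1 id}.
Proof.
move=> x /asboolPn ux; rewrite /padic_inv.
by case: pselect => // h; case: ux.
Qed.

HB.instance Definition _ := GRing.ComNzRing_hasMulInverse.Build Zp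
  padic_mulV padic_unitP padic_invN.

Lemma padic_rem0 n : padic_rem (0 : Zp) n = 0.
Proof. exact: mod0z. Qed.

Fact padic_integral x y : x * y = 0 -> (x == 0) || (y == 0).
Proof.
move=> xy0; apply/orP; case: (pselect (x = 0)) => [->|x0]; first by left.
right; apply/eqP/padicP => m; rewrite padic_rem0.
have [n xn] : exists n, padic_rem x n != 0.
  apply: contrapT => h; apply: x0; apply: padicP => n; rewrite padic_rem0.
  by apply: contrapT => /eqP xn; apply: h; exists n.
have xE k (w : Zp) l : (padic_rem w k == 0) = (q k %| padic_rem w (l + k)%N)%Z.
  by rewrite -(padic_remK w k) (padic_modD w l); apply/eqP/dvdz_mod0P.
apply/eqP; rewrite (xE m y n).
move: xn; rewrite (xE n x m) addnC.
have := congr1 (fun w : Zp => padic_rem w (n + m)) xy0.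
rewrite padic_rem0 => /dvdz_mod0P.
rewrite /dvdz /= !unfold_in abszM.
move: `|padic_rem x _|%N `|padic_rem y _|%N => a b ab na.
have a_gt0 : (0 < a)%N by case: (a) na => //; rewrite dvdn0.
have [->|b_gt0] := posnP b; first exact: dvdn0.
move: ab na; rewrite !pfactor_dvdn ?muln_gt0 ?a_gt0 // lognM //.
by rewrite -ltnNge => ab na; rewrite -(leq_add2l n) (leq_trans ab) // leq_add2r ltnW.
Qed.

HB.instance Definition _ := GRing.ComUnitRing_isIntegral.Build Zp
  padic_integral.

End PadicInt.

Notation padic p_pr := {fraction (padic_int p_pr)}.

Definition int_to_rat : {rmorphism int -> rat} := intr.
Definition padic_int_to_padic (p : nat) (p_pr : prime p) :
  {rmorphism padic_int p_pr -> padic p_pr} := @tofrac (padic_int p_pr).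

(* Q is meant to be the fraction field of R, with canonical embedding f.  For
   an R[G]-module P, the Q[G]-module Q (x)_R P is Q[G] (x)_R[G] P, that is
   tens (gring_map f) P. *)
Section DT.
Variables (R Q : nzRingType) (f : {rmorphism R -> Q}).

Definition DT (gT : finGroupType) (x : relK0 (gring_map f (gT := gT))) : Prop :=
  relK0_tor x.

Definition DT_proj (gT : finGroupType) (D : {group gT})
    (nD : (D <| [set: gT])%g) :
    relK0 (gring_map f (gT := gT)) -> relK0 (gring_map f (gT := coset_of D)) :=
  relK0_map (gring_map_proj f nD).

Definition Xi (gT : finGroupType) : {set {group gT}} :=
  [set cfker_group 'chi_i | i : Iirr [set: gT]].

Definition DT_ker (gT : finGroupType)
    (x : relK0 (gring_map f (gT := gT))) : Prop :=
  DT x /\ forall (D : {group gT}) (nD : (D <| [set: gT])%g), D \in Xi gT ->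
            relK0_eq (DT_proj nD x) (relK0_zero _).
End DT.

(* Main.v *)
(* For odd p the algebra Q[G] is a product of matrix algebras M_d(K) over fields
   K with a single, totally ramified, place above p: this follows by induction on
   |G|, a faithful component being induced from a subgroup of index p or coming
   from a cyclic group.  To a class [P, phi, P'] one attaches, in every component,
   the determinants of phi computed in local bases of P and P'; away from p they
   are defined up to units of the maximal order, and at p up to determinants of
   units of the local ring R_(p)[G].  A class with trivial invariants is trivial,
   because a product of elementary matrices, chosen by approximation, makes phi
   integral at all primes.  Torsion classes have unit invariants.

   A family of units of the components that are all congruent to one integer
   prime to p modulo the primes above p becomes, after raising to the power
   |G|/p, the family of determinants of a single unit of R_(p)[G].  The residue
   fields above p being F_p, a further exponent p - 1 makes any family of units
   congruent to 1, whence the upper bound in (i).  As R_(p)[G] is local with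
   residue map induced by the augmentation, and each component factors through
   the quotient by its kernel, classes in the kernel of the diagonal projection
   satisfy the congruence already, whence (ii).  For the lower bound, a cyclotomic
   unit with residue a primitive root modulo p, glued with 1 on the components
   where a central element of order p acts trivially, gives a torsion class
   whose order is divisible by p - 1. *)

Require Import Defs.
From HB Require Import structures.
From mathcomp Require Import all_boot all_order all_algebra all_fingroup.
From mathcomp Require Import all_solvable all_field all_character.
From mathcomp Require Import boolp ring.

Set Implicit Arguments.
Unset Strict Implicit.
Unset Printing Implicit Defensive.

Import GRing.Theory.
Local Open Scope ring_scope.

(** The exponent [|G|/p] is read off from conductors. In the faithful component of a cyclic group of
    order [p ^ k.+1] generated by [g], put [zeta = g ^ (p ^ k)] and [pi = 1 - g]. Then
    [pi ^ (p ^ k)] is [1 - zeta] modulo [p], and multiplication by [1 - zeta] carries the integers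
    of the component into the local group ring. Hence a unit congruent to 1 modulo [pi] needs only a
    [p ^ k]-th power to come from that ring. For an induced component the conductor is multiplied by
    [p], and one more [p]-th power, available because the group has grown, compensates for it.
    Oddness of [p] enters through group theory: every noncyclic group then has a noncyclic abelian
    normal subgroup, which excludes quaternion-like components. Away from [p] several places may lie
    above one prime. No ideal theory is set up for them: the local orders are shown to be Bezout
    rings from a single congruence [x ^ q = x] modulo the prime. The cases of [int] and of the
    [p]-adic integers are two instances of one interface, [arith]; only approximation at several
    primes distinguishes them. *)

Lemma split_lshift m n (i : 'I_m) : split (lshift n i) = inl i.
Proof. exact: (unsplitK (inl i)). Qed.
Lemma split_rshift m n (i : 'I_n) : split (rshift m i) = inr i.
Proof. exact: (unsplitK (inr i)). Qed.

(** * Finitely generated projective modules *)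
Section FreeModules.
Variable A : pzRingType.

Definition mk_linear (M N : lmodType A) (h : M -> N) (h_lin : linear h) :
  {linear M -> N} := HB.pack h (GRing.isLinear.Build A M N *:%R h h_lin).

Lemma can_linear (M N : lmodType A) (g : {linear M -> N}) (h : N -> M) :
  cancel g h -> cancel h g -> linear h.
Proof. by move=> gK hK a x y; apply: (can_inj gK); rewrite hK linearP !hK. Qed.

Definition rowcomb (M : lmodType A) n (e : 'I_n -> M) (v : 'rV[A]_n) : M :=
  \sum_i v 0 i *: e i.

Lemma rowcomb_linear (M : lmodType A) n (e : 'I_n -> M) : linear (rowcomb e).
Proof.
move=> a x y; rewrite /rowcomb scaler_sumr -big_split; apply: eq_bigr => i _.
by rewrite !mxE scalerDl scalerA.
Qed.

Definition rowlin (M : lmodType A) n (e : 'I_n -> M) : {linear 'rV[A]_n -> M} :=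
  mk_linear (rowcomb_linear e).

Lemma rowlinE (M : lmodType A) n (e : 'I_n -> M) i : rowlin e 'e_i = e i.
Proof.
rewrite /= /rowcomb (bigD1 i) //= mxE !eqxx scale1r big1 ?addr0 // => j ji.
by rewrite mxE (negPf ji) andbF scale0r.
Qed.

Lemma row_linear_ext (M : lmodType A) n (g h : {linear 'rV[A]_n -> M}) :
  (forall i, g 'e_i = h 'e_i) -> g =1 h.
Proof.
move=> gh v; rewrite (row_sum_delta v) !linear_sum; apply: eq_bigr => i _.
by rewrite !linearZ_LR gh.
Qed.

Lemma row_fin_gen n : fin_gen ('rV[A]_n : lmodType A).
Proof.
exists n, (fun i => 'e_i) => x; exists (fun i => x 0 i); exact: row_sum_delta.
Qed.

Lemma row_projective n : projective ('rV[A]_n : lmodType A).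
Proof.
move=> M N g h g_surj; pose e i := projT1 (cid (g_surj (h 'e_i))).
exists (rowlin e); apply: (row_linear_ext (g := g \o rowlin e)) => i.
suff: g (rowlin e 'e_i) = h 'e_i by [].
by rewrite rowlinE /e; case: cid.
Qed.

Definition freem n : fgproj A := FGProj (@row_fin_gen n) (@row_projective n).

Lemma projective_retract (P N : lmodType A) (s : {linear N -> P})
  (t : {linear P -> N}) : cancel s t -> projective P -> projective N.
Proof.
move=> sK prP M L g h g_surj.
have [k gk] := prP _ _ g (h \o t : {linear _ -> _}) g_surj.
exists (k \o s : {linear _ -> _}) => x /=.
by have := gk (s x); rewrite /= sK.
Qed.

Lemma fin_gen_surj (P N : lmodType A) (t : {linear P -> N}) :
  (forall y, exists x, t x = y) -> fin_gen P -> fin_gen N.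
Proof.
move=> t_surj [n [e He]]; exists n, (fun i => t (e i)) => y.
have [x <-] := t_surj y; have [c ->] := He x; exists c.
by rewrite linear_sum; apply: eq_bigr => i _; rewrite linearZ_LR.
Qed.

(** The [m] extra coordinates are sent to 0 by [t]. They let [vanish] work in rank at least 2, rank
    1 having no nontrivial elementary matrices. *)
Lemma fgproj_section (P : fgproj A) m : exists n (s : {linear P -> 'rV[A]_n})
  (t : {linear 'rV[A]_n -> P}), (m <= n)%N /\ cancel s t.
Proof.
have [n [e He]] := fgproj_fin_gen P.
pose e' (i : 'I_(n + m)) := if split i is inl j then e j else 0.
pose t := rowlin e'.
have t_surj y : exists x, t x = y.
  have [c ->] := He y; exists (\row_i (if split i is inl j then c j else 0)).
  rewrite /= /rowcomb big_split_ord /= [X in _ + X]big1 ?addr0 => [|i _].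
    by apply: eq_bigr => i _; rewrite mxE /e' split_lshift.
  by rewrite mxE split_rshift scale0r.
have [s ts] := @fgproj_projective A P _ _ t (idfun : {linear P -> P}) t_surj.
by exists (n + m)%N, s, t; split; [rewrite leq_addl | apply: ts].
Qed.

Section Kernel.
Variables (M N : lmodType A) (t : {linear M -> N}).
Definition kerpred : {pred M} := fun v => t v == 0.
Lemma kerpred_closed : submod_closed kerpred.
Proof.
split=> [|a x y]; rewrite !unfold_in ?linear0 //= => /eqP tx /eqP ty.
by rewrite linearP tx ty scaler0 addr0.
Qed.
HB.instance Definition _ :=
  GRing.isSubmodClosed.Build A M kerpred kerpred_closed.
Definition kermod : Type := {v : M | kerpred v}.
HB.instance Definition _ := SubChoice.on kermod.
HB.instance Definition _ := [SubChoice_isSubLmodule of kermod by <:].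
End Kernel.

Section Product.
Variables P N : fgproj A.
Lemma prod_fin_gen : fin_gen (P * N : lmodType A)%type.
Proof.
have [n [e He]] := fgproj_fin_gen P; have [m [e' He']] := fgproj_fin_gen N.
exists (n + m)%N, (fun i => match split i with inl j => (e j, 0)
                                             | inr j => (0, e' j) end).
case=> x y; have [c ->] := He x; have [c' ->] := He' y.
exists (fun i => match split i with inl j => c j | inr j => c' j end).
transitivity (\sum_i (c i *: e i, 0) + \sum_i (0, c' i *: e' i) : P * N).
  apply/eqP; rewrite xpair_eqE /=; apply/andP; split; apply/eqP.
    by rewrite !(raddf_sum fst) /= [X in _ + X]big1 ?addr0.
  by rewrite !(raddf_sum snd) /= [X in X + _]big1 ?add0r.
rewrite big_split_ord; congr (_ + _); apply: eq_bigr => i _.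
  by rewrite split_lshift; congr pair; rewrite /= scaler0.
by rewrite split_rshift; congr pair; rewrite /= scaler0.
Qed.

Fact inl_linear : linear (fun x : P => (x, 0) : (P * N : lmodType A)%type).
Proof. by move=> a x y; congr pair => /=; rewrite scaler0 addr0. Qed.
Fact inr_linear : linear (fun x : N => (0, x) : (P * N : lmodType A)%type).
Proof. by move=> a x y; congr pair => /=; rewrite scaler0 addr0. Qed.
Definition inlL : {linear P -> (P * N : lmodType A)%type} := mk_linear inl_linear.
Definition inrL : {linear N -> (P * N : lmodType A)%type} := mk_linear inr_linear.
Definition fstL : {linear (P * N : lmodType A)%type -> P} := fst.
Definition sndL : {linear (P * N : lmodType A)%type -> N} := snd.

Lemma prod_projective : projective (P * N : lmodType A)%type.
Proof.
move=> M L g h g_surj.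
have [k gk] := @fgproj_projective A P _ _ g (h \o inlL : {linear _ -> _}) g_surj.
have [l gl] := @fgproj_projective A N _ _ g (h \o inrL : {linear _ -> _}) g_surj.
exists ((k \o fstL) \+ (l \o sndL) : {linear _ -> _}) => -[x y] /=.
have {}gk : g (k x) = h (inlL x) by exact: gk.
have {}gl : g (l y) = h (inrL y) by exact: gl.
rewrite linearD gk gl -linearD; congr (h _).
by congr pair => /=; rewrite ?addr0 ?add0r.
Qed.

Definition fgprod : fgproj A := FGProj prod_fin_gen prod_projective.
End Product.
End FreeModules.

(** * Scalar extension and the relative K_0-group *)
Section TensFunctor.
Variables (A B : pzRingType) (f : {rmorphism A -> B}).

Lemma tmap_id (P : lmodType A) (g : {linear P -> P}) : g =1 id -> tmap f g =1 id.
Proof.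
move=> gE; apply: (tens_linear_ext (h := idfun)) => x.
by rewrite tmapE gE.
Qed.

Lemma tmap_comp (P P' P'' : lmodType A) (g : {linear P -> P'})
    (h : {linear P' -> P''}) (k : {linear P -> P''}) :
  (forall x, h (g x) = k x) -> forall t, tmap f h (tmap f g t) = tmap f k t.
Proof.
move=> E; apply: (tens_linear_ext (g := tmap f h \o tmap f g)) => x.
suff: tmap f h (tmap f g (tpure f 1 x)) = tmap f k (tpure f 1 x) by [].
by rewrite !tmapE E.
Qed.

Lemma tmap0 (P P' : lmodType A) (g : {linear P -> P'}) :
  (forall x, g x = 0) -> forall t, tmap f g t = 0.
Proof.
move=> g0; apply: (tens_linear_ext (h := \0)) => x.
by rewrite tmapE g0 tpure0r.
Qed.

Lemma tmap_add (P P' : lmodType A) (g h k : {linear P -> P'}) :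
  (forall x, g x + h x = k x) -> forall t, tmap f g t + tmap f h t = tmap f k t.
Proof.
move=> E; apply: (tens_linear_ext (g := tmap f g \+ tmap f h)) => x.
suff: tmap f g (tpure f 1 x) + tmap f h (tpure f 1 x) = tmap f k (tpure f 1 x) by [].
by rewrite !tmapE -E tpureDr.
Qed.

Lemma tmap_bij (P P' : lmodType A) (g : {linear P -> P'}) :
  bijective g -> bijective (tmap f g).
Proof.
case=> h gK hK; pose hL := mk_linear (can_linear gK hK).
exists (tmap f hL) => t.
  by rewrite (tmap_comp (k := idfun)) ?tmap_id //; apply: gK.
by rewrite (tmap_comp (k := idfun)) ?tmap_id //; apply: hK.
Qed.

Fact idfun_bij (T : Type) : bijective (@idfun T).
Proof. by exists id. Qed.

End TensFunctor.

Section RelK0Theory.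
Variables (A B : pzRingType) (f : {rmorphism A -> B}).
Local Notation "x == y" := (@relK0_eq A B f x y).
Local Notation cls T := ([:: (false, T)] : relK0 f).
Implicit Types (x y z : relK0 f) (T : rel_triple f).

Lemma relK0_catl x y z : y == z -> (x ++ y) == (x ++ z).
Proof. by move=> h; apply: relK0_cat => //; apply: relK0_refl. Qed.
Lemma relK0_catr x y z : y == z -> (y ++ x) == (z ++ x).
Proof. by move=> h; apply: relK0_cat => //; apply: relK0_refl. Qed.

Lemma relK0_addNl x : (relK0_neg x ++ x) == [::].
Proof. exact: relK0_trans (relK0_catC _ _) (relK0_addN x). Qed.

Lemma relK0_cancel x y z : (x ++ y) == (x ++ z) -> y == z.
Proof.
move=> h; have E w : (relK0_neg x ++ (x ++ w)) == w.
  by rewrite catA; exact: (relK0_catr w (relK0_addNl x)).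
exact: relK0_trans (relK0_sym (E y)) (relK0_trans (relK0_catl _ h) (E z)).
Qed.

Lemma relK0_mulnD m n x :
  relK0_muln (m + n) x = relK0_muln m x ++ relK0_muln n x.
Proof. by elim: m => //= m IHm; rewrite IHm /relK0_add catA. Qed.

Lemma relK0_muln_zero m x : x == [::] -> relK0_muln m x == [::].
Proof.
by move=> h; elim: m => [|m IHm]; [exact: relK0_refl|exact: (relK0_cat h IHm)].
Qed.

Lemma relK0_mulnM m n x : relK0_muln (m * n) x = relK0_muln m (relK0_muln n x).
Proof. by elim: m => //= m IHm; rewrite mulSn relK0_mulnD IHm. Qed.

Definition idT (P : fgproj A) : rel_triple f :=
  @RelTriple A B f P P (idfun : {linear tens f P -> tens f P}) (@idfun_bij _).

(** The identity composed with itself is itself, so the composition relation reads [c = c + c]. *)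
Lemma idT_zero P : cls (idT P) == [::].
Proof.
pose b : bijective (idfun : {linear tens f P -> tens f P}) := @idfun_bij _.
have e : rel_comp b b = idT P by exact/rel_triple_eq.
have h := relK0_comp b b; rewrite e in h.
apply: relK0_sym; apply: (@relK0_cancel (cls (idT P))); rewrite cats0.
exact: h.
Qed.

Fact zero_linear (M N : lmodType A) : linear (fun _ : M => 0 : N).
Proof. by move=> a x y; rewrite scaler0 addr0. Qed.
Definition zeroL (M N : lmodType A) : {linear M -> N} := mk_linear (@zero_linear M N).

Lemma row0_eq (v w : 'rV[A]_0) : v = w.
Proof. by rewrite [v]thinmx0 [w]thinmx0. Qed.

Lemma short_exact_iso (P P' : lmodType A) (g : {linear P -> P'}) :
  bijective g -> short_exact g (zeroL P' 'rV[A]_0).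
Proof.
case=> h gK hK; split; first exact: can_inj gK.
  by move=> y; split=> // _; exists (h y).
by move=> z; exists 0; apply: row0_eq.
Qed.

Lemma tens_row0 (t u : tens f 'rV[A]_0) : t = u.
Proof.
have E (w : tens f 'rV[A]_0) : w = 0.
  rewrite -[w](@tmap_id _ _ f _ (zeroL _ _)) ?tmap0 // => v; exact: row0_eq.
by rewrite [t]E [u]E.
Qed.

(** An isomorphism of triples is an exact sequence whose third term is the identity of the zero
    module. *)
Lemma relK0_transport T T' (g : {linear rt_src T -> rt_src T'})
    (g' : {linear rt_tgt T -> rt_tgt T'}) :
    bijective g -> bijective g' ->
    (forall t, rt_map T' (tmap f g t) = tmap f g' (rt_map T t)) ->
  cls T' == cls T.
Proof.
move=> g_bij g'_bij E.
have h : rel_exact T T' (idT (freem A 0)).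
  exists g, (zeroL _ _), g', (zeroL _ _); split.
  - exact: short_exact_iso.
  - exact: short_exact_iso.
  - exact: E.
  - by move=> t; apply: tens_row0.
apply: relK0_trans (relK0_exact h) _; rewrite -[X in _ == X]cats0.
exact: (relK0_catl (cls T) (idT_zero _)).
Qed.

Lemma iso_zero T (g : {linear rt_src T -> rt_tgt T}) :
  bijective g -> rt_map T =1 tmap f g -> cls T == [::].
Proof.
move=> g_bij E; apply: relK0_trans (idT_zero (rt_src T)).
apply: (@relK0_transport (idT (rt_src T)) T idfun g) => //; first exact: idfun_bij.
by move=> t; rewrite E (@tmap_id _ _ f _ idfun).
Qed.

Lemma inv_triple_ex T : exists T', [/\ rt_src T' = rt_tgt T, rt_tgt T' = rt_src T &
  (cls T ++ cls T') == [::]].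
Proof.
have [psi phiK psiK] := rt_bij T; pose psiL := mk_linear (can_linear phiK psiK).
have psi_bij : bijective psiL by exists (rt_map T).
exists (RelTriple psi_bij); split=> //.
apply: relK0_trans (idT_zero (rt_src T)).
have h := relK0_comp (rt_bij T) psi_bij.
have e : rel_comp (rt_bij T) psi_bij = idT (rt_src T).
  by apply/rel_triple_eq => t; apply: phiK.
have eT : RelTriple (rt_bij T) = T by case: (T).
rewrite e eT in h; exact: relK0_sym.
Qed.

Section SumTriple.
Variables T1 T2 : rel_triple f.
Let P := fgprod (rt_src T1) (rt_src T2).
Let P' := fgprod (rt_tgt T1) (rt_tgt T2).

Definition sum_map : {linear tens f P -> tens f P'} :=
  ((tmap f (inlL (rt_tgt T1) (rt_tgt T2)) \o rt_map T1 \o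
     tmap f (fstL (rt_src T1) (rt_src T2))) \+
   (tmap f (inrL (rt_tgt T1) (rt_tgt T2)) \o rt_map T2 \o
     tmap f (sndL (rt_src T1) (rt_src T2))) : {linear _ -> _}).

Lemma sum_mapE t : sum_map t =
  tmap f (inlL (rt_tgt T1) (rt_tgt T2)) (rt_map T1 (tmap f (fstL (rt_src T1) (rt_src T2)) t))
  + tmap f (inrL (rt_tgt T1) (rt_tgt T2)) (rt_map T2 (tmap f (sndL (rt_src T1) (rt_src T2)) t)).
Proof. by []. Qed.
End SumTriple.

Section TensProd.
Variables P N : fgproj A.
Lemma tfst_inl t : tmap f (fstL P N) (tmap f (inlL P N) t) = t.
Proof. by rewrite (tmap_comp (k := idfun)) ?tmap_id. Qed.
Lemma tsnd_inr t : tmap f (sndL P N) (tmap f (inrL P N) t) = t.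
Proof. by rewrite (tmap_comp (k := idfun)) ?tmap_id. Qed.
Lemma tfst_inr t : tmap f (fstL P N) (tmap f (inrL P N) t) = 0.
Proof. by rewrite (tmap_comp (k := zeroL _ _)) ?tmap0. Qed.
Lemma tsnd_inl t : tmap f (sndL P N) (tmap f (inlL P N) t) = 0.
Proof. by rewrite (tmap_comp (k := zeroL _ _)) ?tmap0. Qed.
Lemma tprod_dec t : tmap f (inlL P N) (tmap f (fstL P N) t) +
                    tmap f (inrL P N) (tmap f (sndL P N) t) = t.
Proof.
rewrite (tmap_comp (k := inlL P N \o fstL P N)) //.
rewrite (tmap_comp (k := inrL P N \o sndL P N)) //.
rewrite (tmap_add (k := idfun)) ?tmap_id // => -[x y].
by congr pair; rewrite /= ?addr0 ?add0r.
Qed.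

Lemma short_exact_prod : short_exact (inlL P N) (sndL P N).
Proof.
split=> [x y []//|[x y]|z]; last by exists (0, z).
by split=> [/= ->|[x' [_ <-]] //]; exists x.
Qed.
End TensProd.

Lemma sum_triple_ex T1 T2 : exists T,
  [/\ rt_src T = fgprod (rt_src T1) (rt_src T2),
      rt_tgt T = fgprod (rt_tgt T1) (rt_tgt T2) & cls T == (cls T1 ++ cls T2)].
Proof.
have [psi1 E1 F1] := rt_bij T1; have [psi2 E2 F2] := rt_bij T2.
pose psi1L := mk_linear (can_linear E1 F1); pose psi2L := mk_linear (can_linear E2 F2).
have E1' t : psi1L (rt_map T1 t) = t by exact: E1.
have F1' t : rt_map T1 (psi1L t) = t by exact: F1.
have E2' t : psi2L (rt_map T2 t) = t by exact: E2.
have F2' t : rt_map T2 (psi2L t) = t by exact: F2.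
have b : bijective (sum_map T1 T2).
  exists (fun t =>
    tmap f (inlL (rt_src T1) (rt_src T2)) (psi1L (tmap f (fstL (rt_tgt T1) (rt_tgt T2)) t))
  + tmap f (inrL (rt_src T1) (rt_src T2)) (psi2L (tmap f (sndL (rt_tgt T1) (rt_tgt T2)) t))) => t.
    rewrite sum_mapE !linearD tfst_inl tsnd_inl tfst_inr tsnd_inr !linear0 addr0 add0r.
    by rewrite E1' E2' tprod_dec.
  rewrite sum_mapE !linearD tfst_inl tsnd_inl tfst_inr tsnd_inr !linear0 addr0 add0r.
  by rewrite F1' F2' tprod_dec.
exists (RelTriple b); split=> //; apply: relK0_exact.
exists (inlL _ _), (sndL _ _), (inlL _ _), (sndL _ _); split.
- exact: short_exact_prod.
- exact: short_exact_prod.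
- move=> t; rewrite /= -/(sum_map T1 T2) [LHS]sum_mapE tfst_inl tsnd_inl.
  by rewrite !linear0 addr0.
- move=> t; rewrite [RHS]/= -/(sum_map T1 T2) [X in _ = tmap f _ X]sum_mapE.
  by rewrite linearD tsnd_inl tsnd_inr add0r.
Qed.

(** Signs are absorbed by inverting the isomorphism, sums by direct sums. *)
Lemma relK0_single x : exists T, x == cls T.
Proof.
elim: x => [|[b T] x [T' E]].
  by exists (idT (freem A 0)); apply/relK0_sym/idT_zero.
have [T1 E1] : exists T1, [:: (b, T)] == cls T1.
  case: b; last by exists T; apply: relK0_refl.
  have [T1 [_ _ h]] := inv_triple_ex T; exists T1.
  apply: (@relK0_cancel (cls T)); apply: relK0_trans (relK0_opp T) _.
  exact: relK0_sym.
have [T2 [_ _ E2]] := sum_triple_ex T1 T'.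
exists T2; apply: relK0_trans (relK0_sym E2).
exact: (relK0_cat E1 E).
Qed.

(** The kernel [N] of a split surjection from a free module is a complement of the source; adding
    the identity triple of [N] makes the source free and leaves the class unchanged. *)
Lemma relK0_rep x m : exists r (P : fgproj A)
    (phi : {linear tens f (freem A r) -> tens f P}) (b : bijective phi),
  (m <= r)%N /\ x == cls (RelTriple b).
Proof.
have [T E] := relK0_single x.
have [r [s [t [mr st]]]] := fgproj_section (rt_src T) m.
pose N0 := kermod t.
have pr_sub v : kerpred t (v - s (t v)) by rewrite /kerpred linearB st subrr.
pose q0 (v : 'rV[A]_r) : N0 := Sub (v - s (t v)) (pr_sub v).
have q_lin : linear q0.
  move=> a u v; apply: val_inj; rewrite linearP /=.
  have -> : s (t (a *: u + v)) = a *: s (t u) + s (t v).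
    by rewrite [t _]linearP [s _]linearP.
  by rewrite scalerBr opprD addrACA.
pose q := mk_linear q_lin.
have i_lin : linear (fun v : N0 => val v) by move=> a u v; rewrite linearP.
pose i := mk_linear i_lin.
have qE v : i (q v) = v - s (t v) by exact: SubK.
have ti u : t (i u) = 0 by apply/eqP; exact: (valP u).
have qi : cancel i q by move=> u; apply: val_inj; rewrite [LHS]qE ti linear0 subr0.
have qs u : q (s u) = 0 by apply: val_inj; rewrite [LHS]qE st subrr.
pose N : fgproj A := FGProj (fin_gen_surj (t := q) (fun w : N0 => ex_intro _ (i w) (qi w)) (row_fin_gen A r))
  (projective_retract qi (@row_projective A r)).
have [T2 [e1 e2 E2]] := sum_triple_ex T (idT N).
have E3 : x == cls T2.
  apply: relK0_trans E _; apply: relK0_trans (relK0_sym E2).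
  by rewrite -[X in X == _]cats0; apply: relK0_catl; apply/relK0_sym/idT_zero.
case: T2 e1 e2 {E2} E3 => P P' phi phi_bij /= e1 e2 E3.
move: phi phi_bij E3; rewrite e1 => phi phi_bij E3.
have g_lin : linear (fun v : 'rV[A]_r => (t v, q v) : rt_src T * N0).
  by move=> a u v; congr pair; rewrite linearP.
pose g : {linear freem A r -> fgprod (rt_src T) N} := mk_linear g_lin.
have g_bij : bijective g.
  exists (fun z : rt_src T * N0 => s z.1 + i z.2) => [v|[u w]].
    by rewrite -[LHS]/(s (t v) + i (q v)) qE addrC subrK.
  rewrite -[LHS]/(t (s u + i w), q (s u + i w)).
  by rewrite !linearD st ti addr0 qs add0r qi.
exists r, P', (phi \o tmap f g : {linear _ -> _}).
exists (bij_comp phi_bij (tmap_bij f g_bij)); split=> //.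
apply: relK0_trans E3 _.
apply: (@relK0_transport (RelTriple (bij_comp phi_bij (tmap_bij f g_bij)))
  (RelTriple phi_bij) g idfun) => //; first exact: idfun_bij.
by move=> u; rewrite (@tmap_id _ _ f _ idfun).
Qed.

End RelK0Theory.

Local Opaque tmap tlift.
(** * Elementary matrices act trivially on classes *)
Section Elementary.
Variable S : pzRingType.

Definition elem r (i j : 'I_r) (a : S) : 'M[S]_r := 1%:M + a *: delta_mx i j.

Inductive El r : 'M[S]_r -> Prop :=
| El_one : El 1%:M
| El_step i j a g : i != j -> El g -> El (elem i j a *m g).

Lemma mul_delta_mx_scale r n (i j : 'I_r) (M : 'M[S]_(r, n)) k l :
  (delta_mx i j *m M) k l = (k == i)%:R * M j l.
Proof.
rewrite mxE (bigD1 j) //= mxE eqxx andbT big1 ?addr0 // => x /negPf xj.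
by rewrite mxE xj andbF mul0r.
Qed.

Lemma elem_mulE r n (i j : 'I_r) a (M : 'M[S]_(r, n)) k l :
  (elem i j a *m M) k l = M k l + (k == i)%:R * (a * M j l).
Proof.
rewrite mulmxDl mul1mx mxE -scalemxAl mxE mul_delta_mx_scale.
by case: (k == i); rewrite ?mul1r // !mul0r mulr0.
Qed.

Lemma elemE r (i j : 'I_r) a k l :
  elem i j a k l = (k == l)%:R + (k == i)%:R * (a * (j == l)%:R).
Proof. by rewrite -[elem i j a]mulmx1 elem_mulE !mxE. Qed.

Lemma elem_mul r (i j : 'I_r) a b : i != j ->
  elem i j a *m elem i j b = elem i j (a + b).
Proof.
move=> ij; apply/matrixP=> k l; rewrite elem_mulE !elemE.
rewrite [j == i]eq_sym (negPf ij) mul0r addr0 -addrA -mulrDr -mulrDl.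
by rewrite [b + a]addrC.
Qed.

Lemma elem0 r (i j : 'I_r) : elem i j 0 = 1%:M.
Proof. by rewrite /elem scale0r addr0. Qed.

Lemma El_mul r (g h : 'M[S]_r) : El g -> El h -> El (g *m h).
Proof.
move=> Eg Eh; elim: Eg => [|i j a g' ij _ IH]; first by rewrite mul1mx.
by rewrite -mulmxA; apply: El_step.
Qed.

Lemma El_elem r (i j : 'I_r) a : i != j -> El (elem i j a).
Proof. by move=> ij; rewrite -[elem _ _ _]mulmx1; apply/El_step/El_one. Qed.

Lemma El_inv r (g : 'M[S]_r) : El g ->
  exists g', [/\ El g', g *m g' = 1%:M & g' *m g = 1%:M].
Proof.
elim=> [|i j a h ij _ [h' [Eh' hh' h'h]]].
  by exists 1%:M; rewrite mul1mx; split=> //; apply: El_one.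
exists (h' *m elem i j (- a)); split.
- exact/El_mul/El_elem.
- by rewrite mulmxA -(mulmxA (elem _ _ _)) hh' mulmx1 elem_mul // subrr elem0.
- by rewrite mulmxA -(mulmxA h') elem_mul // addNr elem0 mulmx1.
Qed.
End Elementary.

Section MatrixOfMap.
Variables (A B : pzRingType) (f : {rmorphism A -> B}).

Definition iotaT n : {linear tens f 'rV[A]_n -> 'rV[B]_n} :=
  @tlift A B f 'rV[A]_n 'rV[B]_n (map_mx f) (@map_mxD _ _ f 1 n)
    (fun a x => map_mxZ f a x).

Lemma iotaTE n b (x : 'rV[A]_n) : iotaT n (tpure f b x) = b *: map_mx f x.
Proof. exact: tliftE. Qed.

Local Opaque iotaT.

Lemma iotaT1 n (x : 'rV[A]_n) : iotaT n (tpure f 1 x) = map_mx f x.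
Proof. by rewrite iotaTE scale1r. Qed.

Definition kappa n : {linear 'rV[B]_n -> tens f 'rV[A]_n} :=
  rowlin (fun i => tpure f 1 'e_i).

Lemma iotaTK n : cancel (@iotaT n) (@kappa n).
Proof.
apply: (tens_linear_ext (g := kappa n \o iotaT n) (h := idfun)) => x.
suff: kappa n (iotaT n (tpure f 1 x)) = tpure f 1 x by [].
rewrite iotaT1 /= /rowcomb {2}(row_sum_delta x).
rewrite (big_morph _ (tpureDr f 1) (tpure0r f _ 1)); apply: eq_bigr => i _.
by rewrite mxE tpure1Z.
Qed.

Lemma kappaK n : cancel (@kappa n) (@iotaT n).
Proof.
apply: (row_linear_ext (g := iotaT n \o kappa n) (h := idfun)) => i.
suff: iotaT n (kappa n 'e_i) = 'e_i by [].
by rewrite rowlinE iotaT1 map_delta_mx.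
Qed.

(** The matrix over [B] of the composite of [t], [phi] and [s], acting on row vectors. As [P] is
    only a retract of a free module, its identity becomes an idempotent matrix. *)
Definition mxP (P P' : lmodType A) m n (t : {linear 'rV[A]_m -> P})
    (s : {linear P' -> 'rV[A]_n}) (phi : tens f P -> tens f P') :
    'M[B]_(m, n) :=
  \matrix_(i < m) iotaT n (tmap f s (phi (tpure f 1 (t 'e_i)))).

Lemma row_mxP (P P' : lmodType A) m n (t : {linear 'rV[A]_m -> P})
    (s : {linear P' -> 'rV[A]_n}) phi i :
  row i (mxP t s phi) = iotaT n (tmap f s (phi (tpure f 1 (t 'e_i)))).
Proof. exact: rowK. Qed.

Lemma mxPE (P P' : lmodType A) m n (t : {linear 'rV[A]_m -> P})
    (s : {linear P' -> 'rV[A]_n}) (phi : {linear tens f P -> tens f P'}) u :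
  iotaT n (tmap f s (phi (tmap f t u))) = iotaT m u *m mxP t s phi.
Proof.
pose g : {linear tens f 'rV[A]_m -> 'rV[B]_n} := iotaT n \o tmap f s \o phi \o tmap f t.
have h_lin : linear (fun u => iotaT m u *m mxP t s phi).
  by move=> b x y; rewrite linearP mulmxDl scalemxAl.
apply: (tens_linear_ext (g := g) (h := mk_linear h_lin)) => x.
suff: iotaT n (tmap f s (phi (tmap f t (tpure f 1 x)))) =
      iotaT m (tpure f 1 x) *m mxP t s phi by [].
rewrite iotaT1 tmapE mulmx_sum_row.
have -> : t x = rowlin (fun i => t 'e_i) x.
  by apply: row_linear_ext => i; rewrite rowlinE.
rewrite -[rowlin _ x]/(rowcomb _ x) /rowcomb.
rewrite (big_morph _ (tpureDr f 1) (tpure0r f P 1)) (linear_sum phi).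
rewrite (linear_sum (tmap f s)) (linear_sum (iotaT n)).
by apply: eq_bigr => i _; rewrite mxE row_mxP tpure1Z !linearZ_LR.
Qed.

Lemma mxP_comp (P P' P'' : lmodType A) m n k (t : {linear 'rV[A]_m -> P})
    (s' : {linear P' -> 'rV[A]_n}) (t' : {linear 'rV[A]_n -> P'})
    (s'' : {linear P'' -> 'rV[A]_k}) (phi : {linear tens f P -> tens f P'})
    (psi : {linear tens f P' -> tens f P''}) :
  cancel s' t' ->
  mxP t s' phi *m mxP t' s'' psi = mxP t s'' (psi \o phi).
Proof.
move=> st; apply/row_matrixP => i; rewrite row_mul !row_mxP -mxPE.
by rewrite (tmap_comp (k := idfun)) // tmap_id.
Qed.

Lemma mxP_tmap (P P' : lmodType A) m n (t : {linear 'rV[A]_m -> P})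
    (s : {linear P' -> 'rV[A]_n}) (g : {linear P -> P'}) :
  mxP t s (tmap f g) = map_mx f (\matrix_i s (g (t 'e_i))).
Proof.
apply/row_matrixP => i; rewrite row_mxP !tmapE iotaT1.
by rewrite -map_row rowK.
Qed.

Lemma mxP_add (P P' : lmodType A) m n (t : {linear 'rV[A]_m -> P})
    (s : {linear P' -> 'rV[A]_n}) (phi psi chi : tens f P -> tens f P') :
  (forall u, phi u + psi u = chi u) ->
  mxP t s phi + mxP t s psi = mxP t s chi.
Proof.
move=> E; apply/row_matrixP => i.
by rewrite [row i _]linearD /= !row_mxP -E (linearD (tmap f s)) (linearD (iotaT n)).
Qed.

Lemma eq_mxP (P P' : lmodType A) m n (t : {linear 'rV[A]_m -> P})
    (s : {linear P' -> 'rV[A]_n}) (phi psi : tens f P -> tens f P') :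
  phi =1 psi -> mxP t s phi = mxP t s psi.
Proof. by move=> E; apply/row_matrixP => i; rewrite !row_mxP E. Qed.

Lemma lin_rowE m n (g : {linear 'rV[A]_m -> 'rV[A]_n}) v :
  g v = v *m \matrix_i g 'e_i.
Proof.
rewrite mulmx_sum_row {1}(row_sum_delta v) linear_sum; apply: eq_bigr => i _.
by rewrite linearZ_LR rowK.
Qed.

Section Action.
Variables (m n : nat) (M : 'M[B]_(m, n)).
Fact actL_lin : linear (fun u : tens f 'rV[A]_m => kappa n (iotaT m u *m M)).
Proof. by move=> b x y; rewrite linearP mulmxDl -scalemxAl linearP. Qed.
Definition actL : {linear tens f 'rV[A]_m -> tens f 'rV[A]_n} := mk_linear actL_lin.
Lemma iotaT_actL u : iotaT n (actL u) = iotaT m u *m M.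
Proof. exact: kappaK. Qed.
End Action.

Lemma actL_bij r (M M' : 'M[B]_r) : M *m M' = 1%:M -> M' *m M = 1%:M ->
  bijective (actL M).
Proof.
by move=> h h'; exists (actL M') => u; apply: (can_inj (@iotaTK r));
  rewrite !iotaT_actL -mulmxA ?h ?h' mulmx1.
Qed.

Lemma mx_mulP m n (g : {linear 'rV[A]_m -> 'rV[A]_n}) (h : 'M[A]_(m,n)) :
  (forall v, g v = v *m h) -> \matrix_i g 'e_i = h.
Proof. by move=> E; apply/row_matrixP => i; rewrite rowK E -rowE. Qed.

End MatrixOfMap.

Lemma map_mx_injective (S T : Type) (g : S -> T) m n :
  injective g -> injective (@map_mx S T g m n).
Proof.
by move=> gI X Y /matrixP E; apply/matrixP => i j; have := E i j; rewrite !mxE => /gI.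
Qed.

Section ElementaryZero.
Variables (A B : pzRingType) (f : {rmorphism A -> B}).
Local Notation "x == y" := (@relK0_eq A B f x y).
Local Notation cls T := ([:: (false, T)] : relK0 f).

Lemma ker_fgproj (P : fgproj A) (N : lmodType A) (s : {linear N -> P})
    (t : {linear P -> N}) : cancel s t ->
  exists (K : fgproj A) (i : {linear K -> P}), short_exact i t.
Proof.
move=> st.
have pr_sub v : kerpred t (v - s (t v)) by rewrite /kerpred linearB st subrr.
pose q0 (v : P) : kermod t := Sub (v - s (t v)) (pr_sub v).
have q_lin : linear q0.
  move=> a u v; apply: val_inj; rewrite linearP /=.
  have -> : s (t (a *: u + v)) = a *: s (t u) + s (t v).
    by rewrite [t _]linearP [s _]linearP.
  by rewrite scalerBr opprD addrACA.
pose q := mk_linear q_lin.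
have i_lin : linear (fun v : kermod t => val v) by move=> a u v; rewrite linearP.
pose i := mk_linear i_lin.
have ti u : t (i u) = 0 by apply/eqP; exact: (valP u).
have qi : cancel i q.
  by move=> u; apply: val_inj; rewrite [LHS]SubK [t _]ti linear0 subr0.
pose K : fgproj A := FGProj
  (fin_gen_surj (t := q) (fun w : kermod t => ex_intro _ (i w) (qi w)) (fgproj_fin_gen P))
  (projective_retract qi (@fgproj_projective A P)).
exists K, i; split; first exact: can_inj qi.
  move=> y; split=> [ty|[x <-]]; last exact: ti.
  by exists (q y); rewrite [LHS]SubK ty linear0 subr0.
by move=> z; exists (s z).
Qed.

(** [phi] fixes the kernel of [t] and induces the identity on the quotient, so its triple is an
    extension of two identity triples. *)
Lemma unipotent_zero (P N : fgproj A) (s : {linear N -> P})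
    (t : {linear P -> N}) (phi : {linear tens f P -> tens f P})
    (b : bijective phi) : cancel s t ->
    (forall u, tmap f t (phi u) = tmap f t u) ->
    (forall x : P, t x = 0 -> phi (tpure f 1 x) = tpure f 1 x) ->
  cls (RelTriple b) == [::].
Proof.
move=> st tphi phi_id; have [K [i ex]] := ker_fgproj st.
have ti x : t (i x) = 0 by case: ex => _ h _; apply/h; exists x.
have h : rel_exact (idT f K) (RelTriple b) (idT f N).
  exists i, t, i, t; split=> //; last by move=> u; rewrite /= tphi.
  apply: (tens_linear_ext (g := phi \o tmap f i) (h := tmap f i)) => x.
  by rewrite -[LHS]/(phi (tmap f i (tpure f 1 x))) tmapE phi_id.
apply: relK0_trans (relK0_exact h) _.
exact: (relK0_cat (idT_zero f K) (idT_zero f N)).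
Qed.

(** Right multiplication by [elem i j a] sends a row [x] to [x + x_i a e_j]: it preserves the [i]-th
    coordinate and fixes the rows where that coordinate is 0. *)
Lemma elem_zero r (i j : 'I_r) a (b : bijective (actL f (elem i j a))) : i != j ->
  cls (@RelTriple A B f (freem A r) (freem A r) (actL f (elem i j a)) b) == [::].
Proof.
move=> ij.
have t_lin : linear (fun v : 'rV[A]_r => \row_(_ < 1) v 0 i).
  by move=> c x y; apply/rowP=> k; rewrite !mxE.
pose t : {linear freem A r -> freem A 1} := mk_linear t_lin.
pose s : {linear freem A 1 -> freem A r} := rowlin (fun=> 'e_i).
have actE (x : 'rV[A]_r) : actL f (elem i j a) (tpure f 1 x) =
    tpure f 1 x + (f (x 0 i) * a) *: tpure f 1 'e_j.
  apply: (can_inj (@iotaTK A B f r)); rewrite iotaT_actL linearD linearZ_LR !iotaT1.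
  rewrite map_delta_mx mulmxDr mulmx1; congr (_ + _); apply/rowP=> k.
  rewrite mxE (bigD1 i) //= big1 ?addr0 => [|l /negPf li].
    by rewrite !mxE !eqxx /= mulrA.
  by rewrite !mxE li mulr0 mulr0.
apply: (unipotent_zero (s := s) (t := t)) => [v|u|x].
- apply/rowP=> k; rewrite -[LHS]/((\row_(_ < 1) (s v) 0 i) 0 k) mxE /= /rowcomb.
  by rewrite big_ord1 !mxE !eqxx mulr1 (ord1 k).
- apply: (tens_linear_ext (g := tmap f t \o actL f (elem i j a)) (h := tmap f t)) => x.
  rewrite -[LHS]/(tmap f t (actL f (elem i j a) (tpure f 1 x))) actE linearD linearZ_LR.
  rewrite !tmapE; have -> : t 'e_j = 0 :> 'rV[A]_1.
    by apply/rowP=> k; rewrite !mxE (negPf ij) andbF.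
  by rewrite tpure0r scaler0 addr0.
- rewrite actE => /rowP/(_ 0); rewrite !mxE => ->.
  by rewrite rmorph0 mul0r scale0r addr0.
Qed.

Lemma El_zero r (E : 'M[B]_r) : El E -> forall b : bijective (actL f E),
  cls (@RelTriple A B f (freem A r) (freem A r) (actL f E) b) == [::].
Proof.
elim=> [b|i j a g ij Eg IH b].
  apply: (@iso_zero _ _ f (@RelTriple A B f (freem A r) (freem A r) (actL f 1%:M) b) idfun).
    exact: idfun_bij.
  move=> u; rewrite (@tmap_id _ _ f _ idfun) //; apply: (can_inj (@iotaTK A B f r)).
  by rewrite iotaT_actL mulmx1.
have [g' [_ gg' g'g]] := El_inv Eg; have bg := actL_bij f gg' g'g.
have [e' [_ ee' e'e]] := El_inv (El_elem a ij); have be := actL_bij f ee' e'e.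
have -> : @RelTriple A B f (freem A r) (freem A r) (actL f (elem i j a *m g)) b =
    @rel_comp A B f (freem A r) (freem A r) (freem A r) _ be _ bg.
  apply: rel_triple_eq => u; apply: (can_inj (@iotaTK A B f r)).
  by rewrite [RHS]iotaT_actL !iotaT_actL mulmxA.
apply: relK0_trans (relK0_comp _ _) _.
exact: (relK0_cat (elem_zero be ij) (IH bg)).
Qed.

(** Once [E] has absorbed the denominators of [phi] and of its inverse, [X0] and [Y0] are inverse
    isomorphisms between [A^r] and [P]. Thus [phi] is an elementary automorphism followed by an
    isomorphism defined over [A], and both have trivial class. *)
Lemma free_triple_zero r (P : fgproj A) n (s : {linear P -> 'rV[A]_n})
    (t : {linear 'rV[A]_n -> P}) (phi : {linear tens f (freem A r) -> tens f P})
    (b : bijective phi) (psi : {linear tens f P -> tens f (freem A r)})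
    (E E' : 'M[B]_r) (X0 : 'M[A]_(r, n)) (Y0 : 'M[A]_(n, r)) :
    injective f -> cancel s t -> cancel phi psi -> cancel psi phi ->
    El E -> E *m E' = 1%:M -> E' *m E = 1%:M ->
    E' *m mxP (idfun : {linear 'rV[A]_r -> 'rV[A]_r}) s phi = map_mx f X0 ->
    mxP t (idfun : {linear 'rV[A]_r -> 'rV[A]_r}) psi *m E = map_mx f Y0 ->
  cls (RelTriple b) == [::].
Proof.
move=> f_inj st phiK psiK ElE EE' E'E hX hY.
set X := mxP _ s phi in hX; set Y := mxP t _ psi in hY.
have XY : X *m Y = 1%:M.
  rewrite mxP_comp // (@eq_mxP A B f _ _ _ _ _ _ _ (tmap f idfun)).
    rewrite mxP_tmap (_ : \matrix_i _ = 1%:M) ?map_mx1 //.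
    by apply: mx_mulP => v; rewrite mulmx1.
  by move=> u; rewrite tmap_id //=; apply: phiK.
have YX : Y *m X = map_mx f (\matrix_i s (t 'e_i)).
  rewrite mxP_comp // -(@mxP_tmap A B f P P _ _ t s idfun).
  by apply: eq_mxP => u; rewrite tmap_id //=; apply: psiK.
have X0Y0 : X0 *m Y0 = 1%:M.
  apply: (map_mx_injective f_inj); rewrite map_mxM map_mx1 -hX -hY.
  by rewrite mulmxA -(mulmxA E') XY mulmx1.
have Y0X0 : Y0 *m X0 = \matrix_i s (t 'e_i).
  apply: (map_mx_injective f_inj); rewrite map_mxM -hX -hY mulmxA -(mulmxA Y).
  by rewrite EE' mulmx1.
have stE v : s (t v) = v *m Y0 *m X0.
  by rewrite -mulmxA Y0X0 -(lin_rowE (s \o t)).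
have g_lin : linear (fun v : 'rV[A]_r => t (v *m X0)).
  by move=> c x y; rewrite mulmxDl -scalemxAl linearP.
pose g : {linear freem A r -> P} := mk_linear g_lin.
have sg v : s (g v) = v *m X0.
  by rewrite [LHS]stE -(mulmxA v) X0Y0 mulmx1.
have g_bij : bijective g.
  exists (fun y => s y *m Y0) => [v|y]; first by rewrite sg -mulmxA X0Y0 mulmx1.
  by rewrite -[LHS]/(t (s y *m Y0 *m X0)) -stE !st.
have bE := actL_bij f EE' E'E.
have bg := tmap_bij f g_bij.
have -> : RelTriple b = @rel_comp A B f (freem A r) (freem A r) P _ bE _ bg.
  apply: rel_triple_eq.
  apply: (tens_linear_ext (h := tmap f g \o actL f E)) => v.
  have inj : injective (fun u => iotaT f n (tmap f s u)).
    move=> u w /(can_inj (@iotaTK A B f n))/(congr1 (tmap f t)).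
    by rewrite !(tmap_comp (k := idfun)) ?tmap_id.
  apply: inj.
  have -> : iotaT f n (tmap f s (phi (tpure f 1 v))) = map_mx f v *m X.
    rewrite -iotaT1 -(mxPE (idfun : {linear 'rV[A]_r -> 'rV[A]_r}) s phi).
    by rewrite (@tmap_id _ _ f _ idfun).
  have -> : X = E *m map_mx f X0 by rewrite -hX mulmxA EE' mul1mx.
  rewrite -[RHS]/(iotaT f n (tmap f s (tmap f g (actL f E (tpure f 1 v))))).
  have h2 := mxPE (idfun : {linear 'rV[A]_r -> 'rV[A]_r}) s (tmap f g) (actL f E (tpure f 1 v)).
  rewrite (@tmap_id _ _ f _ idfun) // in h2; rewrite h2 iotaT_actL iotaT1 mxP_tmap.
  rewrite (_ : \matrix_i _ = X0) ?mulmxA //.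
  exact: (mx_mulP (g := s \o g)).
apply: relK0_trans (relK0_comp _ _) _.
apply: (relK0_cat (El_zero ElE bE) (iso_zero (T := RelTriple bg) g_bij _)) => //.
Qed.
End ElementaryZero.

(** * Determinants as invariants of classes *)
Section SubringMatrices.
Variables (S : pzRingType) (C : S -> Prop).
(** Subrings are plain predicates because the localisations at all primes are compared inside one
    ambient ring. *)
Definition subring_pred : Prop :=
  [/\ C 1, forall a b, C a -> C b -> C (a - b) & forall a b, C a -> C b -> C (a * b)].
Definition mxin m n (X : 'M[S]_(m, n)) := forall i j, C (X i j).

Hypothesis CS : subring_pred.
Lemma subring1 : C 1. Proof. by case: CS. Qed.
Lemma subringB a b : C a -> C b -> C (a - b). Proof. by case: CS => _ h _; apply: h. Qed.
Lemma subringM a b : C a -> C b -> C (a * b). Proof. by case: CS => _ _; apply. Qed.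
Lemma subring0 : C 0. Proof. by rewrite -(subrr 1); apply: subringB; apply: subring1. Qed.
Lemma subringN a : C a -> C (- a).
Proof. by move=> Ca; rewrite -sub0r; apply: subringB => //; apply: subring0. Qed.
Lemma subringD a b : C a -> C b -> C (a + b).
Proof. by move=> Ca Cb; rewrite -[b]opprK; apply: subringB => //; apply: subringN. Qed.
Lemma subring_sum I (r : seq I) (P : pred I) F :
  (forall i, P i -> C (F i)) -> C (\sum_(i <- r | P i) F i).
Proof. by move=> h; elim/big_ind: _ => //; [apply: subring0|apply: subringD]. Qed.
Lemma subring_nat n : C n%:R.
Proof.
elim: n => [|n IHn]; first exact: subring0.
by rewrite -natr1; apply: subringD => //; apply: subring1.
Qed.
Lemma subringX a n : C a -> C (a ^+ n).
Proof.
by move=> Ca; elim: n => [|n IH]; rewrite ?exprS; [apply: subring1|apply: subringM].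
Qed.
Lemma mxin_mul m n k (X : 'M[S]_(m, n)) (Y : 'M[S]_(n, k)) :
  mxin X -> mxin Y -> mxin (X *m Y).
Proof. by move=> hX hY i j; rewrite mxE; apply: subring_sum => l _; apply: subringM. Qed.
Lemma mxin1 n : mxin (1%:M : 'M[S]_n).
Proof. by move=> i j; rewrite mxE; apply: subring_nat. Qed.
Lemma mxin_sub m n (X Y : 'M[S]_(m, n)) : mxin X -> mxin Y -> mxin (X - Y).
Proof. by move=> hX hY i j; rewrite !mxE; apply: subringB. Qed.
Lemma mxin_row_mx m n k (X : 'M[S]_(m, n)) (Y : 'M[S]_(m, k)) :
  mxin X -> mxin Y -> mxin (row_mx X Y).
Proof. by move=> hX hY i j; rewrite mxE; case: split. Qed.
Lemma mxin_col_mx m n k (X : 'M[S]_(m, n)) (Y : 'M[S]_(k, n)) :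
  mxin X -> mxin Y -> mxin (col_mx X Y).
Proof. by move=> hX hY i j; rewrite mxE; case: split. Qed.
End SubringMatrices.

(* If every nonzero idempotent matrix e over C satisfies a e b = 1 for some row
   a and column b, then e splits off rank one pieces until it is zero. *)
Section IdempotentsSplit.
Variables (S : pzRingType) (C : S -> Prop) (k : fieldType) (th : {rmorphism S -> k}).
Hypothesis CS : subring_pred C.
Hypothesis unimod : forall n (e : 'M[S]_n), mxin C e -> e *m e = e -> e <> 0 ->
  exists (a : 'rV[S]_n) (b : 'cV[S]_n), [/\ mxin C a, mxin C b & a *m e *m b = 1%:M].

Definition splits n (e : 'M[S]_n) := exists r (U : 'M[S]_(n, r)) (V : 'M[S]_(r, n)),
  [/\ mxin C U, mxin C V, V *m U = 1%:M & U *m V = e].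

Lemma idempotent_splits n (e : 'M[S]_n) : mxin C e -> e *m e = e -> splits e.
Proof.
have [N] := ubnP (\rank (map_mx th e)); elim: N => // N IH in e *.
move=> rk eC ee; have [->|e0] := pselect (e = 0).
  exists 0%N, 0, 0; split; [by move=> i [] | by move=> [] | | by rewrite mulmx0].
  by apply/matrixP => -[].
have [a [b [aC bC aeb]]] := unimod eC ee e0.
pose u := e *m b; pose v := a *m e.
have vu : v *m u = 1%:M by rewrite /u /v mulmxA -(mulmxA a) ee.
have eu : e *m u = u by rewrite /u mulmxA ee.
have ve : v *m e = v by rewrite /v -mulmxA ee.
have uC : mxin C u by apply: mxin_mul.
have vC : mxin C v by apply: mxin_mul.
pose e' := e - u *m v.
have e'u : e' *m u = 0 by rewrite mulmxBl eu -mulmxA vu mulmx1 subrr.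
have ve' : v *m e' = 0 by rewrite mulmxBr ve mulmxA vu mul1mx subrr.
have ee' : e *m e' = e' by rewrite mulmxBr ee mulmxA eu.
have e'e' : e' *m e' = e' by rewrite {1}/e' mulmxBl ee' -mulmxA ve' mulmx0 subr0.
have e'e : e' *m e = e' by rewrite mulmxBl ee -mulmxA ve.
have [|||r [U [V [UC VC VU UV]]]] := IH e'.
- rewrite ltnS in rk; apply: leq_trans rk; apply: rank_ltmx; rewrite ltmxE; apply/andP; split.
    by rewrite -[X in (map_mx th X <= _)%MS]e'e map_mxM submxMl.
  (* The rank drops: [v] lies in the row space of [e] but not in that of [e'], since [e' *m u = 0]
     while [v *m u = 1]. *)
  apply/negP=> /(submx_trans (submxMl (map_mx th a) _)) /submxP[w E].
  have /eqP := congr1 (map_mx th) vu; rewrite map_mxM map_mx1 [map_mx th v]map_mxM E.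
  rewrite -mulmxA -map_mxM e'u map_mx0 mulmx0 => /eqP/matrixP/(_ 0 0)/eqP.
  by rewrite !mxE eq_sym oner_eq0.
- exact: mxin_sub (mxin_mul CS uC vC).
- by [].
have vU : v *m U = 0 by rewrite -[U]mulmx1 -VU mulmxA mulmxA -(mulmxA v) UV ve' mul0mx.
have Vu : V *m u = 0 by rewrite -[V]mul1mx -VU -!mulmxA (mulmxA U) UV e'u mulmx0.
exists (1 + r)%N, (row_mx u U), (col_mx v V); split.
- exact: mxin_row_mx.
- exact: mxin_col_mx.
- by rewrite mul_col_row vu vU Vu VU -scalar_mx_block.
- by rewrite mul_row_col UV addrC subrK.
Qed.
End IdempotentsSplit.

(** * Determinants in local bases, for a matrix functor [mu] that will be the identity or a
    component *)

Section Invariant.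
Variables (A B B1 : pzRingType) (f : {rmorphism A -> B}) (C : B1 -> Prop).
Variables (sz : nat -> nat) (mu : forall m n, 'M[B]_(m, n) -> 'M[B1]_(sz m, sz n)).
Hypothesis CS : subring_pred C.
Hypothesis muM : forall m n k (X : 'M[B]_(m, n)) (Y : 'M[B]_(n, k)),
  mu (X *m Y) = mu X *m mu Y.
Hypothesis muD : forall m n (X Y : 'M[B]_(m, n)), mu (X + Y) = mu X + mu Y.
Hypothesis mu1 : forall n, mu (1%:M : 'M[B]_n) = 1%:M.
Hypothesis muC : forall m n (X : 'M[A]_(m, n)), mxin C (mu (map_mx f X)).
Hypothesis Csplits : forall n (e : 'M[B1]_n), mxin C e -> e *m e = e -> splits C e.
Hypothesis ibn : forall r r' (X : 'M[B1]_(r, r')) (Y : 'M[B1]_(r', r)),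
  X *m Y = 1%:M -> Y *m X = 1%:M -> r = r'.

(** A local basis of [P]: the idempotent matrix attached to [P] is mapped by [mu] to [U *m V] with
    [V *m U = 1], and [fr_r] is the local rank. *)
Record frame (P : lmodType A) := Frame {
  fr_n : nat;
  fr_s : {linear P -> 'rV[A]_fr_n};
  fr_t : {linear 'rV[A]_fr_n -> P};
  fr_st : cancel fr_s fr_t;
  fr_r : nat;
  fr_U : 'M[B1]_(sz fr_n, fr_r);
  fr_V : 'M[B1]_(fr_r, sz fr_n);
  fr_UC : mxin C fr_U;
  fr_VC : mxin C fr_V;
  fr_VU : fr_V *m fr_U = 1%:M;
  fr_UV : fr_U *m fr_V = mu (mxP fr_t fr_s (tmap f (idfun : {linear P -> P})))
}.

Lemma frame_of (P : lmodType A) n (s : {linear P -> 'rV[A]_n})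
    (t : {linear 'rV[A]_n -> P}) : cancel s t -> exists F : frame P, True.
Proof.
move=> st; pose e := mxP t s (tmap f (idfun : {linear P -> P})).
have ee : e *m e = e.
  by rewrite mxP_comp //; apply: eq_mxP => u; rewrite /= !tmap_id.
have [||r [U [V [UC VC VU UV]]]] := @Csplits _ (mu e).
- by rewrite /e mxP_tmap; apply: muC.
- by rewrite -muM ee.
by exists (@Frame P n s t st r U V UC VC VU UV).
Qed.

Lemma frame_ex (P : fgproj A) : exists F : frame P, True.
Proof. by have [n [s [t [_ st]]]] := fgproj_section P 0; apply: frame_of st. Qed.

Definition std_frame (P : fgproj A) : frame P := projT1 (cid (frame_ex P)).

Section FrameMatrix.
Variables (P P' P'' : lmodType A) (F : frame P) (F' : frame P') (F'' : frame P'').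

Definition Fmx (phi : tens f P -> tens f P') : 'M[B1]_(fr_r F, fr_r F') :=
  fr_V F *m mu (mxP (fr_t F) (fr_s F') phi) *m fr_U F'.

Lemma Fmx_tmapC (g : {linear P -> P'}) : mxin C (Fmx (tmap f g)).
Proof.
apply: (mxin_mul CS); last exact: fr_UC.
by apply: (mxin_mul CS); [apply: fr_VC | rewrite mxP_tmap; apply: muC].
Qed.

Lemma Fmx_add phi psi chi : (forall u, phi u + psi u = chi u) ->
  Fmx phi + Fmx psi = Fmx chi.
Proof.
by move=> E; rewrite /Fmx -(mxP_add _ _ E) muD mulmxDr mulmxDl.
Qed.

Lemma Fmx_zero phi : (forall u, phi u = 0) -> Fmx phi = 0.
Proof.
move=> c0; apply: (addrI (Fmx phi)); rewrite addr0.
by apply: Fmx_add => u; rewrite !c0 addr0.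
Qed.
End FrameMatrix.

Lemma Fmx_comp (P P' P'' : lmodType A) (F : frame P) (F' : frame P')
    (F'' : frame P'') (phi : {linear tens f P -> tens f P'})
    (psi : {linear tens f P' -> tens f P''}) chi :
  (forall u, psi (phi u) = chi u) -> Fmx F F' phi *m Fmx F' F'' psi = Fmx F F'' chi.
Proof.
move=> E; rewrite /Fmx !mulmxA -(mulmxA _ (fr_U F') (fr_V F')) fr_UV.
rewrite -(mulmxA (fr_V F)) -muM mxP_comp; last exact: fr_st.
rewrite -(mulmxA (fr_V F)) -muM.
rewrite (@eq_mxP A B f _ _ _ _ _ _ _ phi) => [|u]; last by rewrite /= tmap_id.
by rewrite mxP_comp; [congr (_ *m mu _ *m _); exact: eq_mxP | exact: fr_st].
Qed.

Lemma Fmx_id (P : lmodType A) (F : frame P) phi : phi =1 id -> Fmx F F phi = 1%:M.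
Proof.
move=> E; rewrite /Fmx (@eq_mxP A B f _ _ _ _ _ _ _ (tmap f (idfun : {linear P -> P}))).
  by rewrite -fr_UV mulmxA -mulmxA !fr_VU mulmx1.
by move=> u; rewrite tmap_id.
Qed.

Lemma Fmx_cancel (P P' : lmodType A) (F : frame P) (F' : frame P')
    (phi : {linear tens f P -> tens f P'}) (psi : {linear tens f P' -> tens f P}) :
  cancel phi psi -> Fmx F F' phi *m Fmx F' F psi = 1%:M.
Proof. by move=> E; rewrite (@Fmx_comp _ _ _ _ _ _ _ _ id) ?Fmx_id. Qed.

Section Determinants.
Variables (J : Type) (KJ : J -> fieldType).
Variable dt : forall j r, 'M[B1]_r -> KJ j.
Hypothesis dtM : forall j r (X Y : 'M[B1]_r), dt j (X *m Y) = dt j X * dt j Y.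
Hypothesis dt1 : forall j r, dt j (1%:M : 'M[B1]_r) = 1.
Hypothesis dt_lblock : forall j r s (X : 'M[B1]_r) (Z : 'M_(s, r)) (W : 'M[B1]_s),
  dt j (block_mx X 0 Z W) = dt j X * dt j W.
Variable US : (forall j, KJ j) -> Prop.
Hypothesis US_C : forall r (h h' : 'M[B1]_r), mxin C h -> mxin C h' ->
  h *m h' = 1%:M -> h' *m h = 1%:M -> US (fun j => dt j h).
Hypothesis US_M : forall a b, US a -> US b -> US (fun j => a j * b j).
Hypothesis US_V : forall a, US a -> US (fun j => (a j)^-1).
Hypothesis US_0 : forall a j, US a -> a j != 0.

(** Source and target ranks are provably equal for invertible [X], but not convertible; [conform_mx]
    makes the determinant total, the identity being a default value. *)
Definition dtr j r r' (X : 'M[B1]_(r, r')) : KJ j :=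
  dt j (conform_mx (1%:M : 'M[B1]_r) X).

Lemma dtr_id j r (X : 'M[B1]_r) : dtr j X = dt j X.
Proof. by rewrite /dtr conform_mx_id. Qed.

Definition inv_pair r r' (X : 'M[B1]_(r, r')) (Y : 'M[B1]_(r', r)) :=
  X *m Y = 1%:M /\ Y *m X = 1%:M.

Lemma inv_pair_mul r r' r'' (X : 'M[B1]_(r, r')) X' (Y : 'M[B1]_(r', r'')) Y' :
  inv_pair X X' -> inv_pair Y Y' -> inv_pair (X *m Y) (Y' *m X').
Proof.
move=> [h1 h2] [h3 h4]; split; rewrite mulmxA.
  by rewrite -(mulmxA X) h3 mulmx1.
by rewrite -(mulmxA Y') h2 mulmx1.
Qed.

Lemma dtr_mul j r r' r'' (X : 'M[B1]_(r, r')) X' (Y : 'M[B1]_(r', r'')) Y' :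
  inv_pair X X' -> inv_pair Y Y' -> dtr j (X *m Y) = dtr j X * dtr j Y.
Proof.
move=> [h1 h2] [h3 h4]; move: (ibn h1 h2) (ibn h3 h4) => e1 e2.
by subst r' r''; rewrite !dtr_id dtM.
Qed.

Lemma dtr_neq0 j r r' (X : 'M[B1]_(r, r')) X' : inv_pair X X' -> dtr j X != 0.
Proof.
move=> [h1 h2]; have e1 := ibn h1 h2; subst r'; rewrite dtr_id.
have /eqP := dt1 j r; rewrite -h1 dtM => /eqP E.
by apply/eqP => X0; have /eqP := E; rewrite X0 mul0r eq_sym oner_eq0.
Qed.

Lemma dtr_US r r' (X : 'M[B1]_(r, r')) X' : inv_pair X X' -> mxin C X -> mxin C X' ->
  US (fun j => dtr j X).
Proof.
move=> [h1 h2] XC X'C; have e1 := ibn h1 h2; subst r'.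
have := US_C XC X'C h1 h2; congr US; apply: functional_extensionality_dep => j.
by rewrite dtr_id.
Qed.

Definition eqU (a b : forall j, KJ j) := exists2 u, US u & forall j, a j = b j * u j.

Lemma eqU_refl a : eqU a a.
Proof.
exists (fun j => 1); last by move=> j; rewrite mulr1.
have := @US_C 0 1%:M 1%:M (@mxin1 _ _ CS _) (@mxin1 _ _ CS _) (mul1mx _) (mul1mx _).
by congr US; apply: functional_extensionality_dep => j; rewrite dt1.
Qed.
Lemma eqU_sym a b : eqU a b -> eqU b a.
Proof.
move=> [u Uu E]; exists (fun j => (u j)^-1); first exact: US_V.
by move=> j; rewrite E mulfK ?US_0.
Qed.
Lemma eqU_trans b a c : eqU a b -> eqU b c -> eqU a c.
Proof.
move=> [u Uu E] [w Uw E']; exists (fun j => w j * u j); first exact: US_M.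
by move=> j; rewrite E E' mulrA.
Qed.
Lemma eqU_mul a b c d : eqU a b -> eqU c d ->
  eqU (fun j => a j * c j) (fun j => b j * d j).
Proof.
move=> [u Uu E] [w Uw E']; exists (fun j => u j * w j); first exact: US_M.
by move=> j; rewrite E E' mulrACA.
Qed.
Lemma eqU_ext a b : (forall j, a j = b j) -> eqU a b.
Proof. by move=> E; have <- : a = b by [apply: functional_extensionality_dep]; apply: eqU_refl. Qed.

Definition vT (T : rel_triple f) j : KJ j :=
  dtr j (Fmx (std_frame (rt_src T)) (std_frame (rt_tgt T)) (rt_map T)).

Lemma Fmx_pair (P P' : lmodType A) (F : frame P) (F' : frame P')
    (phi : {linear tens f P -> tens f P'}) : bijective phi ->
  exists X', inv_pair (Fmx F F' phi) X'.
Proof.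
case=> psi phiK psiK; pose psiL := mk_linear (can_linear phiK psiK).
by exists (Fmx F' F psiL); split; rewrite Fmx_cancel.
Qed.

Lemma Fmx_tmap_pair (P P' : lmodType A) (F : frame P) (F' : frame P')
    (g : {linear P -> P'}) (h : {linear P' -> P}) : cancel g h -> cancel h g ->
  inv_pair (Fmx F F' (tmap f g)) (Fmx F' F (tmap f h)).
Proof.
by move=> gK hK; split; rewrite Fmx_cancel // => u;
  rewrite (tmap_comp (k := idfun)) ?tmap_id.
Qed.

Lemma vT_neq0 T j : vT T j != 0.
Proof. by have [X' h] := Fmx_pair (std_frame (rt_src T)) (std_frame (rt_tgt T)) (rt_bij T); apply: dtr_neq0 h. Qed.

(** The transition matrices are those of identity maps, so they and their inverses have entries in
    [C] and their determinants form families in [US]. *)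
Lemma change_frame (P P' : lmodType A) (F G : frame P) (F' G' : frame P')
    (phi : {linear tens f P -> tens f P'}) : bijective phi ->
  eqU (fun j => dtr j (Fmx F F' phi)) (fun j => dtr j (Fmx G G' phi)).
Proof.
move=> b; have [X hX] := Fmx_pair F F' b; have [Y hY] := Fmx_pair G G' b.
pose iP : {linear P -> P} := idfun; pose iP' : {linear P' -> P'} := idfun.
have h1 := Fmx_tmap_pair F G (g := iP) (h := iP) (fun=> erefl) (fun=> erefl).
have h2 := Fmx_tmap_pair G' F' (g := iP') (h := iP') (fun=> erefl) (fun=> erefl).
have E : Fmx F F' phi = Fmx F G (tmap f iP) *m (Fmx G G' phi *m Fmx G' F' (tmap f iP')).
  rewrite (@Fmx_comp _ _ _ _ _ _ _ _ phi) => [|u]; last by rewrite tmap_id.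
  by rewrite (@Fmx_comp _ _ _ _ _ _ _ _ phi) // => u; rewrite tmap_id.
have h12 : inv_pair (Fmx G G' phi *m Fmx G' F' (tmap f iP')) (Fmx F' G' (tmap f iP') *m Y).
  exact: inv_pair_mul.
exists (fun j => dtr j (Fmx F G (tmap f iP)) * dtr j (Fmx G' F' (tmap f iP'))).
  by apply: US_M; [apply: (dtr_US h1)|apply: (dtr_US h2)]; apply: Fmx_tmapC.
by move=> j; rewrite E (dtr_mul j h1 h12) (dtr_mul j hY h2) mulrCA.
Qed.

Lemma vT_frame T (F : frame (rt_src T)) (F' : frame (rt_tgt T)) :
  eqU (vT T) (fun j => dtr j (Fmx F F' (rt_map T))).
Proof. exact/change_frame/rt_bij. Qed.

Lemma vT_comp (P P' P'' : fgproj A)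
    (phi : {linear tens f P -> tens f P'}) (phi_bij : bijective phi)
    (psi : {linear tens f P' -> tens f P''}) (psi_bij : bijective psi) j :
  vT (rel_comp phi_bij psi_bij) j = vT (RelTriple phi_bij) j * vT (RelTriple psi_bij) j.
Proof.
have [X hX] := Fmx_pair (std_frame P) (std_frame P') phi_bij.
have [Y hY] := Fmx_pair (std_frame P') (std_frame P'') psi_bij.
rewrite /vT /= -(dtr_mul j hX hY); congr (dtr j _).
by rewrite (@Fmx_comp _ _ _ _ _ _ _ _ (psi \o phi)).
Qed.

Lemma dtr_block j r1 r2 r3 s1 s2 s3 (X : 'M[B1]_(r2, s2)) X' (X1 : 'M[B1]_(r1, s1)) X1'
    (X3 : 'M[B1]_(r3, s3)) X3'
    (G : 'M[B1]_(r1 + r3, r2)) G' (H : 'M[B1]_(s1 + s3, s2)) H' Z :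
  inv_pair X X' -> inv_pair X1 X1' -> inv_pair X3 X3' ->
  inv_pair G G' -> inv_pair H H' -> G *m X *m H' = block_mx X1 0 Z X3 ->
  dtr j G * dtr j X * dtr j H' = dtr j X1 * dtr j X3.
Proof.
move=> [a1 a2] [b1 b2] [c1 c2] [d1 d2] [e1 e2] E.
move: (ibn a1 a2) (ibn b1 b2) (ibn c1 c2) (ibn d1 d2) => h1 h2 h3 h4; subst.
by rewrite !dtr_id -!dtM E dt_lblock.
Qed.

(** The splittings of the two sequences are chosen independently and need not be respected by the
    isomorphisms. In the resulting bases the middle matrix is therefore only block triangular, which
    is enough for its determinant. *)
Lemma vT_exact T1 T2 T3 : rel_exact T1 T2 T3 ->
  eqU (vT T2) (fun j => vT T1 j * vT T3 j).
Proof.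
case=> i [q [i' [q' [ex ex' E E']]]].
have split_ex (M N : lmodType A) (L : fgproj A) (i0 : {linear M -> N}) (q0 : {linear N -> L}) :
    short_exact i0 q0 -> exists (r0 : {linear N -> M}) (s0 : {linear L -> N}),
    [/\ cancel i0 r0, cancel s0 q0, forall x, q0 (i0 x) = 0, forall z, r0 (s0 z) = 0
      & forall y, i0 (r0 y) + s0 (q0 y) = y].
  move=> [i_inj iq q_surj].
  have [s qs] := @fgproj_projective A L _ _ q0 (idfun : {linear L -> L}) q_surj.
  have {}qs z : q0 (s z) = z by exact: qs.
  have sec y : exists x, i0 x = y - s (q0 y) by apply/iq; rewrite linearB qs subrr.
  pose r y := projT1 (cid (sec y)).
  have ir y : i0 (r y) = y - s (q0 y) by rewrite /r; case: cid.
  have r_lin : linear r.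
    move=> a x y; apply: i_inj; rewrite [RHS]linearP !ir [q0 _]linearP [s _]linearP scalerBr.
    by rewrite opprD addrACA.
  have qi x : q0 (i0 x) = 0 by apply/iq; exists x.
  exists (mk_linear r_lin), s; split=> //.
  - by move=> x; apply: i_inj; rewrite [LHS]ir qi linear0 subr0.
  - by move=> z; apply: i_inj; rewrite [LHS]ir qs subrr linear0.
  - by move=> y; rewrite [i0 _]ir subrK.
have [r [s [ri qs qi rs dec]]] := split_ex _ _ _ _ _ ex.
have [r' [s' [ri' qs' qi' rs' dec']]] := split_ex _ _ _ _ _ ex'.
pose F1 := std_frame (rt_src T1); pose F2 := std_frame (rt_src T2).
pose F3 := std_frame (rt_src T3); pose F1' := std_frame (rt_tgt T1).
pose F2' := std_frame (rt_tgt T2); pose F3' := std_frame (rt_tgt T3).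
have pair0 (M N L : lmodType A) (G1 : frame M) (G2 : frame N) (G3 : frame L)
   (i0 : {linear M -> N}) (q0 : {linear N -> L}) (r0 : {linear N -> M}) (s0 : {linear L -> N}) :
   cancel i0 r0 -> cancel s0 q0 -> (forall x, q0 (i0 x) = 0) -> (forall z, r0 (s0 z) = 0) ->
   (forall y, i0 (r0 y) + s0 (q0 y) = y) ->
   inv_pair (col_mx (Fmx G1 G2 (tmap f i0)) (Fmx G3 G2 (tmap f s0)))
            (row_mx (Fmx G2 G1 (tmap f r0)) (Fmx G2 G3 (tmap f q0))).
  move=> h1 h2 h3 h4 h5.
  split; last first.
    rewrite mul_row_col.
    rewrite (@Fmx_comp _ _ _ _ _ _ _ _ (tmap f (i0 \o r0))); last first.
      by move=> u; rewrite (tmap_comp (k := i0 \o r0)).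
    rewrite (@Fmx_comp _ _ _ _ _ _ _ _ (tmap f (s0 \o q0))); last first.
      by move=> u; rewrite (tmap_comp (k := s0 \o q0)).
    rewrite (@Fmx_add _ _ _ _ _ _ id) ?Fmx_id // => u.
    by rewrite (tmap_add (k := idfun)) ?tmap_id.
  rewrite mul_col_row !Fmx_cancel.
  - rewrite (@Fmx_comp _ _ _ _ _ _ _ _ (fun=> 0)); last first.
      by move=> u; rewrite (tmap_comp (k := zeroL _ _)) ?tmap0.
    rewrite (@Fmx_comp _ _ _ _ _ _ _ _ (fun=> 0)); last first.
      by move=> u; rewrite (tmap_comp (k := zeroL _ _)) ?tmap0.
    by rewrite !Fmx_zero // -scalar_mx_block.
  - by move=> u; rewrite (tmap_comp (k := idfun)) ?tmap_id.
  - by move=> u; rewrite (tmap_comp (k := idfun)) ?tmap_id.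
have hG := pair0 _ _ _ F1 F2 F3 _ _ _ _ ri qs qi rs dec.
have hH := pair0 _ _ _ F1' F2' F3' _ _ _ _ ri' qs' qi' rs' dec'.
set G := col_mx _ _ in hG; set G' := row_mx _ _ in hG.
set H := col_mx _ _ in hH; set H' := row_mx _ _ in hH.
have [X1' hX1] := Fmx_pair F1 F1' (rt_bij T1).
have [X2' hX2] := Fmx_pair F2 F2' (rt_bij T2).
have [X3' hX3] := Fmx_pair F3 F3' (rt_bij T3).
have e1 u : rt_map T2 (tmap f i u) = tmap f i' (rt_map T1 u) by exact: E.
have e2 u : rt_map T3 (tmap f q u) = tmap f q' (rt_map T2 u) by exact: E'.
have blk : exists Z, G *m Fmx F2 F2' (rt_map T2) *m H' =
    block_mx (Fmx F1 F1' (rt_map T1)) 0 Z (Fmx F3 F3' (rt_map T3)).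
  exists (Fmx F3 F2 (tmap f s) *m Fmx F2 F2' (rt_map T2) *m Fmx F2' F1' (tmap f r')).
  rewrite mul_col_mx mul_col_row; congr block_mx.
  - rewrite (@Fmx_comp _ _ _ _ _ _ _ _ (tmap f i' \o rt_map T1)) //.
    rewrite (@Fmx_comp _ _ _ _ _ _ (tmap f i' \o rt_map T1 : {linear _ -> _}) _ (rt_map T1)) // => u /=.
    by rewrite (tmap_comp (k := idfun)) ?tmap_id.
  - rewrite (@Fmx_comp _ _ _ _ _ _ _ _ (tmap f i' \o rt_map T1)) //.
    rewrite (@Fmx_comp _ _ _ _ _ _ (tmap f i' \o rt_map T1 : {linear _ -> _}) _ (fun=> 0)).
      exact: Fmx_zero.
    by move=> u /=; rewrite (tmap_comp (k := zeroL _ _)) ?tmap0.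
  - rewrite -mulmxA (@Fmx_comp _ _ _ _ _ _ _ _ (rt_map T3 \o tmap f q)) //; last first.
      by move=> u; rewrite /= e2.
    rewrite (@Fmx_comp _ _ _ _ _ _ _ (rt_map T3 \o tmap f q : {linear _ -> _}) (rt_map T3)) // => u /=.
    by rewrite (tmap_comp (k := idfun)) ?tmap_id.
have [Z blkE] := blk.
have hH' : inv_pair H' H by case: hH.
have hGU : US (fun j => dtr j G).
  apply: (dtr_US hG); [apply: mxin_col_mx|apply: mxin_row_mx]; exact: Fmx_tmapC.
have hHU : US (fun j => dtr j H').
  apply: (dtr_US hH'); [apply: mxin_row_mx|apply: mxin_col_mx]; exact: Fmx_tmapC.
apply: eqU_sym; exists (fun j => dtr j G * dtr j H'); first exact: US_M.
move=> j; rewrite -(dtr_block j hX2 hX1 hX3 hG hH blkE).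
by rewrite mulrCA mulrA.
Qed.

Definition vK (x : relK0 f) j : KJ j :=
  \prod_(w <- x) (if w.1 then (vT w.2 j)^-1 else vT w.2 j).

Lemma vK_cat x y j : vK (x ++ y) j = vK x j * vK y j.
Proof. by rewrite /vK big_cat. Qed.

Lemma vK_cls T j : vK [:: (false, T)] j = vT T j.
Proof. by rewrite /vK big_cons big_nil mulr1. Qed.

Lemma vK_neq0 x j : vK x j != 0.
Proof.
rewrite /vK; elim/big_ind: _ => //; first by rewrite oner_eq0.
  by move=> a b; apply: mulf_neq0.
by move=> -[[] T] _ /=; rewrite ?invr_eq0 vT_neq0.
Qed.

Lemma vK_muln m x j : vK (relK0_muln m x) j = vK x j ^+ m.
Proof.
elim: m => [|m IHm]; first by rewrite /vK big_nil.
by rewrite exprS -IHm -vK_cat.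
Qed.

(** With standard frames fixed once and for all, composition is respected exactly; only exact
    sequences cost a family in [US]. *)
Lemma vK_eq x y : relK0_eq x y -> eqU (vK x) (vK y).
Proof.
elim=> {x y}.
- by move=> s; apply: eqU_refl.
- by move=> s t _; apply: eqU_sym.
- by move=> t s u _ h _; apply: eqU_trans.
- move=> s s' t t' _ h _ h'.
  apply: eqU_trans (eqU_ext (vK_cat _ _)) _; apply: eqU_trans (eqU_mul h h') _.
  by apply: eqU_ext => j; rewrite vK_cat.
- by move=> s t; apply: eqU_ext => j; rewrite !vK_cat mulrC.
- move=> T; apply: eqU_ext => j; rewrite /vK !big_cons !big_nil /= mulr1.
  by rewrite divff ?vT_neq0.
- move=> T1 T2 T3 /vT_exact h.
  apply: eqU_trans (eqU_ext (vK_cls T2)) _; apply: eqU_trans h _.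
  by apply: eqU_ext => j; rewrite /vK !big_cons !big_nil /= mulr1.
- move=> P P' P'' phi phi_bij psi psi_bij; apply: eqU_ext => j.
  by rewrite vK_cls vT_comp /vK !big_cons !big_nil /= mulr1.
Qed.
End Determinants.
End Invariant.

(** * Arithmetic of the coefficient rings *)
Section Congruences.
Variables (S : pzRingType) (C : S -> Prop).
Hypothesis CS : subring_pred C.

Lemma frobenius_comm p (x y : S) : prime p -> C x -> C y -> GRing.comm x y ->
  exists2 w, C w & (x + y) ^+ p = x ^+ p + y ^+ p + p%:R * w.
Proof.
move=> p_pr Cx Cy cxy; have p_gt0 := prime_gt0 p_pr.
exists (\sum_(1 <= i < p) (x ^+ (p - i) * y ^+ i) *+ ('C(p, i) %/ p)).
  apply: subring_sum => // i _; rewrite -mulr_natr; apply: subringM => //.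
    by apply: subringM => //; apply: subringX.
  exact: subring_nat.
rewrite (exprDn_comm _ cxy) -(big_mkord xpredT (fun i => (x ^+ (p - i) * y ^+ i) *+ 'C(p, i))).
rewrite big_nat_recr //= (big_ltn p_gt0) subn0 subnn bin0 binn !mulr1n !expr0 mulr1 mul1r.
rewrite -!addrA; congr (_ + _); rewrite addrC; congr (_ + _).
rewrite mulr_sumr; apply: eq_big_nat => i /andP[i_gt0 ltip].
have /divnK {1}<- : (p %| 'C(p, i))%N by apply: prime_dvd_bin; rewrite ?i_gt0.
by rewrite mulr_natl -mulrnA.
Qed.

Definition cong (t x y : S) := exists2 z, C z & x = y + t * z.

Section FixedModulus.
Variable t : S.
Hypothesis Ct : C t.
Hypothesis tC : forall x, GRing.comm t x.

Lemma cong_refl x : cong t x x.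
Proof. by exists 0; [apply: subring0|rewrite mulr0 addr0]. Qed.
Lemma cong_sym x y : cong t x y -> cong t y x.
Proof.
by move=> [z Cz ->]; exists (- z); [apply: subringN|rewrite mulrN addrK].
Qed.
Lemma cong_trans y x z : cong t x y -> cong t y z -> cong t x z.
Proof.
move=> [a Ca ->] [b Cb ->]; exists (b + a); first exact: subringD.
by rewrite mulrDr addrA.
Qed.
Lemma congD x y u v : cong t x y -> cong t u v -> cong t (x + u) (y + v).
Proof.
move=> [a Ca ->] [b Cb ->]; exists (a + b); first exact: subringD.
by rewrite mulrDr addrACA.
Qed.
Lemma congN x y : cong t x y -> cong t (- x) (- y).
Proof.
by move=> [a Ca ->]; exists (- a); [apply: subringN|rewrite opprD mulrN].
Qed.
Lemma congB x y u v : cong t x y -> cong t u v -> cong t (x - u) (y - v).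
Proof. by move=> h h'; apply: congD => //; apply: congN. Qed.
Lemma congM x y u v : C y -> C v -> cong t x y -> cong t u v -> cong t (x * u) (y * v).
Proof.
move=> Cy Cv [a Ca ->] [b Cb ->]; exists (y * b + a * v + a * (t * b)).
  apply: subringD => //; last by apply: subringM => //; apply: subringM.
  by apply: subringD => //; apply: subringM.
rewrite mulrDl !mulrDr -!addrA; congr (_ + _).
by rewrite (mulrA y) -(tC y) !mulrA.
Qed.
Lemma cong_in x y : C y -> cong t x y -> C x.
Proof. by move=> Cy [z Cz ->]; apply: subringD => //; apply: subringM. Qed.
Lemma congX x y n : C y -> cong t x y -> cong t (x ^+ n) (y ^+ n).
Proof.
move=> Cy h; elim: n => [|n IHn]; first exact: cong_refl.
by rewrite !exprS; apply: congM => //; apply: subringX.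
Qed.
Lemma cong_sum I (r : seq I) (P : pred I) F G :
  (forall i, P i -> cong t (F i) (G i)) ->
  cong t (\sum_(i <- r | P i) F i) (\sum_(i <- r | P i) G i).
Proof.
move=> h; elim/big_rec2: _ => [|i x y Pi IH]; first exact: cong_refl.
by apply: congD => //; apply: h.
Qed.
Lemma cong_prod I (r : seq I) (P : pred I) F G :
  (forall i, P i -> C (G i)) -> (forall i, P i -> cong t (F i) (G i)) ->
  cong t (\prod_(i <- r | P i) F i) (\prod_(i <- r | P i) G i).
Proof.
move=> hC h.
suff [] : C (\prod_(i <- r | P i) G i) /\
   cong t (\prod_(i <- r | P i) F i) (\prod_(i <- r | P i) G i) by [].
elim/big_rec2: _ => [|i x y Pi [Cx IH]].
  by split; [exact: subring1|exact: cong_refl].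
by split; [apply: subringM => //; apply: hC|apply: congM => //; [apply: hC|apply: h]].
Qed.
End FixedModulus.

Lemma natr_comm n (x : S) : GRing.comm n%:R x.
Proof. exact/commr_sym/commr_nat. Qed.

Lemma frobeniusX p (x y : S) n : prime p -> C x -> C y -> GRing.comm x y ->
  cong p%:R ((x + y) ^+ (p ^ n)) (x ^+ (p ^ n) + y ^+ (p ^ n)).
Proof.
move=> p_pr Cx Cy cxy; elim: n => [|n IHn].
  by rewrite !expn0 !expr1; apply: cong_refl.
have [|||w Cw E] := @frobenius_comm p (x ^+ (p ^ n)) (y ^+ (p ^ n)) p_pr.
- exact: subringX.
- exact: subringX.
- by apply: commrX; apply/commr_sym/commrX/commr_sym.
rewrite expnSr !exprM; apply: (@cong_trans _ ((x ^+ (p ^ n) + y ^+ (p ^ n)) ^+ p)).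
  apply: congX => //; [exact: subring_nat|exact: natr_comm|].
  by apply: subringD => //; apply: subringX.
by exists w.
Qed.
End Congruences.

Section CongDet.
Variables (S : comPzRingType) (C : S -> Prop).
Hypothesis CS : subring_pred C.
Lemma det_in n (X : 'M[S]_n) : mxin C X -> C (\det X).
Proof.
move=> XC; apply: subring_sum => // s _; apply: subringM => //.
  exact: (subringX CS _ (subringN CS (subring1 CS))).
by elim/big_ind: _ => [||i _]; [apply: subring1|move=> a b; apply: subringM|apply: XC].
Qed.
Lemma cong_det t n (X Y : 'M[S]_n) : C t -> mxin C Y ->
  (forall i j, cong C t (X i j) (Y i j)) -> cong C t (\det X) (\det Y).
Proof.
have tC x : GRing.comm t x by exact: mulrC.
have NC s : C ((-1) ^+ s) := subringX CS s (subringN CS (subring1 CS)).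
move=> Ct YC h; apply: cong_sum => // s _; apply: congM => //.
- by elim/big_ind: _ => [||i _]; [apply: subring1|move=> a b; apply: subringM|apply: YC].
- exact: cong_refl.
- by apply: cong_prod => // i _; apply: YC.
Qed.
Lemma adj_in n (X : 'M[S]_n) : mxin C X -> mxin C (\adj X).
Proof.
move=> XC i j; rewrite mxE; apply: subringM => //.
  exact: (subringX CS _ (subringN CS (subring1 CS))).
by apply: det_in => k l; rewrite !mxE.
Qed.
End CongDet.

(* The common features of Z in Q and Z_p in Q_p: lam enumerates the primes of R,
   lp is the index of p, and ar_I l is the localisation of R at lam l. *)
Record arith (p : nat) (R : nzRingType) (Q : fieldType) (f : {rmorphism R -> Q}) := Arith {
  ar_L : eqType;
  lam : ar_L -> nat;
  lp : ar_L;
  ar_I : ar_L -> Q -> Prop;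
  ar_prime l : prime (lam l);
  ar_lp : lam lp = p;
  ar_lamI : injective lam;
  ar_sub l : subring_pred (ar_I l);
  ar_char0 n : (n.+1)%:R != 0 :> Q;
  ar_inj : injective f;
  ar_glob q : (forall l, ar_I l q) <-> (exists a, q = f a);
  ar_fin q : exists s : seq ar_L, forall l, l \notin s -> ar_I l q;
  ar_approx l q t : exists2 q', (forall l', l' != l -> ar_I l' q') &
    cong (ar_I l) ((lam l)%:R ^+ t) q q';
  ar_res l q : ar_I l q -> exists m : nat, cong (ar_I l) (lam l)%:R q m%:R;
  ar_unit l q : ar_I l q -> ~ cong (ar_I l) (lam l)%:R q 0 -> ar_I l q^-1;
  ar_den l q : exists m, ar_I l ((lam l)%:R ^+ m * q);
  ar_sep l q : (forall m, exists2 z, ar_I l z & q = (lam l)%:R ^+ m * z) -> q = 0;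
  ar_ninv l : ~ ar_I l (lam l)%:R^-1
}.

Section ArithTheory.
Variables (p : nat) (R : nzRingType) (Q : fieldType) (f : {rmorphism R -> Q}).
Variable ar : arith p f.
Local Notation I := (ar_I (a := ar)).
Local Notation lam := (lam (a := ar)).

Lemma lam_neq0 l : (lam l)%:R != 0 :> Q.
Proof. by have := prime_gt0 (ar_prime l); case: (lam l) => // n _; apply: (ar_char0 ar). Qed.

Lemma p_prime : prime p. Proof. by rewrite -(ar_lp ar) ar_prime. Qed.
Lemma p_neq0 : p%:R != 0 :> Q. Proof. by rewrite -(ar_lp ar) lam_neq0. Qed.

Lemma ar_f l a : I l (f a).
Proof. by move: l; apply/ar_glob; exists a. Qed.

(** An element congruent to 1 cannot also be congruent to 0, since [lam l] would then be invertible;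
    hence [ar_unit] applies. *)
Lemma ar_not1 l q : cong (I l) (lam l)%:R q 1 -> I l q^-1.
Proof.
have S := ar_sub (a := ar) l; have Cl := subring_nat S (lam l).
move=> h; apply: ar_unit; first by apply: cong_in h => //; apply: subring1.
move=> /(cong_trans S (cong_sym S h)) [z Iz]; rewrite add0r => E.
apply: (@ar_ninv _ _ _ _ ar l); rewrite -[_^-1]mul1r {1}E mulrAC divff ?lam_neq0 //.
by rewrite mul1r.
Qed.

Lemma ar_natV l n : coprime n (lam l) -> I l n%:R^-1.
Proof.
have S := ar_sub (a := ar) l.
case: n => [|n] co; first by rewrite invr0; apply: subring0.
have [u v E _] := egcdnP (lam l) (ltn0Sn n).
have I1 : I l (u%:R * n.+1%:R)^-1.
  apply: ar_not1; exists v%:R; first exact: subring_nat.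
  by rewrite -natrM E (eqP co) natrD natrM addrC (mulrC v%:R).
have -> : n.+1%:R^-1 = u%:R * (u%:R * n.+1%:R)^-1 :> Q.
  case: u I1 E => [|u _ _]; first by rewrite mul0n (eqP co) addn1.
  by rewrite invfM mulrA divff ?mul1r ?(ar_char0 ar).
by apply: subringM => //; apply: subring_nat.
Qed.

Lemma ar_pV l : l != lp ar -> I l p%:R^-1.
Proof.
move=> ll; apply: ar_natV; rewrite prime_coprime ?p_prime //.
rewrite dvdn_prime2 ?p_prime ?ar_prime //; apply: contra ll => /eqP pl.
by apply/eqP/(ar_lamI (a := ar)); rewrite -pl ar_lp.
Qed.

Lemma ar_fermat l q : I l q -> cong (I l) (lam l)%:R (q ^+ lam l) q.
Proof.
have S := ar_sub (a := ar) l; have Cl := subring_nat S (lam l).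
have tC x : GRing.comm ((lam l)%:R : Q) x by exact: mulrC.
move=> Iq; have [m h] := ar_res Iq.
apply: (@cong_trans _ _ S _ (m%:R ^+ lam l)).
  by apply: congX => //; apply: subring_nat.
apply: (@cong_trans _ _ S _ m%:R); last exact: cong_sym.
have le : (m <= m ^ lam l)%N.
  by case: (m) => // k; apply: (@leq_pexp2l k.+1 1); rewrite ?(prime_gt0 (ar_prime l)).
have /eqP := fermat_little m (ar_prime l).
rewrite eqn_mod_dvd // => /dvdnP[k E].
exists k%:R; first exact: subring_nat.
by rewrite -natrX -natrM mulnC -E -natrD subnKC.
Qed.
End ArithTheory.

(** * The group ring over the coefficient field and its localised orders *)

Section GroupRingBasics.
Variables (Q : fieldType) (gT : finGroupType).
Local Notation B := (gring Q gT).
Implicit Types (b : B) (g h : gT).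

Definition gel g : B := [ffun x : gT => (x == g)%:R : Q].
Definition sc (q : Q) : B := [ffun x : gT => q * (x == 1%g)%:R : Q].
Definition aug b : Q := \sum_g b g.

Lemma gelE g x : gel g x = (x == g)%:R. Proof. by rewrite ffunE. Qed.

Lemma gel_mulE g b x : (gel g * b : B) x = b (g^-1 * x)%g.
Proof.
rewrite gringME (bigD1 g) //= gelE eqxx mul1r big1 ?addr0 // => y /negPf yg.
by rewrite gelE yg mul0r.
Qed.
Lemma mul_gelE g b x : (b * gel g : B) x = b (x * g^-1)%g.
Proof.
rewrite gringME (bigD1 (x * g^-1)%g) //= gelE invMg invgK mulgKV eqxx mulr1.
rewrite big1 ?addr0 // => y yg; rewrite gelE; case: eqP => [E|_]; last by rewrite mulr0.
by case/eqP: yg; rewrite -E invMg invgK mulKVg.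
Qed.
Lemma gelM g h : gel (g * h)%g = gel g * gel h.
Proof.
by apply/ffunP=> x; rewrite gel_mulE !gelE -[in RHS](inj_eq (mulgI g)) mulKVg.
Qed.
Lemma gel1 : gel 1%g = 1.
Proof. by apply/ffunP=> x; rewrite !ffunE. Qed.
Lemma gelX g n : gel (g ^+ n)%g = gel g ^+ n.
Proof. by elim: n => [|n IH]; rewrite ?expg0 ?gel1 // expgS gelM IH exprS. Qed.

Lemma sc_mulE q b x : (sc q * b : B) x = q * b x.
Proof.
rewrite gringME (bigD1 1%g) //= ffunE eqxx mulr1 invg1 mul1g big1 ?addr0 //.
by move=> y /negPf y1; rewrite ffunE y1 mulr0 mul0r.
Qed.
Lemma sc_zmod : zmod_morphism sc.
Proof. by move=> a b; apply/ffunP=> x; rewrite !ffunE mulrBl. Qed.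
Lemma sc_monoid : monoid_morphism sc.
Proof.
split; first by apply/ffunP=> x; rewrite !ffunE mul1r.
by move=> a b; apply/ffunP=> x; rewrite sc_mulE !ffunE mulrA.
Qed.
HB.instance Definition _ := GRing.isZmodMorphism.Build Q B sc sc_zmod.
HB.instance Definition _ := GRing.isMonoidMorphism.Build Q B sc sc_monoid.

Lemma sc_comm q b : sc q * b = b * sc q.
Proof.
apply/ffunP=> x; rewrite sc_mulE gringME (bigD1 x) //= ffunE mulVg eqxx mulr1.
rewrite mulrC big1 ?addr0 // => y yx; rewrite ffunE.
case: eqP => [E|_]; last by rewrite !mulr0.
by case/eqP: yx; rewrite -[RHS](mulKVg y) E mulg1.
Qed.

Lemma gring_dec b : b = \sum_g sc (b g) * gel g.
Proof.
apply/ffunP=> x; rewrite sum_ffunE (bigD1 x) //= sc_mulE gelE eqxx mulr1.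
by rewrite big1 ?addr0 // => y; rewrite eq_sym => /negPf yx; rewrite sc_mulE gelE yx mulr0.
Qed.

Lemma aug_zmod : zmod_morphism aug.
Proof. by move=> a b; rewrite /aug -sumrB; apply: eq_bigr => g _; rewrite !ffunE. Qed.
Lemma aug_monoid : monoid_morphism aug.
Proof.
split.
  rewrite /aug (bigD1 1%g) //= gring1E eqxx big1 ?addr0 // => g /negPf g1.
  by rewrite gring1E g1.
move=> a b; rewrite /aug mulr_suml.
under eq_bigr => g _ do rewrite gringME.
rewrite exchange_big; apply: eq_bigr => h _; rewrite mulr_sumr.
by rewrite (reindex_inj (mulgI h)); apply: eq_bigr => g _; rewrite mulKg.
Qed.
HB.instance Definition _ := GRing.isZmodMorphism.Build B Q aug aug_zmod.
HB.instance Definition _ := GRing.isMonoidMorphism.Build B Q aug aug_monoid.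

Lemma aug_gel g : aug (gel g) = 1.
Proof.
rewrite /aug (bigD1 g) //= gelE eqxx big1 ?addr0 // => h /negPf hg.
by rewrite gelE hg.
Qed.
Lemma aug_sc q : aug (sc q) = q.
Proof.
rewrite /aug (bigD1 1%g) //= ffunE eqxx mulr1 big1 ?addr0 // => h /negPf hg.
by rewrite ffunE hg mulr0.
Qed.

End GroupRingBasics.

Section IntegralGroupRing.
Variables (p : nat) (R : nzRingType) (Q : fieldType) (f : {rmorphism R -> Q}).
Variable ar : arith p f.
Variable gT : finGroupType.
Local Notation B := (gring Q gT).
Local Notation I := (ar_I (a := ar)).
Local Notation lam := (lam (a := ar)).
Implicit Types (b : B) (g h : gT).

Definition inA l (b : B) := forall g, I l (b g).

Lemma inA_subring l : subring_pred (inA l).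
Proof.
have S := ar_sub (a := ar) l; split=> [g|a b ha hb g|a b ha hb g].
- by rewrite gring1E; apply: subring_nat.
- by rewrite !ffunE; apply: subringB.
- by rewrite gringME; apply: subring_sum => // h _; apply: subringM.
Qed.

Lemma inA_gel l g : inA l (gel Q g).
Proof. by move=> x; rewrite gelE; apply: subring_nat; apply: ar_sub. Qed.

Lemma inA_sc l q : I l q -> inA l (sc gT q).
Proof.
move=> Iq x; rewrite ffunE; have S := ar_sub (a := ar) l.
by apply: subringM => //; apply: subring_nat.
Qed.

Lemma inA_aug l b : inA l b -> I l (aug b).
Proof. by move=> h; apply: subring_sum => //; apply: ar_sub. Qed.

Lemma inA_map l (a : gring R gT) : inA l (gring_map f a).
Proof. by move=> g; rewrite ffunE; apply: ar_f. Qed.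

Lemma inA_glob b : (forall l, inA l b) -> exists a, b = gring_map f a.
Proof.
move=> h; have h' g : exists a, b g = f a by apply/(ar_glob ar) => l; apply: h.
exists [ffun g => projT1 (cid (h' g))]; apply/ffunP => g; rewrite !ffunE.
by case: cid.
Qed.

Lemma natB_scE n : n%:R = sc gT n%:R :> B.
Proof. by rewrite rmorph_nat. Qed.

Lemma natr_gringE n b g : (n%:R * b : B) g = n%:R * b g.
Proof. by rewrite natB_scE sc_mulE. Qed.

(* Right multiplication by 1 + l z is given by a matrix congruent to 1, hence by
   a matrix with unit determinant. *)
Lemma one_plus_inv l b : cong (inA l) (lam l)%:R b 1 ->
  exists2 y, inA l y & b * y = 1 /\ y * b = 1.
Proof.
move=> [z Az bE]; have S := ar_sub (a := ar) l; have SA := inA_subring l.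
pose N := #|gT|; pose ev (i : 'I_N) : gT := enum_val i.
pose M : 'M[Q]_N := \matrix_(i, j) b ((ev i)^-1 * ev j)%g.
have Ab : inA l b.
  rewrite bE; apply: (subringD SA) (subring1 SA) _.
  exact: (subringM SA (subring_nat SA _) Az).
have MC : mxin (I l) M by move=> i j; rewrite mxE; apply: Ab.
have detV : I l (\det M)^-1.
  apply: ar_not1; rewrite -[X in cong _ _ _ X](det1 Q N); apply: (cong_det S) => //.
  - exact: (subring_nat S _).
  - exact: (mxin1 S).
  move=> i j; exists (z ((ev i)^-1 * ev j)%g) => //.
  rewrite !mxE bE ffunE natr_gringE gring1E; congr (_ %:R + _).
  by rewrite -eq_mulVg1 (inj_eq enum_val_inj).
have det0 : \det M != 0.
  apply/eqP => d0; have : cong (I l) (lam l)%:R (\det M) 1.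
    rewrite -[X in cong _ _ _ X](det1 Q N); apply: (cong_det S) => //; [exact: (subring_nat S _)|exact: (mxin1 S)|].
    move=> i j; exists (z ((ev i)^-1 * ev j)%g) => //.
    rewrite !mxE bE ffunE natr_gringE gring1E; congr (_ %:R + _).
    by rewrite -eq_mulVg1 (inj_eq enum_val_inj).
  rewrite d0 => -[w Iw /eqP]; rewrite eq_sym addr_eq0 => /eqP E.
  apply: (@ar_ninv _ _ _ _ ar l).
  have -> : (lam l)%:R^-1 = - w :> Q.
    have h : (lam l)%:R * (- w) = 1 :> Q by rewrite mulrN -E.
    by have := mulKf (lam_neq0 l) (- w); rewrite h mulr1.
  exact: (subringN S).
have uM : M \in unitmx by rewrite unitmxE unitfE.
pose rw (x : B) : 'rV[Q]_N := \row_i x (ev i).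
have rwM x : rw (x * b) = rw x *m M.
  apply/rowP => j; rewrite !mxE gringME (reindex ev) /=.
    by apply: eq_bigr => i _; rewrite !mxE.
  by exists enum_rank => x0 _; rewrite /ev ?enum_valK ?enum_rankK.
have rw_inj : injective rw.
  move=> x x' /rowP E; apply/ffunP => g; have := E (enum_rank g).
  by rewrite !mxE /ev enum_rankK.
pose w := rw 1 *m invmx M; pose y : B := [ffun g => w 0 (enum_rank g)].
have rwy : rw y = w by apply/rowP => i; rewrite mxE ffunE /ev enum_valK.
have yb : y * b = 1 by apply: rw_inj; rewrite rwM rwy /w mulmxKV.
exists y; last split=> //.
  move=> g; rewrite ffunE /w /invmx uM; apply: (mxin_mul S).
    by move=> i j; rewrite mxE gring1E; exact: (subring_nat S _).
  by move=> i j; rewrite mxE; apply: (subringM S) => //; apply: (adj_in S).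
(* The left inverse is also a right inverse: [b * y - 1] is killed by right multiplication by [b],
   whose matrix [M] is invertible. *)
apply/eqP; rewrite -subr_eq0; apply/eqP/rw_inj.
have: rw ((b * y - 1) * b) = rw 0 by rewrite mulrBl -mulrA yb mulr1 mul1r subrr.
rewrite rwM => E; rewrite -[LHS](mulmxK uM) E.
by apply/rowP => i; rewrite -[rw 0](_ : 0 = _) ?mul0mx //; apply/rowP => k; rewrite !mxE ffunE.
Qed.

Lemma cong_inA_sep l b : (forall m, exists2 z, inA l z & b = (lam l)%:R ^+ m * z) -> b = 0.
Proof.
move=> h; apply/ffunP => g; rewrite [RHS]ffunE; apply: (@ar_sep _ _ _ _ ar l) => m.
have [z Az ->] := h m; exists (z g) => //.
by rewrite -natrX natr_gringE natrX.
Qed.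
End IntegralGroupRing.

(** * Local structure of the group ring of a p-group *)
Section ProjInfl.
Variables (Q : fieldType) (gT : finGroupType) (D : {group gT}).
Hypothesis char0 : forall n, (n.+1)%:R != 0 :> Q.
Local Notation B := (gring Q gT).
Local Notation B' := (gring Q (coset_of D)).
Local Notation N := ('N(D))%g.

(** For [D] not normal this restricts to the normaliser before projecting, so it is additive but not
    multiplicative; [transversal_pr] is the substitute. *)
Definition pr (b : B) : B' := [ffun c => \sum_(g in N | coset D g == c) b g].
(** The factor [1/|D|] makes this a multiplicative section of [pr], taking 1 to the averaging
    idempotent [eD] of [D]. *)
Definition infl (y : B') : B :=
  [ffun g => if g \in N then #|D|%:R^-1 * y (coset D g) else 0].

Lemma pr_zmod : zmod_morphism pr.
Proof.
by move=> a b; apply/ffunP=> c; rewrite !ffunE -sumrB; apply: eq_bigr => g _; rewrite !ffunE.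
Qed.
HB.instance Definition _ := GRing.isZmodMorphism.Build B B' pr pr_zmod.
Lemma infl_zmod : zmod_morphism infl.
Proof.
move=> a b; apply/ffunP=> g; rewrite !ffunE; case: (g \in N); last by rewrite subr0.
by rewrite mulrBr.
Qed.
HB.instance Definition _ := GRing.isZmodMorphism.Build B' B infl infl_zmod.

Lemma pr_sum I r (P : pred I) F : pr (\sum_(i <- r | P i) F i) = \sum_(i <- r | P i) pr (F i).
Proof. exact: raddf_sum. Qed.
Lemma infl_sum I r (P : pred I) F :
  infl (\sum_(i <- r | P i) F i) = \sum_(i <- r | P i) infl (F i).
Proof. exact: raddf_sum. Qed.
Lemma pr_sc q b : pr (sc gT q * b) = sc _ q * pr b.
Proof.
apply/ffunP=> c; rewrite sc_mulE [LHS]ffunE [pr b c]ffunE mulr_sumr; apply: eq_bigr => g _.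
by rewrite sc_mulE.
Qed.
Lemma infl_sc q y : infl (sc _ q * y) = sc gT q * infl y.
Proof.
apply/ffunP=> g; rewrite sc_mulE [LHS]ffunE [infl y g]ffunE; case: (g \in N); last by rewrite mulr0.
by rewrite sc_mulE mulrCA.
Qed.

Lemma pr_gel g : g \in N -> pr (gel Q g) = gel Q (coset D g).
Proof.
move=> gN; apply/ffunP=> c; rewrite !ffunE; case: eqP => [->|cg].
  rewrite (bigD1 g) /= ?gN ?eqxx // gelE eqxx big1 ?addr0 // => h /andP[_ /negPf hg].
  by rewrite gelE hg.
rewrite big1 // => h /andP[_ /eqP hc]; rewrite gelE; case: eqP => // hg.
by case: cg; rewrite -hc hg.
Qed.

Lemma pr_off (b : B) : (forall g, g \in N -> b g = 0) -> pr b = 0.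
Proof. by move=> h; apply/ffunP=> c; rewrite !ffunE big1 // => g /andP[gN _]; apply: h. Qed.

Lemma infl_gell x y : x \in N -> infl (gel Q (coset D x) * y) = gel Q x * infl y.
Proof.
move=> xN; apply/ffunP=> g; rewrite gel_mulE [LHS]ffunE [infl y _]ffunE groupMl ?groupV //.
case: ifP => // gN; rewrite gel_mulE; congr (_ * y _).
by rewrite morphM ?groupV // morphV.
Qed.
Lemma infl_gelr x y : x \in N -> infl (y * gel Q (coset D x)) = infl y * gel Q x.
Proof.
move=> xN; apply/ffunP=> g; rewrite mul_gelE [LHS]ffunE [infl y _]ffunE groupMr ?groupV //.
case: ifP => // gN; rewrite mul_gelE; congr (_ * y _).
by rewrite morphM ?groupV // morphV.
Qed.

Lemma coset_setE (c : coset_of D) g : (g \in N) && (coset D g == c) = (g \in (c : {set gT})).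
Proof.
apply/andP/idP => [[gN /eqP <-]|gc]; first by rewrite val_coset // rcoset_refl.
have gN : g \in N by apply: (subsetP (coset_norm c)).
by rewrite gN (coset_mem gc).
Qed.

Lemma prK y : pr (infl y) = y.
Proof.
apply/ffunP=> c; rewrite ffunE (eq_bigr (fun=> #|D|%:R^-1 * y c)).
  rewrite sumr_const (eq_card (B := (c : {set gT}))); last first.
    by move=> g; rewrite -coset_setE.
  have -> : #|(c : {set gT})| = #|D|.
    by rewrite -[c]coset_reprK val_coset ?repr_coset_norm // card_rcoset.
  rewrite -[LHS]mulr_natl mulrA mulfV ?mul1r //.
  by rewrite -(prednK (cardG_gt0 D)) char0.
by move=> g /andP[gN /eqP <-]; rewrite ffunE gN.
Qed.

Definition eD : B := infl 1.

Lemma eDE : eD = sc gT (#|D|%:R^-1) * \sum_(d in D) gel Q d.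
Proof.
apply/ffunP=> g; rewrite sc_mulE [LHS]ffunE sum_ffunE.
case: ifP => gN.
  rewrite gring1E; congr (_ * _); case: eqP => [/coset_idr gD|gD].
    rewrite (bigD1 g) /= ?gD // gelE eqxx big1 ?addr0 // => h /andP[_ /negPf].
    by rewrite gelE eq_sym => ->.
  rewrite big1 // => d dD; rewrite gelE; case: eqP => // gd.
  by case: gD; rewrite gd coset_id.
rewrite big1 ?mulr0 // => d dD; rewrite gelE; case: eqP => // gd.
by move: gN; rewrite gd (subsetP (normG D)).
Qed.

Lemma gel_infl d y : d \in D -> gel Q d * infl y = infl y.
Proof.
move=> dD; rewrite -infl_gell ?(subsetP (normG D)) //.
by rewrite coset_id // gel1 mul1r.
Qed.
Lemma infl_gel d y : d \in D -> infl y * gel Q d = infl y.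
Proof.
move=> dD; rewrite -infl_gelr ?(subsetP (normG D)) //.
by rewrite coset_id // gel1 mulr1.
Qed.

Lemma eD_infl y : eD * infl y = infl y.
Proof.
rewrite eDE -mulrA mulr_suml (eq_bigr (fun=> infl y)) => [|d dD]; last exact: gel_infl.
rewrite sumr_const -[infl y *+ _]mulr_natl mulrA (natB_scE Q) -rmorphM /= mulVf ?rmorph1 ?mul1r //.
by rewrite -(prednK (cardG_gt0 D)) char0.
Qed.

Lemma inflM y y' : infl (y * y') = infl y * infl y'.
Proof.
rewrite (gring_dec y) mulr_suml !infl_sum mulr_suml; apply: eq_bigr => c _.
rewrite -mulrA !infl_sc -mulrA; congr (_ * _).
rewrite -[c]coset_reprK infl_gell ?repr_coset_norm //.
rewrite -[X in infl X * _]mulr1 infl_gell ?repr_coset_norm //.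
by rewrite -mulrA -/eD eD_infl.
Qed.

Lemma pr_infll y z : pr (infl y * z) = y * pr z.
Proof.
rewrite (gring_dec z) mulr_sumr !pr_sum mulr_sumr; apply: eq_bigr => g _.
rewrite mulrA -sc_comm -mulrA !pr_sc mulrA -sc_comm -mulrA; congr (_ * _).
case: (boolP (g \in N)) => gN; first by rewrite -infl_gelr // prK pr_gel.
rewrite !pr_off ?mulr0 // => x xN.
  by rewrite gelE; case: eqP => // xg; rewrite -xg xN in gN.
by rewrite mul_gelE ffunE groupMl // groupV (negPf gN).
Qed.
Lemma pr_inflr y z : pr (z * infl y) = pr z * y.
Proof.
rewrite (gring_dec z) mulr_suml !pr_sum mulr_suml; apply: eq_bigr => g _.
rewrite -mulrA !pr_sc -mulrA; congr (_ * _).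
case: (boolP (g \in N)) => gN; first by rewrite -infl_gell // prK pr_gel.
rewrite !pr_off ?mul0r // => x xN.
  by rewrite gelE; case: eqP => // xg; rewrite -xg xN in gN.
by rewrite gel_mulE ffunE groupMr // groupV (negPf gN).
Qed.

Section Transversal.
Variables (m : nat) (tau : 'I_m -> gT).
Hypothesis tauP : forall g, exists a, forall a', ((tau a' * g)%g \in N) = (a' == a).

(** For each group element [g] of the expansion of [x], only the index [a] with [tau a * g] in the
    normaliser survives [pr]. *)
Lemma transversal_suml x y :
  \sum_a gel Q (tau a)^-1%g * infl (pr (gel Q (tau a) * x) * y) = x * infl y.
Proof.
rewrite {2}(gring_dec x) mulr_suml.
under eq_bigr => a _ do rewrite {1}(gring_dec x) mulr_sumr pr_sum mulr_suml infl_sum mulr_sumr.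
rewrite exchange_big; apply: eq_bigr => g _; have [a Ha] := tauP g.
rewrite (bigD1 a) //= big1 ?addr0 => [|a' aa'].
  rewrite mulrA -sc_comm -mulrA pr_sc -gelM pr_gel ?Ha //.
  rewrite -[sc _ _ * _ * y]mulrA infl_sc infl_gell ?Ha //.
  rewrite [gel _ _ * (_ * _)]mulrA -sc_comm -!mulrA; congr (_ * _).
  by rewrite mulrA -gelM mulKg.
rewrite mulrA -sc_comm -mulrA pr_sc -gelM pr_off ?mulr0 ?mul0r ?raddf0 ?mulr0 // => z zN.
rewrite gelE; case: eqP => // zE; move: zN; rewrite zE Ha.
by rewrite (negPf aa').
Qed.

Lemma transversal_sumr x y :
  \sum_a infl (y * pr (x * gel Q (tau a)^-1%g)) * gel Q (tau a) = infl y * x.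
Proof.
rewrite {2}(gring_dec x) mulr_sumr.
under eq_bigr => a _ do rewrite {1}(gring_dec x) mulr_suml pr_sum mulr_sumr infl_sum mulr_suml.
rewrite exchange_big; apply: eq_bigr => g _; have [a Ha] := tauP g^-1%g.
have Ha' a' : ((g * (tau a')^-1)%g \in N) = (a' == a).
  by rewrite -Ha -[RHS]groupV invMg invgK.
rewrite (bigD1 a) //= big1 ?addr0 => [|a' aa'].
  rewrite -mulrA pr_sc -gelM pr_gel ?Ha' // mulrA -sc_comm -mulrA infl_sc.
  rewrite infl_gelr ?Ha' // -!mulrA -gelM mulgKV.
  by rewrite mulrA sc_comm -mulrA.
rewrite -mulrA pr_sc -gelM pr_off ?mulr0 ?raddf0 ?mul0r // => z zN.
rewrite gelE; case: eqP => // zE; move: zN; rewrite zE Ha'.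
by rewrite (negPf aa').
Qed.

(** Summation over the transversal restores the multiplicativity that [pr] lacks; this is the
    product rule for induced matrices. *)
Lemma transversal_pr u v :
  \sum_a pr (u * gel Q (tau a)^-1%g) * pr (gel Q (tau a) * v) = pr (u * v).
Proof.
rewrite -[RHS]mulr1 -pr_inflr -mulrA -(transversal_suml v) mulr_sumr pr_sum.
by apply: eq_bigr => a _; rewrite mulr1 mulrA pr_inflr.
Qed.
End Transversal.
End ProjInfl.

Section LocalGroupRing.
Variables (p : nat) (R : nzRingType) (Q : fieldType) (f : {rmorphism R -> Q}).
Variable ar : arith p f.
Hypothesis p_odd : odd p.
Local Notation I := (ar_I (a := ar)).
Local Notation P := (lp ar).
Local Notation inA := (inA (ar := ar)).

Lemma pr_in (gT : finGroupType) (D : {group gT}) l (b : gring Q gT) :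
  inA l b -> inA l (pr D b).
Proof.
by move=> h c; rewrite ffunE; apply: (subring_sum (ar_sub l)) => g _; apply: h.
Qed.

(** The maximal ideal of the group ring localised at [p]; [Jpow] describes its powers. *)
Definition JI (gT : finGroupType) (b : gring Q gT) := inA P b /\ cong (I P) p%:R (aug b) 0.

Inductive Jpow (gT : finGroupType) : nat -> gring Q gT -> Prop :=
| Jpow_base b : inA P b -> Jpow 0 b
| Jpow_zero n : Jpow n 0
| Jpow_add n a b : Jpow n a -> Jpow n b -> Jpow n (a + b)
| Jpow_mul n a b : JI a -> Jpow n b -> Jpow n.+1 (a * b).

Section OneGroup.
Variable gT : finGroupType.
Local Notation B := (gring Q gT).
Let SA := @inA_subring p R Q f ar gT P.

Lemma Jpow_in n (b : B) : Jpow n b -> inA P b.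
Proof.
elim=> {n b} [b //|n|n a b _ ha _ hb|n a b [ha _] _ hb].
- exact: (subring0 SA).
- exact: (subringD SA).
- exact: (subringM SA).
Qed.

(** The inclusion of [J^(m+n)] in the additive span of products from [J^m] and [J^n], stated as an
    induction principle so that no explicit sums of products are handled. *)
Lemma Jpow_split m n (X : B -> Prop) b :
  X 0 -> (forall a b, X a -> X b -> X (a + b)) ->
  (forall a b, Jpow m a -> Jpow n b -> X (a * b)) -> Jpow (m + n) b -> X b.
Proof.
elim: m X b => [|m IHm] X b X0 XD XM.
  by move=> h; rewrite -[b]mul1r; apply: XM => //; apply/Jpow_base/(subring1 SA).
rewrite addSn; move E: (m + n).+1 => k h.
elim: h E => {k b} [b _|k _|k a b _ IHa _ IHb E|k a b Ja h _ [E]] //.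
  by apply: XD; [apply: IHa|apply: IHb].
rewrite -E in h; apply: (IHm (fun x => X (a * x)) b) => //.
- by rewrite mulr0.
- by move=> x y; rewrite mulrDr; apply: XD.
- by move=> x y hx hy; rewrite mulrA; apply: XM => //; apply: Jpow_mul.
Qed.
End OneGroup.

Lemma aug_pr (gT : finGroupType) (D : {group gT}) (b : gring Q gT) :
  (D <| [set: gT])%g -> aug (pr D b) = aug b.
Proof.
move=> nD; have nDT g : g \in ('N(D))%g by apply: (subsetP (normal_norm nD)); rewrite inE.
rewrite /aug (partition_big (coset D) predT) //=; apply: eq_bigr => c _.
by rewrite ffunE; apply: eq_bigl => g; rewrite nDT.
Qed.

Lemma pr_mul (gT : finGroupType) (D : {group gT}) (a b : gring Q gT) :
  (D <| [set: gT])%g -> pr D (a * b) = pr D a * pr D b.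
Proof.
move=> nD; have nDT g : g \in ('N(D))%g by apply: (subsetP (normal_norm nD)); rewrite inE.
have := @transversal_pr Q gT D (ar_char0 ar) 1 (fun=> 1%g) _ a b.
rewrite big_ord1 invg1 gel1 mulr1 mul1r => <- // g.
by exists 0 => a'; rewrite nDT [a']ord1 eqxx.
Qed.

Lemma pr_Jpow (gT : finGroupType) (D : {group gT}) n (b : gring Q gT) :
  (D <| [set: gT])%g -> Jpow n b -> Jpow n (pr D b).
Proof.
move=> nD; elim=> {n b} [b h|n|n a b _ ha _ hb|n a b [Ja Jb] _ hb].
- exact/Jpow_base/pr_in.
- by rewrite raddf0; apply: Jpow_zero.
- by rewrite raddfD; apply: Jpow_add.
- rewrite pr_mul //; apply: Jpow_mul => //; split; first exact: pr_in.
  by rewrite aug_pr.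
Qed.

(** Modulo [1 - c] each group element may be replaced by a fixed representative of its coset; the
    coefficients then add up to those of [pr b], which are divisible by [p]. *)
Lemma ker_pr (gT : finGroupType) (c : gT) (b : gring Q gT) :
    c \in ('Z([set: gT]))%g -> inA P b ->
    (exists2 z, inA P z & pr <[c]>%G b = p%:R * z) ->
  exists y z, [/\ inA P y, inA P z & b = (1 - gel Q c) * y + p%:R * z].
Proof.
move=> cZ Ab [z' Az' E]; have SA := @inA_subring p R Q f ar gT P.
have cg g : commute c g by apply: commute_sym; apply: (centerC _ cZ); rewrite inE.
have nD : (<[c]> <| [set: gT])%g by rewrite sub_center_normal // cycle_subG.
have nDT g : g \in ('N(<[c]>))%g by apply: (subsetP (normal_norm nD)); rewrite inE.
pose r g := repr (coset <[c]> g).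
have rP g : exists i, g = (r g * c ^+ i)%g.
  have : g \in (r g *: <[c]>)%g.
    rewrite -norm_rlcoset ?nDT // -val_coset ?nDT // coset_reprK val_coset ?nDT //.
    exact: rcoset_refl.
  by case/lcosetP => y /cycleP[i ->] gE; exists i.
have dec g : exists2 y, inA P y & gel Q g = gel Q (r g) + (1 - gel Q c) * y.
  have [i gE] := rP g.
  exists (- ((\sum_(j < i) gel Q c ^+ j) * gel Q (r g))).
    apply/(subringN SA)/(subringM SA); last exact: inA_gel.
    by apply: (subring_sum SA) => j _; apply: (subringX SA); apply: inA_gel.
  have h : (1 - gel Q c) * (\sum_(j < i) gel Q c ^+ j) = 1 - gel Q c ^+ i.
    by rewrite -[1 - gel Q c]opprB mulNr -subrX1 opprB.
  rewrite mulrN mulrA h mulrBl mul1r opprB addrC subrK -gelX -gelM {1}gE.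
  congr (gel Q _); exact: (commuteX i (commute_sym (cg (r g)))).
have [y Hy] : exists y : gT -> gring Q gT, forall g, inA P (y g) /\
    gel Q g = gel Q (r g) + (1 - gel Q c) * y g.
  exists (fun g => s2val (cid2 (dec g))) => g.
  by split; [exact: (s2valP (cid2 (dec g)))|exact: (s2valP' (cid2 (dec g)))].
exists (\sum_g sc gT (b g) * y g), (\sum_(C : coset_of <[c]>) sc gT (z' C) * gel Q (repr C)).
split.
- apply: (subring_sum SA) => g _; apply: (subringM SA); last by case: (Hy g).
  exact/inA_sc/Ab.
- apply: (subring_sum SA) => C _; apply: (subringM SA); last exact: inA_gel.
  exact/inA_sc/Az'.
have cB x : sc gT x * (1 - gel Q c) = (1 - gel Q c) * sc gT x by rewrite sc_comm.
rewrite {1}(gring_dec b) (eq_bigr (fun g => sc gT (b g) * gel Q (r g) +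
   (1 - gel Q c) * (sc gT (b g) * y g))); last first.
  by move=> g _; have [_ {1}->] := Hy g; rewrite mulrDr mulrA cB mulrA.
rewrite big_split /= [RHS]addrC; congr (_ + _); last by rewrite mulr_sumr.
rewrite (partition_big (coset <[c]>) predT) //= mulr_sumr; apply: eq_bigr => C _.
rewrite (eq_bigr (fun g => sc gT (b g) * gel Q (repr C))); last by move=> g /eqP <-.
rewrite -mulr_suml -rmorph_sum mulrA (natB_scE Q gT) -rmorphM /=; congr (sc gT _ * _).
have := congr1 (fun x : gring Q _ => x C) E; rewrite natr_gringE => <-.
by rewrite ffunE; apply: eq_bigl => g; rewrite nDT.
Qed.

(* The quotient by a central subgroup <c> of order p is handled by induction,
   and (1 - c)^p is divisible by p. *)
Lemma J_nilpotent n (gT : finGroupType) : #|gT| = (p ^ n)%N ->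
  exists N, forall b : gring Q gT, Jpow N b -> exists2 z, inA P z & b = p%:R * z.
Proof.
have p_pr := p_prime ar.
elim: n gT => [|n IHn] gT oG.
  exists 1%N => b; have SA := @inA_subring p R Q f ar gT P.
  move E: 1%N => k h; elim: h E => {k b} [//|k _|k a b _ IHa _ IHb E|k a b [Aa [z Iz Ea]] hb _ _].
  - by exists 0; [apply: (subring0 SA)|rewrite mulr0].
  - have [[x Ax ->] [y Ay ->]] := (IHa E, IHb E).
    by exists (x + y); [apply: (subringD SA)|rewrite mulrDr].
  exists (sc gT z * b).
    by apply: (subringM SA); [apply: inA_sc|apply: Jpow_in hb].
  have g1 (g : gT) : g = 1%g.
    have /card1_trivg E1 : #|[set: gT]%G| = 1%N by rewrite cardsT oG.
    by have := in_setT g; rewrite -[setT]/(gval [set: gT]%G) E1 => /set1gP.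
  rewrite mulrA (natB_scE Q gT) -rmorphM /=; congr (_ * _).
  apply/ffunP => g; rewrite ffunE (g1 g) eqxx mulr1.
  move: Ea; rewrite add0r => <-; rewrite /aug (bigD1 1%g) //= big1 ?addr0 // => h.
  by rewrite (g1 h) eqxx.
have pG : (p.-group [set: gT])%g by rewrite /pgroup cardsT oG pnatX pnat_id.
have ntG : [set: gT] != 1%g.
  by rewrite -cardG_gt1 cardsT oG expnS (leq_trans (prime_gt1 p_pr)) // leq_pmulr // expn_gt0 prime_gt0.
have ntZ : ('Z([set: gT]))%g != 1%g by rewrite center_nil_eq1 // (pgroup_nil pG).
have pZ : (p.-group 'Z([set: gT]))%g := pgroupS (center_sub _) pG.
have [_ pdZ _] := pgroup_pdiv pZ ntZ.
have [c cZ oc] := Cauchy p_pr pdZ.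
have nD : (<[c]> <| [set: gT])%g by rewrite sub_center_normal // cycle_subG.
have oQ : #|{: coset_of <[c]>}| = (p ^ n)%N.
  rewrite -cardsT; have -> : setT = ([set: gT] / <[c]>)%g.
    apply/eqP; rewrite eq_sym -subTset; apply/subsetP => C _.
    rewrite -[C]coset_reprK mem_quotient // inE.
  by rewrite card_quotient ?normal_norm // -divgS ?normal_sub // cardsT oG -orderE oc expnS mulKn ?prime_gt0.
(* [J^N] lies in the ideal generated by [1 - c] and [p], by induction and [ker_pr]; hence [J^(pN)]
   lies in the one generated by [(1 - c)^p] and [p]. *)
have [N HN] := IHn _ oQ; exists (p * N)%N => b.
have SA := @inA_subring p R Q f ar gT P.
have cg g : commute c g by apply: commute_sym; apply: (centerC _ cZ); rewrite inE.
have Ac : inA P (1 - gel Q c) by apply: (subringB SA (subring1 SA)); apply: inA_gel.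
have cC (x : gring Q gT) : (1 - gel Q c) * x = x * (1 - gel Q c).
  rewrite mulrBl mulrBr mul1r mulr1; congr (_ - _).
  rewrite (gring_dec x) mulr_sumr mulr_suml; apply: eq_bigr => g _.
  by rewrite mulrA -sc_comm -!mulrA -!gelM cg.
have key k : forall x, Jpow (k * N) x -> exists y z, [/\ inA P y, inA P z &
    x = (1 - gel Q c) ^+ k * y + p%:R * z].
  elim: k => [|k IHk] x.
    move=> /Jpow_in Ax; exists x, 0; split=> //; first exact: (subring0 SA).
    by rewrite expr0 mul1r mulr0 addr0.
  rewrite mulSn.
  apply: (@Jpow_split _ N (k * N) (fun x => exists y z, [/\ inA P y, inA P z &
    x = (1 - gel Q c) ^+ k.+1 * y + p%:R * z])).
  - exists 0, 0; split; try exact: (subring0 SA).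
    by rewrite !mulr0 addr0.
  - move=> u v [y [z [Ay Az ->]]] [y' [z' [Ay' Az' ->]]]; exists (y + y'), (z + z').
    by split; [apply: (subringD SA)|apply: (subringD SA)|rewrite !mulrDr addrACA].
  move=> u v Ju Jv; have [y' [z' [Ay' Az' ->]]] := IHk _ Jv.
  have [|y [z [Ay Az ->]]] := @ker_pr gT c u cZ (Jpow_in Ju).
    by apply: HN; apply: pr_Jpow.
  exists (y * y'), ((1 - gel Q c) * y * z' + z * ((1 - gel Q c) ^+ k * y' + p%:R * z')).
  split; first exact: (subringM SA).
    apply: (subringD SA); first by do 2!apply: (subringM SA) => //.
    apply: (subringM SA) => //; apply: (subringD SA).
      by apply: (subringM SA) => //; apply: (subringX SA).
    by apply: (subringM SA) => //; apply: (subring_nat SA).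
  rewrite mulrDl [in LHS]mulrDr -!addrA; congr (_ + _).
    by rewrite exprS -!mulrA; congr (_ * _); rewrite !mulrA; congr (_ * _); elim: (k) => [|i IH];
       rewrite ?mulr1 ?mul1r // exprS mulrA -cC -!mulrA IH.
  rewrite [in RHS]mulrDr; congr (_ + _).
    by rewrite (mulrA _ p%:R) -[_ * p%:R](natr_comm p) -!mulrA.
  by rewrite -mulrA.
move=> /key[y [z [Ay Az ->]]].
have [|||w Aw E] := @frobenius_comm _ _ SA p 1 (- gel Q c) p_pr.
- exact: (subring1 SA).
- by apply: (subringN SA); apply: inA_gel.
- exact/commr_sym/commr1.
exists (w * y + z); first by apply: (subringD SA) => //; apply: (subringM SA).
(* Modulo [p] the power [(1 - c)^p] is [1 + (- c)^p], and this is [1 - 1] because [p] is odd and [c]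
   has order [p]. *)
rewrite E expr1n exprNn -signr_odd p_odd expr1 mulN1r -gelX -oc expg_order gel1 subrr add0r.
by rewrite mulrDr mulrA oc.
Qed.
End LocalGroupRing.

(** * Idempotent matrices over Bezout domains *)
Section BezoutDomain.
Variables (K : fieldType) (D : K -> Prop).
Hypothesis SD : subring_pred D.

Definition bezout := forall a b, D a -> D b -> exists g u v a' b',
  [/\ [/\ D u, D v, D a' & D b'], g = u * a + v * b, a = g * a' & b = g * b'].

Section Criterion.
Variables (pi : K) (q : nat).
Hypothesis pi0 : pi != 0.
Hypothesis Dpi : D pi.
Hypothesis q2 : (1 < q)%N.
Hypothesis unit1 : forall x, cong D pi x 1 -> D x^-1.
Hypothesis pi_nu : ~ D pi^-1.
Hypothesis frob : forall x, D x -> cong D pi (x ^+ q) x.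
Hypothesis divpi : forall x, D x -> x != 0 -> exists n y, D y /\ x * y = pi ^+ n.

Lemma cong1_neq0 x : cong D pi x 1 -> x != 0.
Proof.
move=> [z Dz E]; apply/eqP => x0; apply: pi_nu.
have h : pi * (- z) = 1.
  by apply/eqP; rewrite mulrN eq_sym -subr_eq0 opprK -E x0.
have := mulKf pi0 (- z); rewrite h mulr1 => ->; exact: (subringN SD).
Qed.

(* An idempotent e modulo pi generates (e, pi) modulo pi; the element
   z = e^2 + pi (1 - e^2) generates the ideal (e, pi) itself. *)
Lemma idem_gen e : D e -> cong D pi (e ^+ 2) e ->
  exists z w, [/\ D z, D w, pi = z * w, cong D pi z (e ^+ 2) & exists2 k, D k & e = z * k].
Proof.
move=> De [c Dc Ec]; have D1 := subring1 SD.
pose z := e ^+ 2 + pi * (1 - e ^+ 2); pose w := (1 - e) ^+ 2 + pi * e ^+ 2.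
have De2 : D (e ^+ 2) by apply: (subringX SD).
have D1e : D (1 - e) by apply: (subringB SD).
have D1e2 : D (1 - e ^+ 2) by apply: (subringB SD).
have Dz : D z by apply: (subringD SD) => //; apply: (subringM SD).
have Dw : D w.
  by apply: (subringD SD); [apply: (subringX SD)|apply: (subringM SD)].
(* [r] results from expanding [z * w] and replacing [e ^ 2 - e] by [pi * c]: the product becomes
   [pi * s], and [s] is congruent to 1, hence invertible. *)
pose r := c ^+ 2 + (c + c) * (1 + e) + (1 - e ^+ 2) * e ^+ 2.
pose s := 1 + pi * r.
have Ec2 : pi * c = e ^+ 2 - e by rewrite Ec addrC addKr.
have zw : z * w = pi * s.
  have E1 : e ^+ 2 * (1 - e) ^+ 2 = pi * (pi * c ^+ 2).
    have -> : pi * (pi * c ^+ 2) = (pi * c) ^+ 2 by ring.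
    by rewrite Ec2; ring.
  have -> : z * w = e ^+ 2 * (1 - e) ^+ 2 + pi * (e ^+ 4 + (1 - e ^+ 2) * (1 - e) ^+ 2 +
     pi * (1 - e ^+ 2) * e ^+ 2) by rewrite /z /w; ring.
  rewrite E1 /s /r.
  have -> : pi * (1 + pi * (c ^+ 2 + (c + c) * (1 + e) + (1 - e ^+ 2) * e ^+ 2)) =
    pi * (pi * c ^+ 2) + pi * (1 + (pi * c + pi * c) * (1 + e) + pi * (1 - e ^+ 2) * e ^+ 2) by ring.
  by rewrite Ec2; ring.
have Dr : D r.
  rewrite /r; repeat first [assumption | apply: (subringD SD) | apply: (subringB SD)
    | apply: (subringM SD) | apply: (subringX SD)].
have s1 : cong D pi s 1 by exists r.
have Ds' := unit1 s1; have s0 := cong1_neq0 s1.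
have Ds : D s by apply: (subringD SD) => //; apply: (subringM SD).
have piE : pi = z * (w * s^-1) by rewrite mulrA zw mulfK.
exists z, (w * s^-1); split=> //; first exact: (subringM SD).
  by exists (1 - e ^+ 2).
exists (1 - w * s^-1 * (1 - e ^+ 2) - w * s^-1 * c).
  repeat first [assumption | apply: (subringB SD) | apply: (subringM SD)].
have -> : z * (1 - w / s * (1 - e ^+ 2) - w / s * c) = z - z * (w * s^-1) * (1 - e ^+ 2) - z * (w * s^-1) * c.
  by ring.
by rewrite -piE Ec2 /z; ring.
Qed.

(** As [a ^ q] is [a] modulo [pi], the power [a ^ (q - 1)] is idempotent modulo [pi] and generates
    the same ideal as [a] there. *)
Lemma frob_idem a : D a -> exists2 e, D e & [/\ cong D pi (e ^+ 2) e, cong D pi (a * e) a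
   & exists2 k, D k & e = a * k].
Proof.
have piC x : GRing.comm pi x by exact: mulrC.
move=> Da; have [k qE] : exists k, q = k.+2 by case: (q) q2 => [|[|k]] // _; exists k.
have hf := frob Da; rewrite qE in hf; have Dk := subringX SD k Da.
exists (a ^+ k.+1); first exact: (subringX SD); split; last by exists (a ^+ k); rewrite ?exprS.
- have -> : (a ^+ k.+1) ^+ 2 = a ^+ k.+2 * a ^+ k.
    by rewrite -exprM -exprD muln2 -addnn addnS addSn.
  by rewrite [X in cong _ _ _ X]exprS; apply: (congM SD Dpi piC) => //; apply: (cong_refl SD).
- by rewrite -exprS.
Qed.

(** Modulo [pi] the ideals of [a] and [b] are generated by idempotents [e1] and [e2], so their sum
    is generated by [e1 + e2 - e1 * e2]; [idem_gen] lifts this to a generator of the ideal of [a],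
    [b] and [pi]. *)
Lemma gcd_with_pi a b : D a -> D b -> exists z w u v t,
  [/\ [/\ D z, D w & pi = z * w], [/\ D u, D v & D t], z = u * a + v * b + t * pi,
      exists2 k, D k & a = z * k & exists2 k, D k & b = z * k].
Proof.
have piC x : GRing.comm pi x by exact: mulrC.
move=> Da Db; have D1 := subring1 SD.
have [e1 De1 [i1 m1 [k1 Dk1 E1]]] := frob_idem Da.
have [e2 De2 [i2 m2 [k2 Dk2 E2]]] := frob_idem Db.
pose e := e1 + e2 - e1 * e2.
have De : D e by apply: (subringB SD); [apply: (subringD SD)|apply: (subringM SD)].
have ie : cong D pi (e ^+ 2) e.
  case: i1 i2 => [c1 Dc1 F1] [c2 Dc2 F2].
  exists (c1 * (1 - e2) ^+ 2 + c2 * (1 - e1) ^+ 2 - pi * c1 * c2).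
    repeat first [assumption | apply: (subringB SD) | apply: (subringD SD) | apply: (subringM SD) | apply: (subringX SD)].
  have G1 : pi * c1 = e1 ^+ 2 - e1 by rewrite F1 addrC addKr.
  have G2 : pi * c2 = e2 ^+ 2 - e2 by rewrite F2 addrC addKr.
  have -> : pi * (c1 * (1 - e2) ^+ 2 + c2 * (1 - e1) ^+ 2 - pi * c1 * c2) =
    (pi * c1) * (1 - e2) ^+ 2 + (pi * c2) * (1 - e1) ^+ 2 - (pi * c1) * (pi * c2) by ring.
  by rewrite G1 G2 /e; ring.
have [z [w [Dz Dw zw [t Dt Et] [k Dk Ek]]]] := idem_gen De ie.
have dva x ex kx : D x -> D ex -> D kx -> cong D pi (x * ex) x ->
    (exists2 y, D y & x * e = x * ex + y * (x * ex - x)) -> exists2 k, D k & x = z * k.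
  move=> Dx Dex Dkx [c Dc Ec] [y Dy Ey].
  exists (k * x - w * c - w * y * c).
    repeat first [assumption | apply: (subringB SD) | apply: (subringM SD)].
  have -> : z * (k * x - w * c - w * y * c) = (z * k) * x - (z * w) * c - y * ((z * w) * c) by ring.
  rewrite -Ek -zw; have -> : pi * c = x * ex - x by rewrite Ec addrC addKr.
  by rewrite (mulrC e) Ey; ring.
exists z, w, (k1 * e * (1 - e2)), (k2 * e), t; split=> //.
- by split=> //; repeat first [assumption | apply: (subringB SD) | apply: (subringM SD)].
- have -> : k1 * e * (1 - e2) * a + k2 * e * b = e * ((a * k1) * (1 - e2) + b * k2) by ring.
  by rewrite -E1 -E2 Et /e; ring.
- apply: (dva a e1 k1) => //; exists (- e2); first exact: (subringN SD).
  by rewrite /e; ring.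
- apply: (dva b e2 k2) => //; exists (- e1); first exact: (subringN SD).
  by rewrite /e; ring.
Qed.

(** Some power [pi ^ n] lies in the ideal of [a] and [b]. Dividing both by a generator of the ideal
    of [a], [b] and [pi] lowers [n] by one, so the process ends without any list of the primes above
    [pi]. *)
Lemma criterion_bezout : bezout.
Proof.
have D1 := subring1 SD; have D0 := subring0 SD.
have main n : forall a b u v, D a -> D b -> D u -> D v -> pi ^+ n = u * a + v * b ->
    exists g u v a' b',
  [/\ [/\ D u, D v, D a' & D b'], g = u * a + v * b, a = g * a' & b = g * b'].
  elim: n => [|n IHn] a b u v Da Db Du Dv E.
    by exists 1, u, v, a, b; split; rewrite ?mul1r.
  have [z [w [x [y [t [[Dz Dw zw] [Dx Dy Dt] Ez [a1 Da1 Ea] [b1 Db1 Eb]]]]]]] := gcd_with_pi Da Db.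
  have z0 : z != 0 by apply: contraNneq pi0 => z0; rewrite zw z0 mul0r.
  have E1 : x * a1 + y * b1 + t * w = 1.
    apply: (mulfI z0); rewrite mulr1; transitivity (x * (z * a1) + y * (z * b1) + t * (z * w)).
      by ring.
    by rewrite -Ea -Eb -zw -Ez.
  have E2 : w * pi ^+ n = u * a1 + v * b1.
    apply: (mulfI z0); transitivity (u * (z * a1) + v * (z * b1)); last by ring.
    by rewrite -Ea -Eb mulrA -zw -exprS E.
  have [|||||g [u' [v' [a' [b' [[Du' Dv' Da' Db'] Eg Ea' Eb']]]]]] :=
      IHn a1 b1 (x * pi ^+ n + t * u) (y * pi ^+ n + t * v) => //.
  - by apply: (subringD SD); apply: (subringM SD) => //; apply: (subringX SD).
  - by apply: (subringD SD); apply: (subringM SD) => //; apply: (subringX SD).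
  - have -> : (x * pi ^+ n + t * u) * a1 + (y * pi ^+ n + t * v) * b1 =
       (x * a1 + y * b1) * pi ^+ n + t * (u * a1 + v * b1) by ring.
    by rewrite -E2 -[LHS]mul1r -{1}E1; ring.
  exists (z * g), u', v', a', b'; split=> //.
  - by rewrite {1}Eg Ea Eb; ring.
  - by rewrite -mulrA -Ea'.
  - by rewrite -mulrA -Eb'.
move=> a b Da Db; have [a0|a0] := eqVneq a 0.
  by exists b, 0, 1, 0, 1; split; rewrite ?a0 ?mulr0 ?mulr1 ?mul1r ?add0r.
have [n [y [Dy E]]] := divpi Da a0.
by apply: (main n a b y 0) => //; rewrite mul0r addr0 mulrC.
Qed.
End Criterion.

Hypothesis bez : bezout.

Lemma gcd_row n (v : 'rV[K]_n) : mxin D v -> exists g (v1 : 'rV[K]_n) (b : 'cV[K]_n),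
  [/\ mxin D v1, mxin D b, v = g *: v1 & v *m b = g%:M].
Proof.
elim: n v => [|n IHn] v Dv.
  exists 0, 0, 0; split; [by move=> i []|by move=> []|by apply/rowP => -[]|].
  by rewrite mulmx0; apply/matrixP => i j; rewrite !mxE mul0rn.
pose v' := (v : 'rV_(1 + n)); rewrite -[v]/v' -(hsubmxK v').
set x := lsubmx v'; set w := rsubmx v'.
have [|g [w1 [b [Dw1 Db Ew Eb]]]] := IHn w; first by move=> i j; rewrite !mxE.
have Dx : D (x 0 0) by rewrite !mxE.
have Dg : D g.
  have /matrixP/(_ 0 0) := Eb; rewrite !mxE eqxx mulr1n => <-.
  by apply: (subring_sum SD) => i _; apply: (subringM SD) => //; rewrite !mxE.
have [h [u [t [a' [b' [[Du Dt Da' Db'] Eh Ea' Eb']]]]]] := bez Dx Dg.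
have hsc y : D y -> mxin D (y%:M : 'M[K]_1).
  by move=> Dy i j; rewrite !mxE !ord1 eqxx mulr1n.
have hZ k l y (M : 'M[K]_(k, l)) : D y -> mxin D M -> mxin D (y *: M).
  by move=> Dy DM i j; rewrite mxE; apply: (subringM SD).
exists h, (row_mx a'%:M (b' *: w1)), (col_mx u%:M (t *: b)); split.
- exact: (mxin_row_mx (hsc _ Da') (hZ _ _ _ _ Db' Dw1)).
- exact: (mxin_col_mx (hsc _ Du) (hZ _ _ _ _ Dt Db)).
- have E2 : row_mx x w = h *: (row_mx a'%:M (b' *: w1) : 'rV_(1 + n)).
    rewrite scale_row_mx scalerA -Eb' -Ew scale_scalar_mx -Ea'; congr row_mx.
    exact: mx11_scalar.
  exact: E2.
- have E2 : row_mx x w *m col_mx u%:M (t *: b) = h%:M.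
    rewrite mul_row_col -scalemxAr Eb mul_mx_scalar [x]mx11_scalar !scale_scalar_mx -raddfD /=.
    by rewrite Eh.
  exact: E2.
Qed.

(** A nonzero row of [e] is a scalar times a unimodular row [v1]; since that row is fixed by [e], so
    is [v1]. *)
Lemma bezout_unimod n (e : 'M[K]_n) : mxin D e -> e *m e = e -> e <> 0 ->
  exists (a : 'rV[K]_n) (b : 'cV[K]_n), [/\ mxin D a, mxin D b & a *m e *m b = 1%:M].
Proof.
move=> De ee e0.
have [i ri0] : exists i, row i e != 0.
  apply: contrapT => h; apply: e0; apply/row_matrixP => i; rewrite row0.
  by apply/eqP; apply: contrapT => /negP ri; apply: h; exists i.
have [|g [v1 [b [Dv1 Db Ev Eb]]]] := @gcd_row n (row i e); first by move=> k l; rewrite mxE.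
have g0 : g != 0 by apply: contraNneq ri0 => g0; rewrite Ev g0 scale0r.
have v1e : v1 *m e = v1.
  apply: (scalerI g0); rewrite scalemxAl -Ev -row_mul ee //.
exists v1, b; split=> //; rewrite v1e; apply: (scalerI g0).
by rewrite scalemxAl -Ev Eb scale_scalar_mx mulr1.
Qed.

(** Write [x = a' / b'] in lowest terms. As [a' ^ m] is [b' ^ m] times an element of [D], the
    relation [1 = (u * a') ^ m + b' * r] shows that [b'] divides 1. *)
Lemma integrally_closed x m : (0 < m)%N -> (exists a b, [/\ D a, D b, b != 0 & x = a / b]) ->
  D (x ^+ m) -> D x.
Proof.
move=> m0 [a [b [Da Db b0 ->]]] Dm.
have [g [u [v [a' [b' [[Du Dv Da' Db'] Eg Ea Eb]]]]]] := bez Da Db.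
have g0 : g != 0 by apply: contraNneq b0 => g0; rewrite Eb g0 mul0r.
have b'0 : b' != 0 by apply: contraNneq b0 => b0; rewrite Eb b0 mulr0.
have E1 : u * a' + v * b' = 1.
  apply: (mulfI g0); rewrite mulr1; transitivity (u * (g * a') + v * (g * b')); first by ring.
  by rewrite -Ea -Eb -Eg.
have xE : a / b = a' / b' by rewrite Ea Eb -mulf_div divff // mul1r.
rewrite xE in Dm *.
have key k : exists r, D r /\ 1 = (u * a') ^+ k + b' * r.
  elim: k => [|k [r [Dr Er]]]; first by exists 0; split; [exact: (subring0 SD)|rewrite expr0 mulr0 addr0].
  exists (v * (u * a') ^+ k + r); split.
    by apply: (subringD SD) => //; apply: (subringM SD) => //; apply: (subringX SD); apply: (subringM SD).
  rewrite Er exprS; have -> : u * a' = 1 - v * b' by rewrite -E1 addrK.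
  by ring.
have [r [Dr Er]] := key m.
have DbV : D b'^-1.
  have -> : b'^-1 = b' ^+ m.-1 * u ^+ m * (a' / b') ^+ m + r.
    apply: (mulfI b'0); rewrite divff // [LHS]Er mulrDr; congr (_ + _).
    have F : (a' / b') ^+ m * b' ^+ m = a' ^+ m by rewrite expr_div_n divfK ?expf_neq0.
    rewrite exprMn -F; have -> : b' ^+ m = b' * b' ^+ m.-1 by rewrite -exprS prednK.
    by ring.
  apply: (subringD SD) => //; apply: (subringM SD) => //; apply: (subringM SD); exact: (subringX SD).
exact: (subringM SD).
Qed.
End BezoutDomain.

(** * Elementary generation of the special linear group over a field *)

Section SpecialLinear.
Variable K : fieldType.

Lemma El_clear_col n (v : 'cV[K]_n.+1) : v 0 0 = 1 ->
  exists2 g, El g & g *m v = delta_mx 0 0.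
Proof.
move=> v0; have key (s : seq 'I_n.+1) : exists2 g, El g &
    forall i, (g *m v) i 0 = if (i \in s) && (i != 0) then 0 else v i 0.
  elim: s => [|j s [g Eg Hg]]; first by exists 1%:M => [|i]; [apply: El_one|rewrite mul1mx].
  have [j0|j0] := eqVneq j 0.
    exists g => // i; rewrite Hg inE j0; case: (eqVneq i 0) => [->|] //=.
    by rewrite andbF.
  have [js|js] := boolP (j \in s).
    by exists g => // i; rewrite Hg inE; case: (eqVneq i j) => [->|] //=; rewrite js.
  exists (elem j 0 (- v j 0) *m g); first exact: El_step.
  move=> i; rewrite -mulmxA elem_mulE !Hg inE eqxx andbF v0 mulr1.
  case: (eqVneq i j) => [->|ij] /=; last by rewrite mul0r addr0.
  by rewrite (negPf js) j0 /= mul1r subrr.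
have [g Eg Hg] := key (enum 'I_n.+1); exists g => //; apply/colP => i.
by rewrite Hg mem_enum !mxE; case: (eqVneq i 0) => [->|].
Qed.

(** Having two rows is what matters: a nonzero entry is produced away from the top, and a multiple
    of its row turns the top entry into 1. *)
Lemma El_col n (v : 'cV[K]_n.+2) : v != 0 -> exists2 g, El g & g *m v = delta_mx 0 0.
Proof.
move=> v0; have [g [k [Eg k0 gk]]] : exists g k, [/\ El g, k != 0 & (g *m v) k 0 != 0].
  have [[k [k0 vk]]|h] := pselect (exists k, k != 0 /\ v k 0 != 0).
    by exists 1%:M, k; split=> //; [apply: El_one|rewrite mul1mx].
  have h0 k : k != 0 -> v k 0 = 0.
    by move=> k0; apply/eqP; apply: contrapT => /negP vk; apply: h; exists k.
  exists (elem 1 0 1), 1; split=> //; first exact: El_elem.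
  rewrite elem_mulE eqxx !mul1r h0 // add0r; apply: contraNneq v0 => v00.
  by apply/eqP/colP => i; rewrite mxE; case: (eqVneq i 0) => [->|] //; apply: h0.
pose w := elem 0 k ((1 - (g *m v) 0 0) / (g *m v) k 0) *m (g *m v).
have [|g' Eg' Hg'] := @El_clear_col n.+1 w.
  by rewrite /w elem_mulE eqxx mul1r divfK // addrC subrK.
exists (g' *m (elem 0 k ((1 - (g *m v) 0 0) / (g *m v) k 0) *m g)).
  by apply: El_mul => //; apply: El_step => //; rewrite eq_sym.
by rewrite -!mulmxA.
Qed.

Lemma El_block n (h : 'M[K]_n) : El h -> El (block_mx (1%:M : 'M_1) 0 0 h).
Proof.
elim=> [|i j a g ij _ IH]; first by rewrite -scalar_mx_block; apply: El_one.
have -> : block_mx (1%:M : 'M_1) 0 0 (elem i j a *m g) =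
    elem (rshift 1 i) (rshift 1 j) a *m block_mx 1%:M 0 0 g.
  have -> : elem (rshift 1 i) (rshift 1 j) a = block_mx (1%:M : 'M_1) 0 0 (elem i j a).
    apply/matrixP => k l; rewrite elemE.
    case: (split_ordP k) => k' ->; case: (split_ordP l) => l' ->.
    - by rewrite block_mxEul eq_lrshift mul0r addr0 (inj_eq (@lshift_inj _ _)) mxE.
    - by rewrite block_mxEur !eq_lrshift mul0r addr0 mxE.
    - by rewrite block_mxEdl !eq_rlshift add0r !mulr0 mxE.
    - by rewrite block_mxEdr !(inj_eq (@rshift_inj _ _)) elemE.
  by rewrite mulmx_block !mulmx0 !mul0mx !addr0 add0r mulmx1.
by apply: El_step => //; rewrite (inj_eq (@rshift_inj _ _)).
Qed.

Lemma El_clear_row n (w : 'rV[K]_n) : El (block_mx (1%:M : 'M_1) w 0 (1%:M : 'M_n)).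
Proof.
have -> : block_mx (1%:M : 'M_1) w 0 (1%:M : 'M_n) =
    1%:M + \sum_(j <- enum 'I_n) w 0 j *: delta_mx (lshift n 0) (rshift 1 j).
  apply/matrixP => k l; rewrite [RHS]mxE summxE.
  case: (split_ordP k) => k' ->; case: (split_ordP l) => l' ->.
  - rewrite block_mxEul !mxE (inj_eq (@lshift_inj _ _)) big1 ?addr0 // => j _.
    by rewrite !mxE eq_lrshift andbF mulr0.
  - rewrite block_mxEur mxE eq_lrshift add0r big_enum /= (bigD1 l') //= !mxE !ord1 !eqxx mulr1 big1 ?addr0 //.
    by move=> j jl; rewrite !mxE (inj_eq (@rshift_inj _ _)) eq_sym (negPf jl) andbF mulr0.
  - by rewrite block_mxEdl !mxE eq_rlshift big1 ?addr0 // => j _; rewrite !mxE eq_rlshift mulr0.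
  - by rewrite block_mxEdr !mxE (inj_eq (@rshift_inj _ _)) big1 ?addr0 // => j _; rewrite !mxE eq_rlshift mulr0.
elim: (enum 'I_n) => [|j s IH]; first by rewrite big_nil addr0; apply: El_one.
rewrite big_cons; set Y := \sum_(_ <- _) _ in IH *.
have -> : 1%:M + (w 0 j *: delta_mx (lshift n 0) (rshift 1 j) + Y) =
    elem (lshift n 0) (rshift 1 j) (w 0 j) *m (1%:M + Y).
  have XY : (w 0 j *: delta_mx (lshift n (0 : 'I_1)) (rshift 1 j)) *m (Y : 'M[K]_(1 + n)) = 0.
    rewrite /Y mulmx_sumr big1 // => i _.
    by rewrite -scalemxAl -scalemxAr mul_delta_mx_0 ?scaler0 // eq_rlshift.
  by rewrite /elem mulmxDl mul1mx mulmxDr mulmx1 XY addr0 -addrA; congr (_ + _); rewrite addrC.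
by apply: El_step => //; rewrite eq_lrshift.
Qed.

Lemma det_elem n (i j : 'I_n) (a : K) : i != j -> \det (elem i j a) = 1.
Proof.
move=> ij.
have diag k : elem i j a k k = 1.
  rewrite elemE eqxx; case: (eqVneq k i) => [->|_]; last by rewrite mul0r addr0.
  by rewrite [j == i]eq_sym (negPf ij) !mulr0 addr0.
have [lij|lji] := ltnP j i.
  rewrite det_trig ?big1 //; apply/is_trig_mxP => k l kl; rewrite elemE.
  have -> : (k == l) = false by apply: contraTF kl => /eqP ->; rewrite ltnn.
  rewrite add0r; case: (eqVneq k i) => [ki|_]; last by rewrite mul0r.
  case: (eqVneq j l) => [jl|_]; last by rewrite !mulr0.
  by move: kl; rewrite ki -jl ltnNge ltnW.
rewrite -det_tr det_trig ?big1 // => [k _|]; first by rewrite mxE.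
apply/is_trig_mxP => k l kl; rewrite mxE elemE.
have -> : (l == k) = false by apply: contraTF kl => /eqP ->; rewrite ltnn.
rewrite add0r; case: (eqVneq l i) => [li|_]; last by rewrite mul0r.
case: (eqVneq j k) => [jk|_]; last by rewrite !mulr0.
by move: kl; rewrite li -jk ltnNge lji.
Qed.

Lemma det_El n (h : 'M[K]_n) : El h -> \det h = 1.
Proof.
elim=> [|i j a h' ij _ IH]; first exact: det1.
by rewrite det_mulmx IH mulr1 det_elem.
Qed.

Lemma SL_El n (M : 'M[K]_n) : \det M = 1 -> El M.
Proof.
elim: n M => [|[|n] IHn] M detM.
- have -> : M = 1%:M by apply/matrixP => -[].
  exact: El_one.
- have -> : M = 1%:M; last exact: El_one.
  by rewrite [M]mx11_scalar -det_mx11 detM.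
have c0 : col 0 M != 0.
  apply: contraTneq (oner_neq0 K) => M0; rewrite -detM negbK (expand_det_col M 0) big1 // => i _.
  by have /colP/(_ i) := M0; rewrite !mxE => ->; rewrite mul0r.
have [g Eg gM] := El_col c0; have [g' [Eg' gg' g'g]] := El_inv Eg.
have [M' M'E] : exists M' : 'M[K]_(1 + n.+1), M' = g *m M by exists (g *m M).
have hc i : M' i 0 = (i == 0)%:R.
  have /colP/(_ i) : col 0 M' = delta_mx 0 0 by rewrite M'E -gM !colE mulmxA.
  by rewrite !mxE eqxx andbT.
have l0 : lshift n.+1 (0 : 'I_1) = 0 by apply: val_inj.
have ulM : ulsubmx M' = 1%:M.
  by apply/matrixP => i j; rewrite !ord1 !mxE l0 hc.
have dlM : dlsubmx M' = 0.
  by apply/matrixP => i j; rewrite ord1 !mxE l0 hc -l0 eq_rlshift.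
have M'b : M' = block_mx 1%:M (ursubmx M') 0 (drsubmx M') by rewrite -[LHS]submxK ulM dlM.
have detM' : \det M' = 1 by rewrite M'E det_mulmx detM mulr1 det_El.
have E1 : El (drsubmx M').
  by apply: IHn; rewrite -detM' M'b det_ublock det1 mul1r block_mxKdr.
have -> : M = g' *m M' by rewrite M'E mulmxA g'g mul1mx.
apply: El_mul => //; have -> : M' = block_mx 1%:M 0 0 (drsubmx M') *m block_mx 1%:M (ursubmx M') 0 1%:M.
  by rewrite mulmx_block !mul1mx !mulmx0 !mul0mx !mulmx1 !addr0 add0r.
by apply: El_mul; [apply: El_block|apply: El_clear_row].
Qed.
End SpecialLinear.

(** * Matrices with matrix entries, flattened *)

Section BlockMatrices.
Variables (K : comNzRingType) (d : nat).

Definition bidx m (k : 'I_(m * d)) : 'I_m * 'I_d :=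
  enum_val (cast_ord (esym (mxvec_cast m d)) k).

Lemma bidxK m (i : 'I_m) (k : 'I_d) : bidx (mxvec_index i k) = (i, k).
Proof. by rewrite /bidx /mxvec_index cast_ordK enum_rankK. Qed.
Lemma mxvec_bidx m (k : 'I_(m * d)) : mxvec_index (bidx k).1 (bidx k).2 = k.
Proof. by case/mxvec_indexP: k => i j; rewrite bidxK. Qed.

Definition blk m n (X : 'M['M[K]_d]_(m, n)) : 'M[K]_(m * d, n * d) :=
  \matrix_(a, b) X (bidx a).1 (bidx b).1 (bidx a).2 (bidx b).2.
Definition unblk m n (Y : 'M[K]_(m * d, n * d)) : 'M['M[K]_d]_(m, n) :=
  \matrix_(i, j) \matrix_(k, l) Y (mxvec_index i k) (mxvec_index j l).

Lemma blkK m n : cancel (@blk m n) (@unblk m n).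
Proof. by move=> X; apply/matrixP=> i j; apply/matrixP=> k l; rewrite !mxE !bidxK. Qed.
Lemma unblkK m n : cancel (@unblk m n) (@blk m n).
Proof. by move=> Y; apply/matrixP=> a b; rewrite !mxE !mxvec_bidx. Qed.

Lemma sum_bidx m (V : nmodType) (F : 'I_(m * d) -> V) :
  \sum_a F a = \sum_i \sum_k F (mxvec_index i k).
Proof.
by rewrite (reindex _ (curry_mxvec_bij m d)) pair_bigA; apply: eq_bigr => -[i k] _.
Qed.

Lemma blkM m n r (X : 'M['M[K]_d]_(m, n)) (Y : 'M['M[K]_d]_(n, r)) :
  blk (X *m Y) = blk X *m blk Y.
Proof.
apply/matrixP => a b; rewrite !mxE summxE sum_bidx; apply: eq_bigr => i _.
by rewrite mxE; apply: eq_bigr => k _; rewrite !mxE !bidxK.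
Qed.
Lemma blkD m n (X Y : 'M['M[K]_d]_(m, n)) : blk (X + Y) = blk X + blk Y.
Proof. by apply/matrixP => a b; rewrite !mxE. Qed.
Lemma blkB m n (X Y : 'M['M[K]_d]_(m, n)) : blk (X - Y) = blk X - blk Y.
Proof. by apply/matrixP => a b; rewrite !mxE. Qed.
Lemma blk1 m : blk (1%:M : 'M['M[K]_d]_m) = 1%:M.
Proof.
apply/matrixP => a b; rewrite -[a]mxvec_bidx -[b]mxvec_bidx.
case: (bidx a) (bidx b) => i k [j l] /=; rewrite !mxE !bidxK /=.
have -> : (mxvec_index i k == mxvec_index j l) = (i == j) && (k == l).
  by rewrite -xpair_eqE -(inj_eq (can_inj (g := fun x => mxvec_index x.1 x.2) (@mxvec_bidx m))) !bidxK.
by case: (i == j); rewrite ?mulr1n ?mulr0n !mxE.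
Qed.

Lemma det_reindex n m (h : 'I_n -> 'I_m) (g : 'I_m -> 'I_n) (M : 'M[K]_m) :
  cancel h g -> cancel g h -> \det (\matrix_(i, j) M (h i) (h j)) = \det M.
Proof.
move=> hK gK; have e : n = m by rewrite -(card_ord n) -(card_ord m); apply: bij_eq_card; exists g.
subst m; pose s := perm (can_inj hK).
have -> : \matrix_(i, j) M (h i) (h j) = row_perm s (col_perm s M).
  by apply/matrixP => i j; rewrite !mxE !permE.
rewrite row_permE col_permE !det_mulmx !det_perm mulrC -mulrA.
by rewrite odd_permV -signr_addb addbb mulr1.
Qed.

(** Flattening the blocks and taking blocks of flattened matrices give different index types,
    related by a bijection applied to rows and columns alike; the determinant does not change. *)
Lemma det_blk_lblock m n (X : 'M['M[K]_d]_m) Z (W : 'M['M[K]_d]_n) :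
  \det (blk (block_mx X 0 Z W)) = \det (blk X) * \det (blk W).
Proof.
rewrite -(det_lblock _ (blk Z)).
pose h (a : 'I_((m + n) * d)) : 'I_(m * d + n * d) := match split (bidx a).1 with
  | inl i => lshift _ (mxvec_index i (bidx a).2) | inr i => rshift _ (mxvec_index i (bidx a).2) end.
pose g (b : 'I_(m * d + n * d)) : 'I_((m + n) * d) := match split b with
  | inl c => mxvec_index (lshift _ (bidx c).1) (bidx c).2
  | inr c => mxvec_index (rshift _ (bidx c).1) (bidx c).2 end.
rewrite -(@det_reindex _ _ h g); first last.
- move=> b; rewrite /g /h; case: (split_ordP b) => c ->; rewrite ?split_lshift ?split_rshift bidxK /=.
    by rewrite split_lshift mxvec_bidx.
  by rewrite split_rshift mxvec_bidx.
- move=> a; rewrite /h /g -[RHS]mxvec_bidx; case: (split_ordP (bidx a).1) => i ->.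
    by rewrite !split_lshift bidxK.
  by rewrite !split_rshift bidxK.
congr (\det _); apply/matrixP => a b; rewrite [LHS]mxE [RHS]mxE /h.
case: (split_ordP (bidx a).1) => i ->; case: (split_ordP (bidx b).1) => j ->;
  rewrite ?split_lshift ?split_rshift ?block_mxEul ?block_mxEur ?block_mxEdl ?block_mxEdr.
- by rewrite mxE !bidxK.
- by rewrite !mxE.
- by rewrite mxE !bidxK.
- by rewrite mxE !bidxK.
Qed.
End BlockMatrices.

(** * Simple components of the rational group ring *)
Section LocalFacts.
Variables (p : nat) (R : nzRingType) (Q : fieldType) (f : {rmorphism R -> Q}).
Variable ar : arith p f.
Hypothesis p_odd : odd p.
Variables (gT : finGroupType) (n : nat).
Hypothesis oG : #|gT| = (p ^ n)%N.
Local Notation B := (gring Q gT).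
Local Notation I := (ar_I (a := ar)).
Local Notation P := (lp ar).
Local Notation inA := (inA (ar := ar)).
Let SA := @inA_subring p R Q f ar gT P.
Let SI := ar_sub (a := ar) P.

Lemma Jpow_exp (j : B) m : JI ar j -> Jpow ar m (j ^+ m).
Proof.
move=> Jj; elim: m => [|m IH]; first exact/Jpow_base/(subring1 SA).
by rewrite exprS; apply: Jpow_mul.
Qed.

(** By Frobenius, [(1 + j) ^ (p ^ N)] is [1 + j ^ (p ^ N)] modulo [p], and [p ^ N] exceeds [N], the
    exponent at which powers of the ideal become divisible by [p]. *)
Lemma unipotent_pow (j : B) : JI ar j -> exists t, cong (inA P) p%:R ((1 + j) ^+ (p ^ t)) 1.
Proof.
move=> Jj; have [Aj _] := Jj; have p_pr := p_prime ar.
have [N HN] := J_nilpotent ar p_odd oG; exists N.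
have [z Az Ez] := HN _ (Jpow_exp N Jj).
have [w Aw E] := frobeniusX SA N p_pr (subring1 SA) Aj (commr_sym (commr1 j)).
exists (z * j ^+ (p ^ N - N) + w).
  by apply: (subringD SA) => //; apply: (subringM SA) => //; apply: (subringX SA).
rewrite E expr1n -addrA mulrDr; congr (_ + (_ + _)).
by rewrite mulrA -Ez -exprD subnKC // ltnW // ltn_expl // prime_gt1.
Qed.

(** Scaled to augmentation 1, the element [u] has a [p]-power congruent to 1 modulo [p], and that
    power is invertible by [one_plus_inv]. *)
Lemma local_unit (u : B) : inA P u -> ~ cong (I P) p%:R (aug u) 0 ->
  exists2 y, inA P y & u * y = 1 /\ y * u = 1.
Proof.
move=> Au nu; have p_pr := p_prime ar.
have Iu : I P (aug u)^-1.
  by apply: ar_unit; [apply: inA_aug|rewrite (ar_lp ar)].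
have u0 : aug u != 0.
  by apply/eqP => u0; apply: nu; rewrite u0; apply: (cong_refl SI).
pose v := sc gT (aug u)^-1 * u.
have Av : inA P v by apply: (subringM SA) => //; apply: inA_sc.
have Jv : JI ar (v - 1).
  split; first by apply: (subringB SA) => //; apply: (subring1 SA).
  rewrite rmorphB rmorph1 /= rmorphM /= aug_sc mulVf // subrr; exact: (cong_refl SI).
have [t Ht] := unipotent_pow Jv; rewrite [1 + _]addrC subrK in Ht.
have [|y Ay [vy yv]] := @one_plus_inv p R Q f ar gT P (v ^+ (p ^ t)); first by rewrite (ar_lp ar).
have pt : (p ^ t)%N = (p ^ t).-1.+1 by rewrite prednK // expn_gt0 prime_gt0.
pose s := sc gT (aug u)^-1; have su : s * u = u * s by exact: sc_comm.
exists (s * v ^+ (p ^ t).-1 * y).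
  by do 2!apply: (subringM SA) => //; [apply: inA_sc|apply: (subringX SA)].
have e1 : u * (s * v ^+ (p ^ t).-1 * y) = 1 by rewrite !mulrA -su -exprS -pt.
split=> //; have e2 : (y * v ^+ (p ^ t).-1 * s) * u = 1.
  by rewrite -!mulrA -exprSr -pt.
rewrite -[X in X * u = 1]mul1r -{1}e2 -[X in X * u = 1]mulrA e1 mulr1; exact: e2.
Qed.

(** Either some entry of [e] is a unit, or all entries lie in the maximal ideal; in the second case
    [e = e ^ k] for all [k] makes the entries divisible by every power of [p], so [e] is 0. *)
Lemma local_unimod m (e : 'M[B]_m) : mxin (inA P) e -> e *m e = e -> e <> 0 ->
  exists (a : 'rV[B]_m) (b : 'cV[B]_m), [/\ mxin (inA P) a, mxin (inA P) b & a *m e *m b = 1%:M].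
Proof.
move=> Ae ee e0.
have [[i [j nu]]|h] := pselect (exists i j, ~ cong (I P) p%:R (aug (e i j)) 0).
  have [y Ay [uy yu]] := local_unit (Ae i j) nu.
  exists 'e_i, (y *: delta_mx j 0); split.
  - by move=> k l; rewrite mxE; apply: (subring_nat SA).
  - by move=> k l; rewrite !mxE; apply: (subringM SA) => //; apply: (subring_nat SA).
  apply/matrixP => k l; rewrite !ord1 -rowE mxE (bigD1 j) //= !mxE !eqxx mulr1 uy.
  rewrite big1 ?addr0 // => x xj; by rewrite !mxE (negPf xj) !mulr0.
case: e0; have Je i j : JI ar (e i j).
  by split=> //; apply: contrapT => nu; apply: h; exists i, j.
have [N HN] := J_nilpotent ar p_odd oG.
have Jp k i j : Jpow ar k (e i j).
  elim: k i j => [|k IH] i j; first exact: Jpow_base.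
  rewrite -ee mxE; elim/big_ind: _ => [||x _]; [exact: Jpow_zero|exact: Jpow_add|exact: Jpow_mul].
have div k i j : exists2 z, inA P z & e i j = p%:R ^+ k * z.
  elim: k i j => [|k IH] i j; first by exists (e i j); rewrite ?mul1r.
  have h1 x : exists z, inA P z /\ e i x = p%:R * z.
    by have [z Az Ez] := HN _ (Jp N i x); exists z.
  have h2 x : exists z, inA P z /\ e x j = p%:R ^+ k * z.
    by have [z Az Ez] := IH x j; exists z.
  have [z1 H1] : exists z : 'I_m -> B, forall x, inA P (z x) /\ e i x = p%:R * z x.
    by exists (fun x => projT1 (cid (h1 x))) => x; case: cid.
  have [z2 H2] : exists z : 'I_m -> B, forall x, inA P (z x) /\ e x j = p%:R ^+ k * z x.
    by exists (fun x => projT1 (cid (h2 x))) => x; case: cid.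
  exists (\sum_x z1 x * z2 x).
    by apply: (subring_sum SA) => x _; apply: (subringM SA); [case: (H1 x)|case: (H2 x)].
  transitivity ((e *m e) i j); first by rewrite ee.
  rewrite mxE mulr_sumr; apply: eq_bigr => x _.
  have [_ ->] := H1 x; have [_ ->] := H2 x.
  rewrite exprS -!mulrA; congr (_ * _); rewrite !mulrA; congr (_ * _).
  by rewrite -natrX; apply/esym/natr_comm.
apply/matrixP => i j; rewrite mxE; apply: (@cong_inA_sep p R Q f ar gT P) => k.
by rewrite (ar_lp ar); apply: div.
Qed.

Lemma local_splits m (e : 'M[B]_m) : mxin (inA P) e -> e *m e = e -> splits (inA P) e.
Proof.
exact: (@idempotent_splits B (inA P) Q (@aug Q gT) SA local_unimod).
Qed.
End LocalFacts.

Section Components.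
Variables (p : nat) (R : nzRingType) (Q : fieldType) (f : {rmorphism R -> Q}).
Variable ar : arith p f.
Hypothesis p_odd : odd p.
Local Notation I := (ar_I (a := ar)).
Local Notation P := (lp ar).
Local Notation inA := (inA (ar := ar)).

(** The centre of a component with its orders: [cD l] is the order localised at [l], [cpi] generates
    the maximal ideal above [p], and [c_frob] says that the residue field there is [F_p]. Places are
    never named; congruences and the Bezout property stand in for valuations. *)
Record cfield := CField {
  cK : fieldType;
  cD : ar_L ar -> cK -> Prop;
  cpi : cK;
  c_sub l : subring_pred (cD l);
  c_bez l : bezout (cD l);
  c_frac l x : exists a b, [/\ cD l a, cD l b, b != 0 & x = a / b];
  c_piD : cD P cpi;
  c_unit x : cong (cD P) cpi x 1 -> cD P x^-1;
  c_neq0 x : cong (cD P) cpi x 1 -> x != 0;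
  c_p : cong (cD P) cpi p%:R 0;
  c_frob x : cD P x -> cong (cD P) cpi (x ^+ p) x
}.

(* A simple component M_d(K) of Q[G], |G| = p^n, embedded by csig; cc is a
   conductor of the maximal order at p. *)
Record scomp (gT : finGroupType) (n : nat) := Comp {
  cF :> cfield;
  cc : cK cF;
  cd : nat;
  cd0 : 'I_cd;
  crho : gring Q gT -> 'M[cK cF]_cd;
  csig : 'M[cK cF]_cd -> gring Q gT;
  c_d : exists k, cd = (p ^ k)%N;
  c_cD : cD P cc;
  c_pow x : cong (@cD cF P) (cpi cF) x 1 -> cong (@cD cF P) (p%:R * cc) (x ^+ (p ^ n)) 1;
  c_pow' x : (0 < n)%N -> cong (@cD cF P) (cpi cF) x 1 ->
    cong (@cD cF P) cc (x ^+ (p ^ n.-1)) 1;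
  c_rhoB a b : crho (a - b) = crho a - crho b;
  c_rhoM a b : crho (a * b) = crho a *m crho b;
  c_rho1 : crho 1 = 1%:M;
  c_sigB X Y : csig (X - Y) = csig X - csig Y;
  c_rs X : crho (csig X) = X;
  c_sr b : csig (crho b) = b * csig 1%:M;
  c_sl b : csig (crho b) = csig 1%:M * b;
  c_rhoin l b : inA l b -> mxin (@cD cF l) (crho b);
  c_sigin l X : l != P -> mxin (@cD cF l) X -> inA l (csig X);
  c_sigp X : mxin (@cD cF P) X -> inA P (csig (cc *: X))
}.

Arguments csig {gT n} _ _.
Arguments crho {gT n} _ _.

Section CompTheory.
Variables (gT : finGroupType) (n : nat) (k : scomp gT n).
Local Notation B := (gring Q gT).

Lemma rho0 : crho k 0 = 0. Proof. by rewrite -(subrr 0) c_rhoB subrr. Qed.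
Lemma rhoN a : crho k (- a) = - crho k a.
Proof. by rewrite -sub0r c_rhoB rho0 sub0r. Qed.
Lemma rhoD a b : crho k (a + b) = crho k a + crho k b.
Proof. by rewrite -{1}[b]opprK c_rhoB rhoN opprK. Qed.
Lemma rho_sum J (r : seq J) (PP : pred J) F :
  crho k (\sum_(i <- r | PP i) F i) = \sum_(i <- r | PP i) crho k (F i).
Proof. by apply: (big_morph _ rhoD rho0). Qed.
Lemma sig0 : csig k 0 = 0. Proof. by rewrite -(subrr 0) c_sigB subrr. Qed.
Lemma sigN a : csig k (- a) = - csig k a.
Proof. by rewrite -sub0r c_sigB sig0 sub0r. Qed.
Lemma sigD a b : csig k (a + b) = csig k a + csig k b.
Proof. by rewrite -{1}[b]opprK c_sigB sigN opprK. Qed.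

Definition ce : B := csig k 1%:M.
Lemma rho_ce : crho k ce = 1%:M. Proof. exact: c_rs. Qed.
Lemma ce_idem : ce * ce = ce. Proof. by rewrite -c_sr rho_ce. Qed.
Lemma sig_cer X : csig k X * ce = csig k X. Proof. by rewrite -c_sr c_rs. Qed.
Lemma sig_cel X : ce * csig k X = csig k X. Proof. by rewrite -c_sl c_rs. Qed.
Lemma comm_scalar (X : 'M[cK k]_(cd k)) : (forall Y, X *m Y = Y *m X) ->
  exists a, X = a%:M.
Proof.
move=> XC; exists (X (cd0 k) (cd0 k)).
have E i j a b : X a i * (b == j)%:R = (a == i)%:R * X j b.
  have /matrixP/(_ a b) := XC (delta_mx i j); rewrite mul_delta_mx_scale => <-.
  rewrite mxE (bigD1 i) //= !mxE eqxx big1 ?addr0 // => x xi.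
  by rewrite !mxE (negPf xi) mulr0.
apply/matrixP => a i; rewrite mxE; have := E i (cd0 k) a (cd0 k).
by rewrite eqxx mulr1 => ->; case: eqP; rewrite ?mul1r ?mul0r.
Qed.

Lemma central_scalar z : (forall b, z * b = b * z) -> exists a, crho k z = a%:M.
Proof.
move=> zC; apply: comm_scalar => Y; rewrite -[Y]c_rs -!c_rhoM zC //.
Qed.

Lemma central_idem z : (forall b, z * b = b * z) -> z * z = z ->
  crho k z = 0 \/ crho k z = 1%:M.
Proof.
move=> zC zz; have [a Ea] := central_scalar zC.
have /matrixP/(_ (cd0 k) (cd0 k)) := congr1 (crho k) zz.
rewrite c_rhoM Ea -scalar_mxM !mxE eqxx !mulr1n => /eqP.
rewrite -subr_eq0 -{3}[a]mulr1 -mulrBr mulf_eq0 subr_eq0 => /orP[]/eqP ->.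
  by left; rewrite -scalemx1 scale0r.
by right.
Qed.
End CompTheory.

Definition covers (gT : finGroupType) n (e : gring Q gT) := exists (J : finType)
  (k : J -> scomp gT n), (forall i j, i != j -> ce (k i) * ce (k j) = 0) /\ \sum_i ce (k i) = e.

Section Covers.
Variables (gT : finGroupType) (n : nat).
Local Notation B := (gring Q gT).
Implicit Types e : B.

Lemma cover_mul (J : finType) (k : J -> scomp gT n) e :
  (forall i j, i != j -> ce (k i) * ce (k j) = 0) -> \sum_i ce (k i) = e ->
  forall i, ce (k i) * e = ce (k i) /\ e * ce (k i) = ce (k i).
Proof.
move=> orth <- i; rewrite mulr_sumr mulr_suml.
by split; rewrite (bigD1 i) //= ce_idem big1 ?addr0 // => j ji; rewrite orth // eq_sym.
Qed.

Lemma covers_add e e' : e * e' = 0 -> e' * e = 0 ->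
  covers n e -> covers n e' -> covers n (e + e').
Proof.
move=> h h' [J [k [o s]]] [J' [k' [o' s']]].
exists (J + J')%type, (fun i => match i with inl j => k j | inr j => k' j end); split.
  move=> [i|i] [j|j] ij.
  - by apply: o; apply: contraNneq ij => ->.
  - have [<- _] := cover_mul o s i; have [_ <-] := cover_mul o' s' j.
    by rewrite -mulrA (mulrA e) h mul0r mulr0.
  - have [<- _] := cover_mul o' s' i; have [_ <-] := cover_mul o s j.
    by rewrite -mulrA (mulrA e') h' mul0r mulr0.
  - by apply: o'; apply: contraNneq ij => ->.
by rewrite big_sumType /= s s'.
Qed.

Lemma covers0 : covers n (0 : B).
Proof. by exists void, (@of_void _); split=> [[]|]; rewrite big1 // => -[]. Qed.

Lemma covers_sum m (e : 'I_m -> B) : (forall i j, i != j -> e i * e j = 0) ->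
  (forall i, covers n (e i)) -> covers n (\sum_i e i).
Proof.
elim: m e => [|m IH] e orth ce; first by rewrite big_ord0; apply: covers0.
rewrite big_ord_recl; apply: covers_add => //.
- by rewrite mulr_sumr big1 // => i _; apply: orth.
- by rewrite mulr_suml big1 // => i _; apply: orth.
- by apply: IH => // i j ij; apply: orth; rewrite (inj_eq (@lift_inj _ _)).
Qed.

(** A central idempotent acts as 0 or 1 on each component; keeping the components where [z] acts as
    0 decomposes [1 - z]. *)
Lemma covers_filter (z : B) : (forall b, z * b = b * z) -> z * z = z ->
  covers n (1 : B) -> covers n (1 - z).
Proof.
move=> zC zz [J [k [o s]]].
exists {i : J | crho (k i) z == 0}, (fun i => k (val i)); split.
  by move=> i j ij; apply: o; rewrite (inj_eq val_inj).
transitivity ((\sum_i ce (k i)) * (1 - z)); last by rewrite s mul1r.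
rewrite mulr_suml [RHS](bigID (fun i => crho (k i) z == 0)) /=.
rewrite [X in _ + X]big1 ?addr0 => [|i nz]; last first.
  rewrite mulrBr mulr1 -c_sl; have [z0|->] := central_idem (k i) zC zz.
    by rewrite z0 eqxx in nz.
  by rewrite subrr.
rewrite [RHS](eq_bigr (fun i => ce (k i))) => [|i /eqP z0]; last first.
  by rewrite mulrBr mulr1 -c_sl z0 sig0 subr0.
by rewrite [RHS](reindex_omap (fun i : {i : J | crho (k i) z == 0} => val i) insub) => [|i Pi]; [apply: eq_bigl => i; rewrite /= valK (valP i) eqxx|rewrite insubT].
Qed.
End Covers.

(** Sharper than [frobenius_comm]: the mixed terms keep a factor [t] besides [p], so a conductor
    dividing [t] is multiplied by [p] instead of being lost. *)
Lemma one_plus_pow (K : comPzRingType) (C : K -> Prop) t : subring_pred C -> C t ->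
  exists2 w, C w & (1 + t) ^+ p = 1 + t ^+ p + p%:R * t * w.
Proof.
move=> SC Ct; have p_pr := p_prime ar; have p_gt0 := prime_gt0 p_pr.
exists (\sum_(1 <= i < p) t ^+ i.-1 *+ ('C(p, i) %/ p)).
  apply: subring_sum => // i _; rewrite -mulr_natr; apply: subringM => //; first exact: subringX.
  exact: subring_nat.
rewrite exprDn -(big_mkord xpredT (fun i => (1 ^+ (p - i) * t ^+ i) *+ 'C(p, i))).
rewrite big_nat_recr //= (big_ltn p_gt0) subn0 subnn bin0 binn !mulr1n !expr1n expr0 !mulr1 mul1r.
rewrite -!addrA; congr (_ + _); rewrite addrC; congr (_ + _).
rewrite mulr_sumr; apply: eq_big_nat => i /andP[i_gt0 ltip].
have /divnK {1}<- : (p %| 'C(p, i))%N by apply: prime_dvd_bin; rewrite ?i_gt0.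
rewrite expr1n mul1r -{1}(prednK i_gt0) exprS -mulr_natr natrM -[in RHS]mulr_natr; ring.
Qed.

Section Induce.
Variables (gT : finGroupType) (D : {group gT}) (n n' j m : nat) (tau : 'I_m -> gT).
Hypothesis oD : #|D| = p.
Hypothesis ltn'n : (n' < n)%N.
Hypothesis mE : m = (p ^ j)%N.
Hypothesis tauP : forall g, exists a, forall a', ((tau a' * g)%g \in ('N(D))%g) = (a' == a).
Variable k : scomp (coset_of D) n'.
Hypothesis orth : forall g, g \notin ('N(D))%g ->
  infl (ce k) * gel Q g * infl (ce k) = 0.

Let char0 := ar_char0 ar.
Local Notation B := (gring Q gT).
Local Notation t a := (gel Q (tau a)).
Local Notation t' a := (gel Q (tau a)^-1%g).
Let K := cK k.
Let d := cd k.

Lemma tau_mem a b : ((tau a * (tau b)^-1)%g \in ('N(D))%g) = (a == b).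
Proof.
have [c Hc] := tauP (tau b)^-1%g; have := Hc b; rewrite mulgV group1 => /esym/eqP bc.
by rewrite Hc bc.
Qed.

(** The representation induced from the normaliser of [D], in block form along the transversal;
    [isig] below is its section. *)
Definition irho (x : B) : 'M[K]_(m * d) :=
  blk (\matrix_(a, b) crho k (pr D (t a * x * t' b))).
Definition isig (X : 'M[K]_(m * d)) : B :=
  \sum_a \sum_b t' a * infl (csig k (unblk X a b)) * t b.

Lemma rho_pr z : crho k (pr D z) = crho k (pr D (infl (ce k) * z * infl (ce k))).
Proof. by rewrite pr_inflr // pr_infll // !c_rhoM rho_ce mul1mx mulmx1. Qed.

Lemma isig1 : isig 1%:M = \sum_a t' a * infl (ce k) * t a.
Proof.
rewrite /isig; apply: eq_bigr => a _; rewrite -(blk1 K d m) blkK (bigD1 a) //= mxE eqxx mulr1n.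
rewrite big1 ?addr0 // => b ba; rewrite mxE eq_sym (negPf ba) mulr0n.
by rewrite (_ : (0 : 'M[K]_d) = 0) // sig0 raddf0 mulr0 mul0r.
Qed.

Lemma irhoM x y : irho (x * y) = irho x *m irho y.
Proof.
rewrite /irho -blkM; congr blk; apply/matrixP => a b; rewrite !mxE.
rewrite (eq_bigr (fun c => crho k (pr D (t a * x * t' c) * pr D (t c * y * t' b)))).
  rewrite -rho_sum; congr (crho k _).
  have := @transversal_pr Q gT D char0 m tau tauP (t a * x) (y * t' b).
  rewrite !mulrA => <-; by apply: eq_bigr => c _; rewrite !mulrA.
by move=> c _; rewrite !mxE c_rhoM.
Qed.

(** By [orth], the conjugates of [ce k] by distinct transversal elements are orthogonal, so all
    blocks but the intended one vanish and the induced algebra is a full matrix algebra. *)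
Lemma irho_isig X : irho (isig X) = X.
Proof.
rewrite -[RHS]unblkK /irho; congr blk; apply/matrixP => a b; rewrite [LHS]mxE.
rewrite /isig mulr_sumr mulr_suml pr_sum rho_sum (bigD1 a) //=.
rewrite [X in _ + X]big1 ?addr0 => [|c ca].
  rewrite mulr_sumr mulr_suml pr_sum rho_sum (bigD1 b) //= [X in _ + X]big1 ?addr0 => [|e eb].
    rewrite !mulrA -gelM mulgV gel1 mul1r -mulrA -gelM mulgV gel1 mulr1 prK //.
    exact: c_rs.
  rewrite !mulrA -gelM mulgV gel1 mul1r -mulrA -gelM rho_pr -[csig k _]sig_cer inflM //.
  rewrite -!mulrA (mulrA (infl (ce k)) (gel Q _)) orth ?mulr0 ?raddf0 ?rho0 //.
  by rewrite tau_mem.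
rewrite mulr_sumr mulr_suml pr_sum rho_sum big1 // => e _.
rewrite !mulrA -gelM -(mulrA _ (t e)) -gelM rho_pr -[csig k _]sig_cel inflM //.
rewrite !mulrA orth ?mul0r ?raddf0 ?rho0 //.
by rewrite tau_mem eq_sym.
Qed.

Lemma isig_irho_r x : isig (irho x) = x * isig 1%:M.
Proof.
rewrite isig1 /isig /irho blkK exchange_big mulr_sumr; apply: eq_bigr => b _.
have := @transversal_suml Q gT D m tau tauP (x * t' b) (ce k).
rewrite mulrA mulrA => <-; rewrite mulr_suml; apply: eq_bigr => a _.
by rewrite mxE c_sr mulrA.
Qed.

Lemma isig_irho_l x : isig (irho x) = isig 1%:M * x.
Proof.
rewrite isig1 /isig /irho blkK mulr_suml; apply: eq_bigr => a _.
have := @transversal_sumr Q gT D m tau tauP (t a * x) (ce k).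
rewrite -!mulrA => <-; rewrite mulr_sumr; apply: eq_bigr => b _.
by rewrite mxE c_sl !mulrA.
Qed.

(** [infl] divides by [|D| = p], so the conductor becomes [p * cc]. The congruence of [c_pow] at
    level [n'] already gives the new [c_pow'], because [n' < n]; one further [p]-th power gives the
    new [c_pow]. *)
Lemma induced_comp : exists k' : scomp gT n, ce k' = \sum_a t' a * infl (ce k) * t a.
Proof.
have p_pr := p_prime ar; have [jj dE] := c_d k.
have SP := c_sub k P; have cDk := c_cD k; have Cp := subring_nat SP p.
have Cpc : cD P (p%:R * cc k) by apply: (subringM SP).
have CC x y : GRing.comm (x : K) y by exact: mulrC.
have m0 : (0 < m)%N by rewrite mE expn_gt0 prime_gt0.
have pw' x : (0 < n)%N -> cong (@cD k P) (cpi k) x 1 -> cong (@cD k P) (p%:R * cc k) (x ^+ (p ^ n.-1)) 1.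
  move=> n0 /(c_pow) h; have -> : (p ^ n.-1 = p ^ n' * p ^ (n.-1 - n'))%N.
    by rewrite -expnD subnKC // -ltnS prednK.
  have := congX SP Cpc (CC _) (p ^ (n.-1 - n')) (subring1 SP) h.
  by rewrite expr1n -exprM.
have n0 : (0 < n)%N by apply: leq_ltn_trans ltn'n.
have pw x : cong (@cD k P) (cpi k) x 1 -> cong (@cD k P) (p%:R * (p%:R * cc k)) (x ^+ (p ^ n)) 1.
  move=> h; have [z Dz E] := pw' x n0 h; rewrite -(prednK n0) expnSr exprM E.
  have [|w Dw ->] := @one_plus_pow _ _ (p%:R * cc k * z) SP; first exact: (subringM SP).
  exists (p%:R ^+ p.-2 * cc k ^+ p.-1 * z ^+ p + z * w).
    apply: (subringD SP); last exact: (subringM SP).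
    by repeat first [assumption | apply: (subringM SP) | apply: (subringX SP)].
  rewrite -addrA; congr (_ + _); rewrite !exprMn.
  have p2 : p = p.-2.+2 by case: (p) p_pr => [|[]].
  have -> : p%:R ^+ p = p%:R * (p%:R * p%:R ^+ p.-2) :> K by rewrite -!exprS -p2.
  have -> : cc k ^+ p = cc k * cc k ^+ p.-1 by rewrite -exprS prednK // prime_gt0.
  by ring.
have iD : exists kk, (m * d)%N = (p ^ kk)%N by exists (j + jj)%N; rewrite mE expnD -dE.
have irhoB a b : irho (a - b) = irho a - irho b.
  rewrite /irho -blkB; congr blk; apply/matrixP => x y; rewrite !mxE.
  by rewrite mulrBr mulrBl raddfB c_rhoB.
have irho1 : irho 1 = 1%:M.
  rewrite /irho -(blk1 K d m); congr blk; apply/matrixP => a b; rewrite !mxE mulr1 -gelM.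
  have := tau_mem a b; case: eqP => [->|_] h.
    by rewrite mulgV gel1 -(gel1 Q gT) pr_gel ?group1 // morph1 gel1 c_rho1.
  rewrite pr_off ?rho0 // => g gN; rewrite gelE; case: eqP => // E.
  by rewrite -E gN in h.
have isigB X Y : isig (X - Y) = isig X - isig Y.
  rewrite /isig -sumrB; apply: eq_bigr => a _; rewrite -sumrB; apply: eq_bigr => b _.
  have -> : unblk (X - Y) a b = unblk X a b - unblk Y a b.
    by apply/matrixP => x y; rewrite !mxE.
  by rewrite c_sigB raddfB mulrBr mulrBl.
have irhoin l b : inA l b -> mxin (@cD k l) (irho b).
  move=> Ab x y; rewrite !mxE; apply: c_rhoin; apply: pr_in.
  have SA := @inA_subring p R Q f ar gT l.
  by apply: (subringM SA); [apply: (subringM SA) => //|]; apply: inA_gel.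
have inN l z : I l #|D|%:R^-1 -> inA l z -> inA l (infl (D := D) z).
  move=> h Az g; rewrite ffunE; have S := ar_sub (a := ar) l.
  by case: ifP => _; [apply: (subringM S)|apply: (subring0 S)].
have isigin l X : l != P -> mxin (@cD k l) X -> inA l (isig X).
  move=> lP DX; have SA := @inA_subring p R Q f ar gT l.
  apply: (subring_sum SA) => a _; apply: (subring_sum SA) => b _.
  apply: (subringM SA); [apply: (subringM SA); [exact: inA_gel|]|exact: inA_gel].
  apply: inN; first by rewrite oD; apply: ar_pV.
  by apply: c_sigin => // x y; rewrite !mxE.
have isigp X : mxin (@cD k P) X -> inA P (isig ((p%:R * cc k) *: X)).
  move=> DX; have SA := @inA_subring p R Q f ar gT P.
  apply: (subring_sum SA) => a _; apply: (subring_sum SA) => b _.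
  apply: (subringM SA); [apply: (subringM SA); [exact: inA_gel|]|exact: inA_gel].
  have -> : unblk ((p%:R * cc k) *: X) a b = cc k *: (p%:R *: unblk X a b).
    by apply/matrixP => x y; rewrite !mxE mulrA (mulrC (cc k)).
  have -> : cc k *: (p%:R *: unblk X a b) = (cc k *: unblk X a b) *+ p.
    by rewrite scalerA mulrC -scalerA scaler_nat.
  have -> : csig k ((cc k *: unblk X a b) *+ p) = p%:R * csig k (cc k *: unblk X a b).
    by rewrite mulr_natl; elim: (p) => [|i IH]; rewrite ?mulr0n ?sig0 // !mulrS sigD IH.
  rewrite (natB_scE Q) infl_sc => g; rewrite sc_mulE ffunE.
  case: ifP => _; last by rewrite mulr0; apply: (subring0 (ar_sub P)).
  rewrite oD mulrA mulfV ?(p_neq0 ar) // mul1r.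
  by apply: c_sigp => x y; rewrite !mxE.
exists (@Comp gT n (cF k) (p%:R * cc k) (m * d) (mxvec_index (Ordinal m0) (cd0 k)) irho isig
  iD Cpc pw (fun x h => pw' x h) irhoB irhoM irho1 isigB irho_isig isig_irho_r isig_irho_l irhoin isigin isigp).
exact: isig1.
Qed.
End Induce.

(** Orthogonality of the conjugates of [z] passes to the components of [z], each of which is induced
    separately. *)
Lemma covers_ind (gT : finGroupType) (D : {group gT}) n n' j m (tau : 'I_m -> gT)
    (z : gring Q (coset_of D)) :
  #|D| = p -> (n' < n)%N -> m = (p ^ j)%N ->
  (forall g, exists a, forall a', ((tau a' * g)%g \in ('N(D))%g) = (a' == a)) ->
  (forall g, g \notin ('N(D))%g -> infl z * gel Q g * infl z = 0) ->
  covers n' z -> covers n (\sum_a gel Q (tau a)^-1%g * infl z * gel Q (tau a)).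
Proof.
move=> oD ltn mE tauP orth [J [k [o s]]]; have char0 := ar_char0 ar.
have zl i : infl (ce (k i)) = infl (ce (k i)) * infl z.
  by rewrite -inflM //; have [-> _] := cover_mul o s i.
have zr i : infl (ce (k i)) = infl z * infl (ce (k i)).
  by rewrite -inflM //; have [_ ->] := cover_mul o s i.
have oij i i' g : g \notin ('N(D))%g -> infl (ce (k i)) * gel Q g * infl (ce (k i')) = 0.
  move=> gN; rewrite zl (zr i') -!mulrA (mulrA (infl z) (gel Q g)) (mulrA (infl z * gel Q g)).
  by rewrite orth // mul0r mulr0.
have ex i := induced_comp oD ltn mE tauP (oij i i).
exists J, (fun i => projT1 (cid (ex i))); split=> [i i' ii'|].
  case: cid => k1 /= ->; case: cid => k2 /= ->.
  rewrite mulr_suml big1 // => a _; rewrite mulr_sumr big1 // => b _.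
  rewrite -!mulrA (mulrA (gel Q (tau a))) -gelM.
  have := tau_mem tauP a b; case: (a =P b) => [->|_] h.
    rewrite mulgV gel1 mul1r (mulrA (infl _)) -inflM // o // raddf0 mul0r mulr0 //.
  by rewrite (mulrA (infl _)) (mulrA (infl _ * _)) oij ?h // mul0r mulr0.
rewrite (eq_bigr (fun i => \sum_a gel Q (tau a)^-1%g * infl (ce (k i)) * gel Q (tau a))).
  rewrite exchange_big; apply: eq_bigr => a _; rewrite -s infl_sum mulr_sumr mulr_suml.
  by [].
by move=> i _; case: cid.
Qed.
End Components.

(** * The field cut out by an idempotent of a commutative ring *)

Record corner_hyp (S : nzRingType) (e : S) : Prop := CornerHyp {
  ch_comm : forall x y : S, x * y = y * x;
  ch_idem : e * e = e;
  ch_neq0 : e != 0;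
  ch_inv : forall x, e * x = x -> x != 0 -> exists2 y, e * y = y & y * x = e
}.

Section CornerField.
Variables (S : nzRingType) (e : S) (H : corner_hyp e).

Definition cpred : {pred S} := fun x => e * x == x.
Fact cpred_closed : zmod_closed cpred.
Proof.
split=> [|x y]; rewrite !unfold_in ?mulr0 // => /eqP ex /eqP ey.
by rewrite mulrBr ex ey.
Qed.
HB.instance Definition _ := GRing.isZmodClosed.Build S cpred cpred_closed.

Definition corner (h : corner_hyp e) : Type := {x : S | cpred x}.
Local Notation C := (corner H).
HB.instance Definition _ := SubChoice.on C.
HB.instance Definition _ := [SubChoice_isSubZmodule of C by <:].

Fact cproj_sub b : cpred (e * b).
Proof. by rewrite /cpred mulrA (ch_idem H). Qed.
Definition cproj b : C := exist _ (e * b) (cproj_sub b).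
Definition cval (x : C) : S := val x.
Lemma cvalP x : e * cval x = cval x. Proof. exact/eqP/(valP x). Qed.
Lemma cprojE b : cval (cproj b) = e * b. Proof. by []. Qed.
Lemma cval_inj : injective cval. Proof. exact: val_inj. Qed.

Definition cmul (x y : C) := cproj (cval x * cval y).
Definition cone := cproj 1.
Lemma cmulE x y : cval (cmul x y) = cval x * cval y.
Proof. by rewrite cprojE mulrA cvalP. Qed.
Lemma coneE : cval cone = e. Proof. by rewrite cprojE mulr1. Qed.
Lemma cvalD x y : cval (x + y) = cval x + cval y. Proof. by []. Qed.

Fact cmulA : associative cmul.
Proof. by move=> x y z; apply: cval_inj; rewrite !cmulE mulrA. Qed.
Fact cmulC : commutative cmul.
Proof. by move=> x y; apply: cval_inj; rewrite !cmulE (ch_comm H). Qed.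
Fact cmul1 : left_id cone cmul.
Proof. by move=> x; apply: cval_inj; rewrite cmulE coneE cvalP. Qed.
Fact cmulDl : left_distributive cmul +%R.
Proof. by move=> x y z; apply: cval_inj; rewrite !(cmulE, cvalD) mulrDl. Qed.
Fact cone_neq0 : cone != 0.
Proof.
apply/eqP => /(congr1 cval); rewrite coneE => e0.
by have := ch_neq0 H; rewrite e0 eqxx.
Qed.
HB.instance Definition _ := GRing.Zmodule_isComNzRing.Build C cmulA cmulC cmul1 cmulDl cone_neq0.

Fact cinv_ex (x : C) : x != 0 -> exists y : C, y * x = 1.
Proof.
move=> x0; have [|y ey yx] := ch_inv H (cvalP x).
  by apply: contra x0 => /eqP x0; apply/eqP/cval_inj.
exists (cproj y); apply: cval_inj; rewrite [LHS]cmulE cprojE ey yx; exact/esym/coneE.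
Qed.
Definition cinv (x : C) : C :=
  if pselect (x != 0) is left h then projT1 (cid (cinv_ex h)) else 0.
Fact cmulV x : x != 0 -> cinv x * x = 1.
Proof. by move=> x0; rewrite /cinv; case: pselect => // h; case: cid. Qed.
Fact cinv0 : cinv 0 = 0.
Proof. by rewrite /cinv; case: pselect => // h; exfalso; move/eqP: h. Qed.
HB.instance Definition _ := GRing.ComNzRing_isField.Build C cmulV cinv0.
End CornerField.

(** Presents the corner as an abstract field with a projection [r] and an embedding [v], so that its
    construction as a subtype stays hidden. *)
Lemma corner_field (S : nzRingType) (e : S) : corner_hyp e ->
  exists (K : fieldType) (v : K -> S) (r : {rmorphism S -> K}),
  [/\ forall b, v (r b) = e * b, forall x, r (v x) = x, forall x y, v (x - y) = v x - v y
    & forall x y, v (x * y) = v x * v y].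
Proof.
move=> H.
have rz : zmod_morphism (cproj H).
  by move=> x y; apply: cval_inj; rewrite [RHS]/(_ - _ : S) cprojE mulrBr.
have rm : monoid_morphism (cproj H).
  split=> [//|x y]; apply: cval_inj; rewrite [RHS]cmulE !cprojE !mulrA; congr (_ * _).
  by rewrite -[RHS]mulrA [x * e](ch_comm H) mulrA (ch_idem H).
pose r : {rmorphism S -> corner H} := HB.pack (cproj H)
  (GRing.isZmodMorphism.Build _ _ (cproj H) rz) (GRing.isMonoidMorphism.Build _ _ (cproj H) rm).
exists (corner H : fieldType), (@cval S e H), r; split=> // [x|x y].
  by apply: cval_inj; rewrite [LHS]cprojE cvalP.
exact: cmulE.
Qed.

(** * The trivial group, and idempotents averaging over a subgroup of order [p] *)

Section BaseComponents.
Variables (p : nat) (R : nzRingType) (Q : fieldType) (f : {rmorphism R -> Q}).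
Variable ar : arith p f.
Hypothesis p_odd : odd p.
Local Notation I := (ar_I (a := ar)).
Local Notation P := (lp ar).
Local Notation inA := (inA (ar := ar)).
Let p_pr := p_prime ar.

Lemma lam_frac l (x : Q) : exists a b, [/\ I l a, I l b, b != 0 & x = a / b].
Proof.
have [m h] := ar_den (a := ar) l x; exists ((lam l)%:R ^+ m * x), ((lam l)%:R ^+ m).
have z0 : (lam l)%:R ^+ m != 0 :> Q by rewrite expf_neq0 // lam_neq0.
by split=> //; [rewrite -natrX; apply: (subring_nat (ar_sub l))|rewrite mulrC mulKf].
Qed.

Lemma ar_bezout l : bezout (I l).
Proof.
apply: (@criterion_bezout Q (I l) (ar_sub l) (lam l)%:R (lam l)).
- exact: lam_neq0.
- exact: (subring_nat (ar_sub l)).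
- exact/prime_gt1/ar_prime.
- exact: ar_not1.
- exact: ar_ninv.
- exact: ar_fermat.
move=> x Ix x0; have [m h] := ar_den (a := ar) l x^-1.
by exists m, ((lam l)%:R ^+ m * x^-1); rewrite mulrCA divff // mulr1.
Qed.

Fact base_unit x : cong (I P) p%:R x 1 -> I P x^-1.
Proof. by move=> h; apply: ar_not1; rewrite (ar_lp ar). Qed.
Fact base_neq0 x : cong (I P) p%:R x 1 -> x != 0.
Proof.
move=> h; apply: (cong1_neq0 (ar_sub P) (lam_neq0 P) (@ar_ninv _ _ _ _ ar P)).
by rewrite (ar_lp ar).
Qed.
Fact base_p : cong (I P) p%:R p%:R 0.
Proof. by exists 1; [apply: (subring1 (ar_sub P))|rewrite add0r mulr1]. Qed.
Fact base_frob x : I P x -> cong (I P) p%:R (x ^+ p) x.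
Proof. by move=> h; have := ar_fermat h; rewrite (ar_lp ar). Qed.

Definition base_cfield : cfield ar :=
  @CField p R Q f ar Q (fun l => I l) p%:R (fun l => ar_sub l) ar_bezout lam_frac
    (subring_nat (ar_sub P) p) base_unit base_neq0 base_p base_frob.

Lemma trivial_comp (gT : finGroupType) : #|gT| = 1%N ->
  exists k : scomp ar gT 0, ce k = 1.
Proof.
move=> oG; have SP := ar_sub (a := ar) P.
have g1 (g : gT) : g = 1%g.
  have /card1_trivg E1 : #|[set: gT]%G| = 1%N by rewrite cardsT oG.
  by have := in_setT g; rewrite -[setT]/(gval [set: gT]%G) E1 => /set1gP.
have scaug (b : gring Q gT) : sc gT (aug b) = b.
  apply/ffunP => g; rewrite ffunE (g1 g) eqxx mulr1 /aug (bigD1 1%g) //= big1 ?addr0 // => h.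
  by rewrite (g1 h) eqxx.
pose rho (b : gring Q gT) : 'M[cK base_cfield]_1 := (aug b : cK base_cfield)%:M.
pose sig (X : 'M[cK base_cfield]_1) : gring Q gT := sc gT (X 0 0).
have sig1 : sig 1%:M = 1 by rewrite /sig mxE eqxx rmorph1.
have h1 : exists k, 1%N = (p ^ k)%N by exists 0%N.
have h2 : @cD _ _ _ _ _ base_cfield P (1 : Q) by exact: (subring1 SP).
have h3 x : cong (@cD _ _ _ _ _ base_cfield P) (cpi base_cfield) x 1 ->
    cong (@cD _ _ _ _ _ base_cfield P) (p%:R * 1) (x ^+ (p ^ 0)) 1.
  by rewrite mulr1 expn0 expr1.
have h4 (x : cK base_cfield) : (0 < 0)%N -> cong (@cD _ _ _ _ _ base_cfield P) (cpi base_cfield) x 1 ->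
    cong (@cD _ _ _ _ _ base_cfield P) (1 : Q) (x ^+ (p ^ 0.-1)) 1 by [].
have h5 a b : rho (a - b) = rho a - rho b by rewrite /rho !rmorphB.
have h6 a b : rho (a * b) = rho a *m rho b by rewrite /rho rmorphM /= scalar_mxM.
have h7 : rho 1 = 1%:M by rewrite /rho rmorph1.
have h8 X Y : sig (X - Y) = sig X - sig Y by rewrite /sig !mxE rmorphB.
have h9 X : rho (sig X) = X by rewrite /rho /sig aug_sc -mx11_scalar.
have h10 b : sig (rho b) = b * sig 1%:M by rewrite sig1 mulr1 /sig /rho mxE eqxx mulr1n scaug.
have h11 b : sig (rho b) = sig 1%:M * b by rewrite sig1 mul1r /sig /rho mxE eqxx mulr1n scaug.
have h12 l b : inA l b -> mxin (@cD _ _ _ _ _ base_cfield l) (rho b).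
  by move=> Ab i j; rewrite !mxE !ord1 eqxx mulr1n; apply: inA_aug.
have h13 l X : l != P -> mxin (@cD _ _ _ _ _ base_cfield l) X -> inA l (sig X).
  by move=> _ h; apply: inA_sc; apply: h.
have h14 X : mxin (@cD _ _ _ _ _ base_cfield P) X -> inA P (sig ((1 : Q) *: X)).
  by move=> h; rewrite scale1r; apply: inA_sc; apply: h.
by exists (@Comp p R Q f ar gT 0 base_cfield 1 1 0 rho sig h1 h2 h3 h4 h5 h6 h7 h8 h9 h10 h11 h12 h13 h14).
Qed.

(* The idempotent attached to the trivial character of <x>, for x^p = 1. *)
Definition avg (gT : finGroupType) (x : gT) : gring Q gT :=
  sc gT p%:R^-1 * \sum_(i < p) gel Q x ^+ i.

Section Ez.
Variables (gT : finGroupType) (x : gT).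
Hypothesis xp : (x ^+ p = 1)%g.
Local Notation B := (gring Q gT).

Lemma gel_ez : gel Q x * avg x = avg x.
Proof.
rewrite /avg mulrA -sc_comm -mulrA; congr (_ * _); rewrite mulr_sumr.
under eq_bigr => i _ do rewrite -exprS.
rewrite -(big_mkord xpredT (fun i => gel Q x ^+ i.+1)) -(big_mkord xpredT (fun i => gel Q x ^+ i)).
have p0 := prime_gt0 p_pr; rewrite -{1 2}(prednK p0) big_nat_recr //= big_nat_recl //=.
by rewrite addrC; congr (_ + _); rewrite prednK // -gelX xp gel1.
Qed.
Lemma gelX_ez i : gel Q x ^+ i * avg x = avg x.
Proof. by elim: i => [|i IH]; rewrite ?mul1r // exprSr -mulrA gel_ez. Qed.
Lemma ez_comm b : (forall g, commute x g) -> avg x * b = b * avg x.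
Proof.
move=> xC; rewrite /avg -mulrA sc_comm [RHS]mulrA -(sc_comm _ b) -[RHS]mulrA -sc_comm.
congr (_ * _); rewrite mulr_suml mulr_sumr; apply: eq_bigr => i _.
rewrite (gring_dec b) mulr_sumr mulr_suml; apply: eq_bigr => g _.
rewrite mulrA -sc_comm -!mulrA -gelX -!gelM; congr (_ * gel Q _).
exact: (commute_sym (commuteX i (commute_sym (xC g)))).
Qed.
Lemma sum_gel_ez : \sum_(i < p) gel Q x ^+ i = p%:R * avg x.
Proof. by rewrite (natB_scE Q) /avg mulrA -rmorphM /= mulfV ?(p_neq0 ar) // rmorph1 mul1r. Qed.
Lemma ez_mul b : gel Q x * b = b -> avg x * b = b.
Proof.
move=> xb; rewrite /avg -mulrA mulr_suml (eq_bigr (fun=> b)) => [|i _]; last first.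
  by elim: (nat_of_ord i) => [|j IH]; rewrite ?mul1r // exprSr -mulrA xb.
rewrite sumr_const card_ord -[b *+ _]mulr_natl mulrA (natB_scE Q) -rmorphM /= mulVf ?(p_neq0 ar) //.
by rewrite rmorph1 mul1r.
Qed.
Lemma ez_idem : avg x * avg x = avg x.
Proof. exact/ez_mul/gel_ez. Qed.
Lemma ez_eD : #[x]%g = p -> avg x = eD Q <[x]>%G.
Proof.
move=> ox; have char0 := ar_char0 ar.
have e1 : avg x * eD Q <[x]>%G = eD Q <[x]>%G.
  by apply: ez_mul; apply: gel_infl; apply: cycle_id.
have e2 : eD Q <[x]>%G * avg x = avg x.
  rewrite eDE -mulrA mulr_suml (eq_bigr (fun=> avg x)) => [|d /cycleP[i ->]]; last first.
    by rewrite gelX gelX_ez.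
  rewrite sumr_const -[avg x *+ _]mulr_natl mulrA (natB_scE Q) -rmorphM /= -orderE ox.
  by rewrite mulVf ?(p_neq0 ar) // rmorph1 mul1r.
rewrite -e2 -{2}e1; apply/esym; rewrite /avg -mulrA [RHS]mulrA -sc_comm -mulrA; congr (_ * _).
rewrite mulr_suml mulr_sumr; apply: eq_bigr => i _.
by rewrite -gelX gel_infl ?infl_gel ?mem_cycle.
Qed.
Lemma ez_in l : l != P -> inA l (avg x).
Proof.
move=> lP; have SA := @inA_subring p R Q f ar gT l.
apply: (subringM SA); first exact/inA_sc/ar_pV.
by apply: (subring_sum SA) => i _; apply: (subringX SA); apply: inA_gel.
Qed.
End Ez.
End BaseComponents.

(** * The faithful component of a cyclic group *)

Section CyclicComponent.
Variables (p : nat) (R : nzRingType) (Q : fieldType) (f : {rmorphism R -> Q}).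
Variable ar : arith p f.
Hypothesis p_odd : odd p.
Local Notation I := (ar_I (a := ar)).
Local Notation P := (lp ar).
Local Notation inA := (inA (ar := ar)).
Let p_pr := p_prime ar.

Lemma gring_comm (gT : finGroupType) (x y : gring Q gT) :
  (forall a b : gT, commute a b) -> x * y = y * x.
Proof.
move=> ab; have gC g : gel Q g * y = y * gel Q g.
  rewrite (gring_dec y) mulr_sumr mulr_suml; apply: eq_bigr => h _.
  by rewrite mulrA -sc_comm -!mulrA -!gelM (ab g h).
rewrite (gring_dec x) mulr_sumr mulr_suml; apply: eq_bigr => h _.
by rewrite -mulrA gC !mulrA sc_comm.
Qed.

Lemma inA_den (gT : finGroupType) l (x : gring Q gT) :
  exists M, inA l ((lam l)%:R ^+ M * x).
Proof.
have [M HM] : exists M : gT -> nat, forall g, I l ((lam l)%:R ^+ M g * x g).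
  have h g := ar_den (a := ar) l (x g).
  by exists (fun g => projT1 (cid (h g))) => g; case: cid.
exists (\sum_g M g)%N => g; rewrite -natrX natr_gringE (bigD1 g) //= expnD mulnC natrM -mulrA.
apply: (subringM (ar_sub l)); first exact: (subring_nat (ar_sub l)).
by rewrite natrX.
Qed.

Lemma frob_sum (S : pzRingType) (C : S -> Prop) (J : Type) (r : seq J) (F : J -> S) q m :
  subring_pred C -> prime q -> (forall x y : S, x * y = y * x) -> (forall i, C (F i)) ->
  cong C q%:R ((\sum_(i <- r) F i) ^+ (q ^ m)) (\sum_(i <- r) F i ^+ (q ^ m)).
Proof.
move=> SC q_pr cS CF; elim: r => [|a r IH].
  rewrite !big_nil expr0n expn_eq0; case: (q) q_pr => // q' _; exact: (cong_refl SC).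
rewrite !big_cons; apply: (@cong_trans _ _ SC _ (F a ^+ (q ^ m) + (\sum_(j <- r) F j) ^+ (q ^ m))).
  by apply: (frobeniusX SC m q_pr (CF a) _ (cS _ _)); apply: (subring_sum SC).
by apply: (congD SC) => //; apply: (cong_refl SC).
Qed.

Variables (gT : finGroupType) (k' : nat) (g : gT).
Hypothesis oG : #|gT| = (p ^ k'.+1)%N.
Hypothesis genG : forall x, x \in <[g]>%g.
Local Notation B := (gring Q gT).
Variables (c : gT) (e pi0 : B).
Hypothesis cE : c = (g ^+ (p ^ k'))%g.
Hypothesis eE : e = 1 - avg p Q c.
Hypothesis piE : pi0 = 1 - gel Q g.
Let SA l := @inA_subring p R Q f ar gT l.
Local Notation A := (inA P).

Let comB (x y : B) : x * y = y * x.
Proof.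
apply: gring_comm => a b.
have [/cycleP[i ->] /cycleP[j ->]] := (genG a, genG b).
exact/commuteX2.
Qed.

Let og : #[g]%g = (p ^ k'.+1)%N.
Proof.
rewrite orderE -oG -cardsT; apply/eq_card => x; rewrite inE; exact: genG.
Qed.

Lemma cyc_cp : (c ^+ p = 1)%g.
Proof. by rewrite cE -expgM -expnSr -og expg_order. Qed.

Lemma cyc_c1 : c != 1%g.
Proof.
rewrite cE -order_dvdn og; apply/negP => /dvdn_leq.
by rewrite expn_gt0 prime_gt0 // leqNgt ltn_exp2l ?prime_gt1 // ltnSn => /(_ isT).
Qed.
Let cp := cyc_cp.

Let ezz : avg p Q c * avg p Q c = avg p Q c. Proof. exact: (ez_idem ar cp). Qed.
Let e_ez : e * avg p Q c = 0. Proof. by rewrite eE mulrBl mul1r ezz subrr. Qed.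
Let ee : e * e = e. Proof. by rewrite {2}eE mulrBr mulr1 e_ez subr0. Qed.
Let e_neq0 : e != 0.
Proof.
rewrite eE subr_eq0; apply/eqP => z1; have := @gel_ez p R Q f ar gT c cp.
rewrite -z1 mulr1 => /ffunP/(_ c); rewrite gelE eqxx -(gel1 Q gT) gelE (negPf cyc_c1).
by apply/eqP; rewrite oner_eq0.
Qed.

Let Api : A pi0. Proof. by rewrite piE; apply: (subringB (SA _)); [apply: (subring1 (SA _))|apply: inA_gel]. Qed.
Let aug_pi : aug pi0 = 0. Proof. by rewrite piE rmorphB rmorph1 /= aug_gel subrr. Qed.

Let one_sub_pow m : exists2 t, forall l, inA l t & 1 - gel Q (g ^+ m)%g = pi0 * t.
Proof.
exists (\sum_(i < m) gel Q g ^+ i).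
  by move=> l; apply: (subring_sum (SA l)) => i _; apply: (subringX (SA l)); apply: inA_gel.
by rewrite piE gelX -opprB subrX1 -mulNr opprB.
Qed.

(** On [e] the powers of [c] sum to 0, so [p * e] is [e] times the sum of the [1 - c ^ i], and each
    term is divisible by [1 - g]. *)
Lemma cyc_p : exists2 t, A t & p%:R * e = e * (pi0 * t).
Proof.
have [t Ht] : exists t : 'I_p -> B, forall i, A (t i) /\ 1 - gel Q (c ^+ i)%g = pi0 * t i.
  have h (i : 'I_p) : exists t, A t /\ 1 - gel Q (c ^+ i)%g = pi0 * t.
    by rewrite cE -expgM; have [t At E] := one_sub_pow (p ^ k' * i); exists t.
  by exists (fun i => projT1 (cid (h i))) => i; case: cid.
exists (\sum_i t i); first by apply: (subring_sum (SA P)) => i _; case: (Ht i).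
rewrite mulr_sumr (eq_bigr (fun i : 'I_p => 1 - gel Q c ^+ i)) => [|i _]; last first.
  by have [_ <-] := Ht i; rewrite gelX.
rewrite sumrB sumr_const card_ord (@sum_gel_ez p R Q f ar gT c) mulrBr mulrA.
by rewrite -!(natr_comm p e) -[_ * e * _]mulrA e_ez mulr0 subr0.
Qed.

(** Every group element is a power of [g], hence congruent to 1 modulo [pi0]; the augmentation is
    therefore the residue map. *)
Lemma cyc_aug a : A a -> exists2 s, A s & a = sc gT (aug a) + pi0 * s.
Proof.
move=> Aa; have [t Ht] : exists t : gT -> B, forall h, A (t h) /\ gel Q h = 1 - pi0 * t h.
  have hh (h : gT) : exists t, A t /\ gel Q h = 1 - pi0 * t.
    have /cycleP[i ->] := genG h; have [t At E] := one_sub_pow i; exists t; split; first exact: At.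
    by rewrite -E opprB addrC subrK.
  by exists (fun i => projT1 (cid (hh i))) => i; case: cid.
exists (- \sum_h sc gT (a h) * t h).
  apply: (subringN (SA P)); apply: (subring_sum (SA P)) => h _; apply: (subringM (SA P)).
    by apply: inA_sc; apply: Aa.
  by case: (Ht h).
rewrite {1}(gring_dec a) mulrN mulr_sumr /aug rmorph_sum -sumrB; apply: eq_bigr => h _.
have [_ {1}->] := Ht h; rewrite mulrBr mulr1; congr (_ - _).
by rewrite !mulrA sc_comm.
Qed.

Lemma cyc_div a : A a -> cong (I P) p%:R (aug a) 0 -> exists2 b, A b & e * a = e * (pi0 * b).
Proof.
move=> Aa [z Iz]; rewrite add0r => Ez; have [s As Ea] := cyc_aug Aa.
have [t At Et] := cyc_p; exists (t * sc gT z + s).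
  by apply: (subringD (SA P)) => //; apply: (subringM (SA P)) => //; apply: inA_sc.
rewrite {1}Ea Ez rmorphM /= rmorph_nat !mulrDr; congr (_ + _).
by rewrite mulrA -(natr_comm p e) Et !mulrA.
Qed.

(** If [e * a] could be divided by [pi0] for ever it would be divisible by all powers of [p],
    because a power of [pi0] is divisible by [p]; then it would be 0. *)
Lemma cyc_dvr a : A a -> e * a != 0 ->
  exists m b, [/\ A b, ~ cong (I P) p%:R (aug b) 0 & e * a = e * (pi0 ^+ m * b)].
Proof.
move=> Aa ea0; apply: contrapT => no.
have h m : exists2 b, A b & e * a = e * (pi0 ^+ m * b).
  elim: m => [|m [b Ab Eb]]; first by exists a; rewrite ?mul1r.
  have [|nb] := pselect (cong (I P) p%:R (aug b) 0); last by case: no; exists m, b.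
  case/(cyc_div Ab) => b' Ab' Eb'; exists b' => //.
  have aux x y : e * (x * y) = x * (e * y) by rewrite mulrA [e * x]comB mulrA.
  by rewrite Eb aux Eb' -aux exprSr !mulrA.
have [N HN] := J_nilpotent ar p_odd oG.
have Jpi : JI ar pi0 by split=> //; rewrite aug_pi; apply: (cong_refl (ar_sub P)).
have [z Az Ez] := HN _ (Jpow_exp N Jpi).
(* [e] has denominator [p], so divisibility is tested on [p * (e * a)]. *)
have pe : A (p%:R * e).
  rewrite eE mulrBr mulr1 -(sum_gel_ez ar); apply: (subringB (SA P)); first exact: (subring_nat (SA P)).
  by apply: (subring_sum (SA P)) => i _; apply: (subringX (SA P)); apply: inA_gel.
case/eqP: ea0; have : p%:R * (e * a) = 0.
  apply: (@cong_inA_sep p R Q f ar gT P) => m; have [b Ab Eb] := h (N * m)%N.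
  exists (p%:R * e * (z ^+ m * b)).
    by apply: (subringM (SA P)) => //; apply: (subringM (SA P)) => //; apply: (subringX (SA P)).
  rewrite (ar_lp ar) Eb exprM Ez exprMn_comm; last exact: natr_comm.
  by rewrite -natrX !mulrA; congr (_ * _ * _); rewrite -[RHS]mulrA; exact: comB.
rewrite (natB_scE Q) => /(congr1 (fun x => sc gT p%:R^-1 * x)).
by rewrite mulr0 mulrA -rmorphM /= mulVf ?(p_neq0 ar) // rmorph1 mul1r.
Qed.

(** After clearing denominators a nonzero element is a power of [pi0] times a local unit, and [pi0]
    is invertible on [e] because it divides [p] there. No irreducibility of cyclotomic polynomials
    is invoked. *)
Lemma cyc_corner : corner_hyp e.
Proof.
split=> //.
move=> x ex x0; have [M AM] := inA_den P x; rewrite (ar_lp ar) in AM.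
have exM : e * (p%:R ^+ M * x) = p%:R ^+ M * x.
  by rewrite -natrX mulrA -[e * _]natr_comm -mulrA ex.
have pk0 : p%:R != 0 :> Q := p_neq0 ar.
have xM0 : e * (p%:R ^+ M * x) != 0.
  rewrite exM; apply: contra x0 => /eqP E; apply/eqP.
  rewrite -[x]mul1r -(rmorph1 (sc gT)) -(@mulVf _ (p%:R ^+ M)) ?expf_neq0 // rmorphM rmorphXn /= rmorph_nat.
  by rewrite -mulrA E mulr0.
have [m [b [Ab nb Eb]]] := cyc_dvr AM xM0.
have [b' _ [bb' _]] := local_unit p_odd oG Ab nb.
have [t _ Et] := cyc_p.
pose w := t * sc gT p%:R^-1.
have ew : e * (pi0 * w) = e.
  rewrite /w !mulrA -[e * pi0 * t]mulrA -Et -mulrA [e * sc _ _]comB mulrA -(rmorph_nat (sc gT)) -rmorphM /=.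
  by rewrite mulfV // rmorph1 mul1r.
have ewm : e * (pi0 ^+ m * w ^+ m) = e.
  rewrite -exprMn_comm; last exact: comB.
  by elim: (m) => [|i IH]; rewrite ?mulr1 // exprS mulrA ew.
pose Y : B := w ^+ m * b'.
exists (e * (Y * p%:R ^+ M)); first by rewrite (mulrA e e) ee.
rewrite -mulrA -(mulrA Y) (mulrA e Y) [e * Y]comB -mulrA Eb comB /Y.
transitivity (e * (pi0 ^+ m * w ^+ m) * (b * b')).
  by rewrite -!mulrA; congr (_ * (_ * _)); rewrite mulrA [b * _]comB -mulrA.
by rewrite ewm bb' mulr1.
Qed.

(** With [q] a power of [lam l] congruent to 1 modulo the group order (Euler), raising to the power
    [q] fixes group elements, and fixes the coefficients modulo [lam l] by Fermat. *)
Lemma frob_l l : l != P -> exists2 q, (1 < q)%N &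
  forall a : B, inA l a -> cong (inA l) (lam l)%:R (a ^+ q) a.
Proof.
move=> lP; have l_pr := ar_prime (a := ar) l.
have cop : coprime (lam l) (p ^ k'.+1).
  rewrite coprime_sym coprime_pexpl // prime_coprime // dvdn_prime2 //.
  by apply: contra lP => /eqP pl; apply/eqP/ar_lamI; rewrite (ar_lp ar).
set m := totient (p ^ k'.+1); exists (lam l ^ m)%N.
  by rewrite -{1}(expn0 (lam l)) ltn_exp2l ?prime_gt1 // totient_gt0 expn_gt0 prime_gt0.
move=> a Aa; rewrite {1}(gring_dec a).
have sI := ar_sub (a := ar) l.
have fer q j : I l q -> cong (I l) (lam l)%:R (q ^+ (lam l ^ j)) q.
  move=> Iq; elim: j => [|j IH]; first exact: (cong_refl sI).
  rewrite expnSr exprM; apply: (cong_trans sI) (ar_fermat Iq).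
  by apply: (congX sI) => //; [apply: (subring_nat sI)|move=> x; apply: mulrC].
apply: (@cong_trans _ _ (SA l) _ (\sum_h (sc gT (a h) * gel Q h) ^+ (lam l ^ m))).
  apply: frob_sum => // h; apply: (subringM (SA l)); [exact/inA_sc/Aa|exact: inA_gel].
rewrite [X in cong _ _ _ X](gring_dec a); apply: (cong_sum (SA l)) => h _.
rewrite exprMn_comm; last exact: comB.
have -> : gel Q h ^+ (lam l ^ m) = gel Q h.
  rewrite -gelX; congr (gel Q _); have /cycleP[i ->] := genG h.
  rewrite -expgM mulnC expgM; congr (_ ^+ _)%g; apply/eqP.
  by rewrite -[X in _ == X]expg1 eq_expg_mod_order og; apply/eqP/Euler_exp_totient.
rewrite -rmorphXn /=; have [z Iz ->] := fer _ m (Aa h).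
exists (sc gT z * gel Q h); first by apply: (subringM (SA l)); [apply: inA_sc|apply: inA_gel].
by rewrite rmorphD rmorphM /= rmorph_nat mulrDl -!mulrA.
Qed.

(** The order at [l] is the image of the localised group ring, and both cases of [criterion_bezout]
    occur: at [p] with [pi] and exponent [p], elsewhere with [lam l] and the exponent of
    [frob_l]. *)
Lemma cyclic_comp : exists k : scomp ar gT k'.+1, ce k = e.
Proof.
have [K [v [r [vr rv vB vM]]]] := corner_field cyc_corner.
pose D l (x : K) := exists2 a, inA l a & x = r a.
have SD l : subring_pred (D l).
  split; first by exists 1; [apply: (subring1 (SA l))|rewrite rmorph1].
    move=> _ _ [a Aa ->] [b Ab ->]; exists (a - b); last by rewrite rmorphB.
    exact: (subringB (SA l)).
  move=> _ _ [a Aa ->] [b Ab ->]; exists (a * b); last by rewrite rmorphM.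
  exact: (subringM (SA l)).
have r_e b : r (e * b) = r b by rewrite -vr rv.
have v1 : v 1 = e by rewrite -(rmorph1 r) vr mulr1.
have natK (m : nat) : m%:R = r (sc gT m%:R) by rewrite !rmorph_nat.
have scK q : q != 0 -> r (sc gT q) != 0.
  move=> q0; apply/eqP => h; have := rmorph1 r; rewrite -(rmorph1 (sc gT)) -(mulfV q0) !rmorphM /= h mul0r.
  by move/esym/eqP; rewrite oner_eq0.
(* [zeta] is a primitive [p]-th root of unity and [gam = 1 - zeta] is the conductor: [e] itself is
   not integral at [p], but [(1 - c) * e = 1 - c] is. *)
pose pi := r pi0; pose zeta := r (gel Q c); pose gam := r (1 - gel Q c).
have gamE : gam = 1 - zeta by rewrite /gam rmorphB rmorph1.
have sumz : \sum_(i < p) zeta ^+ i = 0.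
  transitivity (r (\sum_(i < p) gel Q c ^+ i)).
    by rewrite rmorph_sum; apply: eq_bigr => i _; rewrite rmorphXn.
  by rewrite (sum_gel_ez ar) -r_e mulrA -[e * _]natr_comm -mulrA e_ez mulr0 rmorph0.
have zp : zeta ^+ p = 1 by rewrite -rmorphXn /= -gelX cp gel1 rmorph1.
have Dpi : D P pi by exists pi0.
have Dgam : D P gam.
  by exists (1 - gel Q c) => //; apply: (subringB (SA P)); [apply: (subring1 (SA P))|apply: inA_gel].
have Dnat l m : D l m%:R := subring_nat (SD l) m.
have unitP x : cong (D P) pi x 1 -> exists2 y, D P y & x * y = 1.
  move=> [z [a Aa ->] ->]; rewrite -(rmorph1 r) -rmorphM -rmorphD.
  have Ab : A (1 + pi0 * a) by apply: (subringD (SA P)); [apply: (subring1 (SA P))|apply: (subringM (SA P))].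
  have nb : ~ cong (I P) p%:R (aug (1 + pi0 * a)) 0.
    rewrite rmorphD rmorph1 rmorphM /= aug_pi mul0r addr0 => -[w Iw]; rewrite add0r => E.
    apply: (@ar_ninv _ _ _ _ ar P); rewrite (ar_lp ar).
    suff -> : p%:R^-1 = w :> Q by [].
    by apply: (mulfI (p_neq0 ar)); rewrite -E mulfV ?(p_neq0 ar).
  have [y Ay [by1 _]] := local_unit p_odd oG Ab nb.
  by exists (r y); [exists y|rewrite -rmorphM by1].
have unit x : cong (D P) pi x 1 -> D P x^-1.
  move=> /unitP[y Dy xy]; suff -> : x^-1 = y by [].
  have x0 : x != 0 by apply/eqP => x0; move/eqP: xy; rewrite x0 mul0r eq_sym oner_eq0.
  by apply: (mulfI x0); rewrite xy mulfV.
have neq0 x : cong (D P) pi x 1 -> x != 0.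
  by move=> /unitP[y Dy xy]; apply/eqP => x0; move/eqP: xy; rewrite x0 mul0r eq_sym oner_eq0.
have pD : cong (D P) pi p%:R 0.
  have [t At Et] := cyc_p; exists (r t); first by exists t.
  by rewrite add0r -rmorphM /= -r_e -Et rmorphM /= rmorph_nat -[e]mulr1 r_e rmorph1 mulr1.
have comK (x : K) : GRing.comm p%:R x by apply: natr_comm.
have comKr (x y : K) : GRing.comm x y by exact: mulrC.
have pcong x y : cong (D P) p%:R x y -> cong (D P) pi x y.
  move=> [z Dz ->]; have [w Dw Ew] := pD; rewrite add0r in Ew.
  by exists (w * z); [apply: (subringM (SD P))|rewrite Ew mulrA].
have frob x : D P x -> cong (D P) pi (x ^+ p) x.
  move=> [a Aa ->]; have [s As Ea] := cyc_aug Aa.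
  have xc : cong (D P) pi (r a) (r (sc gT (aug a))).
    by exists (r s); [exists s|rewrite {1}Ea rmorphD rmorphM].
  have Daug : D P (r (sc gT (aug a))) by exists (sc gT (aug a)) => //; apply: inA_sc; apply: inA_aug.
  apply: (cong_trans (SD P)) (congX (SD P) Dpi (comKr pi) p Daug xc) _.
  apply: (cong_trans (SD P)) (cong_sym (SD P) xc); apply: pcong.
  rewrite -(rmorphXn r) /= -(rmorphXn (sc gT)) /=; have := ar_fermat (inA_aug Aa); rewrite (ar_lp ar) => -[z Iz ->].
  exists (r (sc gT z)); first by exists (sc gT z) => //; apply: inA_sc.
  by rewrite !rmorphD !rmorphM /= !rmorph_nat.
have frac l x : exists a b, [/\ D l a, D l b, b != 0 & x = a / b].
  have [M AM] := inA_den l (v x); exists (r ((lam l)%:R ^+ M * v x)), ((lam l)%:R ^+ M).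
  have l0 : (lam l)%:R ^+ M != 0 :> K by rewrite expf_neq0 // natK scK // lam_neq0.
  split=> //; [by exists ((lam l)%:R ^+ M * v x)|by rewrite -natrX; apply: Dnat|].
  by rewrite rmorphM rmorphXn /= rmorph_nat rv mulrC mulKf.
have pK0 : p%:R != 0 :> K by rewrite natK scK // (p_neq0 ar).
have pi_neq0 : pi != 0.
  apply/eqP => h; have [w _] := pD; rewrite h mul0r addr0 => /eqP; exact/negP.
have bez l : bezout (D l).
  have [->|lP] := eqVneq l P.
    apply: (@criterion_bezout K (D P) (SD P) pi p) => //; first exact: prime_gt1.
      move=> h; have := neq0 0; rewrite eqxx => h0; suff: false by []; apply: h0.
      exists (- pi^-1); first exact: (subringN (SD P)).
      by rewrite mulrN mulfV // subrr.
    move=> x [a Aa Ex] x0; have ea0 : e * a != 0.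
      by apply: contra x0 => /eqP h; rewrite Ex -r_e h rmorph0.
    have [m [b [Ab nb Eb]]] := cyc_dvr Aa ea0.
    have [y Ay [by1 _]] := local_unit p_odd oG Ab nb.
    exists m, (r y); split; first by exists y.
    by rewrite Ex -r_e Eb r_e -rmorphM -mulrA by1 mulr1 rmorphXn.
  have [q q1 Hq] := frob_l lP.
  have lK0 : (lam l)%:R != 0 :> K by rewrite natK scK // lam_neq0.
  have unitl x : cong (D l) (lam l)%:R x 1 -> exists2 y, D l y & x * y = 1.
    move=> [z [a Aa ->] ->].
    have [|y Ay [by1 _]] := @one_plus_inv p R Q f ar gT l (1 + (lam l)%:R * a); first by exists a.
    by exists (r y); [exists y|rewrite -(rmorph_nat r) -(rmorph1 r) -rmorphM -rmorphD -rmorphM by1].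
  have nx0 x : cong (D l) (lam l)%:R x 1 -> x != 0.
    by move=> /unitl[y Dy xy]; apply/eqP => x0; move/eqP: xy; rewrite x0 mul0r eq_sym oner_eq0.
  apply: (@criterion_bezout K (D l) (SD l) (lam l)%:R q) => //.
  - move=> x xc; have x0 := nx0 x xc; have [y Dy xy] := unitl x xc; suff -> : x^-1 = y by [].
    by apply: (mulfI x0); rewrite xy mulfV.
  - move=> h; have := nx0 0; rewrite eqxx => h0; suff: false by []; apply: h0.
    exists (- (lam l)%:R^-1); first exact: (subringN (SD l)).
    by rewrite mulrN mulfV // subrr.
  - move=> x [a Aa ->]; have [z Az Ez] := Hq a Aa; exists (r z); first by exists z.
    by rewrite -rmorphXn /= Ez rmorphD rmorphM /= rmorph_nat.
  - move=> x [a Aa Ex] x0; have [M AM] := inA_den l (v x^-1).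
    exists M, (r ((lam l)%:R ^+ M * v x^-1)); split; first by exists ((lam l)%:R ^+ M * v x^-1).
    by rewrite rmorphM rmorphXn /= rmorph_nat rv mulrCA mulfV // mulr1.
pose F := @CField p R Q f ar K D pi SD bez frac Dpi unit neq0 pD frob.
(* Since the powers of [zeta] sum to 0, [p] is the sum of the [1 - zeta ^ i]. *)
have pgam : exists2 w, D P w & p%:R = gam * w.
  exists (\sum_(i < p) \sum_(j < i) zeta ^+ j).
    apply: (subring_sum (SD P)) => i _; apply: (subring_sum (SD P)) => j _; apply: (subringX (SD P)).
    by exists (gel Q c) => //; apply: inA_gel.
  rewrite mulr_sumr (eq_bigr (fun i : 'I_p => 1 - zeta ^+ i)); last first.
    by move=> i _; rewrite gamE -[RHS]opprB subrX1 -mulNr opprB.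
  by rewrite sumrB sumr_const card_ord sumz subr0.
have gamp : exists2 w, D P w & gam ^+ p.-1 = p%:R * w.
  have Dz : D P zeta by exists (gel Q c) => //; apply: inA_gel.
  (* The coefficients of [(1 - zeta) ^ (p - 1)] are all 1 modulo [p], so that this power is
     congruent to the sum of the [zeta ^ i], which is 0. *)
  have bin (i : nat) : (i < p)%N -> exists2 w, D P w & ('C(p.-1, i)%:R * (-1) ^+ i : K) = 1 + p%:R * w.
    elim: i => [_|i IH ip]; first by exists 0; rewrite ?bin0 ?mulr1 ?mulr0 ?addr0 //; apply: (subring0 (SD P)).
    have [w Dw Ew] := IH (ltnW ip).
    have /dvdnP[q Eq] : (p %| 'C(p, i.+1))%N by apply: prime_dvd_bin.
    have Ebin : 'C(p.-1, i.+1)%:R = q%:R * p%:R - 'C(p.-1, i)%:R :> K.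
      rewrite -natrM -Eq -{2}(prednK (prime_gt0 p_pr)) binS natrD addrK //.
    exists (q%:R * (-1) ^+ i.+1 + w).
      apply: (subringD (SD P)) => //; apply: (subringM (SD P)) => //; apply: (subringX (SD P)).
      by apply: (subringN (SD P)); apply: (subring1 (SD P)).
    rewrite Ebin mulrBl {2}exprS mulN1r mulrN opprK Ew mulrDr addrCA; congr (_ + (_ + _)).
    by rewrite mulrAC mulrC mulrA.
  have [w Hw] : exists w : 'I_p -> K, forall i, D P (w i) /\ 'C(p.-1, i)%:R * (-1) ^+ i = 1 + p%:R * w i.
    have h (i : 'I_p) : exists w, D P w /\ 'C(p.-1, i)%:R * (-1) ^+ i = 1 + p%:R * w.
      by have [w Dw Ew] := bin i (ltn_ord i); exists w.
    by exists (fun i => projT1 (cid (h i))) => i; case: cid.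
  exists (\sum_(i < p) w i * zeta ^+ i).
    apply: (subring_sum (SD P)) => i _; apply: (subringM (SD P)); first by case: (Hw i).
    exact: (subringX (SD P)).
  rewrite gamE exprDn (prednK (prime_gt0 p_pr)) mulr_sumr -[RHS]add0r -[X in _ = X + _]sumz -big_split /=.
  apply: eq_bigr => i _; rewrite expr1n mul1r exprNn -mulr_natl mulrA.
  by have [_ Ew] := Hw i; rewrite mulrA Ew mulrDl mul1r.
(* By Frobenius, [pi ^ (p ^ k')] is [1 - zeta], that is [gam], modulo [p]; and [p] is itself a
   multiple of [gam]. *)
have pw' x : cong (D P) pi x 1 -> cong (D P) gam (x ^+ (p ^ k')) 1.
  move=> [z Dz ->]; have Dpz : D P (pi * z) by apply: (subringM (SD P)).
  have [w Dw ->] := frobeniusX (SD P) k' p_pr (subring1 (SD P)) Dpz (comKr _ _).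
  have [w2 Dw2 pE] := pgam.
  have DNg : D P (- r (gel Q g)) by apply: (subringN (SD P)); exists (gel Q g) => //; apply: inA_gel.
  have [w1 Dw1 Epi] := frobeniusX (SD P) k' p_pr (subring1 (SD P)) DNg (comKr _ _).
  have {}Epi : pi ^+ (p ^ k') = gam + p%:R * w1.
    rewrite /pi piE rmorphB rmorph1 Epi expr1n exprNn -signr_odd oddX p_odd orbT expr1 mulN1r.
    by rewrite -rmorphXn /= -gelX -cE -/zeta gamE.
  exists ((1 + w2 * w1) * z ^+ (p ^ k') + w2 * w).
    apply: (subringD (SD P)); apply: (subringM (SD P)) => //; last exact: (subringX (SD P)).
    by apply: (subringD (SD P)); [apply: (subring1 (SD P))|apply: (subringM (SD P))].
  rewrite expr1n exprMn Epi pE -addrA; congr (_ + _).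
  by rewrite mulrDr !mulrA; congr (_ + _); rewrite mulrDr mulr1 !mulrA.
(* One more [p]-th power of [1 + gam * z]: the term [gam ^ p] is [gam] times a multiple of [p], by
   [gamp]. *)
have pw x : cong (D P) pi x 1 -> cong (D P) (p%:R * gam) (x ^+ (p ^ k'.+1)) 1.
  move=> /pw'[z Dz Ez]; rewrite expnSr exprM Ez.
  have Dgz : D P (gam * z) by apply: (subringM (SD P)).
  have [w Dw ->] := one_plus_pow ar (SD P) Dgz.
  have [s Ds Es] := gamp; exists (s * z ^+ p + z * w).
    apply: (subringD (SD P)); apply: (subringM (SD P)) => //; exact: (subringX (SD P)).
  rewrite -addrA; congr (_ + _); rewrite exprMn mulrDr; congr (_ + _); last by rewrite !mulrA.
  by rewrite -{1}(prednK (prime_gt0 p_pr)) exprS Es !mulrA [gam * _]mulrC.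
pose rho (b : B) : 'M[K]_1 := (r b)%:M.
pose sig (X : 'M[K]_1) : B := v (X 0 0).
have sig1 : sig 1%:M = e by rewrite /sig mxE eqxx.
have h1 : exists k, 1%N = (p ^ k)%N by exists 0%N.
have h5 a b : rho (a - b) = rho a - rho b by rewrite /rho !rmorphB.
have h6 a b : rho (a * b) = rho a *m rho b by rewrite /rho rmorphM /= scalar_mxM.
have h7 : rho 1 = 1%:M by rewrite /rho rmorph1.
have h8 X Y : sig (X - Y) = sig X - sig Y by rewrite /sig !mxE vB.
have h9 X : rho (sig X) = X by rewrite /rho /sig rv -mx11_scalar.
have h11 b : sig (rho b) = sig 1%:M * b by rewrite sig1 /sig /rho mxE eqxx mulr1n vr.
have h10 b : sig (rho b) = b * sig 1%:M by rewrite h11 comB.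
have h12 l b : inA l b -> mxin (@cD _ _ _ _ _ F l) (rho b).
  by move=> Ab i j; rewrite !mxE !ord1 eqxx mulr1n; exists b.
have h13 l X : l != P -> mxin (@cD _ _ _ _ _ F l) X -> inA l (sig X).
  move=> lP h; have [a Aa] := h 0 0; rewrite /sig => ->; rewrite vr.
  apply: (subringM (SA l)) => //; rewrite eE; apply: (subringB (SA l)); first exact: (subring1 (SA l)).
  exact: ez_in.
have h14 X : mxin (@cD _ _ _ _ _ F P) X -> inA P (sig (gam *: X)).
  move=> h; have [a Aa Ea] := h 0 0; rewrite /sig mxE Ea -rmorphM vr mulrA.
  apply: (subringM (SA P)) => //; rewrite eE mulrBl mul1r mulrBr mulr1 [avg _ _ _ * gel _ _]comB.
  rewrite (@gel_ez p R Q f ar gT c cp) subrr subr0.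
  by apply: (subringB (SA P)); [apply: (subring1 (SA P))|apply: inA_gel].
exists (@Comp p R Q f ar gT k'.+1 F gam 1 0 rho sig h1 Dgam pw (fun x _ => pw' x)
  h5 h6 h7 h8 h9 h10 h11 h12 h13 h14).
exact: sig1.
Qed.
End CyclicComponent.

(** * Decomposition of the group ring, by induction on the group order *)

Section Wedderburn.
Variables (p : nat) (R : nzRingType) (Q : fieldType) (f : {rmorphism R -> Q}).
Variable ar : arith p f.
Hypothesis p_odd : odd p.
Let p_pr := p_prime ar.
Let char0 := ar_char0 ar.
Local Notation ez := (avg p Q).

Lemma card_cosets (gT : finGroupType) (D : {group gT}) n : #|D| = p -> #|gT| = (p ^ n)%N ->
  exists2 n', (n' < n)%N & #|[set: coset_of D]| = (p ^ n')%N.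
Proof.
move=> oD oG; have E : (#|[set: coset_of D]| * p)%N = #|('N(D))%g|.
  rewrite -(quotientT D) -quotientInorm setTI card_quotient // mulnC -{1}oD.
  by rewrite Lagrange // normG.
have dv : (#|[set: coset_of D]| * p %| p ^ n)%N by rewrite E -oG -cardsT cardSg ?subsetT.
have /(dvdn_pfactor _ _ p_pr)[m _ Em] : (#|[set: coset_of D]| %| p ^ n)%N.
  by apply: dvdn_trans dv; apply: dvdn_mulr.
by exists m; rewrite // -(dvdn_Pexp2l _ _ (prime_gt1 p_pr)) expnSr -Em.
Qed.

Section EzCalculus.
Variable gT : finGroupType.
Local Notation B := (gring Q gT).

Lemma ez_absorb (c x : gT) (w : B) i : gel Q x * w = w -> c = (x ^+ i)%g -> ez c * w = w.
Proof.
move=> xw ->; apply: (ez_mul ar); rewrite gelX.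
by elim: i => [|i IH]; rewrite ?mul1r // exprS -mulrA IH.
Qed.

Lemma ez_conj (x h : gT) : gel Q h^-1%g * ez x * gel Q h = ez (x ^ h)%g.
Proof.
rewrite /avg mulrA -sc_comm -!mulrA; congr (_ * _); rewrite mulr_suml mulr_sumr.
by apply: eq_bigr => i _; rewrite -!gelX -!gelM -conjXg.
Qed.

Lemma infl_ez (D : {group gT}) (c : gT) : c \in ('N(D))%g ->
  infl (ez (coset D c)) = ez c * eD Q D.
Proof.
move=> cN; rewrite /avg infl_sc -mulrA; congr (_ * _); rewrite infl_sum mulr_suml.
apply: eq_bigr => i _; rewrite -!gelX -morphX // -[X in infl X]mulr1 infl_gell ?groupX //.
Qed.

Variables (c y : gT).
Hypothesis cC : forall g, commute c g.
Hypothesis oc : #[c]%g = p.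
Hypothesis oy : #[y]%g = p.
Hypothesis yc : y \notin <[c]>%g.
Let cp : (c ^+ p = 1)%g. Proof. by rewrite -oc expg_order. Qed.
Let yp : (y ^+ p = 1)%g. Proof. by rewrite -oy expg_order. Qed.
Variable z0 : B.
Hypothesis z0E : z0 = 1 - ez c.

Lemma z0_comm b : z0 * b = b * z0.
Proof. by rewrite z0E mulrBl mulrBr mul1r mulr1; congr (_ - _); exact: ez_comm. Qed.
Lemma ez_z0 : ez c * z0 = 0.
Proof. by rewrite z0E mulrBr mulr1 (ez_idem ar cp) subrr. Qed.

Lemma c_powK s : ~~ (p %| s)%N -> exists i, c = ((c ^+ s) ^+ i)%g.
Proof.
move=> ps; have cop : coprime #[c]%g s by rewrite oc prime_coprime.
have /cycleP[i Ei] : c \in <[c ^+ s]>%g; last by exists i.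
have /eqP <- : generator <[c]> (c ^+ s) by rewrite generator_coprime.
exact: cycle_id.
Qed.

Lemma ordyc j : #[y * c ^+ j]%g = p.
Proof.
apply: nt_prime_order => //.
  rewrite expgMn; last exact/commute_sym/commute_sym/commuteX/commute_sym/cC.
  by rewrite yp mul1g -expgM mulnC expgM cp expg1n.
apply: contra yc => /eqP E; rewrite (_ : y = (c ^+ j)^-1)%g ?groupV ?mem_cycle //.
by apply: (mulIg (c ^+ j)%g); rewrite E mulVg.
Qed.
Let ycp j : ((y * c ^+ j) ^+ p = 1)%g. Proof. by rewrite -(ordyc j) expg_order. Qed.

(** In the elementary abelian group generated by [y] and [c], expand the averages over the [p]
    subgroups generated by [y * c ^ j]: the coefficient of [y ^ i] is an average over the group
    generated by [c ^ i], which [z0] kills unless [i = 0]. *)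
Lemma sum_ez_z0 : (\sum_(j < p) ez (y * c ^+ j)%g) * z0 = z0.
Proof.
have yX j i : ((y * c ^+ j) ^+ i = y ^+ i * (c ^+ i) ^+ j)%g.
  rewrite expgMn; last exact/commute_sym/commute_sym/commuteX/commute_sym/cC.
  by rewrite -!expgM mulnC.
have E : \sum_(j < p) ez (y * c ^+ j)%g = \sum_(i < p) gel Q (y ^+ i)%g * ez (c ^+ i)%g.
  rewrite /avg -mulr_sumr exchange_big /= mulr_sumr; apply: eq_bigr => i _.
  rewrite mulrA -sc_comm -mulrA; congr (_ * _); rewrite mulr_sumr; apply: eq_bigr => j _.
  by rewrite -!gelX yX gelM.
have p0 := prime_gt0 p_pr; rewrite E mulr_suml (bigD1 (Ordinal p0)) //= !expg0 gel1 mul1r.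
rewrite (_ : ez 1%g = 1) ?mul1r; last first.
  by rewrite -[LHS]mulr1; apply: (ez_mul ar); rewrite gel1 mul1r.
rewrite big1 ?addr0 // => i i0.
have ps : ~~ (p %| i)%N.
  by rewrite gtnNdvd // lt0n; apply: contra i0 => /eqP i0; apply/eqP/val_inj.
have [k Ek] := c_powK ps.
have cip : ((c ^+ i) ^+ p = 1)%g by rewrite -expgM mulnC expgM cp expg1n.
rewrite -(ez_absorb (gel_ez ar cip) Ek).
by rewrite -mulrA -(mulrA (ez c)) -z0_comm (mulrA (ez c)) ez_z0 mul0r mulr0.
Qed.

(** What is fixed by both [y * c ^ s] and [y * c ^ (s + t)] is fixed by [c ^ t], hence by [c], and
    is killed by [z0]. *)
Lemma ez_orth s t : ~~ (p %| t)%N -> ez (y * c ^+ s)%g * ez (y * c ^+ s * c ^+ t)%g * z0 = 0.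
Proof.
move=> pt; set x := (y * c ^+ s)%g; set x' := (x * c ^+ t)%g.
have xp : (x ^+ p = 1)%g by apply: ycp.
have xp' : (x' ^+ p = 1)%g by rewrite /x' -mulgA -expgD; apply: ycp.
have xx' : commute x x'.
  by apply: commuteM; [exact: commute_refl|exact/commuteX/commute_sym/cC].
have gC a : gel Q x' ^+ a * gel Q x = gel Q x * gel Q x' ^+ a.
  by rewrite -gelX -!gelM (commuteX a xx').
set w := ez x * ez x'.
have h1 : gel Q x * w = w by rewrite mulrA (gel_ez ar xp).
have h2 : gel Q x' * w = w.
  suff xw : gel Q x' * ez x = ez x * gel Q x' by rewrite mulrA xw -mulrA (gel_ez ar xp').
  rewrite /avg mulrA -sc_comm -!mulrA; congr (_ * _); rewrite mulr_sumr mulr_suml.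
  by apply: eq_bigr => i _; rewrite -gelX -!gelM (commuteX i (commute_sym xx')).
have h3 : gel Q (c ^+ t)%g * w = w.
  rewrite -{1}h1 mulrA -gelM (_ : (c ^+ t * x = x')%g) //.
  by rewrite /x'; exact: (commute_sym (commuteX t (commute_sym (cC x)))).
have [k Ek] := c_powK pt.
by rewrite -(ez_absorb h3 Ek) -mulrA -z0_comm mulrA ez_z0 mul0r.
Qed.

Lemma central_norm (D : {group gT}) : c \in ('N(D))%g.
Proof. by apply: (subsetP (cent_sub D)); apply/centP => u _; apply: cC. Qed.

Lemma infl_z0 (D : {group gT}) : infl (1 - ez (coset D c)) = z0 * eD Q D.
Proof. by rewrite raddfB /= infl_ez ?central_norm // z0E mulrBl mul1r. Qed.

Lemma coset_ezC (D : {group gT}) b : ez (coset D c) * b = b * ez (coset D c).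
Proof.
apply: ez_comm => u; have [g gN ->] := cosetP u.
by rewrite /commute -!morphM ?central_norm // (cC g).
Qed.

Lemma coset_ez_idem (D : {group gT}) : ez (coset D c) * ez (coset D c) = ez (coset D c).
Proof. by apply: (ez_idem ar); rewrite -morphX ?central_norm // cp morph1. Qed.

Variable n : nat.
Hypothesis oG : #|gT| = (p ^ n)%N.
Hypothesis IH : forall n', (n' < n)%N -> forall hT : finGroupType, #|hT| = (p ^ n')%N ->
  covers ar n' (1 : gring Q hT).

(** Inflation from a proper quotient is induction with a one-element transversal. *)
Lemma covers_normal (D : {group gT}) (z : gring Q (coset_of D)) : (forall g, g \in ('N(D))%g) ->
  #|D| = p -> (forall n', covers ar n' (1 : gring Q (coset_of D)) -> covers ar n' z) ->
  covers ar n (infl z).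
Proof.
move=> nD oD cz; have [n' ltn' oD'] := card_cosets oD oG.
have h := @covers_ind p R Q f ar gT D n n' 0 1 (fun=> 1%g) z oD ltn' (esym (expn0 p)).
have := h _ _ _; rewrite big_ord1 invg1 gel1 mul1r mulr1; apply.
- by move=> g; exists ord0 => a'; rewrite mul1g nD ord1 eqxx.
- by move=> g; rewrite nD.
- by apply: cz; apply: IH => //; rewrite -cardsT.
Qed.

Lemma covers_ez : covers ar n (ez c).
Proof.
rewrite (ez_eD ar cp oc); apply: covers_normal => //.
by move=> g; apply: (subsetP (cent_sub _)); apply/centP => u /cycleP[i ->]; exact/commuteX/commute_sym/cC.
Qed.

(** When [y] is central too, each piece of [sum_ez_z0] is inflated from the quotient by the central
    subgroup of [y * c ^ i]. *)
Lemma covers_central : (forall g, commute y g) -> covers ar n z0.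
Proof.
move=> yC; rewrite -sum_ez_z0 mulr_suml; apply: covers_sum => [i j ij|i].
  rewrite -mulrA [z0 * _]z0_comm (mulrA (ez (y * c ^+ i)%g)) (mulrA (ez (y * c ^+ i)%g)).
  have -> : (y * c ^+ j = y * c ^+ i * c ^+ (j + (p - i)))%g.
    by rewrite -mulgA -expgD addnCA subnKC 1?ltnW // expgD cp mulg1.
  rewrite ez_orth ?mul0r //; apply: contra ij => pd; apply/eqP/val_inj => /=.
  have : (j + (p - i) = 0 %[mod p])%N by rewrite mod0n; apply/eqP.
  move/(congr1 (fun x => (x + i) %% p)%N); rewrite !modnDml add0n -addnA subnK 1?ltnW // modnDr.
  by rewrite !modn_small.
have nD g : g \in ('N(<[y * c ^+ i]>))%g.
  apply: (subsetP (cent_sub _)); apply/centP => u /cycleP[k ->]; apply: commuteX.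
  by apply: commuteM; [exact/commute_sym/yC|exact/commuteX/commute_sym/cC].
have oD : #|<[y * c ^+ i]>%g| = p by rewrite -orderE ordyc.
rewrite -z0_comm (ez_eD ar (ycp i) (ordyc i)) -infl_z0; apply: covers_normal => // n' c1.
by apply: covers_filter c1; [exact: coset_ezC|exact: coset_ez_idem].
Qed.

(** [g0] permutes the subgroups of the [y * c ^ b] cyclically, so its powers are a transversal of
    the normaliser of [<y>] and [z0] is induced from there. An element outside the normaliser moves
    [y] to some [y * c ^ i] with [i] prime to [p], and [ez_orth] gives the required
    orthogonality. *)
Lemma covers_noncentral g0 : (forall g, exists i, (y ^ g = y * c ^+ i)%g) ->
  (y ^ g0 = y * c)%g -> covers ar n z0.
Proof.
move=> yg yg0; set D := <[y]>%G.
have cg i g : ((c ^+ i) ^ g = c ^+ i)%g.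
  by apply/conjg_fixP/commgP/commute_sym/commuteX/commute_sym/cC.
have c_neq i : ~~ (p %| i)%N -> (c ^+ i)%g \notin D.
  move=> pi; apply: contra yc => ciD; have [k Ek] := c_powK pi.
  have cD : <[c]>%g \subset D by rewrite cycle_subG Ek groupX.
  have /eqP -> : <[c]>%g == D; last exact: cycle_id.
  by rewrite eqEcard cD /= -!orderE oc oy.
have ci1 i : ((c ^+ i)%g == 1%g) = (p %| i)%N by rewrite -order_dvdn oc.
have nDE g i : (y ^ g = y * c ^+ i)%g -> (g \in ('N(D))%g) = (p %| i)%N.
  move=> E; apply/idP/idP => [gN|pi].
    apply: contraT => npi; case/negP: (c_neq i npi).
    have : (y ^ g)%g \in D by rewrite memJ_norm ?cycle_id.
    by rewrite E groupMl ?cycle_id.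
  apply: (subsetP (cent_sub _)); apply/centP => u /cycleP[k ->]; apply/commuteX/commute_sym/commgP/conjg_fixP.
  by rewrite E; move: pi; rewrite -ci1 => /eqP ->; rewrite mulg1.
have yg0X b : (y ^ (g0 ^+ b) = y * c ^+ b)%g.
  elim: b => [|b IHb]; first by rewrite !expg0 conjg1 mulg1.
  by rewrite expgSr conjgM IHb conjMg yg0 cg -mulgA -expgS.
have tauP g : exists a : 'I_p, forall a' : 'I_p, ((g0 ^+ a' * g)%g \in ('N(D))%g) = (a' == a).
  have [i Ei] := yg g; have p0 := prime_gt0 p_pr.
  have E a' : (y ^ (g0 ^+ a' * g) = y * c ^+ (i + a'))%g.
    by rewrite conjgM yg0X conjMg cg Ei -mulgA -expgD.
  have ha : ((p - i %% p) %% p < p)%N by rewrite ltn_mod.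
  exists (Ordinal ha) => a'; rewrite (nDE _ _ (E a')); apply/idP/eqP => [pd|->]; last first.
    by rewrite /dvdn /= modnDmr -modnDml subnKC ?modnn // ltnW // ltn_mod.
  apply: val_inj => /=; have : (i + a' = 0 %[mod p])%N by rewrite mod0n; apply/eqP.
  move/(congr1 (fun x => (x + (p - i %% p)) %% p)%N).
  rewrite !modnDml add0n -addnA addnC -modnDmr -addnA.
  by rewrite subnK; [rewrite modnDr modn_small|rewrite ltnW // ltn_mod].
have oD : #|D| = p by rewrite -orderE.
have [n' ltn' oD'] := card_cosets oD oG.
have iz : infl (1 - ez (coset D c)) = z0 * ez y by rewrite infl_z0 (ez_eD ar yp oy).
have := @covers_ind p R Q f ar gT D n n' 1 p (fun b => (g0 ^+ b)%g) _ oD ltn' (esym (expn1 p)) tauP _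
  (covers_filter (@coset_ezC D) (coset_ez_idem D) (IH ltn' (etrans (esym (cardsT _)) oD'))).
rewrite iz (eq_bigr (fun b : 'I_p => ez (y * c ^+ b)%g * z0)) => [|b _]; last first.
  by rewrite mulrA -z0_comm -mulrA -mulrA (mulrA (gel Q _)) ez_conj yg0X z0_comm.
rewrite -mulr_suml sum_ez_z0; apply => g gN.
have gy : gel Q g * ez y = ez (y ^ g^-1)%g * gel Q g.
  by rewrite -ez_conj invgK -!mulrA -gelM mulVg gel1 mulr1.
have [i Ei] := yg g^-1%g.
have pi : ~~ (p %| i)%N by rewrite -(nDE _ _ Ei) groupV.
rewrite -mulrA -mulrA (mulrA (gel Q g)) -(z0_comm (gel Q g)) -(mulrA z0) gy Ei.
rewrite (mulrA z0 (ez (y * c ^+ i)%g)) (z0_comm (ez (y * c ^+ i)%g)) (mulrA (ez y)) (mulrA (ez y)).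
have := ez_orth 0 pi; rewrite expg0 mulg1 => ->.
by rewrite mul0r mulr0.
Qed.
End EzCalculus.

(** [E], the elements of exponent [p] of a noncyclic abelian normal subgroup, is normal and
    elementary abelian of rank at least 2. It meets the centre, which gives [c]; modulo [<c>] it
    meets the centre again, and [y] is a lift to [E] of an element found there. *)
Lemma pgroup_structure (gT : finGroupType) n : #|gT| = (p ^ n)%N -> ~~ cyclic [set: gT] ->
  exists c y : gT, [/\ forall g, commute c g, #[c]%g = p, #[y]%g = p, y \notin <[c]>%g
    & forall g, exists i, (y ^ g = y * c ^+ i)%g].
Proof.
move=> oG ncG; pose G := [set: gT]%G.
have pG : p.-group%g G by rewrite /pgroup cardsT oG pnatX pnat_id.
have [X [nX aX ncX]] : exists X : {group gT}, [/\ (X <| G)%g, abelian X & ~~ cyclic X].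
  (* A [p]-group whose normal abelian subgroups are all cyclic is cyclic, or else [p = 2]. *)
  apply: contrapT => no; have [|cG|/and3P[/eqP p2 _ _]] := normal_rank1_structure pG.
  - by move=> X nX aX; apply: contrapT => /negP ncX; apply: no; exists X.
  - by rewrite cG in ncG.
  - by move: p_odd; rewrite p2.
pose E := 'Ohm_1(X)%G; have pX : p.-group%g X := pgroupS (normal_sub nX) pG.
have abE : p.-abelem%g E := Ohm1_abelem pX aX.
have nE : (E <| G)%g := char_normal_trans (Ohm_char 1 X) nX.
have rE : ~~ ('r_p(E)%g <= 1)%N by rewrite p_rank_Ohm1 -(rank_pgroup pX) -abelian_rank1_cyclic.
have E1 : E :!=: 1%g by apply: contra rE => /eqP ->; rewrite p_rank1.
have /trivgPn[c /setIP[cE cZ] c1] := meet_center_nil (pgroup_nil pG) nE E1.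
have cC g : commute c g by have /setIP[_ /centP h] := cZ; apply: h; rewrite inE.
have oc : #[c]%g = p := abelem_order_p abE cE c1.
pose C := <[c]>%G; have nC : (C <| G)%g by apply: sub_center_normal; rewrite cycle_subG.
have EC1 : (E / C)%G :!=: 1%g.
  apply: contra rE => /eqP EC; have sEC : E \subset C.
    by rewrite -quotient_sub1 ?(subset_trans (normal_sub nE)) ?normal_norm //= EC.
  apply: leq_trans (p_rankS p sEC) _; rewrite -(@rank_pgroup _ p) ?rank_cycle ?leq_b1 //.
  by apply: pgroupS pG; rewrite subsetT.
have pGC : p.-group%g (G / C)%g by apply: quotient_pgroup.
have /trivgPn[yb /setIP[ybE ybZ] yb1] := meet_center_nil (pgroup_nil pGC) (quotient_normal C nE) EC1.
case/morphimP: ybE => y yN yE Ey.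
have yC : y \notin C by apply: contra yb1 => yC; rewrite Ey /= coset_id.
have y1 : y != 1%g by apply: contra yC => /eqP ->; rewrite group1.
exists c, y; split=> //; first exact: (abelem_order_p abE yE y1).
move=> g; have gN : g \in ('N(C))%g by apply: (subsetP (normal_norm nC)); rewrite inE.
have : [~ y, g]%g \in C.
  apply: coset_idr; first by rewrite groupR.
  rewrite morphR //; apply/eqP/commgP; have /setIP[_ /centP h] := ybZ.
  by rewrite /= -Ey; apply: h; apply: mem_quotient; rewrite inE.
by case/cycleP=> i Ei; exists i; rewrite conjg_mulR Ei.
Qed.

Theorem wedderburn n (gT : finGroupType) : #|gT| = (p ^ n)%N -> covers ar n (1 : gring Q gT).
Proof.
elim/ltn_ind: n gT => -[|n] IH gT oG.
  have [k kE] := trivial_comp ar oG; exists 'I_1, (fun=> k).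
  by split=> [i j|]; rewrite ?ord1 ?big_ord1 // (ord1 i) (ord1 j) eqxx.
have [/cyclicP[g gE]|nc] := boolP (cyclic [set: gT]).
  have genG x : x \in <[g]>%g by rewrite -gE inE.
  set c := (g ^+ (p ^ n))%g.
  have [k kE] := @cyclic_comp p R Q f ar p_odd gT n g oG genG c _ _ (erefl _) (erefl _) (erefl _).
  have cC h : commute c h.
    by have /cycleP[i ->] := genG h; exact: commuteX2.
  have cp := @cyc_cp p gT n g oG genG c (erefl _).
  have c1 := @cyc_c1 p R Q f ar gT n g oG genG c (erefl _).
  have oc : #[c]%g = p by apply: nt_prime_order.
  rewrite -(subrK (ez c) 1); apply: covers_add.
  - by rewrite mulrBl mul1r (ez_idem ar cp) subrr.
  - by rewrite mulrBr mulr1 (ez_idem ar cp) subrr.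
  - by exists 'I_1, (fun=> k); split=> [i j|]; rewrite ?big_ord1 ?kE // (ord1 i) (ord1 j) eqxx.
  - exact: (covers_ez cC oc oG IH).
have [c [y [cC oc oy yc yg]]] := pgroup_structure oG nc.
have cp : (c ^+ p = 1)%g by rewrite -oc expg_order.
rewrite -(subrK (ez c) 1); apply: covers_add; last exact: (covers_ez cC oc oG IH).
- by rewrite mulrBl mul1r (ez_idem ar cp) subrr.
- by rewrite mulrBr mulr1 (ez_idem ar cp) subrr.
have [yC|/existsNP[g0 yg0]] := pselect (forall g, commute y g).
  exact: (covers_central cC oc oy yc (erefl _) oG IH).
have [i Ei] := yg g0.
have pi : ~~ (p %| i)%N.
  apply/negP => pi; apply: yg0; apply/commgP/conjg_fixP; rewrite Ei.
  by move: pi; rewrite -oc order_dvdn => /eqP ->; rewrite mulg1.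
have [k Ek] := c_powK oc pi.
(* Replacing [c] by another generator of the same subgroup makes [g0] move [y] to [y * c']
   exactly. *)
pose c' := (c ^+ i)%g; have c'C g : commute c' g by exact/commute_sym/commuteX/commute_sym/cC.
have cc' : <[c']>%g = <[c]>%g.
  by apply/eqP; rewrite eqEsubset !cycle_subG mem_cycle {1}Ek mem_cycle.
have oc' : #[c']%g = p by rewrite orderE cc' -orderE.
have c'p : (c' ^+ p = 1)%g by rewrite -oc' expg_order.
have eE : ez c = ez c' by rewrite (ez_eD ar cp oc) (ez_eD ar c'p oc') !eDE /= cc'.
rewrite eE; apply: (covers_noncentral c'C oc' oy _ (erefl _) oG IH (g0 := g0)) => //.
  by rewrite cc'.
move=> g; have [j ->] := yg g; exists (k * j)%N; rewrite expgM; congr (_ * _ ^+ _)%g; exact: Ek.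
Qed.
End Wedderburn.

(** * Invariants attached to the simple components *)
Section InvariantPackage.
Variables (A B B1 : pzRingType) (f : {rmorphism A -> B}) (C : B1 -> Prop).
Variables (sz : nat -> nat) (mu : forall m n, 'M[B]_(m, n) -> 'M[B1]_(sz m, sz n)).
Hypothesis CS : subring_pred C.
Hypothesis muM : forall m n k (X : 'M[B]_(m, n)) (Y : 'M[B]_(n, k)),
  mu (X *m Y) = mu X *m mu Y.
Hypothesis muD : forall m n (X Y : 'M[B]_(m, n)), mu (X + Y) = mu X + mu Y.
Hypothesis muC : forall m n (X : 'M[A]_(m, n)), mxin C (mu (map_mx f X)).
Hypothesis Csplits : forall n (e : 'M[B1]_n), mxin C e -> e *m e = e -> splits C e.
Hypothesis ibn : forall r r' (X : 'M[B1]_(r, r')) (Y : 'M[B1]_(r', r)),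
  X *m Y = 1%:M -> Y *m X = 1%:M -> r = r'.
Variables (J : Type) (KJ : J -> fieldType).
Variable dt : forall j r, 'M[B1]_r -> KJ j.
Hypothesis dtM : forall j r (X Y : 'M[B1]_r), dt j (X *m Y) = dt j X * dt j Y.
Hypothesis dt1 : forall j r, dt j (1%:M : 'M[B1]_r) = 1.
Hypothesis dt_lblock : forall j r s (X : 'M[B1]_r) (Z : 'M_(s, r)) (W : 'M[B1]_s),
  dt j (block_mx X 0 Z W) = dt j X * dt j W.
Variable US : (forall j, KJ j) -> Prop.
Hypothesis US_C : forall r (h h' : 'M[B1]_r), mxin C h -> mxin C h' ->
  h *m h' = 1%:M -> h' *m h = 1%:M -> US (fun j => dt j h).
Hypothesis US_M : forall a b, US a -> US b -> US (fun j => a j * b j).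
Hypothesis US_V : forall a, US a -> US (fun j => (a j)^-1).
Hypothesis US_0 : forall a j, US a -> a j != 0.

(** The interface of the invariants: the chosen standard frames disappear, and any frames compute
    the value up to [US]. *)
Lemma inv_package : exists v : relK0 f -> forall j, KJ j,
  [/\ forall x j, v x j != 0, forall m x j, v (relK0_muln m x) j = v x j ^+ m,
      forall x, relK0_eq x [::] -> US (v x) &
      forall x T (F : frame f C mu (rt_src T)) (F' : frame f C mu (rt_tgt T)),
        relK0_eq x [:: (false, T)] ->
        eqU US (v x) (fun j => dtr dt j (Fmx F F' (rt_map T)))].
Proof.
exists (vK muM muC Csplits dt); split.
- by move=> x j; apply: (vK_neq0 muM muC Csplits ibn dtM dt1).
- by move=> m x j; apply: vK_muln.
- move=> x /(vK_eq CS muM muD muC Csplits ibn dtM dt1 dt_lblock US_C US_M US_V US_0)[u Uu E].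
  by have -> : vK muM muC Csplits dt x = u
    by apply: functional_extensionality_dep => j; rewrite E /vK big_nil mul1r.
move=> x T F F' h.
have [u Uu E] := vK_eq CS muM muD muC Csplits ibn dtM dt1 dt_lblock US_C US_M US_V US_0 h.
have [w Uw E'] := vT_frame CS muM muC Csplits ibn dtM US_C US_M F F'.
by exists (fun j => w j * u j); [exact: US_M|move=> j; rewrite E vK_cls E' mulrA].
Qed.
End InvariantPackage.

Lemma det_blk_ublock (K : comNzRingType) d m n (X : 'M['M[K]_d]_m) Z (W : 'M['M[K]_d]_n) :
  \det (blk (block_mx X Z 0 W)) = \det (blk X) * \det (blk W).
Proof.
rewrite -(det_ublock _ (blk Z)).
pose h (a : 'I_((m + n) * d)) : 'I_(m * d + n * d) := match split (bidx a).1 with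
  | inl i => lshift _ (mxvec_index i (bidx a).2) | inr i => rshift _ (mxvec_index i (bidx a).2) end.
pose g (b : 'I_(m * d + n * d)) : 'I_((m + n) * d) := match split b with
  | inl c => mxvec_index (lshift _ (bidx c).1) (bidx c).2
  | inr c => mxvec_index (rshift _ (bidx c).1) (bidx c).2 end.
rewrite -(@det_reindex _ _ _ h g); first last.
- move=> b; rewrite /g /h; case: (split_ordP b) => c ->; rewrite ?split_lshift ?split_rshift bidxK /=.
    by rewrite split_lshift mxvec_bidx.
  by rewrite split_rshift mxvec_bidx.
- move=> a; rewrite /h /g -[RHS]mxvec_bidx; case: (split_ordP (bidx a).1) => i ->.
    by rewrite !split_lshift bidxK.
  by rewrite !split_rshift bidxK.
congr (\det _); apply/matrixP => a b; rewrite [LHS]mxE [RHS]mxE /h.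
case: (split_ordP (bidx a).1) => i ->; case: (split_ordP (bidx b).1) => j ->;
  rewrite ?split_lshift ?split_rshift ?block_mxEul ?block_mxEur ?block_mxEdl ?block_mxEdr.
- by rewrite mxE !bidxK.
- by rewrite mxE !bidxK.
- by rewrite !mxE.
- by rewrite mxE !bidxK.
Qed.

Lemma inv_conj (S : pzRingType) r (h h' e e' : 'M[S]_r) :
  h *m h' = 1%:M -> h' *m h = 1%:M -> e *m e' = 1%:M -> e' *m e = 1%:M ->
  h *m e *m (e' *m h') = 1%:M /\ e' *m h' *m (h *m e) = 1%:M.
Proof.
move=> hh' h'h ee' e'e; split; rewrite mulmxA.
  by rewrite -(mulmxA h e e') ee' mulmx1.
by rewrite -(mulmxA e' h' h) h'h mulmx1.
Qed.

Lemma det_blk1 (K : comNzRingType) d (X : 'M['M[K]_d]_1) : \det (blk X) = \det (X 0 0).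
Proof.
rewrite -(@det_reindex _ _ _ (fun k : 'I_(1 * d) => (bidx k).2) (fun k => mxvec_index 0 k)).
- by congr (\det _); apply/matrixP => a b; rewrite !mxE !ord1.
- by move=> k; rewrite -[RHS]mxvec_bidx (ord1 (bidx k).1).
- by move=> k; rewrite bidxK.
Qed.

Section Reps.
Variables (p : nat) (R : nzRingType) (Q : fieldType) (f : {rmorphism R -> Q}).
Variable ar : arith p f.
Hypothesis p_odd : odd p.
Local Notation I := (ar_I (a := ar)).
Local Notation P := (lp ar).
Local Notation inA := (inA (ar := ar)).
Let p_pr := p_prime ar.

(** The part of a component on which the invariants depend. Without the section [csig], the
    augmentation and representations of quotient groups qualify as well. *)
Record rep (hT : finGroupType) := Rep {
  rF :> cfield ar;
  rd : nat;
  rrho : gring Q hT -> 'M[cK rF]_rd;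
  r_d : exists k, rd = (p ^ k)%N;
  r_B a b : rrho (a - b) = rrho a - rrho b;
  r_M a b : rrho (a * b) = rrho a *m rrho b;
  r_1 : rrho 1 = 1%:M;
  r_in l b : inA l b -> mxin (@cD _ _ _ _ _ rF l) (rrho b)
}.

Section OneRep.
Variables (hT : finGroupType) (s : rep hT).
Local Notation B := (gring Q hT).
Local Notation rho := (@rrho hT s).

Lemma rrho0 : rho 0 = 0. Proof. by rewrite -(subrr 0) r_B subrr. Qed.
Lemma rrhoN a : rho (- a) = - rho a. Proof. by rewrite -sub0r r_B rrho0 sub0r. Qed.
Lemma rrhoD a b : rho (a + b) = rho a + rho b.
Proof. by rewrite -{1}[b]opprK r_B rrhoN opprK. Qed.
Lemma rrho_sum J (r : seq J) (PP : pred J) F :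
  rho (\sum_(i <- r | PP i) F i) = \sum_(i <- r | PP i) rho (F i).
Proof. exact: (big_morph _ rrhoD rrho0). Qed.
Lemma rrho_nat m : rho m%:R = m%:R%:M.
Proof.
elim: m => [|m IH]; first by rewrite rrho0 -scalemx1 scale0r.
by rewrite !mulrS rrhoD IH r_1 raddfD.
Qed.

Definition rmu m n (X : 'M[B]_(m, n)) : 'M[cK s]_(m * rd s, n * rd s) := blk (map_mx rho X).

Lemma rmuM m n k (X : 'M[B]_(m, n)) (Y : 'M[B]_(n, k)) : rmu (X *m Y) = rmu X *m rmu Y.
Proof.
rewrite /rmu -blkM; congr blk; apply/matrixP => i j; rewrite !mxE rrho_sum.
by apply: eq_bigr => h _; rewrite !mxE r_M.
Qed.
Lemma rmuD m n (X Y : 'M[B]_(m, n)) : rmu (X + Y) = rmu X + rmu Y.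
Proof. by rewrite /rmu -blkD; congr blk; apply/matrixP => i j; rewrite !mxE rrhoD. Qed.
Lemma map_rho0 m n : map_mx rho (0 : 'M[B]_(m, n)) = 0.
Proof. by apply/matrixP => i j; rewrite !mxE rrho0. Qed.
Lemma map_rho1 m : map_mx rho (1%:M : 'M[B]_m) = 1%:M.
Proof. by apply/matrixP => i j; rewrite !mxE; case: eqP => _; rewrite ?r_1 ?rrho0. Qed.
Lemma rmu1 m : rmu (1%:M : 'M[B]_m) = 1%:M.
Proof. by rewrite /rmu map_rho1 blk1. Qed.
Lemma rmu_in l m n (X : 'M[B]_(m, n)) : mxin (inA l) X -> mxin (@cD _ _ _ _ _ s l) (rmu X).
Proof. by move=> h i j; rewrite !mxE; apply: r_in. Qed.

Definition rdet r (X : 'M[B]_r) : cK s := \det (rmu X).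
Lemma rdetM r (X Y : 'M[B]_r) : rdet (X *m Y) = rdet X * rdet Y.
Proof. by rewrite /rdet rmuM det_mulmx. Qed.
Lemma rdet1 r : rdet (1%:M : 'M[B]_r) = 1.
Proof. by rewrite /rdet rmu1 det1. Qed.
Lemma rdet_lblock r m (X : 'M[B]_r) Z (W : 'M[B]_m) :
  rdet (block_mx X 0 Z W) = rdet X * rdet W.
Proof. by rewrite /rdet /rmu map_block_mx map_rho0 det_blk_lblock. Qed.
Lemma rdet_ublock r m (X : 'M[B]_r) Z (W : 'M[B]_m) :
  rdet (block_mx X Z 0 W) = rdet X * rdet W.
Proof. by rewrite /rdet /rmu map_block_mx map_rho0 det_blk_ublock. Qed.
Lemma rdet11 (u : B) : rdet (u%:M : 'M_1) = \det (rho u).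
Proof. by rewrite /rdet /rmu det_blk1 !mxE eqxx mulr1n. Qed.
Lemma rdet_diag r (u : B) : rdet (block_mx (u%:M : 'M_1) 0 0 (1%:M : 'M_r)) = \det (rho u).
Proof. by rewrite rdet_lblock rdet1 mulr1 rdet11. Qed.
End OneRep.

Section Residue.
Variables (hT : finGroupType) (m : nat).
Hypothesis oH : #|hT| = (p ^ m)%N.
Local Notation B := (gring Q hT).
Let SA := @inA_subring p R Q f ar hT P.

Lemma c_pcong (F : cfield ar) x y : cong (@cD _ _ _ _ _ F P) p%:R x y -> cong (@cD _ _ _ _ _ F P) (cpi F) x y.
Proof.
move=> [z Dz ->]; have [w Dw] := c_p F; rewrite add0r => Ew.
by exists (w * z); [apply: (subringM (c_sub _ _))|rewrite Ew mulrA].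
Qed.

Lemma c_frobX (F : cfield ar) x t : @cD _ _ _ _ _ F P x ->
  cong (@cD _ _ _ _ _ F P) (cpi F) (x ^+ (p ^ t)) x.
Proof.
move=> Dx; have SD := c_sub F P; elim: t => [|t IH]; first by rewrite expn0 expr1; apply: (cong_refl SD).
rewrite expnSr exprM; apply: (cong_trans SD) (c_frob Dx).
by apply: (congX SD) => //; [exact: c_piD|move=> y; apply: mulrC].
Qed.

(* The group ring is local at p and its residue field is reached through the
   augmentation, so every representation sees the same residue. *)
Lemma residue (s : rep hT) (u : B) c : inA P u -> coprime c p -> cong (I P) p%:R (aug u) c%:R ->
  cong (@cD _ _ _ _ _ s P) (cpi s) (\det (rrho s u)) c%:R.
Proof.
move=> Au cop [z Iz Ez]; have SD := c_sub s P; have SI := ar_sub (a := ar) P.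
have Icv : I P c%:R^-1 by apply: ar_natV; rewrite (ar_lp ar).
have c0 : c%:R != 0 :> Q.
  case: (c) cop => [|c' _]; last exact: (ar_char0 ar).
  by rewrite /coprime gcd0n => /eqP p1; have := prime_gt1 p_pr; rewrite p1.
pose v := sc hT c%:R^-1 * u.
have uE : u = c%:R * v by rewrite /v (natB_scE Q) mulrA -rmorphM /= mulfV // rmorph1 mul1r.
have Av : inA P v by apply: (subringM SA) => //; apply: inA_sc.
have Jv : JI ar (v - 1).
  split; first by apply: (subringB SA) => //; apply: (subring1 SA).
  exists (c%:R^-1 * z); first exact: (subringM SI).
  by rewrite rmorphB rmorph1 /= rmorphM /= aug_sc Ez mulrDr mulVf // add0r addrC addKr mulrCA.
have [t [w Aw Ew]] := unipotent_pow p_odd oH Jv; rewrite [1 + _]addrC subrK in Ew.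
have Dv : @cD _ _ _ _ _ s P (\det (rrho s v)) by apply: (det_in SD); apply: r_in.
have rX (y : B) j : \det (rrho s (y ^+ j)) = \det (rrho s y) ^+ j.
  by elim: j => [|j IH]; rewrite ?r_1 ?det1 // !exprS r_M det_mulmx IH.
have h1 : cong (@cD _ _ _ _ _ s P) p%:R (\det (rrho s v) ^+ (p ^ t)) 1.
  rewrite -rX Ew -[X in cong _ _ _ X](det1 _ (rd s)); apply: (cong_det SD) => [|i j|i j].
  - exact: (subring_nat SD).
  - by rewrite mxE; apply: (subring_nat SD).
  - exists (rrho s w i j); first exact: r_in.
    by rewrite rrhoD r_M r_1 rrho_nat mul_scalar_mx !mxE.
have h2 := cong_trans SD (cong_sym SD (c_frobX t Dv)) (c_pcong h1).
(* The scalar [c] has determinant [c ^ d] with [d] a power of [p], so its residue is again [c] by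
   Frobenius. *)
have [k dk] := r_d s.
rewrite uE r_M det_mulmx rrho_nat det_scalar -[X in cong _ _ _ X]mulr1.
have Dn : @cD _ _ _ _ _ s P c%:R by apply: (subring_nat SD).
apply: (congM SD) => //; [exact: c_piD|by move=> y; apply: mulrC|exact: (subring1 SD)|].
by rewrite dk; apply: c_frobX.
Qed.

Lemma aug_not0 (u u' : B) : inA P u' -> u * u' = 1 -> ~ cong (I P) p%:R (aug u) 0.
Proof.
move=> Au' uu' [z Iz]; rewrite add0r => E.
have /(congr1 (@aug Q hT)) := uu'; rewrite rmorphM rmorph1 /= E => h.
apply: (@ar_ninv _ _ _ _ ar P); rewrite (ar_lp ar).
have -> : p%:R^-1 = z * aug u' by apply: (mulfI (p_neq0 ar)); rewrite mulrA h mulfV ?(p_neq0 ar).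
by apply: (subringM (ar_sub P)) => //; apply: inA_aug.
Qed.

Lemma aug_coprime (u u' : B) : inA P u -> inA P u' -> u * u' = 1 ->
  exists2 c, coprime c p & cong (I P) p%:R (aug u) c%:R.
Proof.
move=> Au Au' uu'; have [c] := ar_res (inA_aug Au); rewrite (ar_lp ar) => hc.
exists c => //; rewrite coprime_sym prime_coprime //; apply/negP => /dvdnP[k kE].
apply: (aug_not0 Au' uu'); apply: (cong_trans (ar_sub P)) hc _.
by exists k%:R; [apply: (subring_nat (ar_sub P))|rewrite kE natrM mulrC add0r].
Qed.

Variables (J : Type) (s : J -> rep hT).

(** At [p] the components are linked: an admissible family consists of the determinants of one and
    the same unit of the local group ring. *)
Definition USp (a : forall j, cK (s j)) := exists u u', [/\ inA P u, inA P u', u * u' = 1, u' * u = 1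
  & forall j, a j = \det (rrho (s j) u)].

Lemma USp_M a b : USp a -> USp b -> USp (fun j => a j * b j).
Proof.
move=> [u [u' [Au Au' h h' E]]] [w [w' [Aw Aw' g g' E']]].
exists (u * w), (w' * u'); split; [exact: (subringM SA)|exact: (subringM SA)| | |].
- by rewrite mulrA -(mulrA u) g mulr1.
- by rewrite mulrA -(mulrA w') h' mulr1.
- by move=> j; rewrite r_M det_mulmx E E'.
Qed.
Lemma USp_unit u u' j : u * u' = 1 -> \det (rrho (s j) u) * \det (rrho (s j) u') = 1.
Proof. by move=> h; rewrite -det_mulmx -r_M h r_1 det1. Qed.
Lemma USp_V a : USp a -> USp (fun j => (a j)^-1).
Proof.
move=> [u [u' [Au Au' h h' E]]]; exists u', u; split=> // j; rewrite E.
have e := USp_unit j h; have u0 : \det (rrho (s j) u) != 0.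
  by apply/eqP => u0; move/eqP: e; rewrite u0 mul0r eq_sym oner_eq0.
by apply: (mulfI u0); rewrite mulfV ?e.
Qed.
Lemma USp_0 a j : USp a -> a j != 0.
Proof.
move=> [u [u' [Au Au' h h' E]]]; rewrite E; apply/eqP => u0.
by have /eqP := USp_unit j h; rewrite u0 mul0r eq_sym oner_eq0.
Qed.

(** Gaussian elimination over the local group ring reduces [h] to a single unit. It takes place
    before any representation is chosen, so that this unit serves all [j] at once. *)
Lemma USp_C r (h h' : 'M[B]_r) : mxin (inA P) h -> mxin (inA P) h' ->
  h *m h' = 1%:M -> h' *m h = 1%:M -> USp (fun j => rdet (s j) h).
Proof.
elim: r h h' => [|r IH] h h' Ah Ah' hh' h'h.
  exists 1, 1; split; rewrite ?mulr1 //; try exact: (subring1 SA).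
  move=> j; rewrite r_1 det1 /rdet; have -> : h = 1%:M by apply/matrixP => -[].
  by rewrite rmu1 det1.
(* A row of an invertible matrix has an entry outside the maximal ideal; adding its column to column
   0 makes the corner entry a unit and preserves all determinants. *)
wlog nu : h h' Ah Ah' hh' h'h / ~ cong (I P) p%:R (aug (h 0 0)) 0.
  move=> W; have [c0|] := pselect (cong (I P) p%:R (aug (h 0 0)) 0); last by move=> nu; apply: (W h h').
  have [j nj] : exists j, ~ cong (I P) p%:R (aug (h 0 j)) 0.
    apply: contrapT => no; have all0 j : cong (I P) p%:R (aug (h 0 j)) 0.
      by apply: contrapT => nj; apply: no; exists j.
    have : cong (I P) p%:R (aug (1 : B)) 0.
      have <- : \sum_k h 0 k * h' k 0 = 1 by have /matrixP/(_ 0 0) := hh'; rewrite !mxE eqxx.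
      rewrite rmorph_sum; elim/big_ind: _ => [|x y hx hy|k _].
      + exact: (cong_refl (ar_sub P)).
      + by rewrite -(addr0 0); apply: (congD (ar_sub P)).
      have [z Iz] := all0 k; rewrite add0r => Ez; exists (z * aug (h' k 0)).
        by apply: (subringM (ar_sub P)) => //; apply: inA_aug.
      by rewrite rmorphM /= Ez add0r mulrA.
    by apply: (@aug_not0 1 1); [exact: (subring1 SA)|rewrite mulr1].
  have j0 : j != 0 by apply/eqP => j0; apply: nj; rewrite j0.
  have Ael (a : B) : a = 1 \/ a = -1 -> mxin (inA P) (elem j 0 a).
    move=> ha k l; rewrite elemE; apply: (subringD SA); first exact: (subring_nat SA).
    apply: (subringM SA); first exact: (subring_nat SA).
    apply: (subringM SA); last exact: (subring_nat SA).
    by case: ha => ->; [|apply: (subringN SA)]; apply: (subring1 SA).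
  have e1 : elem j 0 1 *m elem j 0 (-1) = 1%:M :> 'M[B]_r.+1 by rewrite elem_mul // subrr elem0.
  have e2 : elem j 0 (-1) *m elem j 0 1 = 1%:M :> 'M[B]_r.+1 by rewrite elem_mul // addNr elem0.
  have := W (h *m elem j 0 1) (elem j 0 (-1) *m h') _ _ _ _ _.
  have -> : (fun i => rdet (s i) (h *m elem j 0 1)) = (fun i => rdet (s i) h).
    apply: functional_extensionality_dep => i; rewrite rdetM.
    suff -> : rdet (s i) (elem j 0 1) = 1 by rewrite mulr1.
    have [jb jE] : exists jb : 'I_r, j = lift 0 jb.
      by case: (unliftP 0 j) j0 => [jb -> _|->]; [exists jb|rewrite eqxx].
    have e0 : j = rshift 1 jb :> 'I_(1 + r) by apply: val_inj; rewrite jE.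
    have e3 : 0 = lshift r 0 :> 'I_(1 + r) by apply: val_inj.
    suff : rdet (s i) (elem (rshift 1 jb) (lshift r 0) 1 : 'M[B]_(1 + r)) = 1 by rewrite -e0 -e3; exact.
    have -> : elem (rshift 1 jb) (lshift r 0) 1 = block_mx 1%:M 0 (delta_mx jb 0) 1%:M :> 'M[B]_(1 + r).
      apply/matrixP => k l; rewrite elemE mul1r.
      case: (split_ordP k) => a ->; case: (split_ordP l) => b ->;
        rewrite ?block_mxEul ?block_mxEur ?block_mxEdl ?block_mxEdr !mxE ?eq_shift ?ord1 ?eqxx ?andbT
          ?mulr1 ?mul0r ?mulr0 ?addr0 ?add0r //.
    by rewrite rdet_lblock !rdet1 mulr1.
  apply.
  - by apply: (mxin_mul SA) => //; apply: Ael; left.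
  - by apply: (mxin_mul SA) => //; apply: Ael; right.
  - by have [] := inv_conj hh' h'h e1 e2.
  - by have [] := inv_conj hh' h'h e1 e2.
  have -> : (h *m elem j 0 1) 0 0 = h 0 0 + h 0 j.
    rewrite /elem mulmxDr mulmx1 scale1r mxE; congr (_ + _).
    by rewrite mxE (bigD1 j) //= !mxE !eqxx mulr1 big1 ?addr0 // => k kj; rewrite !mxE (negPf kj) mulr0.
  move=> hc; apply: nj; have -> : aug (h 0 j) = aug (h 0 0 + h 0 j) - aug (h 0 0).
    by rewrite rmorphD addrC addKr.
  by have := congB (ar_sub P) hc c0; rewrite subr0.
have [y Ay [uy yu]] := local_unit p_odd oH (Ah 0 0) nu.
pose H : 'M[B]_(1 + r) := h; pose a := h 0 0.
have HE : H = block_mx (a%:M : 'M_1) (ursubmx H) (dlsubmx H) (drsubmx H).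
  rewrite -[LHS]submxK; congr block_mx; apply/matrixP => i j; rewrite !mxE !ord1 eqxx mulr1n /a.
  by congr (h _ _); apply: val_inj.
pose L : 'M[B]_(1 + r) := block_mx 1%:M 0 (- (dlsubmx H *m y%:M)) 1%:M.
pose L' : 'M[B]_(1 + r) := block_mx 1%:M 0 (dlsubmx H *m y%:M) 1%:M.
pose U : 'M[B]_(1 + r) := block_mx 1%:M (- (y%:M *m ursubmx H)) 0 1%:M.
pose U' : 'M[B]_(1 + r) := block_mx 1%:M (y%:M *m ursubmx H) 0 1%:M.
(* The Schur complement of the unit corner entry; the unipotent factors [L] and [U] have determinant
   1 in every representation. *)
pose W := drsubmx H - dlsubmx H *m y%:M *m ursubmx H.
have E : L *m H *m U = block_mx (a%:M : 'M_1) 0 0 W.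
  rewrite {1}HE /L /U !mulmx_block !mul1mx !mul0mx !mulmx1 !mulmx0 !addr0.
  have ya : y%:M *m a%:M = 1%:M :> 'M[B]_1 by rewrite -scalar_mxM yu.
  have ay : a%:M *m y%:M = 1%:M :> 'M[B]_1 by rewrite -scalar_mxM uy.
  have z1 : - (dlsubmx H *m y%:M) *m a%:M + dlsubmx H = 0.
    by rewrite mulNmx -mulmxA ya mulmx1 addNr.
  rewrite z1 mul0mx add0r; congr block_mx.
    by rewrite mulmxN mulmxA ay mul1mx addNr.
  by rewrite mulNmx addrC.
have LL' : L *m L' = 1%:M.
  by rewrite mulmx_block !mul1mx !mul0mx !mulmx1 !mulmx0 !addr0 ?add0r addNr -scalar_mx_block.
have L'L : L' *m L = 1%:M.
  by rewrite mulmx_block !mul1mx !mul0mx !mulmx1 !mulmx0 !addr0 ?add0r subrr -scalar_mx_block.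
have UU' : U *m U' = 1%:M.
  by rewrite mulmx_block !mul1mx !mul0mx !mulmx1 !mulmx0 !addr0 ?add0r subrr -scalar_mx_block.
have U'U : U' *m U = 1%:M.
  by rewrite mulmx_block !mul1mx !mul0mx !mulmx1 !mulmx0 !addr0 ?add0r addNr -scalar_mx_block.
pose M : 'M[B]_(1 + r) := U' *m (h' : 'M_(1 + r)) *m L'.
have AHu : mxin (inA P) (ursubmx H) by move=> i j; rewrite !mxE.
have AHd : mxin (inA P) (dlsubmx H) by move=> i j; rewrite !mxE.
have Ay1 : mxin (inA P) (y%:M : 'M_1) by move=> i j; rewrite !mxE !ord1 eqxx mulr1n.
have blkA (X : 'M[B]_1) Y Z (V : 'M_r) : mxin (inA P) X -> mxin (inA P) Y -> mxin (inA P) Z ->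
    mxin (inA P) V -> mxin (inA P) (block_mx X Y Z V).
  by move=> hX hY hZ hV; apply: mxin_col_mx; apply: mxin_row_mx.
have A0 k l : mxin (inA P) (0 : 'M[B]_(k, l)) by move=> i j; rewrite mxE; apply: (subring0 SA).
have AL' : mxin (inA P) L'.
  by apply: blkA => //; try exact: (@mxin1 _ _ SA); apply: (mxin_mul SA).
have AU' : mxin (inA P) U'.
  by apply: blkA => //; try exact: (@mxin1 _ _ SA); apply: (mxin_mul SA).
have AM : mxin (inA P) M by apply: (mxin_mul SA) => //; apply: (mxin_mul SA).
have EM : block_mx (a%:M : 'M_1) 0 0 W *m M = 1%:M.
  rewrite -E /M !mulmxA -(mulmxA (L *m H)) UU' mulmx1 -(mulmxA L) hh' mulmx1; exact: LL'.
have ME : M *m block_mx (a%:M : 'M_1) 0 0 W = 1%:M.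
  rewrite -E /M !mulmxA -(mulmxA (U' *m _)) L'L mulmx1 -(mulmxA U') h'h mulmx1; exact: U'U.
have WM : W *m drsubmx M = 1%:M.
  have := congr1 (fun X : 'M_(1 + r) => drsubmx X) EM; rewrite /= -{1}[M]submxK mulmx_block block_mxKdr.
  by rewrite mul0mx add0r scalar_mx_block block_mxKdr.
have MW : drsubmx M *m W = 1%:M.
  have := congr1 (fun X : 'M_(1 + r) => drsubmx X) ME; rewrite /= -{1}[M]submxK mulmx_block block_mxKdr.
  by rewrite mulmx0 add0r scalar_mx_block block_mxKdr.
have AW : mxin (inA P) W.
  apply: (mxin_sub SA); first by move=> i j; rewrite !mxE.
  by apply: (mxin_mul SA) => //; apply: (mxin_mul SA).
have AM' : mxin (inA P) (drsubmx M).
  by move=> i j; have := AM (rshift 1 i) (rshift 1 j); rewrite -{1}[M]submxK block_mxEdr.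
have Ua : USp (fun j => \det (rrho (s j) a)) by exists a, y; split=> //; apply: Ah.
have := USp_M Ua (IH _ _ AW AM' WM MW); congr USp; apply: functional_extensionality_dep => j.
have := congr1 (fun Z : 'M[B]_(1 + r) => rdet (s j) Z) E; rewrite /= [RHS]rdet_lblock rdet11 !rdetM => <-.
by rewrite /L /U rdet_lblock rdet_ublock !rdet1 !mulr1 mul1r.
Qed.

Lemma ibn_gring r r' (X : 'M[B]_(r, r')) (Y : 'M[B]_(r', r)) :
  X *m Y = 1%:M -> Y *m X = 1%:M -> r = r'.
Proof.
have le a b (Z : 'M[B]_(a, b)) W : Z *m W = 1%:M -> (a <= b)%N.
  move=> /(congr1 (map_mx (@aug Q hT))); rewrite map_mxM map_mx1; exact: mulmx1_min.
by move=> h h'; apply/eqP; rewrite eqn_leq (le _ _ _ _ h) (le _ _ _ _ h').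
Qed.

Local Notation F := (gring_map f (gT := hT)).
Let idmu m n (X : 'M[B]_(m, n)) : 'M[B]_(id m, id n) := X.

Definition frameP (N : lmodType (gring R hT)) k (i : {linear N -> 'rV_k}) (t : {linear 'rV_k -> N})
    r (U : 'M[B]_(k, r)) (V : 'M[B]_(r, k)) :=
  [/\ cancel i t, mxin (inA P) U, mxin (inA P) V, V *m U = 1%:M
    & U *m V = mxP t i (tmap F (idfun : {linear N -> N}))].

(** The instance of the package in which [mu] is the identity: frames live over the group ring at
    [p], and representations are applied only to the final matrix. *)
Lemma inv_p : exists v : relK0 F -> forall j, cK (s j),
  [/\ forall x j, v x j != 0, forall m x j, v (relK0_muln m x) j = v x j ^+ m,
      forall x, relK0_eq x [::] -> USp (v x) &
      forall x T r k i t U V k' i' t' U' V', @frameP (rt_src T) k i t r U V ->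
        @frameP (rt_tgt T) k' i' t' r U' V' -> relK0_eq x [:: (false, T)] ->
        eqU USp (v x) (fun j => rdet (s j) (V *m mxP t i' (rt_map T) *m U'))].
Proof.
have [|||||||v [v0 vm vz vf]] := @inv_package _ _ B F (inA P) id idmu SA _ _ _ _ ibn_gring
  J (fun j => cK (s j)) (fun j r X => rdet (s j) X) _ _ _ USp USp_C USp_M USp_V USp_0.
- by [].
- by [].
- by move=> a b X k l; rewrite mxE; apply: inA_map.
- exact: (local_splits p_odd oH).
- by move=> j r X Y; apply: rdetM.
- by move=> j r; apply: rdet1.
- by move=> j r r' X Z W; apply: rdet_lblock.
exists v; split=> // x T r k i t U V k' i' t' U' V' [c1 c2 c3 c4 c5] [d1 d2 d3 d4 d5] hx.
pose F1 : frame F (inA P) idmu (rt_src T) := Frame c1 c2 c3 c4 c5.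
pose F2 : frame F (inA P) idmu (rt_tgt T) := Frame d1 d2 d3 d4 d5.
have [u Uu E] := vf x T F1 F2 hx; exists u => // j; rewrite E; congr (_ * _).
transitivity (dtr (fun j r X => rdet (s j) X) j (V *m mxP t i' (rt_map T) *m U')); first by [].
by rewrite dtr_id.
Qed.
End Residue.

Section AtL.
Variables (hT : finGroupType) (s : rep hT) (l : ar_L ar).
Local Notation B := (gring Q hT).
Local Notation F := (gring_map f (gT := hT)).
Local Notation D := (@cD _ _ _ _ _ s l).
Let SD := c_sub s l.

Definition Dunit (a : cK s) := [/\ a != 0, D a & D a^-1].
Lemma Dunit_M a b : Dunit a -> Dunit b -> Dunit (a * b).
Proof.
move=> [a0 Da Da'] [b0 Db Db']; split; [exact: mulf_neq0|exact: (subringM SD)|].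
by rewrite invfM; apply: (subringM SD).
Qed.
Lemma Dunit_V a : Dunit a -> Dunit a^-1.
Proof. by move=> [a0 Da Da']; split; rewrite ?invr_eq0 ?invrK. Qed.

Lemma D_splits k (e : 'M[cK s]_k) : mxin D e -> e *m e = e -> splits D e.
Proof.
apply: (@idempotent_splits (cK s) D (cK s) (idfun : {rmorphism _ -> _}) SD).
by move=> r e' De' ee' e0; apply: (bezout_unimod SD (@c_bez _ _ _ _ _ s l)).
Qed.

(** Here [mu] is the representation itself, so the frames live over the order [cD l] of one
    component and the invariant is defined up to units of that order alone. *)
Lemma inv_l : exists w : relK0 F -> cK s,
  [/\ forall x, w x != 0, forall m x, w (relK0_muln m x) = w x ^+ m,
      forall x, relK0_eq x [::] -> Dunit (w x) &
      forall x r (N : fgproj _) (phi : {linear tens F (freem _ r) -> tens F N}) (b : bijective phi)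
        k (i : {linear N -> 'rV_k}) (t : {linear 'rV_k -> N})
        (U : 'M_(k * rd s, r * rd s)) (V : 'M_(r * rd s, k * rd s)),
        cancel i t -> mxin D U -> mxin D V -> V *m U = 1%:M ->
        U *m V = rmu s (mxP t i (tmap F (idfun : {linear N -> N}))) ->
        relK0_eq x [:: (false, RelTriple b)] ->
        exists2 u, Dunit u & w x = \det (rmu s (mxP idfun i phi) *m U) * u].
Proof.
pose US (a : unit -> cK s) := Dunit (a tt).
have [|||||||||v [v0 vm vz vf]] := @inv_package _ _ (cK s) F D (fun m => (m * rd s)%N) (@rmu hT s) SD
  (@rmuM hT s) (@rmuD hT s) _ D_splits _ unit (fun=> cK s) (fun _ r X => \det X) _ _ _ US _ _ _ _.
- by move=> a b X; apply: rmu_in => i j; rewrite mxE; apply: inA_map.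
- move=> r r' X Y XY YX; apply/eqP; rewrite eqn_leq (mulmx1_min XY); exact: (mulmx1_min YX).
- by move=> _ r X Y; apply: det_mulmx.
- by move=> _ r; apply: det1.
- by move=> _ r r' X Z W; apply: det_lblock.
- move=> r h h' Dh Dh' hh' h'h; have e : \det h * \det h' = 1 by rewrite -det_mulmx hh' det1.
  have h0 : \det h != 0 by apply/eqP => h0; move/eqP: e; rewrite h0 mul0r eq_sym oner_eq0.
  split=> //; first exact: (det_in SD).
  by have -> : (\det h)^-1 = \det h' by [apply: (mulfI h0); rewrite mulfV]; apply: (det_in SD).
- by move=> a b; apply: Dunit_M.
- by move=> a; apply: Dunit_V.
- by move=> a [] [].
exists (fun x => v x tt); split=> // x r N phi b k i t U V c1 c2 c3 c4 c5 hx.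
have e1 : (1%:M : 'M[cK s]_(r * rd s)) *m 1%:M =
    rmu s (mxP (idfun : {linear 'rV_r -> 'rV_r}) (idfun : {linear 'rV_r -> 'rV_r})
      (tmap F (idfun : {linear freem (gring R hT) r -> freem (gring R hT) r}))).
  rewrite mulmx1 mxP_tmap (_ : map_mx F _ = 1%:M) ?rmu1 // -(map_mx1 F); congr map_mx.
  by apply/matrixP => x1 x2; rewrite !mxE eq_sym.
have d1 := @mxin1 _ _ SD (r * rd s).
pose F1 : frame F D (@rmu hT s) (rt_src (RelTriple b)) :=
  @Frame _ _ _ _ _ _ _ _ r idfun idfun (fun=> erefl) _ _ _ d1 d1 (mul1mx _) e1.
pose F2 : frame F D (@rmu hT s) (rt_tgt (RelTriple b)) := Frame c1 c2 c3 c4 c5.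
have [u Uu E] := vf x _ F1 F2 hx; exists (u tt) => //; rewrite E; congr (_ * _).
transitivity (dtr (fun (_ : unit) r X => \det X : cK s) tt (1%:M *m rmu s (mxP idfun i phi) *m U)).
  by [].
by rewrite dtr_id mul1mx.
Qed.
End AtL.
End Reps.

(** * Elementary matrices: commutators, approximation, local to global *)

Section ElemComm.
Variable S : pzRingType.
(** The Steinberg commutator relation. *)
Lemma elem_comm r (a b c : 'I_r) (x y : S) : a != b -> b != c -> a != c ->
  elem a b x *m elem b c y *m elem a b (- x) *m elem b c (- y) = elem a c (x * y).
Proof.
move=> ab bc ac.
have E : elem a b x *m elem b c y = elem a c (x * y) *m (elem b c y *m elem a b x).
  apply/matrixP => k l; rewrite !elem_mulE !elemE (eq_sym c b) (negPf bc) (eq_sym c a) (negPf ac).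
  rewrite eqxx (_ : false%:R = 0 :> S) // (_ : true%:R = 1 :> S) // mul1r !mul0r !addr0 !mulrDr !mulrA -!addrA.
  by congr (_ + _); rewrite addrCA.
rewrite E -(mulmxA (elem a c _)) -(mulmxA (elem b c y)) (elem_mul _ _ ab) subrr elem0 mulmx1.
by rewrite -mulmxA (elem_mul _ _ bc) subrr elem0 mulmx1.
Qed.

(** The matrix identities of the inductive step of [El_approx]: the approximation error [D] appears
    only conjugated by [g]. *)
Lemma conj_step r (h h' g g' k Ea Ea' Eb Eb' D D' : 'M[S]_r) :
  h *m h' = 1%:M -> h' *m h = 1%:M -> g *m g' = 1%:M -> k = g' *m Ea' ->
  Eb *m Eb' = 1%:M -> Eb' *m Eb = 1%:M -> Eb' *m Ea = D -> Ea' *m Eb = D' ->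
  [/\ Eb *m h *m (h' *m Eb') = 1%:M, h' *m Eb' *m (Eb *m h) = 1%:M,
      h' *m Eb' *m (Ea *m g) = h' *m g *m (g' *m D *m g)
    & k *m (Eb *m h) = g' *m D' *m g *m (g' *m h)].
Proof.
move=> hh' h'h gg' -> b1 b2 <- <-; split.
- by rewrite mulmxA -(mulmxA Eb h h') hh' mulmx1.
- by rewrite mulmxA -(mulmxA h' Eb' Eb) b2 mulmx1.
- by rewrite !mulmxA -(mulmxA h' g g') gg' mulmx1.
- by rewrite !mulmxA -(mulmxA _ g g') gg' mulmx1.
Qed.
End ElemComm.

Section DiagEntry.
Variables (K : comNzRingType) (d : nat) (x : 'I_d).
Definition dg (c : K) : 'M[K]_d := 1%:M + (c - 1) *: delta_mx x x.
Lemma dgM a b : dg a *m dg b = dg (a * b).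
Proof.
rewrite /dg mulmxDl !mulmxDr !mul1mx !mulmx1 -scalemxAl -scalemxAr mul_delta_mx scalerA -!addrA.
by congr (_ + _); rewrite -!scalerDl; congr (_ *: _); ring.
Qed.
Lemma dg1 : dg 1 = 1%:M. Proof. by rewrite /dg subrr scale0r addr0. Qed.
Lemma det_dg c : \det (dg c) = c.
Proof.
have -> : dg c = diag_mx (\row_j (if j == x then c else 1)).
  apply/matrixP => i j; rewrite !mxE; case: (i =P j) => [->|ij]; last first.
    by rewrite mulr0n add0r; case: (i =P x) => [ix|_]; case: (j =P x) => [jx|_] /=; rewrite ?mulr0 //; case: ij; rewrite ix jx.
  by case: (j =P x) => _ /=; rewrite ?mulr1 ?mulr0 ?addr0 ?mulr1n // addrC subrK.
rewrite det_diag (bigD1 x) //= mxE eqxx big1 ?mulr1 // => j jx; by rewrite mxE (negPf jx).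
Qed.
Lemma dg_in (D : K -> Prop) c : subring_pred D -> D c -> mxin D (dg c).
Proof.
move=> SD Dc i j; rewrite !mxE; apply: (subringD SD); first exact: (subring_nat SD).
apply: (subringM SD); last exact: (subring_nat SD).
by apply: (subringB SD) => //; apply: (subring1 SD).
Qed.
End DiagEntry.

Section Approximation.
Variables (p : nat) (R : nzRingType) (Q : fieldType) (f : {rmorphism R -> Q}).
Variable ar : arith p f.
Variable gT : finGroupType.
Local Notation I := (ar_I (a := ar)).
Local Notation inA := (inA (ar := ar)).
Local Notation B := (gring Q gT).
Let SA l := @inA_subring p R Q f ar gT l.

Lemma inA_approx l (a : B) t : exists2 a', (forall l', l' != l -> inA l' a')
  & exists2 z, inA l z & a - a' = (lam l)%:R ^+ t * z.
Proof.
have h g : exists q, (forall l', l' != l -> I l' q) /\ exists2 z, I l z & a g = q + (lam l)%:R ^+ t * z.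
  by have [q h1 h2] := ar_approx (a := ar) l (a g) t; exists q; split.
pose q g := projT1 (cid (h g)).
have hq g : (forall l', l' != l -> I l' (q g)) /\ exists2 z, I l z & a g = q g + (lam l)%:R ^+ t * z.
  by rewrite /q; case: cid.
have h2 g : exists z, I l z /\ a g = q g + (lam l)%:R ^+ t * z by have [_ [z]] := hq g; exists z.
pose z g := projT1 (cid (h2 g)).
have hz g : I l (z g) /\ a g = q g + (lam l)%:R ^+ t * z g by rewrite /z; case: cid.
exists ([ffun g => q g] : B); first by move=> l' nl g; rewrite ffunE; case: (hq g) => h1 _; apply: h1.
exists ([ffun g => z g] : B); first by move=> g; rewrite ffunE; case: (hz g).
apply/ffunP => g; rewrite -natrX natr_gringE natrX !ffunE; have [_ ->] := hz g.
by rewrite addrC addKr.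
Qed.

Lemma mx_den l m n (X : 'M[B]_(m, n)) : exists N, forall i j, inA l ((lam l)%:R ^+ N * X i j).
Proof.
have h i j := inA_den l (X i j); pose N i j := projT1 (cid (h i j)).
have hN i j : inA l ((lam l)%:R ^+ N i j * X i j) by rewrite /N; case: cid.
exists (\sum_i \sum_j N i j)%N => i j; rewrite (bigD1 i) //= (bigD1 j) //= -addnA addnC exprD -mulrA.
by apply: (subringM (SA l)) => //; apply: (subringX (SA l)); apply: (subring_nat (SA l)).
Qed.

(** Conjugation introduces only bounded denominators at [l], so a sufficiently divisible [c] stays
    integral. *)
Lemma El_conj_in l r (g g' : 'M[B]_r) i j : g' *m g = 1%:M ->
  exists t, forall c, (exists2 z, inA l z & c = (lam l)%:R ^+ t * z) ->
    mxin (inA l) (g' *m elem i j c *m g).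
Proof.
move=> g'g; have [N HN] := mx_den l g; have [N' HN'] := mx_den l g'.
exists (N' + N)%N => c [z Az ->] x y.
rewrite mulmxDr mulmxDl mulmx1 g'g mxE; apply: (subringD (SA l)).
  by rewrite mxE; apply: (subring_nat (SA l)).
rewrite -mulmxA -scalemxAl mxE (bigD1 i) //= big1 ?addr0; last first.
  by move=> k ki; rewrite mxE mul_delta_mx_scale (negPf ki) mul0r !mulr0.
rewrite mxE mul_delta_mx_scale eqxx mul1r.
have -> : g' x i * ((lam l)%:R ^+ (N' + N) * z * g j y) =
  ((lam l)%:R ^+ N' * g' x i) * z * ((lam l)%:R ^+ N * g j y).
  rewrite exprD -!natrX !mulrA; congr (_ * _); rewrite -(natr_comm _ (g' x i)).
  by rewrite -[LHS]mulrA -[RHS]mulrA; congr (_ * _); exact: natr_comm.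
by apply: (subringM (SA l)) => //; apply: (subringM (SA l)).
Qed.

Lemma inA_lamN l t (c : B) : (exists2 z, inA l z & c = (lam l)%:R ^+ t * z) ->
  exists2 z, inA l z & - c = (lam l)%:R ^+ t * z.
Proof. by move=> [z Az ->]; exists (- z); [exact: (subringN (SA l))|rewrite mulrN]. Qed.

Lemma elem_in l r (i j : 'I_r) (a : B) : inA l a -> mxin (inA l) (elem i j a).
Proof.
move=> Aa x y; rewrite elemE; apply: (subringD (SA l)); first exact: (subring_nat (SA l)).
apply: (subringM (SA l)); first exact: (subring_nat (SA l)).
by apply: (subringM (SA l)) => //; apply: (subring_nat (SA l)).
Qed.

(** Strong approximation, one elementary factor at a time: each coefficient is replaced by one that
    is integral at all other primes and close to it at [l]. The result agrees with [g] at [l] up to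
    integral invertible matrices. *)
Lemma El_approx l r (g : 'M[B]_r) : El g -> forall g', g *m g' = 1%:M -> g' *m g = 1%:M ->
  exists h h', [/\ El h, h *m h' = 1%:M /\ h' *m h = 1%:M,
    forall l', l' != l -> mxin (inA l') h /\ mxin (inA l') h',
    mxin (inA l) (h' *m g) & mxin (inA l) (g' *m h)].
Proof.
elim=> [|i j a g0 ij Eg0 IH] g' gg' g'g.
  have -> : g' = 1%:M by rewrite -[g']mul1mx.
  exists 1%:M, 1%:M; rewrite !mulmx1; split=> //; [exact: El_one|move=> l' _; split|..]; exact: (@mxin1 _ _ (SA _)).
pose g0' := g' *m elem i j a.
have g0'g0 : g0' *m g0 = 1%:M by rewrite -mulmxA.
have e1 : elem i j a *m elem i j (- a) = 1%:M by rewrite elem_mul // subrr elem0.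
have e2 : elem i j (- a) *m elem i j a = 1%:M by rewrite elem_mul // addNr elem0.
have g'E : g' = g0' *m elem i j (- a) by rewrite -mulmxA e1 mulmx1.
have g0g0' : g0 *m g0' = 1%:M.
  have := congr1 (fun X => elem i j (- a) *m X *m elem i j a) gg'.
  by rewrite /= !mulmxA e2 mul1mx mulmx1 e2 -mulmxA.
have [h [h' [Eh [hh' h'h] hl hA gA]]] := IH g0' g0g0' g0'g0.
(* The precision [t] depends on the factors already treated, since the error [a - b] will be
   conjugated by [g0]. *)
have [t Ht] := El_conj_in l i j g0'g0.
have [b bl hb] := inA_approx l a t.
have b1 : elem i j b *m elem i j (- b) = 1%:M :> 'M[B]_r by rewrite elem_mul // subrr elem0.
have b2 : elem i j (- b) *m elem i j b = 1%:M :> 'M[B]_r by rewrite elem_mul // addNr elem0.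
have eD : elem i j (- b) *m elem i j a = elem i j (a - b) by rewrite (elem_mul _ _ ij) addrC.
have eD' : elem i j (- a) *m elem i j b = elem i j (- (a - b)).
  by rewrite (elem_mul _ _ ij); congr (elem i j _); rewrite opprB addrC.
have [c1 c2 c3 c4] := conj_step hh' h'h g0g0' g'E b1 b2 eD eD'.
exists (elem i j b *m h), (h' *m elem i j (- b)); split.
- exact: El_step.
- by split.
- move=> l' nl; have [h1 h2] := hl l' nl; have Ab := bl l' nl.
  split; [apply: (mxin_mul (SA l') _ h1)|apply: (mxin_mul (SA l') h2)]; apply: elem_in.
    exact: Ab.
  exact: (subringN (SA l') Ab).
- rewrite c3; exact: (mxin_mul (SA l) hA (Ht _ hb)).
- rewrite c4; exact: (mxin_mul (SA l) (Ht _ (inA_lamN hb)) gA).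
Qed.

Lemma fin_bad m n (X : 'M[B]_(m, n)) : exists s : seq (ar_L ar), forall l, l \notin s -> mxin (inA l) X.
Proof.
have h (w : 'I_m * 'I_n * gT) := ar_fin ar (X w.1.1 w.1.2 w.2).
pose s w := projT1 (cid (h w)).
have hs w l : l \notin s w -> I l (X w.1.1 w.1.2 w.2) by rewrite /s; case: cid => s' h'; apply: h'.
exists (flatten [seq s w | w <- enum {: 'I_m * 'I_n * gT}]) => l nl i j g.
apply: (hs (i, j, g)); apply: contra nl => ls; apply/flattenP; exists (s (i, j, g)) => //.
by apply: map_f; rewrite mem_enum.
Qed.

(** [X] and [Y] are integral outside a finite set of primes. These are repaired one at a time, and a
    repair that is integral at the other primes does not disturb them. *)
Lemma El_global r n (X : 'M[B]_(r, n)) (Y : 'M[B]_(n, r)) :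
  (forall l, exists E E', [/\ El E, E *m E' = 1%:M, E' *m E = 1%:M, mxin (inA l) (E' *m X)
     & mxin (inA l) (Y *m E)]) ->
  exists E E', [/\ El E, E *m E' = 1%:M, E' *m E = 1%:M, forall l, mxin (inA l) (E' *m X)
     & forall l, mxin (inA l) (Y *m E)].
Proof.
have [s1 h1] := fin_bad X; have [s2 h2] := fin_bad Y.
have : forall l, l \notin s1 ++ s2 -> mxin (inA l) X /\ mxin (inA l) Y.
  by move=> l; rewrite mem_cat negb_or => /andP[/h1 ? /h2 ?].
elim: (s1 ++ s2) X Y {h1 h2} => [|l s IH] X Y good loc.
  exists 1%:M, 1%:M; rewrite !mulmx1; split=> //; first exact: El_one.
    by move=> l; rewrite mul1mx; case: (good l isT).
  by move=> l; case: (good l isT).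
have [E [E' [EE h1 h2 h3 h4]]] := loc l.
have [h [h' [Eh [hh' h'h] hl hA gA]]] := El_approx l EE h1 h2.
have [|l'|F [F' [EF FF' F'F hX hY]]] := IH (h' *m X) (Y *m h).
- move=> l' nl'; have [->|ll'] := eqVneq l' l.
    split.
      have -> : h' *m X = (h' *m E) *m (E' *m X) by rewrite !mulmxA -(mulmxA h') h1 mulmx1.
      exact: (mxin_mul (SA l)).
    have -> : Y *m h = (Y *m E) *m (E' *m h) by rewrite !mulmxA -(mulmxA Y) h1 mulmx1.
    exact: (mxin_mul (SA l)).
  have [gX gY] : mxin (inA l') X /\ mxin (inA l') Y by apply: good; rewrite inE negb_or ll'.
  by have [a1 a2] := hl l' ll'; split; apply: (mxin_mul (SA l')).
- have [G [G' [EG GG' G'G GX GY]]] := loc l'.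
  have [k [Ek hk kh]] := El_inv Eh.
  have kE : k = h' by rewrite -[k]mul1mx -h'h -mulmxA hk mulmx1.
  exists (h' *m G), (G' *m h); split.
  + by rewrite -kE; apply: El_mul.
  + by rewrite mulmxA -(mulmxA h') GG' mulmx1; exact: h'h.
  + by rewrite mulmxA -(mulmxA G') hh' mulmx1; exact: G'G.
  + by rewrite mulmxA -(mulmxA G') hh' mulmx1; exact: GX.
  + by rewrite mulmxA -(mulmxA Y) hh' mulmx1; exact: GY.
exists (h *m F), (F' *m h'); split.
- exact: El_mul.
- by rewrite mulmxA -(mulmxA h) FF' mulmx1; exact: hh'.
- by rewrite mulmxA -(mulmxA F') h'h mulmx1; exact: F'F.
- by move=> l'; rewrite -mulmxA; exact: hX.
- by move=> l'; rewrite mulmxA; exact: hY.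
Qed.
End Approximation.

Arguments csig {p R Q f ar gT n} _ _.
Arguments crho {p R Q f ar gT n} _ _.

(** * The vanishing criterion and powers of unit families *)

Section Main.
Variables (p : nat) (R : nzRingType) (Q : fieldType) (f : {rmorphism R -> Q}).
Variable ar : arith p f.
Hypothesis p_odd : odd p.
Variables (gT : finGroupType) (n : nat).
Hypothesis oG : #|gT| = (p ^ n)%N.
Variables (J : finType) (k : J -> scomp ar gT n).
Hypothesis orth : forall i j, i != j -> ce (k i) * ce (k j) = 0.
Hypothesis sum1 : \sum_i ce (k i) = 1.
Local Notation I := (ar_I (a := ar)).
Local Notation P := (lp ar).
Local Notation inA := (inA (ar := ar)).
Local Notation B := (gring Q gT).
Local Notation F := (gring_map f (gT := gT)).
Local Notation D i l := (@cD _ _ _ _ _ (k i) l).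
Let SA l := @inA_subring p R Q f ar gT l.

Definition comp_rep (i : J) : rep ar gT := @Rep p R Q f ar gT (k i) (cd (k i)) (crho (k i)) (c_d (k i))
  (@c_rhoB _ _ _ _ _ _ _ (k i)) (@c_rhoM _ _ _ _ _ _ _ (k i)) (c_rho1 (k i)) (@c_rhoin _ _ _ _ _ _ _ (k i)).
Local Notation s := comp_rep.
Local Notation mu i := (rmu (s i)).

Lemma rho_sig_off i j X : i != j -> crho (k i) (csig (k j) X) = 0.
Proof.
move=> ij; rewrite -sig_cer c_rhoM -[crho (k i) (ce (k j))]mul1mx -(rho_ce (k i)) -c_rhoM orth //.
by rewrite rho0 mulmx0.
Qed.

Lemma rho_inj x y : (forall i, crho (k i) x = crho (k i) y) -> x = y.
Proof.
move=> E; rewrite -[x]mulr1 -[y]mulr1 -sum1 !mulr_sumr; apply: eq_bigr => i _.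
by rewrite -!c_sr E.
Qed.

Definition smx i m r (X : 'M[cK (k i)]_(m * cd (k i), r * cd (k i))) : 'M[B]_(m, r) :=
  map_mx (csig (k i)) (unblk X).
Lemma mu_smx i m r (X : 'M[cK (k i)]_(m * cd (k i), r * cd (k i))) : mu i (smx X) = X.
Proof.
rewrite -[RHS]unblkK /rmu /smx; congr blk; apply/matrixP => a b.
by rewrite [LHS]mxE [X in rrho _ X]mxE; exact: c_rs.
Qed.
Lemma mu_smx_off i j m r (X : 'M[cK (k j)]_(m * cd (k j), r * cd (k j))) : i != j -> mu i (smx X) = 0.
Proof.
move=> ij; apply/matrixP => a b; rewrite !mxE.
by rewrite [X in (X : 'M__) _ _](rho_sig_off _ ij) mxE.
Qed.
Lemma mu_inj m r (X Y : 'M[B]_(m, r)) : (forall i, mu i X = mu i Y) -> X = Y.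
Proof.
move=> E; apply/matrixP => a b; apply: rho_inj => i.
have /(congr1 (@unblk _ _ _ _)) := E i; rewrite !blkK => /matrixP/(_ a b).
by rewrite !mxE.
Qed.
Definition cmb m r (Z : forall i, 'M[cK (k i)]_(m * cd (k i), r * cd (k i))) : 'M[B]_(m, r) :=
  \sum_i smx (Z i).
Lemma mu_sum i m r (h : J -> 'M[B]_(m, r)) : mu i (\sum_j h j) = \sum_j mu i (h j).
Proof.
apply: (big_morph _ (@rmuD _ _ _ _ _ _ (s i) m r)).
by rewrite /rmu map_rho0; apply/matrixP => a b; rewrite !mxE.
Qed.
Lemma mu_cmb i m r Z : mu i (@cmb m r Z) = Z i.
Proof.
rewrite mu_sum (bigD1 i) //= mu_smx big1 ?addr0 // => j ji.
by apply: mu_smx_off; rewrite eq_sym.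
Qed.
Lemma cmb_in l m r Z : l != P -> (forall i, mxin (D i l) (Z i)) -> mxin (inA l) (@cmb m r Z).
Proof.
move=> lP DZ a b; rewrite summxE; apply: (subring_sum (SA l)) => i _; rewrite mxE.
by apply: c_sigin => // x y; rewrite !mxE; apply: DZ.
Qed.

(** The matrix over the group ring that is [h] in component [i] and the identity in all the
    others. *)
Definition Lf i r (h : 'M[cK (k i)]_(r * cd (k i))) : 'M[B]_r := smx (h - 1%:M) + 1%:M.
Lemma mu_Lf i r (h : 'M[cK (k i)]_(r * cd (k i))) : mu i (Lf h) = h.
Proof. by rewrite rmuD mu_smx rmu1 subrK. Qed.
Lemma mu_Lf_off i j r (h : 'M[cK (k j)]_(r * cd (k j))) : i != j -> mu i (Lf h) = 1%:M.
Proof. by move=> ij; rewrite rmuD mu_smx_off // rmu1 add0r. Qed.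
Lemma Lf_M i r (g h : 'M[cK (k i)]_(r * cd (k i))) : Lf (g *m h) = Lf g *m Lf h.
Proof.
apply: mu_inj => j; rewrite rmuM; have [->|ji] := eqVneq j i; first by rewrite !mu_Lf.
by rewrite !mu_Lf_off // mulmx1.
Qed.
Lemma Lf_1 i r : Lf (1%:M : 'M[cK (k i)]_(r * cd (k i))) = 1%:M.
Proof.
apply: mu_inj => j; have [->|ji] := eqVneq j i; first by rewrite mu_Lf rmu1.
by rewrite mu_Lf_off // rmu1.
Qed.

Lemma Lf_elem i r (a b : 'I_r) x y (c : cK (k i)) :
  Lf (elem (mxvec_index a x) (mxvec_index b y) c) = elem a b (csig (k i) (c *: delta_mx x y)).
Proof.
have eE : elem (mxvec_index a x) (mxvec_index b y) c - 1%:M = c *: delta_mx (mxvec_index a x) (mxvec_index b y).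
  by rewrite /elem addrC addKr.
rewrite /Lf eE addrC /elem; congr (_ + _); apply/matrixP => a' b'.
rewrite [LHS]mxE [RHS]mxE [X in _ * X]mxE.
have mE a1 x1 a2 x2 : (@mxvec_index r (cd (k i)) a1 x1 == mxvec_index a2 x2) = (a1 == a2) && (x1 == x2).
  by rewrite -xpair_eqE -(can_eq (f := fun u : 'I_r * 'I_(cd (k i)) => mxvec_index u.1 u.2) (g := @bidx _ r)) // => -[u v]; rewrite bidxK.
case: (a' =P a) => [->|na]; [case: (b' =P b) => [->|nb]|] => /=; rewrite ?mulr1 ?mulr0.
- by congr (csig (k i) _); apply/matrixP => x' y'; rewrite !mxE !mE !eqxx.
- rewrite -(sig0 (k i)); congr (csig (k i) _); apply/matrixP => x' y'; rewrite !mxE !mE.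
  by move/eqP/negPf: nb => ->; rewrite /= andbF mulr0.
- rewrite -(sig0 (k i)); congr (csig (k i) _); apply/matrixP => x' y'; rewrite !mxE !mE.
  by move/eqP/negPf: na => ->; rewrite /= mulr0.
Qed.

(** An elementary matrix joining two positions of the same diagonal block is not elementary over the
    group ring. It is a commutator of matrices passing through another block, whence [1 < r]. *)
Lemma El_Lf i r (h : 'M[cK (k i)]_(r * cd (k i))) : (1 < r)%N -> El h -> El (Lf h).
Proof.
move=> r1; elim=> [|a b c g ab _ IH]; first by rewrite Lf_1; apply: El_one.
rewrite Lf_M; apply: El_mul => // {g IH}.
rewrite -[a]mxvec_bidx -[b]mxvec_bidx in ab *.
case: (bidx a) (bidx b) ab => [a1 a2] [b1 b2] /= ab {a b}.
have [ab1|ab1] := eqVneq a1 b1; last by rewrite Lf_elem; apply: El_elem.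
subst b1; have [g ga] : exists g : 'I_r, a1 != g.
  have r0 : (0 < r)%N by apply: ltnW.
  have [e|e] := eqVneq a1 (Ordinal r0); last by exists (Ordinal r0).
  by exists (Ordinal r1); rewrite e.
have mI a' x' b' y' : @mxvec_index r (cd (k i)) a' x' = mxvec_index b' y' -> a' = b' /\ x' = y'.
  by move/(congr1 (@bidx _ r)); rewrite !bidxK => -[].
have n1 : mxvec_index a1 a2 != mxvec_index g b2 by apply: contra ga => /eqP/mI[->].
have n2 : mxvec_index g b2 != mxvec_index a1 b2 by apply: contra ga => /eqP/mI[->].
rewrite -[c]mulr1 -(elem_comm c 1 n1 n2 ab) !Lf_M !Lf_elem.
have ga' : g != a1 by rewrite eq_sym.
by do !apply: El_mul; apply: El_elem.
Qed.

(** Over fields determinant 1 suffices to be elementary, and [g] is the product of its finitely many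
    components, each lifted by [Lf]. *)
Lemma det1_El r (g : 'M[B]_r) : (1 < r)%N -> (forall i, rdet (s i) g = 1) -> El g.
Proof.
move=> r1 dg.
have key (q : seq J) : uniq q -> exists2 h, El h & forall j, mu j h = if j \in q then mu j g else 1%:M.
  elim: q => [|i q IH] /=; first by exists 1%:M; [exact: El_one|move=> j; rewrite rmu1].
  case/andP=> iq /IH[h Eh hE]; exists (Lf (mu i g : 'M[cK (k i)]_(r * cd (k i))) *m h).
    by apply: El_mul => //; apply: El_Lf => //; apply: SL_El; exact: dg.
  move=> j; rewrite rmuM hE inE; have [->|ji] := eqVneq j i.
    by rewrite (negPf iq) mulmx1 mu_Lf.
  by rewrite mu_Lf_off // mul1mx.
have [h Eh hE] := key _ (enum_uniq J).
by rewrite (_ : g = h) //; apply: mu_inj => j; rewrite hE mem_enum.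
Qed.

Definition vP := projT1 (cid (inv_p p_odd oG s)).
Lemma vP_spec : [/\ forall x j, vP x j != 0, forall m x j, vP (relK0_muln m x) j = vP x j ^+ m,
      forall x, relK0_eq x [::] -> USp (vP x) &
      forall x T r k i t U V k' i' t' U' V', @frameP _ _ _ _ ar _ (rt_src T) k i t r U V ->
        @frameP _ _ _ _ ar _ (rt_tgt T) k' i' t' r U' V' -> relK0_eq x [:: (false, T)] ->
        eqU (USp (s := s)) (vP x) (fun j => rdet (s j) (V *m mxP t i' (rt_map T) *m U'))].
Proof. by rewrite /vP; case: cid. Qed.
Definition wL i l := projT1 (cid (inv_l (s i) l)).
Lemma wL_spec i l : [/\ forall x, wL i l x != 0, forall m x, wL i l (relK0_muln m x) = wL i l x ^+ m,
      forall x, relK0_eq x [::] -> Dunit l (wL i l x) &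
      forall x r (N : fgproj _) (phi : {linear tens F (freem _ r) -> tens F N}) (b : bijective phi)
        k (i' : {linear N -> 'rV_k}) (t : {linear 'rV_k -> N})
        (U : 'M_(k * rd (s i), r * rd (s i))) (V : 'M_(r * rd (s i), k * rd (s i))),
        cancel i' t -> mxin (@cD _ _ _ _ _ (s i) l) U -> mxin (@cD _ _ _ _ _ (s i) l) V -> V *m U = 1%:M ->
        U *m V = rmu (s i) (mxP t i' (tmap F (idfun : {linear N -> N}))) ->
        relK0_eq x [:: (false, RelTriple b)] ->
        exists2 u, Dunit (s := s i) l u & wL i l x = \det (rmu (s i) (mxP idfun i' phi) *m U) * u].
Proof. by rewrite /wL; case: cid. Qed.

Lemma mx_id_tmap r : mxP (idfun : {linear 'rV_r -> 'rV_r}) (idfun : {linear 'rV_r -> 'rV_r})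
  (tmap F (idfun : {linear freem (gring R gT) r -> freem (gring R gT) r})) = 1%:M.
Proof.
rewrite mxP_tmap -(map_mx1 F); congr map_mx.
by apply/matrixP => x1 x2; rewrite !mxE eq_sym.
Qed.

Lemma frame_pair (S : pzRingType) r q r' (X : 'M[S]_(r, q)) (Y : 'M[S]_(q, r)) (e : 'M[S]_q)
    (U : 'M[S]_(q, r')) (V : 'M[S]_(r', q)) :
  X *m Y = 1%:M -> Y *m X = e -> V *m U = 1%:M -> U *m V = e ->
  [/\ X *m U *m (V *m Y) = 1%:M, V *m Y *m (X *m U) = 1%:M, V *m Y *m X = V & Y *m (X *m U) = U].
Proof.
move=> XY YX VU UV; split.
- by rewrite mulmxA -(mulmxA X U V) UV -YX (mulmxA X Y X) XY mul1mx.
- by rewrite mulmxA -(mulmxA V Y X) YX -UV (mulmxA V U V) VU mul1mx.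
- by rewrite -mulmxA YX -UV mulmxA VU mul1mx.
- by rewrite mulmxA YX -UV -mulmxA VU mulmx1.
Qed.

(** [X *m U] expresses [phi] in the local basis. Multiplying it by the inverse of a diagonal matrix
    with one entry [u] brings all component determinants to 1 without losing integrality, and
    [det1_El] makes the result elementary. *)
Lemma local_El l r q (X : 'M[B]_(r.+2, q)) (Y : 'M[B]_(q, r.+2)) (e : 'M[B]_q)
    (U : 'M[B]_(q, r.+2)) (V : 'M[B]_(r.+2, q)) u u' :
  X *m Y = 1%:M -> Y *m X = e -> V *m U = 1%:M -> U *m V = e ->
  mxin (inA l) U -> mxin (inA l) V -> inA l u -> inA l u' -> u * u' = 1 -> u' * u = 1 ->
  (forall i, rdet (s i) (X *m U) = \det (rrho (s i) u)) ->
  exists E E', [/\ El E, E *m E' = 1%:M, E' *m E = 1%:M, mxin (inA l) (E' *m X)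
     & mxin (inA l) (Y *m E)].
Proof.
move=> XY YX VU UV AU AV Au Au' uu' u'u dG.
have [G1 G2 G3 G4] := frame_pair XY YX VU UV.
pose h w : 'M[B]_(1 + r.+1) := block_mx (w%:M : 'M_1) 0 0 1%:M.
have hM w w' : w * w' = 1 -> h w *m h w' = 1%:M.
  move=> ww'; rewrite mulmx_block !mulmx0 !mul0mx !mulmx1 !addr0 ?add0r -scalar_mxM ww'.
  by rewrite -scalar_mx_block.
have hA w : inA l w -> mxin (inA l) (h w).
  move=> Aw; have A0 a b : mxin (inA l) (0 : 'M[B]_(a, b)) by move=> x y; rewrite mxE; apply: (subring0 (SA l)).
  apply: mxin_col_mx; apply: mxin_row_mx => //; last exact: (@mxin1 _ _ (SA l)).
  by move=> x y; rewrite mxE !ord1 eqxx mulr1n.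
have hd i w : rdet (s i) (h w) = \det (rrho (s i) w) by exact: rdet_diag.
pose h1 : 'M[B]_r.+2 := h u; pose h2 : 'M[B]_r.+2 := h u'.
have h21 : h2 *m h1 = 1%:M by exact: hM.
have h12 : h1 *m h2 = 1%:M by exact: hM.
have [c1 c2] := inv_conj G1 G2 h21 h12.
exists (X *m U *m h2), (h1 *m (V *m Y)); split=> //.
- apply: det1_El => // i; rewrite rdetM dG.
  have -> : rdet (s i) h2 = \det (rrho (s i) u') by exact: hd.
  by rewrite -det_mulmx -r_M uu' r_1 det1.
- by rewrite -mulmxA G3; apply: (mxin_mul (SA l)) => //; exact: hA.
- by rewrite mulmxA G4; apply: (mxin_mul (SA l)) => //; exact: hA.
Qed.

Lemma rho_sum_sig i (Z : forall j, 'M[cK (k j)]_(cd (k j))) :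
  crho (k i) (\sum_j csig (k j) (Z j)) = Z i.
Proof.
rewrite rho_sum (bigD1 i) //= c_rs big1 ?addr0 // => j ji.
by apply: rho_sig_off; rewrite eq_sym.
Qed.

(** Trivial invariants provide at each prime a local unit with the right determinants, hence an
    elementary matrix making [phi] integral there; [El_global] merges them and [free_triple_zero]
    concludes. *)
Lemma vanish y : USp (s := s) (vP y) -> (forall l i, l != P -> Dunit (s := s i) l (wL i l y)) ->
  relK0_eq y [::].
Proof.
move=> hU hD; have [r [N [phi [b [r2 hy]]]]] := relK0_rep y 2.
case: r => [|[|r]] // in phi b r2 hy *.
case: (b) => psi0 phiK psiK; pose psi := mk_linear (can_linear phiK psiK).
have [q [i0 [t0 [_ it]]]] := fgproj_section N 0.
pose idr := (idfun : {linear 'rV[gring R gT]_r.+2 -> 'rV[gring R gT]_r.+2}).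
pose X : 'M[B]_(r.+2, q) := mxP idr i0 phi.
pose Y : 'M[B]_(q, r.+2) := mxP t0 idr psi.
pose eps : 'M[B]_q := mxP t0 i0 (tmap F (idfun : {linear N -> N})).
have XY : X *m Y = 1%:M.
  rewrite mxP_comp // -mx_id_tmap; apply: eq_mxP => u; rewrite tmap_id //=; apply: phiK.
have YX : Y *m X = eps.
  rewrite mxP_comp //; apply: eq_mxP => u; rewrite tmap_id //=; apply: psiK.
have ee : eps *m eps = eps by rewrite -YX mulmxA -(mulmxA Y X Y) XY mulmx1.
have Ae l : mxin (inA l) eps by move=> x z; rewrite /eps mxP_tmap mxE; apply: inA_map.
have [v0 vm vz vf] := vP_spec.
have loc l : exists E E', [/\ El E, E *m E' = 1%:M, E' *m E = 1%:M, mxin (inA l) (E' *m X)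
     & mxin (inA l) (Y *m E)].
  have [->|lP] := eqVneq l P.
    have [r' [U [V [AU AV VU UV]]]] := local_splits p_odd oG (Ae P) ee.
    have [G1 G2 _ _] := frame_pair XY YX VU UV.
    have er := ibn_gring G1 G2; subst r'.
    have f1 : @frameP _ _ _ _ ar _ (freem (gring R gT) r.+2) r.+2 idfun idfun r.+2 1%:M 1%:M.
      split=> //; try exact: (@mxin1 _ _ (SA P)); first exact: mul1mx.
      by rewrite mulmx1 mx_id_tmap.
    have f2 : @frameP _ _ _ _ ar _ N q i0 t0 r.+2 U V by split.
    have [u0 Uu0 Eu0] := vf y (RelTriple b) _ _ _ _ _ _ _ _ _ _ _ f1 f2 hy.
    have [u [u' [Au Au' uu' u'u Eu]]] := USp_M hU (USp_V Uu0).
    apply: (local_El XY YX VU UV AU AV Au Au' uu' u'u) => i; rewrite -Eu Eu0 mul1mx mulfK //.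
    exact: USp_0 Uu0.
  have ex i : exists Z : 'M[cK (k i)]_(q * cd (k i), r.+2 * cd (k i)) * 'M[cK (k i)]_(r.+2 * cd (k i), q * cd (k i)),
      [/\ mxin (D i l) Z.1, mxin (D i l) Z.2, Z.2 *m Z.1 = 1%:M & Z.1 *m Z.2 = mu i eps].
    have [|r' [U [V [AU AV VU UV]]]] := @D_splits _ _ _ _ _ _ (s i) l _ (mu i eps) (rmu_in (s := s i) (Ae l)).
      by rewrite -rmuM ee.
    have mXY : mu i X *m mu i Y = 1%:M by rewrite -rmuM XY rmu1.
    have mYX : mu i Y *m mu i X = mu i eps by rewrite -rmuM YX.
    have [G1 G2 _ _] := frame_pair mXY mYX VU UV.
    have er : r' = (r.+2 * cd (k i))%N.
      by apply/eqP; rewrite eqn_leq (mulmx1_min G2) (mulmx1_min G1).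
    by subst r'; exists (U, V).
  pose Z i := projT1 (cid (ex i)).
  have hZ i : [/\ mxin (D i l) (Z i).1, mxin (D i l) (Z i).2, (Z i).2 *m (Z i).1 = 1%:M
    & (Z i).1 *m (Z i).2 = mu i eps] by rewrite /Z; case: cid.
  pose U := cmb (fun i => (Z i).1); pose V := cmb (fun i => (Z i).2).
  have AU : mxin (inA l) U by apply: cmb_in => // i; case: (hZ i).
  have AV : mxin (inA l) V by apply: cmb_in => // i; case: (hZ i).
  have VU : V *m U = 1%:M.
    by apply: mu_inj => i; rewrite rmuM !mu_cmb rmu1; case: (hZ i).
  have UV : U *m V = eps.
    by apply: mu_inj => i; rewrite rmuM !mu_cmb; case: (hZ i).
  have ha i : Dunit (s := s i) l (rdet (s i) (X *m U)).
    have [_ _ _ wf] := wL_spec i l; have [z1 z2 z3 z4] := hZ i.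
    have [u0 Uu0 Eu0] := wf y _ _ _ b _ _ _ _ _ it z1 z2 z3 z4 hy.
    have -> : rdet (s i) (X *m U) = wL i l y * u0^-1.
      rewrite Eu0 mulfK; last by case: Uu0.
      by rewrite /rdet rmuM mu_cmb.
    by apply: Dunit_M; [exact: hD|exact: Dunit_V].
  (* Away from [p] the localised group ring is the product of its components, so a unit with
     prescribed determinants is assembled from the diagonal matrices with entries
     [c i, 1, ..., 1]. *)
  pose w (c : forall i, cK (k i)) := \sum_i csig (k i) (dg (cd0 (k i)) (c i)).
  have wA c : (forall i, D i l (c i)) -> inA l (w c).
    move=> Dc; apply: (subring_sum (SA l)) => i _; apply: c_sigin => //.
    by apply: dg_in => //; exact: c_sub.
  have wM c c' : (forall i, c i * c' i = 1) -> w c * w c' = 1.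
    by move=> cc'; apply: rho_inj => i; rewrite c_rhoM !rho_sum_sig dgM cc' dg1 c_rho1.
  pose a i := rdet (s i) (X *m U).
  have a0 i : a i != 0 by case: (ha i).
  apply: (local_El XY YX VU UV AU AV (u := w a) (u' := w (fun i => (a i)^-1))).
  - by apply: wA => i; case: (ha i).
  - by apply: wA => i; case: (ha i).
  - by apply: wM => i; exact: (mulfV (a0 i)).
  - by apply: wM => i; exact: (mulVf (a0 i)).
  - by move=> i; rewrite /= rho_sum_sig det_dg.
have [E [E' [EE e1 e2 hX hY]]] := El_global loc.
have glob a c (M : 'M[B]_(a, c)) : (forall l, mxin (inA l) M) -> exists M0 : 'M[gring R gT]_(a, c), M = map_mx F M0.
  move=> hM; have h x z : exists m, M x z = F m by apply: (inA_glob (ar := ar)) => l; apply: hM.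
  exists (\matrix_(x, z) projT1 (cid (h x z))); apply/matrixP => x z; rewrite !mxE; by case: cid.
have [X0 EX] := glob _ _ _ hX; have [Y0 EY] := glob _ _ _ hY.
have finj : injective F.
  move=> x z /ffunP E1; apply/ffunP => g; have := E1 g; rewrite !ffunE; exact: (ar_inj ar).
apply: relK0_trans hy _.
exact: (@free_triple_zero _ _ F r.+2 N q i0 t0 phi b psi E E' X0 Y0 finj it phiK psiK EE e1 e2 EX EY).
Qed.

(** If [a i = 1 + cc * z i], adding to 1 the images of the matrices with single entry [cc * z i]
    gives an element integral at [p], by [c_sigp], with determinants [a i]; the inverses have the
    same form. *)
Lemma conductor (a : forall i, cK (k i)) : (forall i, cong (D i P) (cc (k i)) (a i) 1) ->
  (forall i, a i != 0) -> (forall i, D i P (a i)^-1) -> USp (s := s) a.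
Proof.
move=> ha a0 Da'.
pose w (z : forall i, cK (k i)) := 1 + \sum_i csig (k i) (cc (k i) *: (z i *: delta_mx (cd0 (k i)) (cd0 (k i)))).
have wA z : (forall i, D i P (z i)) -> inA P (w z).
  move=> Dz; apply: (subringD (SA P)); first exact: (subring1 (SA P)).
  apply: (subring_sum (SA P)) => i _; apply: c_sigp => x y; rewrite !mxE.
  by have SD := c_sub (k i) P; apply: (subringM SD) => //; apply: (subring_nat SD).
have wE z i : crho (k i) (w z) = dg (cd0 (k i)) (1 + cc (k i) * z i).
  by rewrite rhoD c_rho1 rho_sum_sig /dg scalerA [1 + _ * _ - 1]addrC addKr.
have ex i : exists z, D i P z /\ a i = 1 + cc (k i) * z by have [z Dz Ez] := ha i; exists z.
pose z i := projT1 (cid (ex i)).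
have hz i : D i P (z i) /\ a i = 1 + cc (k i) * z i by rewrite /z; case: cid.
pose z' i := - (z i * (a i)^-1).
have hz' i : (a i)^-1 = 1 + cc (k i) * z' i.
  have [_ E] := hz i; rewrite /z' mulrN mulrA; apply: (mulfI (a0 i)); rewrite mulfV // mulrBr mulr1.
  by rewrite mulrC mulfVK // {1}E addrK.
have wM z1 z2 : (forall i, (1 + cc (k i) * z1 i) * (1 + cc (k i) * z2 i) = 1) -> w z1 * w z2 = 1.
  by move=> h; apply: rho_inj => i; rewrite c_rhoM !wE dgM h dg1 c_rho1.
exists (w z), (w z'); split.
- by apply: wA => i; case: (hz i).
- apply: wA => i; have SD := c_sub (k i) P; apply: (subringN SD); apply: (subringM SD) => //.
  by case: (hz i).
- by apply: wM => i; rewrite -hz'; have [_ <-] := hz i; rewrite mulfV.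
- by apply: wM => i; rewrite -hz'; have [_ <-] := hz i; rewrite mulVf.
- by move=> j /=; rewrite wE det_dg; case: (hz j).
Qed.

Hypothesis n0 : (0 < n)%N.

(** Dividing by the determinants of the scalar [c] makes the family congruent to 1; by [c_pow'] its
    power [p ^ n.-1] is then congruent to 1 modulo the conductors. *)
Lemma unit_pow (v : forall i, cK (k i)) c : coprime c p ->
  (forall i, cong (D i P) (cpi (k i)) (v i) c%:R) -> USp (s := s) (fun i => v i ^+ (p ^ n.-1)).
Proof.
move=> cop hv; pose q := (p ^ n.-1)%N.
have Icv : I P c%:R^-1 by apply: ar_natV; rewrite (ar_lp ar).
have c0 : c%:R != 0 :> Q.
  case: (c) cop => [|c' _]; last exact: (ar_char0 ar).
  by rewrite /coprime gcd0n => /eqP p1; have := prime_gt1 (p_prime ar); rewrite p1.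
have Ac : inA P (c%:R : B) by exact: (subring_nat (SA P)).
have Ac' : inA P (sc gT c%:R^-1) by exact: inA_sc.
have cc1 : (c%:R : B) * sc gT c%:R^-1 = 1 by rewrite (natB_scE Q) -rmorphM /= mulfV // rmorph1.
have cc2 : sc gT c%:R^-1 * (c%:R : B) = 1 by rewrite (natB_scE Q) -rmorphM /= mulVf // rmorph1.
pose t i := \det (rrho (s i) c%:R).
pose t' i := \det (rrho (s i) (sc gT c%:R^-1)).
have tt' i : t i * t' i = 1 by exact: (USp_unit s).
have t0 i : t i != 0.
  by apply/eqP => t0; have /eqP := tt' i; rewrite t0 mul0r eq_sym oner_eq0.
have Dt' i : D i P (t' i) by have SD := c_sub (k i) P; apply: (det_in SD); exact: c_rhoin.
have tc i : cong (D i P) (cpi (k i)) (t i) c%:R.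
  apply: (residue p_odd oG (s i)) => //.
  rewrite (natB_scE Q) aug_sc; exact: (cong_refl (ar_sub P)).
pose y i := v i * t' i.
have vE i : v i = y i * t i by rewrite /y -mulrA [t' i * _]mulrC tt' mulr1.
have y1 i : cong (D i P) (cpi (k i)) (y i) 1.
  have SD := c_sub (k i) P; have [z Dz Ez] := cong_trans SD (hv i) (cong_sym SD (tc i)).
  exists (z * t' i); first exact: (subringM SD).
  by rewrite /y Ez mulrDl tt' mulrA.
have U1 : USp (s := s) (fun i => y i ^+ q).
  apply: conductor => i; first exact: c_pow'.
    by rewrite expf_neq0 // (c_neq0 (y1 i)).
  by rewrite -exprVn; have SD := c_sub (k i) P; apply: (subringX SD); apply: c_unit.
have U2 : USp (s := s) (fun i => t i ^+ q).
  exists (c%:R ^+ q), (sc gT c%:R^-1 ^+ q); split; try exact: (subringX (SA P)).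
  - by rewrite -exprMn_comm ?cc1 ?expr1n //; apply/commr_sym; exact: sc_comm.
  - by rewrite -exprMn_comm ?cc2 ?expr1n //; exact: sc_comm.
  - by move=> j; elim: (q) => [|q' IH]; rewrite ?expr0 ?r_1 ?det1 // !exprS r_M det_mulmx IH.
have := USp_M U1 U2; congr USp; apply: functional_extensionality_dep => i.
by rewrite -exprMn -vE.
Qed.

(** Bezout orders are integrally closed; this is applied to [x] and to its inverse. *)
Lemma Dunit_root i l x m : (0 < m)%N -> x != 0 -> Dunit (s := s i) l (x ^+ m) -> Dunit (s := s i) l x.
Proof.
move=> m0 x0 [_ Dx Dx']; split=> //.
  have [a [b [Da Db b0 E]]] := @c_frac _ _ _ _ _ (k i) l x.
  exact: (integrally_closed (c_sub (k i) l) (@c_bez _ _ _ _ _ (k i) l) m0 (ex_intro _ a (ex_intro _ b (And4 Da Db b0 E))) Dx).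
have [a [b [Da Db b0 E]]] := @c_frac _ _ _ _ _ (k i) l x^-1; rewrite -exprVn in Dx'.
exact: (integrally_closed (c_sub (k i) l) (@c_bez _ _ _ _ _ (k i) l) m0 (ex_intro _ a (ex_intro _ b (And4 Da Db b0 E))) Dx').
Qed.

Lemma Dunit_exp i l x m : Dunit (s := s i) l x -> Dunit (s := s i) l (x ^+ m).
Proof.
move=> [x0 Dx Dx']; have SD := c_sub (k i) l.
by split; rewrite ?expf_neq0 // -?exprVn; apply: (subringX SD).
Qed.

(** A multiple of [x] vanishes, so a power of each invariant is a unit, and roots of units are
    units. *)
Lemma torsion_units (x : relK0 F) : relK0_tor x ->
  (forall i, Dunit (s := s i) P (vP x i)) /\ (forall l i, Dunit (s := s i) l (wL i l x)).
Proof.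
move=> [m m0 hx]; have [v0 vm vz vf] := vP_spec; split=> [i|l i].
  apply: (Dunit_root m0 (v0 x i)); rewrite -vm; have [u [u' [Au Au' uu' u'u E]]] := vz _ hx.
  rewrite E; have e := USp_unit s i uu'; have SD := c_sub (k i) P.
  have d0 : \det (rrho (s i) u) != 0.
    by apply/eqP => d0; have /eqP := e; rewrite d0 mul0r eq_sym oner_eq0.
  split=> //; first by apply: (det_in SD); exact: c_rhoin.
  have -> : (\det (rrho (s i) u))^-1 = \det (rrho (s i) u') by apply: (mulfI d0); rewrite mulfV.
  by apply: (det_in SD); exact: c_rhoin.
have [w0 wm wz _] := wL_spec i l.
by apply: (Dunit_root m0 (w0 x)); rewrite -wm; apply: wz.
Qed.

Lemma units_kill_res (x : relK0 F) c : (forall l i, l != P -> Dunit (s := s i) l (wL i l x)) ->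
  coprime c p -> (forall i, cong (D i P) (cpi (k i)) (vP x i) c%:R) ->
  relK0_eq (relK0_muln (p ^ n.-1) x) [::].
Proof.
move=> hl cop hc; have [v0 vm vz vf] := vP_spec.
apply: vanish => [|l i lP].
  have := unit_pow cop hc; congr USp; apply: functional_extensionality_dep => i; exact/esym/vm.
by have [_ wm _ _] := wL_spec i l; rewrite wm; apply: Dunit_exp; apply: hl.
Qed.

(** The residue fields being [F_p], the power [p - 1] makes every unit congruent to 1, and
    [units_kill_res] applies with residue 1. *)
Lemma units_kill (x : relK0 F) : (forall i, Dunit (s := s i) P (vP x i)) ->
  (forall l i, l != P -> Dunit (s := s i) l (wL i l x)) ->
  relK0_eq (relK0_muln (p.-1 * p ^ n.-1) x) [::].
Proof.
move=> hp hl; have [v0 vm vz vf] := vP_spec.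
have p_pr := p_prime ar; rewrite mulnC relK0_mulnM; apply: (units_kill_res (c := 1)).
- by move=> l i lP; have [_ wm _ _] := wL_spec i l; rewrite wm; apply: Dunit_exp; apply: hl.
- by rewrite /coprime gcd1n.
move=> i; have [v1 Dv Dv'] := hp i; have [z Dz Ez] := c_frob Dv.
exists (z * (vP x i)^-1); first exact: (subringM (c_sub (k i) P)).
rewrite vm; apply: (mulIf v1); rewrite -exprSr (prednK (prime_gt0 p_pr)) Ez mulrDl mul1r.
by rewrite -!mulrA mulVf ?mulr1.
Qed.
End Main.

(** * Passage to quotient groups *)
Section FrameBaseChange.
Variables (A B A' B' : pzRingType).
Variables (f : {rmorphism A -> B}) (f' : {rmorphism A' -> B'}).
Variables (u : {rmorphism A -> A'}) (v : {rmorphism B -> B'}).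
Hypothesis sq : forall a, f' (u a) = v (f a).

Definition bc_s (N : lmodType A) k (i : {linear N -> 'rV[A]_k}) : {linear tens u N -> 'rV[A']_k} :=
  iotaT u k \o tmap u i.
Definition bc_t (N : lmodType A) k (t : {linear 'rV[A]_k -> N}) : {linear 'rV[A']_k -> tens u N} :=
  tmap u t \o kappa u k.

Lemma bc_st (N : lmodType A) k (i : {linear N -> 'rV[A]_k}) (t : {linear 'rV[A]_k -> N}) :
  cancel i t -> cancel (bc_s i) (bc_t t).
Proof.
move=> it x; transitivity (tmap u t (tmap u i x)); first by congr (tmap u t _); exact: iotaTK.
by rewrite (tmap_comp (k := idfun)) ?tmap_id.
Qed.

(** Retractions chosen over [A] can be transported along [u], so that the class over [A'] is
    computed from the image under [v] of the old matrix. *)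
Lemma mxP_bc (N N' : lmodType A) k k' (t : {linear 'rV[A]_k -> N}) (i : {linear N' -> 'rV[A]_k'})
    (phi : {linear tens f N -> tens f N'}) :
  mxP (bc_t t) (bc_s i) (bc_map sq phi) = map_mx v (mxP t i phi).
Proof.
have key z : iotaT f' k' (tmap f' (bc_s i) (bc_can sq z)) = map_mx v (iotaT f k' (tmap f i z)).
  elim/tens_ind: z => [|x y ex ey|b x].
  - by rewrite bc_can0 !linear0 map_mx0.
  - by rewrite bc_can_add !linearD ex ey map_mxD.
  rewrite bc_canE !linearZ_LR !tmapE /= !iotaTE scale1r tmapE iotaTE scale1r map_mxZ; congr (_ *: _).
  by apply/matrixP => a c; rewrite !mxE sq.
apply/row_matrixP => a; rewrite -map_row !row_mxP -key; congr (iotaT f' k' (tmap f' _ _)).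
have -> : bc_t t 'e_a = tpure u 1 (t 'e_a).
  by transitivity (tmap u t (tpure u 1 'e_a)); [congr (tmap u t _); exact: rowlinE|rewrite tmapE].
exact: bc_mapE.
Qed.

Lemma bc_map_id (N : lmodType A) z :
  bc_map sq (tmap f (idfun : {linear N -> N})) z = tmap f' (idfun : {linear tens u N -> tens u N}) z.
Proof.
apply: (tens2_ext (g := bc_map sq (tmap f idfun)) (h := tmap f' idfun)) => x.
by rewrite bc_mapE !tmapE bc_canE rmorph1 scale1r.
Qed.
End FrameBaseChange.

Section ExponentFacts.
Variables (A B : pzRingType) (f : {rmorphism A -> B}).
(** The least killing integer divides every other one, since a nonzero remainder would also kill and
    be smaller. *)
Lemma exponent_ex (S : relK0 f -> Prop) m : (0 < m)%N -> kills S m ->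
  exists2 e, is_exponent S e & forall m', kills S m' -> (e %| m')%N.
Proof.
move=> m0 km; pose Pb e := `[< (0 < e)%N /\ kills S e >].
have ex : exists e, Pb e by exists m; apply/asboolP.
case: (ex_minnP ex) => e /asboolP[e0 ke] emin; exists e.
  by split=> // m' m'0 km'; apply: emin; apply/asboolP.
move=> m' km'; apply/eqP; apply: contrapT => /eqP nz.
have : (e <= m' %% e)%N.
  apply: emin; apply/asboolP; split; first by rewrite lt0n.
  move=> x Sx; apply: (@relK0_cancel _ _ f (relK0_muln (m' %/ e * e) x)); rewrite cats0 -relK0_mulnD -divn_eq.
  apply: relK0_trans (km' x Sx) (relK0_sym _); rewrite relK0_mulnM; apply: relK0_muln_zero; exact: ke.
by rewrite leqNgt ltn_mod e0.
Qed.
End ExponentFacts.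

Section Quotients.
Variables (p : nat) (R : nzRingType) (Q : fieldType) (f : {rmorphism R -> Q}).
Variable ar : arith p f.
Hypothesis p_odd : odd p.
Local Notation I := (ar_I (a := ar)).
Local Notation P := (lp ar).
Local Notation inA := (inA (ar := ar)).
Let char0 := ar_char0 ar.
Let p_pr := p_prime ar.

(** The trivial representation, whose determinants record the residue shared by all representations;
    it is unchanged on passing to a quotient group. *)
Definition aug_rep (hT : finGroupType) : rep ar hT.
Proof.
refine (@Rep p R Q f ar hT (base_cfield ar) 1 (fun b => (aug b : cK (base_cfield ar))%:M) _ _ _ _ _).
- by exists 0%N.
- by move=> a b; rewrite !rmorphB.
- by move=> a b; rewrite rmorphM /= scalar_mxM.
- by rewrite rmorph1.
- by move=> l b Ab i j; rewrite !mxE !ord1 eqxx mulr1n; apply: inA_aug.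
Defined.

Section Infl.
Variables (gT : finGroupType) (D : {group gT}).
Hypothesis nD : forall g, g \in ('N(D))%g.
Local Notation B := (gring Q gT).

Lemma infl_pr (b : B) : infl (pr D b) = b * eD Q D.
Proof.
rewrite {1}(gring_dec b) pr_sum infl_sum {2}(gring_dec b) mulr_suml; apply: eq_bigr => g _.
by rewrite pr_sc infl_sc pr_gel // -[gel Q (coset D g)]mulr1 infl_gell // mulrA.
Qed.

Lemma pr_lift l (b : gring Q (coset_of D)) : inA l b -> exists2 b', inA l b' & pr D b' = b.
Proof.
move=> Ab; have SA := @inA_subring p R Q f ar gT l.
exists (\sum_c sc gT (b c) * gel Q (repr c)).
  by apply: (subring_sum SA) => c _; apply: (subringM SA); [apply: inA_sc|apply: inA_gel].
rewrite pr_sum [RHS]gring_dec; apply: eq_bigr => c _.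
by rewrite pr_sc pr_gel // coset_reprK.
Qed.

Lemma aug_pr' (b : B) : aug (pr D b) = aug b.
Proof.
rewrite (gring_dec b) pr_sum !rmorph_sum; apply: eq_bigr => g _.
by rewrite pr_sc pr_gel // !rmorphM /= !aug_sc !aug_gel.
Qed.

Variables (n : nat) (k : scomp ar gT n).
Hypothesis Dk : forall d, d \in D -> crho k (gel Q d) = 1%:M.

Lemma rho_eD : crho k (eD Q D) = 1%:M.
Proof.
have E : \sum_(d in D) crho k (gel Q d) = crho k #|D|%:R.
  rewrite (eq_bigr (fun=> crho k 1)) => [|d dD]; last by rewrite Dk // c_rho1.
  by rewrite sumr_const; elim: #|D| => [|m IH]; rewrite ?mulr0n ?rho0 // !mulrS rhoD IH.
rewrite eDE c_rhoM rho_sum E -c_rhoM (natB_scE Q) -rmorphM /= mulVf ?rmorph1 ?c_rho1 //.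
by case: #|D| (cardG_gt0 D) => // m _; apply: char0.
Qed.

Lemma rho_infl_pr b : crho k (infl (pr D b)) = crho k b.
Proof. by rewrite infl_pr c_rhoM rho_eD mulmx1. Qed.

(** A component on which [D] acts trivially, seen as a representation of the quotient by [D];
    integral elements of the quotient lift, which gives [r_in]. *)
Definition quo_rep : rep ar (coset_of D).
Proof.
refine (@Rep p R Q f ar (coset_of D) k (cd k) (fun b => crho k (infl b)) (c_d k) _ _ _ _).
- by move=> a b; rewrite raddfB c_rhoB.
- by move=> a b; rewrite inflM // c_rhoM.
- exact: rho_eD.
- by move=> l b /pr_lift[b' Ab' <-]; rewrite rho_infl_pr; apply: c_rhoin.
Defined.
End Infl.

(** If [a - b] were prime to [p], then [cpi], dividing both, would divide 1. *)
Lemma nat_cong (F : cfield ar) a b : cong (@cD _ _ _ _ _ F P) (cpi F) a%:R b%:R -> a = b %[mod p].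
Proof.
wlog ab : a b / (b <= a)%N.
  move=> W; case: (leqP b a) => [|/ltnW] h hc; first exact: W.
  by apply/esym/W => //; apply: (cong_sym (c_sub F P)).
move=> [z Dz Ez]; apply/eqP; rewrite eqn_mod_dvd //; apply: contraT => npd.
have SD := c_sub F P; have cop : coprime (a - b) p by rewrite coprime_sym prime_coprime.
have [m _ [w Ew]] : exists2 m, True & exists w, ((a - b) * m = w * p + 1)%N.
  have ab0 : (0 < a - b)%N by case: (a - b)%N npd => //; rewrite dvdn0.
  case: (egcdnP p ab0) => u w E _; exists u => //; exists w.
  by rewrite mulnC E (eqP (cop : gcdn _ _ == 1)%N).
have h0 : cong (@cD _ _ _ _ _ F P) (cpi F) 0 1.
  have [y Dy] := c_p F; rewrite add0r => Ey.
  exists (y * w%:R - z * m%:R).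
    by apply: (subringB SD); apply: (subringM SD) => //; apply: (subring_nat SD).
  have : (a - b)%:R * m%:R = w%:R * p%:R + 1 :> cK F by rewrite -!natrM Ew natrD.
  rewrite natrB // Ez addrC addKr Ey => /eqP; rewrite -subr_eq0 => /eqP E.
  by rewrite -[LHS]oppr0 -E; ring.
by have := c_neq0 h0; rewrite eqxx.
Qed.

Lemma primitive_root : exists2 c, coprime c p & forall e, (c ^ e = 1 %[mod p])%N -> (p.-1 %| e)%N.
Proof.
have /cyclicP[a aE] := field_unit_group_cyclic [set: {unit 'F_p}]%G.
have oa : #[a]%g = p.-1 by rewrite orderE -aE card_finField_unit card_Fp.
pose c : nat := (FinRing.uval a : 'F_p).
have cE : c%:R = FinRing.uval a :> 'F_p by rewrite natr_Zp.
exists c.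
  rewrite coprime_sym prime_coprime //; apply/negP => pc.
  have : FinRing.uval a \is a GRing.unit := valP a.
  by rewrite -cE -(Fp_nat_mod p_pr) (eqP pc) unitr0.
move=> e ce1; rewrite -oa order_dvdn; apply/eqP; apply: val_inj.
rewrite /= FinRing.val_unitX /= -cE -natrX -(Fp_nat_mod p_pr) ce1 Fp_nat_mod //.
Qed.
End Quotients.

(** * Kernels of components and of complex characters *)

Section FaithfulKernel.
Variables (p : nat) (R : nzRingType) (Q : fieldType) (f : {rmorphism R -> Q}).
Variable ar : arith p f.
Variables (gT : finGroupType) (n : nat).
Hypothesis oG : #|gT| = (p ^ n)%N.
Variable k : scomp ar gT n.
Let phi g := crho k (gel Q g).

Let phiM g h : phi (g * h)%g = phi g *m phi h. Proof. by rewrite /phi gelM c_rhoM. Qed.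
Let phi1 : phi 1%g = 1%:M. Proof. by rewrite /phi gel1 c_rho1. Qed.

Definition krho := [set g | phi g == 1%:M].
Lemma krho_group : group_set krho.
Proof.
apply/group_setP; split=> [|x y]; rewrite !inE ?phi1 // => /eqP hx /eqP hy.
by rewrite phiM hx hy mulmx1.
Qed.
Definition Krho := Group krho_group.

Lemma Krho_normal : (Krho <| [set: gT])%g.
Proof.
rewrite /normal subsetT; apply/subsetP => g _; rewrite inE; apply/subsetP => _ /imsetP[x xK ->].
move: xK; rewrite !inE => /eqP hx; rewrite /conjg !phiM hx mul1mx -phiM mulVg phi1 //.
Qed.
Let nK g : g \in ('N(Krho))%g. Proof. by apply: (subsetP (normal_norm Krho_normal)); rewrite inE. Qed.

Let phi_repr g : phi (repr (coset Krho g)) = phi g.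
Proof.
have : repr (coset Krho g) \in (coset Krho g : {set gT}) by apply: mem_repr_coset.
rewrite val_coset // => /rcosetP[h]; rewrite inE => /eqP hh ->.
by rewrite phiM hh mul1mx.
Qed.

Let phi_comm z : coset Krho z \in 'Z([set: gT] / Krho)%g -> exists a, phi z = a%:M.
Proof.
move=> /setIP[_ /centP zC]; apply: (comm_scalar (k := k)) => Y; rewrite -[Y]c_rs; move: (csig k Y) => b.
rewrite -!c_rhoM (gring_dec b) mulr_sumr mulr_suml !rho_sum; apply: eq_bigr => h _.
have hz : phi (z * h)%g = phi (h * z)%g.
  have hq : coset Krho h \in ([set: gT] / Krho)%g by apply: mem_quotient; rewrite inE.
  have hzc : (coset Krho z * coset Krho h = coset Krho h * coset Krho z)%g := zC _ hq.
  have E : coset Krho (z * h)%g = coset Krho (h * z)%g by rewrite !coset_morphM ?nK // hzc.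
  by rewrite -phi_repr E phi_repr.
by rewrite mulrA -sc_comm -!mulrA -!gelM !c_rhoM; congr (_ *m _); exact: hz.
Qed.

(** The centre of the quotient acts faithfully by scalars, hence embeds in the multiplicative group
    of a field. *)
Lemma Krho_center_cyclic : cyclic 'Z([set: gT] / Krho)%g.
Proof.
pose F c := phi (repr c) (cd0 k) (cd0 k).
have FE c : c \in 'Z([set: gT] / Krho)%g -> phi (repr c) = (F c)%:M.
  have [z zN ->] := cosetP c => zZ; rewrite /F phi_repr; have [a ->] := phi_comm zZ.
  by rewrite !mxE eqxx.
apply: (@field_mul_group_cyclic _ 'Z([set: gT] / Krho)%G (cK k) F) => [x y xZ yZ|x xZ].
  have := FE _ (groupM xZ yZ); have [g gN xE] := cosetP x; have [h hN yE] := cosetP y.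
  have -> : phi (repr (x * y)%g) = phi (repr x) *m phi (repr y).
    by rewrite xE yE -morphM // !phi_repr phiM.
  rewrite (FE x) // (FE y) // -scalar_mxM => /matrixP/(_ (cd0 k) (cd0 k)).
  by rewrite !mxE eqxx !mulr1n.
split=> [F1|->].
  have xK : repr x \in krho by rewrite inE FE // F1.
  by rewrite -[x](coset_reprK (H := Krho)) coset_id.
by rewrite /F -(morph1 (coset Krho)) phi_repr phi1 mxE eqxx.
Qed.

(** The quotient by the kernel of the component is a [p]-group with cyclic centre, so it has a
    faithful irreducible complex character. Inflating that character gives a member of [Xi] that
    acts trivially on the component, and no comparison of [Q] with the complex numbers is
    required. *)
Lemma Xi_sub_krho : exists D : {group gT}, [/\ D \in Xi gT, (D <| [set: gT])%g &
  forall d, d \in D -> crho k (gel Q d) = 1%:M].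
Proof.
have pG : (p.-group ([set: gT] / Krho)%g)%g.
  by apply: quotient_pgroup; rewrite /pgroup cardsT oG pnatX pnat_id ?(p_prime ar).
have [i fi] := pgroup_cyclic_faithful pG Krho_center_cyclic.
pose j : Iirr [set: gT] := mod_Iirr i.
exists (cfker_group 'chi_j); split; [exact: imset_f|exact: cfker_normal|].
move=> d; rewrite /= /j (mod_IirrE _ Krho_normal) /cfMod cfker_morph ?normal_norm ?Krho_normal //.
case/setIP=> _ /morphpreP[_ hd]; have := subsetP fi _ hd; rewrite inE => /eqP d1.
have : d \in Krho by apply: coset_idr.
by rewrite inE => /eqP.
Qed.
End FaithfulKernel.

(** * Upper bounds for the two exponents *)

Section Exponents.
Variables (p : nat) (R : nzRingType) (Q : fieldType) (f : {rmorphism R -> Q}).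
Variable ar : arith p f.
Hypothesis p_odd : odd p.
Variables (gT : finGroupType) (n : nat).
Hypothesis oG : #|gT| = (p ^ n)%N.
Hypothesis n0 : (0 < n)%N.
Variables (J : finType) (k : J -> scomp ar gT n).
Hypothesis orth : forall i j, i != j -> ce (k i) * ce (k j) = 0.
Hypothesis sum1 : \sum_i ce (k i) = 1.
Local Notation I := (ar_I (a := ar)).
Local Notation P := (lp ar).
Local Notation inA := (inA (ar := ar)).
Local Notation B := (gring Q gT).
Local Notation F := (gring_map f (gT := gT)).
Local Notation DD i l := (@cD _ _ _ _ _ (k i) l).
Local Notation s := (comp_rep k).
Local Notation vP := (vP p_odd oG k).
Let SA l := @inA_subring p R Q f ar gT l.
Let p_pr := p_prime ar.

Lemma frame_at_p r (N : fgproj (gring R gT)) (phi : {linear tens F (freem _ r) -> tens F N}) :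
  bijective phi -> exists q i t U V, @frameP _ _ _ _ ar _ N q i t r U V.
Proof.
case=> psi0 phiK psiK; pose psi := mk_linear (can_linear phiK psiK).
have [q [i0 [t0 [_ it]]]] := fgproj_section N 0.
pose idr := (idfun : {linear 'rV[gring R gT]_r -> 'rV[gring R gT]_r}).
pose X : 'M[B]_(r, q) := mxP idr i0 phi.
pose Y : 'M[B]_(q, r) := mxP t0 idr psi.
pose eps : 'M[B]_q := mxP t0 i0 (tmap F (idfun : {linear N -> N})).
have XY : X *m Y = 1%:M.
  rewrite mxP_comp // -(@mx_id_tmap R Q f gT r); apply: eq_mxP => u; rewrite tmap_id //=; apply: phiK.
have YX : Y *m X = eps.
  rewrite mxP_comp //; apply: eq_mxP => u; rewrite tmap_id //=; apply: psiK.
have ee : eps *m eps = eps by rewrite -YX mulmxA -(mulmxA Y X Y) XY mulmx1.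
have Ae : mxin (inA P) eps by move=> x z; rewrite /eps mxP_tmap mxE; apply: inA_map.
have [r' [U [V [AU AV VU UV]]]] := local_splits p_odd oG Ae ee.
have [G1 G2 _ _] := frame_pair XY YX VU UV.
have er := ibn_gring G1 G2; subst r'.
by exists q, i0, t0, U, V; split.
Qed.

Lemma frame_id r : @frameP _ _ _ _ ar _ (freem (gring R gT) r) r idfun idfun r 1%:M 1%:M.
Proof.
split=> //; try exact: (@mxin1 _ _ (SA P)); first exact: mul1mx.
by rewrite mulmx1 mx_id_tmap.
Qed.

Section Quotient.
Variables (D : {group gT}) (nD : (D <| [set: gT])%g) (i : J).
Hypothesis Dk : forall d, d \in D -> crho (k i) (gel Q d) = 1%:M.
Let nD' g : g \in ('N(D))%g. Proof. by apply: (subsetP (normal_norm nD)); rewrite inE. Qed.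
Let v := @Defs.gring_proj Q gT D nD.
Let sq := gring_map_proj f nD.
Local Notation F' := (gring_map f (gT := coset_of D)).

Lemma gring_projE (b : B) : Defs.gring_proj nD b = pr D b.
Proof. by apply/ffunP => c; rewrite !ffunE; apply: eq_bigl => g; rewrite nD'. Qed.

(** The frame of [N] is pushed forward to the quotient. As the image class is trivial, the
    determinants there are those of one local unit [w], and [residue] compares its component with
    its augmentation. *)
Lemma quotient_residue (x : relK0 F) r (N : fgproj (gring R gT))
    (phi : {linear tens F (freem _ r) -> tens F N}) (b : bijective phi) q i0 t0 U V :
  @frameP _ _ _ _ ar _ N q i0 t0 r U V -> relK0_eq x [:: (false, RelTriple b)] ->
  relK0_eq (DT_proj nD x) [::] ->
  let G := mxP idfun i0 phi *m U in
  (exists2 c, coprime c p & cong (I P) p%:R (rdet (aug_rep ar gT) G) c%:R) /\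
  forall c, coprime c p -> cong (I P) p%:R (rdet (aug_rep ar gT) G) c%:R ->
    cong (DD i P) (cpi (k i)) (rdet (s i) G) c%:R.
Proof.
move=> [it AU AV VU UV] hx hz G.
have [m oH0] : exists m, #|[set: coset_of D]| = (p ^ m)%N.
  have dv : (#|[set: coset_of D]| %| p ^ n)%N.
    by rewrite -(quotientT D) card_quotient ?normal_norm // -oG -cardsT dvdn_indexg.
  by have /(dvdn_pfactor _ _ p_pr)[m _ Em] := dv; exists m.
have oH := etrans (esym (cardsT (coset_of D))) oH0.
(* The augmentation and component [i] are treated as one family, so that the same unit [w] computes
   both determinants. *)
pose s' (j : bool) := if j then aug_rep ar (coset_of D) else quo_rep nD' Dk.
have [v' [v0 vm vz vf]] := inv_p p_odd oH s'.
have SA' := @inA_subring p R Q f ar (coset_of D) P.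
have hm : relK0_eq (DT_proj nD x) [:: (false, rel_triple_map sq (RelTriple b))].
  exact: (relK0_map_eq sq hx).
pose u := @Defs.gring_proj R gT D nD.
have mv a c (M : 'M[B]_(a, c)) : mxin (inA P) M -> mxin (inA P) (map_mx v M).
  by move=> AM y z; rewrite mxE [v _]gring_projE; apply: pr_in.
have tid (M : fgproj (gring R gT)) qq (tt : {linear 'rV_qq -> M}) ii :
    map_mx v (mxP tt ii (tmap F (idfun : {linear M -> M}))) =
    mxP (bc_t u tt) (bc_s u ii) (tmap F' (idfun : {linear tens u M -> tens u M})).
  by rewrite -(mxP_bc sq); apply: eq_mxP => y; apply: bc_map_id.
have f1 : @frameP _ _ _ _ ar _ (fgproj_tens u (freem (gring R gT) r)) r
    (bc_s u idfun) (bc_t u idfun) r 1%:M 1%:M.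
  split; [by apply: bc_st| | | |]; try exact: (@mxin1 _ _ SA'); first exact: mul1mx.
  by rewrite mulmx1 -(tid _ (freem _ r)) mx_id_tmap map_mx1.
have f2 : @frameP _ _ _ _ ar _ (fgproj_tens u N) q (bc_s u i0) (bc_t u t0) r (map_mx v U) (map_mx v V).
  split; [by apply: bc_st|exact: mv|exact: mv| |].
    by rewrite -map_mxM VU map_mx1.
  by rewrite -map_mxM UV tid.
have [u0 Uu0 Eu0] := vf _ (rel_triple_map sq (RelTriple b)) _ _ _ _ _ _ _ _ _ _ _ f1 f2 hm.
have [w [w' [Aw Aw' ww' w'w Ew]]] := USp_M (vz _ hz) (USp_V Uu0).
have GE j : rdet (s' j) (map_mx v G) = \det (rrho (s' j) w).
  rewrite -Ew Eu0 mulfK; last exact: USp_0 Uu0.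
  congr (rdet _ _); rewrite mul1mx /G map_mxM; congr (_ *m _); apply/esym; exact: mxP_bc.
have G1 : rdet (aug_rep ar gT) G = aug w.
  transitivity (rdet (aug_rep ar (coset_of D)) (map_mx v G)).
    rewrite /rdet /rmu; congr (\det (blk _)); apply/matrixP => y z; rewrite !mxE [v _]gring_projE.
    by rewrite /= aug_pr'.
  by rewrite (GE true) /= det_scalar expr1.
have G2 : rdet (s i) G = \det (rrho (quo_rep nD' Dk) w).
  rewrite -(GE false) /rdet /rmu; congr (\det (blk _)); apply/matrixP => y z.
  by rewrite !mxE [v _]gring_projE /= rho_infl_pr.
rewrite G1 G2; split; first exact: (aug_coprime Aw Aw' ww').
by move=> c cop hc; apply: (residue p_odd oH (quo_rep nD' Dk)).
Qed.
End Quotient.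

(** The quotient used depends on [i], but the augmentation does not see it; it therefore ties the
    residues of all components to a single integer. *)
Lemma kernel_residue (x : relK0 F) :
  (forall (D : {group gT}) (nD : (D <| [set: gT])%g), D \in Xi gT -> relK0_eq (DT_proj nD x) [::]) ->
  exists2 c, coprime c p & forall i, cong (DD i P) (cpi (k i)) (vP x i) c%:R.
Proof.
move=> hx; have [r [N [phi [b [_ hy]]]]] := relK0_rep x 0.
have [q [i0 [t0 [U [V fr]]]]] := frame_at_p b.
have [_ _ _ vf] := vP_spec p_odd oG k.
have [u0 [u1 [u1' [Au Au' uu' u'u Eu]]] Eu0] := vf x (RelTriple b) _ _ _ _ _ _ _ _ _ _ _ (frame_id r) fr hy.
have key i : (exists2 c, coprime c p & cong (I P) p%:R (rdet (aug_rep ar gT) (mxP idfun i0 phi *m U)) c%:R) /\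
  forall c, coprime c p -> cong (I P) p%:R (rdet (aug_rep ar gT) (mxP idfun i0 phi *m U)) c%:R ->
    cong (DD i P) (cpi (k i)) (rdet (s i) (mxP idfun i0 phi *m U)) c%:R.
  have [D [DX nD Dk]] := Xi_sub_krho oG (k i).
  exact: (quotient_residue Dk fr hy (hx D nD DX)).
have [c1 cop1 hc1] := aug_coprime Au Au' uu'.
case: (pickP (fun _ : J => true)) => [i1 _|no]; last first.
  by exists 1%N => [|i]; [rewrite /coprime gcd1n|have := no i].
have [[c cop hc] _] := key i1.
(* [c] is the residue of the determinant in the chosen frame, and [c1] that of the unit by which
   [vP x] differs from it. *)
exists (c * c1)%N; first by rewrite coprimeMl cop.
move=> i; rewrite Eu0 mul1mx natrM.
have SD := c_sub (k i) P; have [_ h1] := key i.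
apply: (congM SD); [exact: c_piD|by move=> y; apply: mulrC|exact: (subring_nat SD)|exact: (subring_nat SD)|exact: h1|].
by rewrite Eu; apply: (residue p_odd oG (s i)).
Qed.

Lemma DT_kills : kills (DT (f := f) (gT := gT)) (p.-1 * p ^ n.-1).
Proof.
move=> x tx; have [hp hl] := torsion_units p_odd oG k tx.
exact: (units_kill orth sum1 n0 hp (fun l i _ => hl l i)).
Qed.

Lemma DT_ker_kills : kills (DT_ker (f := f) (gT := gT)) (p ^ n.-1).
Proof.
move=> x [tx hx]; have [hp hl] := torsion_units p_odd oG k tx.
have [c cop hc] := kernel_residue hx.
exact: (units_kill_res orth sum1 n0 (fun l i _ => hl l i) cop hc).
Qed.
End Exponents.

(** * A torsion class whose order is divisible by p - 1 *)
Section LowerBound.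
Variables (p : nat) (R : nzRingType) (Q : fieldType) (f : {rmorphism R -> Q}).
Variable ar : arith p f.
Hypothesis p_odd : odd p.
Variables (gT : finGroupType) (n : nat).
Hypothesis oG : #|gT| = (p ^ n)%N.
Hypothesis n0 : (0 < n)%N.
Variables (J : finType) (k : J -> scomp ar gT n).
Hypothesis orth : forall i j, i != j -> ce (k i) * ce (k j) = 0.
Hypothesis sum1 : \sum_i ce (k i) = 1.
Local Notation I := (ar_I (a := ar)).
Local Notation P := (lp ar).
Local Notation inA := (inA (ar := ar)).
Local Notation B := (gring Q gT).
Local Notation F := (gring_map f (gT := gT)).
Local Notation s := (comp_rep k).
Local Notation vP := (vP p_odd oG k).
Local Notation ez := (avg p Q).
Let SA l := @inA_subring p R Q f ar gT l.
Let p_pr := p_prime ar.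

Lemma central_order_p : exists2 g : gT, (forall h, commute g h) & #[g]%g = p.
Proof.
have pG : (p.-group [set: gT])%g by rewrite /pgroup cardsT oG pnatX pnat_id.
have G1 : [set: gT] != 1%g.
  by rewrite -cardG_gt1 cardsT oG -(expn0 p) ltn_exp2l ?prime_gt1.
have Z1 : 'Z([set: gT])%g != 1%g.
  by apply: contra G1 => /eqP/(trivg_center_pgroup pG)/eqP.
have [_ pZ _] := pgroup_pdiv (pgroupS (center_sub _) pG) Z1.
have [g /setIP[_ /centP gC] og] := Cauchy p_pr pZ.
by exists g => // h; apply: gC; rewrite inE.
Qed.

Lemma mxP_actL r (M : 'M[B]_r) :
  mxP (idfun : {linear 'rV_r -> 'rV_r}) (idfun : {linear 'rV_r -> 'rV_r}) (actL F M) = M.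
Proof.
apply/row_matrixP => i; rewrite row_mxP.
transitivity (iotaT F r (actL F M (tpure F 1 'e_i))); first by congr (iotaT F r _); rewrite tmap_id.
by rewrite iotaT_actL iotaT1 map_delta_mx -rowE.
Qed.

Lemma USp_Dunit a i : USp (s := s) a -> Dunit (s := s i) P (a i).
Proof.
move=> [u [u' [Au Au' uu' u'u E]]]; have e := USp_unit s i uu'; have SD := c_sub (k i) P.
rewrite E; have d0 : \det (rrho (s i) u) != 0.
  by apply/eqP => d0; have /eqP := e; rewrite d0 mul0r eq_sym oner_eq0.
split=> //; first by apply: (det_in SD); exact: c_rhoin.
have -> : (\det (rrho (s i) u))^-1 = \det (rrho (s i) u') by apply: (mulfI d0); rewrite mulfV.
by apply: (det_in SD); exact: c_rhoin.
Qed.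

Lemma USp_X a e : USp (s := s) a -> USp (s := s) (fun i => a i ^+ e).
Proof.
move=> Ua; elim: e => [|e IH].
  exists 1, 1; rewrite !mulr1; split=> //; try exact: (subring1 (SA P)).
  by move=> j; rewrite r_1 det1.
by have := USp_M Ua IH; congr USp; apply: functional_extensionality_dep => i; rewrite exprS.
Qed.

(* The cyclotomic unit (1 - g^c) / (1 - g), c a primitive root modulo p, glued
   with 1 on the components where g acts trivially. *)
Lemma lower_bound : exists2 x : relK0 F, relK0_tor x &
  forall e, relK0_eq (relK0_muln e x) [::] -> (p.-1 %| e)%N.
Proof.
have [g gC og] := central_order_p; have gp : (g ^+ p = 1)%g by rewrite -og expg_order.
have [c cop cprim] := primitive_root ar.
have c_gt0 : (0 < c)%N.
  by case: (c) cop => //; rewrite /coprime gcd0n => /eqP p1; have := prime_gt1 p_pr; rewrite p1.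
have [c' [w Ew]] : exists c' w, (c * c' = w * p + 1)%N.
  case: (egcdnP p c_gt0) => u w E _; exists u, w.
  by rewrite mulnC E (eqP (cop : gcdn _ _ == 1)%N).
(* [th] is [(1 - G ^ c) / (1 - G)]. As [c * c'] is 1 modulo [p], the quotient [et] of
   [1 - G ^ (c * c')] by [1 - G ^ c] inverts it wherever [1 - G] is invertible. *)
pose G := gel Q g; pose th : B := \sum_(i < c) G ^+ i; pose et : B := \sum_(j < c') (G ^+ c) ^+ j.
have [z0 z0E] : exists z0 : B, z0 = 1 - ez g by exists (1 - ez g).
have zC b : z0 * b = b * z0 := z0_comm gC z0E b.
have ezC b : ez g * b = b * ez g by exact: ez_comm.
have ee : ez g * ez g = ez g := ez_idem ar gp.
have ez0 : ez g * z0 = 0 by rewrite z0E mulrBr mulr1 ee subrr.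
have z0e : z0 * ez g = 0 by rewrite zC ez0.
have zz : z0 * z0 = z0 by rewrite {1}z0E mulrBl mul1r ez0 subr0.
have Gp : G ^+ p = 1 by rewrite /G -gelX gp gel1.
have thet : (1 - G) * (th * et) = 1 - G.
  rewrite mulrA; have -> : (1 - G) * th = 1 - G ^+ c by rewrite -[RHS]opprB subrX1 -mulNr opprB.
  have -> : (1 - G ^+ c) * et = 1 - (G ^+ c) ^+ c' by rewrite -[RHS]opprB subrX1 -mulNr opprB.
  by rewrite -exprM Ew exprD mulnC exprM Gp expr1n mul1r expr1.
have com : th * et = et * th.
  apply: (commr_sum _) => j _; apply/commrX/commrX/commr_sym; apply: (commr_sum _) => i _.
  exact/commrX/commr_refl.
have y0 : z0 * (th * et) = z0.
  have h : G * (th * et - 1) = th * et - 1.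
    have /eqP := thet; rewrite mulrBl mul1r subr_eq => /eqP E.
    by rewrite mulrBr mulr1 [X in _ = X - 1]E [RHS]addrC !addrA addNr add0r addrC.
  have : z0 * (th * et - 1) = 0 by rewrite z0E mulrBl mul1r (ez_mul ar h) subrr.
  by rewrite mulrBr mulr1 => /eqP; rewrite subr_eq0 => /eqP.
pose th' := th * z0 + ez g; pose et' := et * z0 + ez g.
have mulz a b : (a * z0 + ez g) * (b * z0 + ez g) = z0 * (a * b) + ez g.
  rewrite mulrDl !mulrDr ee -(mulrA a z0 (ez g)) z0e mulr0 addr0.
  rewrite (mulrA (ez g) b z0) (ezC b) -(mulrA b (ez g) z0) ez0 mulr0 add0r; congr (_ + _).
  by rewrite -(mulrA a z0) (mulrA z0 b z0) (zC b) -(mulrA b z0 z0) zz mulrA zC.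
have te : th' * et' = 1 by rewrite mulz y0 z0E subrK.
have et1 : et' * th' = 1 by rewrite mulz -com y0 z0E subrK.
pose M : 'M[B]_1 := th'%:M; pose M' : 'M[B]_1 := et'%:M.
have MM' : M *m M' = 1%:M by rewrite -scalar_mxM te.
have M'M : M' *m M = 1%:M by rewrite -scalar_mxM et1.
have bM := actL_bij F MM' M'M.
pose T := @RelTriple _ _ F (freem _ 1) (freem _ 1) (actL F M) bM.
pose x : relK0 F := [:: (false, T)].
pose t i := \det (rrho (s i) th').
have thA l : inA l th.
  by apply: (subring_sum (SA l)) => i _; apply: (subringX (SA l)); apply: inA_gel.
have etA l : inA l et.
  by apply: (subring_sum (SA l)) => i _; do 2!apply: (subringX (SA l)); apply: inA_gel.
(* The central idempotent [ez g] is 1 or 0 on each component; accordingly [t i] is 1 or the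
   determinant of the cyclotomic unit. *)
have tcase i : (crho (k i) (ez g) = 1%:M /\ t i = 1) \/
    (crho (k i) (ez g) = 0 /\ t i = \det (rrho (s i) th) /\ \det (rrho (s i) th) * \det (rrho (s i) et) = 1).
  have [h|h] := central_idem (k i) ezC ee.
    right; split=> //; have hz : crho (k i) z0 = 1%:M by rewrite z0E c_rhoB c_rho1 h subr0.
    split; first by rewrite /t /= rhoD c_rhoM hz h addr0 mulmx1.
    rewrite -det_mulmx -r_M /=; have -> : crho (k i) (th * et) = crho (k i) (z0 * (th * et)).
      by rewrite [RHS]c_rhoM hz mul1mx.
    by rewrite y0 hz det1.
  left; split=> //; have hz : crho (k i) z0 = 0 by rewrite z0E c_rhoB c_rho1 h subrr.
  by rewrite /t /= rhoD c_rhoM hz h mulmx0 add0r det1.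
have tu l i : Dunit (s := s i) l (t i).
  have SD := c_sub (k i) l.
  have [[_ ->]|[_ [-> e1]]] := tcase i.
    by split; rewrite ?oner_eq0 ?invr1 //; apply: (subring1 SD).
  have d0 : \det (rrho (s i) th) != 0.
    by apply/eqP => d0; have /eqP := e1; rewrite d0 mul0r eq_sym oner_eq0.
  split=> //; first by apply: (det_in SD); exact: c_rhoin.
  have -> : (\det (rrho (s i) th))^-1 = \det (rrho (s i) et) by apply: (mulfI d0); rewrite mulfV.
  by apply: (det_in SD); exact: c_rhoin.
have [v0 vm vz vf] := vP_spec p_odd oG k.
have xx : relK0_eq x [:: (false, T)] by exact: relK0_refl.
have fr1 := @frame_id p R Q f ar gT 1.
have [u0 Uu0 Eu0] := vf x T _ _ _ _ _ _ _ _ _ _ _ fr1 fr1 xx.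
have vE i : vP x i = t i * u0 i by rewrite Eu0 mul1mx mulmx1 mxP_actL rdet11.
have hp i : Dunit (s := s i) P (vP x i).
  by rewrite vE; apply: Dunit_M; [exact: tu|exact: USp_Dunit].
have hl l i : l != P -> Dunit (s := s i) l (wL k i l x).
  move=> lP; have [_ _ _ wf] := wL_spec k i l; have d1 := @mxin1 _ _ (c_sub (k i) l) (1 * cd (k i)).
  have e1 : (1%:M : 'M[cK (s i)]_(1 * rd (s i))) *m 1%:M =
      rmu (s i) (mxP (idfun : {linear 'rV_1 -> 'rV_1}) (idfun : {linear 'rV_1 -> 'rV_1})
        (tmap F (idfun : {linear freem (gring R gT) 1 -> freem (gring R gT) 1}))).
    by rewrite mx_id_tmap rmu1 mulmx1.
  have [u1 Uu1 ->] := wf x 1%N (freem _ 1) (actL F M) bM 1%N idfun idfun _ _ (fun=> erefl) d1 d1 (mul1mx _) e1 xx.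
  rewrite mulmx1 mxP_actL; apply: Dunit_M => //.
  by rewrite -[\det _]/(rdet (s i) M) rdet11; apply: tu.
exists x.
  exists (p.-1 * p ^ n.-1)%N; last exact: (units_kill orth sum1 n0 hp hl).
  have p1 : (0 < p.-1)%N by case: (p) (prime_gt1 p_pr) => [|[]].
  by rewrite muln_gt0 p1 expn_gt0 prime_gt0.
move=> e /vz; have -> : vP (relK0_muln e x) = (fun i => t i ^+ e * u0 i ^+ e).
  by apply: functional_extensionality_dep => i; rewrite vm vE exprMn.
move=> /USp_M/(_ (USp_V (USp_X e Uu0)))[u2 [u2' [Au Au' uu' u'u Eu]]].
have {}Eu i : t i ^+ e = \det (rrho (s i) u2).
  by rewrite -Eu mulfK // expf_neq0 // (USp_0 i Uu0).
(* Every component sees the same residue [c2] of the unit [u2]: it is 1 where [t] is 1, and [c ^ e]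
   where [t] comes from the cyclotomic unit. *)
have [c2 cop2 hc2] := aug_coprime Au Au' uu'.
(* [ez g] has augmentation 1, so it does not vanish on all components. *)
have [i1 h1] : exists i, crho (k i) (ez g) <> 0.
  apply: contrapT => no; have : ez g = 0.
    apply: (rho_inj sum1) => i; rewrite rho0; apply: contrapT => h; apply: no; by exists i.
  move/(congr1 (@aug Q gT)); rewrite rmorph0 /avg rmorphM /= aug_sc rmorph_sum.
  rewrite (eq_bigr (fun=> 1)) => [|j _]; last by rewrite rmorphXn /= aug_gel expr1n.
  rewrite sumr_const card_ord mulVf ?(p_neq0 ar) // => /eqP; by rewrite oner_eq0.
(* [ez g] is not 1, since [g] is not the identity. *)
have [i2 h2] : exists i, crho (k i) (ez g) <> 1%:M.
  apply: contrapT => no; have e1 : ez g = 1.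
    apply: (rho_inj sum1) => i; rewrite c_rho1; apply: contrapT => h; apply: no; by exists i.
  have := gel_ez ar gp; rewrite e1 mulr1 -(gel1 Q gT) => /ffunP/(_ g); rewrite !gelE eqxx.
  have g1 : g != 1%g by rewrite -order_gt1 og prime_gt1.
  by rewrite (negPf g1) => /eqP; rewrite oner_eq0.
have r1 : c2 = 1 %[mod p].
  apply: (nat_cong (F := k i1)); have SD := c_sub (k i1) P; apply: (cong_sym SD).
  have [[_ t1]|[h _]] := tcase i1; last by rewrite h in h1.
  have := residue p_odd oG (s i1) Au cop2 hc2; rewrite -Eu t1 expr1n; exact.
have r2 : (c ^ e)%N = c2 %[mod p].
  apply: (nat_cong (F := k i2)); have SD := c_sub (k i2) P.
  have [[h _]|[_ [t2 _]]] := tcase i2; first by rewrite h in h2.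
  have hth : cong (I P) p%:R (aug th) c%:R.
    rewrite rmorph_sum (eq_bigr (fun=> 1)) => [|j _]; last by rewrite rmorphXn /= aug_gel expr1n.
    by rewrite sumr_const card_ord; apply: (cong_refl (ar_sub P)).
  have r3 := residue p_odd oG (s i2) (thA P) cop hth.
  have r4 := residue p_odd oG (s i2) Au cop2 hc2.
  apply: (cong_trans SD) r4; rewrite -Eu t2 natrX; apply: (cong_sym SD).
  by apply: (congX SD) => //; [exact: c_piD|move=> y; apply: mulrC|exact: (subring_nat SD)].
by apply: cprim; rewrite r2 r1.
Qed.
End LowerBound.

Theorem arith_exponents (p : nat) (R : nzRingType) (Q : fieldType) (f : {rmorphism R -> Q})
    (ar : arith p f) (gT : finGroupType) (n : nat) :
  odd p -> #|gT| = (p ^ n)%N -> (1 < #|gT|)%N ->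
  (exists2 e : nat, is_exponent (DT (f := f) (gT := gT)) e
     & (p.-1 %| e)%N /\ (e %| (p.-1 * #|gT|) %/ p)%N) /\
  (exists2 e : nat, is_exponent (DT_ker (f := f) (gT := gT)) e & (e %| #|gT| %/ p)%N).
Proof.
move=> p_odd oG ntG; have p_pr := p_prime ar; have p0 := prime_gt0 p_pr.
have n0 : (0 < n)%N by rewrite lt0n; apply/eqP => n0; move: ntG; rewrite oG n0.
have [J [k [orth sum1]]] := wedderburn ar p_odd oG.
have nE : (p ^ n %/ p = p ^ n.-1)%N by rewrite -{1}(prednK n0) expnSr mulnK.
have nE' : ((p.-1 * p ^ n) %/ p = p.-1 * p ^ n.-1)%N by rewrite -{1}(prednK n0) expnSr mulnA mulnK.
have q0 : (0 < p ^ n.-1)%N by rewrite expn_gt0 p0.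
rewrite oG nE nE'; split.
  have kD := DT_kills p_odd oG n0 orth sum1.
  have [|e he hd] := exponent_ex _ kD.
    by rewrite muln_gt0 q0 andbT; case: (p) (prime_gt1 p_pr) => [|[]].
  exists e => //; split; last exact: hd.
  have [x tx hx] := lower_bound p_odd oG n0 orth sum1.
  by apply: hx; case: he => _ ke _; apply: ke.
have kD := DT_ker_kills p_odd oG n0 orth sum1.
have [e he hd] := exponent_ex q0 kD.
by exists e => //; apply: hd.
Qed.

(** * The integers and the p-adic integers *)
Section RationalArith.
Import Order.TTheory Num.Theory.
Definition ratI (l : nat) (q : rat) : Prop := ~~ (l %| `|denq q|)%N.

Lemma ratIP l q : prime l ->
  ratI l q <-> exists (a : int) (b : nat), ~~ (l %| b)%N /\ q * b%:R = a%:~R.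
Proof.
move=> l_pr; split=> [h|[a [b [lb E]]]].
  exists (numq q), `|denq q|%N; split=> //.
  by rewrite numqE -[denq q]gez0_abs ?denq_ge0 // pmulrn.
apply: contra lb => ld.
have E' : (numq q * b%:Z = a * denq q)%R.
  by apply: (@intr_inj rat); rewrite !rmorphM /= numqE -E; ring.
have : (`|denq q| %| `|numq q| * b)%N.
  by rewrite -[b]/`|b%:Z|%N -abszM E' abszM dvdn_mull.
rewrite Gauss_dvdr; last by rewrite coprime_sym coprime_num_den.
exact: dvdn_trans.
Qed.

Lemma ratI_sub l : prime l -> subring_pred (ratI l).
Proof.
move=> l_pr; split.
- apply/(ratIP _ l_pr); exists 1, 1%N; split; last by rewrite mulr1.
  by rewrite dvdn1; apply: contraTneq l_pr => ->.
- move=> x y /(ratIP _ l_pr)[a [b [lb E]]] /(ratIP _ l_pr)[a' [b' [lb' E']]].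
  apply/(ratIP _ l_pr); exists (a * b'%:Z - a' * b%:Z), (b * b')%N; split.
    by rewrite Euclid_dvdM // negb_or lb.
  by rewrite natrM rmorphB !rmorphM /= -E -E' -?pmulrn; ring.
- move=> x y /(ratIP _ l_pr)[a [b [lb E]]] /(ratIP _ l_pr)[a' [b' [lb' E']]].
  apply/(ratIP _ l_pr); exists (a * a'), (b * b')%N; split.
    by rewrite Euclid_dvdM // negb_or lb.
  by rewrite natrM rmorphM /= -E -E'; ring.
Qed.

Lemma ratI_int l (a : int) : prime l -> ratI l a%:~R.
Proof.
move=> l_pr; apply/(ratIP _ l_pr); exists a, 1%N; split; last by rewrite mulr1.
by rewrite dvdn1; apply: contraTneq l_pr => ->.
Qed.

Lemma ratI_div l (a : int) (b : nat) : prime l -> ~~ (l %| b)%N -> ratI l (a%:~R / b%:R).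
Proof.
move=> l_pr lb; apply/(ratIP _ l_pr); exists a, b; split=> //; rewrite mulfVK //.
by rewrite pnatr_eq0; apply: contraNneq lb => ->; rewrite dvdn0.
Qed.

Lemma rat_split l q : prime l -> exists m (b : nat), ~~ (l %| b)%N /\ q * ((l ^ m * b)%N)%:R = (numq q)%:~R.
Proof.
move=> l_pr; have d0 : (0 < `|denq q|)%N by rewrite absz_gt0 denq_neq0.
have [b lb dE] := pfactor_coprime l_pr d0.
exists (logn l `|denq q|), b; split; first by rewrite -prime_coprime.
by rewrite mulnC -dE numqE -{2}[denq q]gez0_abs ?denq_ge0 // pmulrn.
Qed.

Lemma int_bez l m b : prime l -> ~~ (l %| b)%N -> exists u v : int, u * b%:Z + v * (l ^ m)%N%:Z = 1.
Proof.
move=> l_pr lb; have [u [v E]] := Bezoutz b%:Z (l ^ m)%N%:Z.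
exists u, v; rewrite E; congr Posz; apply/eqP.
change (coprime b (l ^ m)); case: m {E} => [|m]; first by rewrite expn0 coprimen1.
by rewrite coprime_pexpr // coprime_sym prime_coprime.
Qed.

Lemma ratI_glob q : (forall l, prime l -> ratI l q) -> exists a, q = int_to_rat a.
Proof.
move=> h; exists (numq q); rewrite /int_to_rat /= numqE; suff -> : denq q = 1 by rewrite mulr1.
rewrite -[denq q]gez0_abs ?denq_ge0 //; congr Posz; apply/eqP; apply: contraT => d1.
have d2 : (1 < `|denq q|)%N by rewrite ltn_neqAle eq_sym d1 absz_gt0 denq_neq0.
by have := h _ (pdiv_prime d2); rewrite /ratI pdiv_dvd.
Qed.

(** Partial fractions: with [q = N / (l^m b)] and [u b + v l^(m+t) = 1], one has
    [q = N u / l^m + l^t N v / b], and the first summand is integral away from [l]. *)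
Lemma ratI_approx l q t : prime l -> exists2 q', (forall l', prime l' -> l' != l -> ratI l' q')
  & cong (ratI l) (l%:R ^+ t) q q'.
Proof.
move=> l_pr; have [m [b [lb E]]] := rat_split q l_pr; move: (numq q) E => N E.
  have [u [v uv]] := int_bez (m + t) l_pr lb.
  have l0 : l%:R != 0 :> rat by rewrite pnatr_eq0 -lt0n prime_gt0.
  have b0 : b%:R != 0 :> rat by rewrite pnatr_eq0; apply: contraNneq lb => ->; rewrite dvdn0.
  exists ((N * u)%:~R / (l ^ m)%N%:R).
    move=> l' l'_pr ll'; apply: ratI_div => //; apply/negP => ld.
    by move: ld; rewrite Euclid_dvdX // dvdn_prime2 // (negPf ll').
  exists ((N * v)%:~R / b%:R); first exact: ratI_div.
  have lm0 : l%:R ^+ m != 0 :> rat by rewrite expf_neq0.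
  have -> : q = N%:~R / (l%:R ^+ m * b%:R) by rewrite -E natrM natrX mulfK // mulf_neq0.
  have := congr1 (fun z : int => z%:~R : rat) uv; rewrite rmorphD !rmorphM /= -!pmulrn expnD natrM !natrX => uv'.
  transitivity (N%:~R / (l%:R ^+ m * b%:R) * (u%:~R * b%:R + v%:~R * (l%:R ^+ m * l%:R ^+ t)) : rat).
    by rewrite uv' mulr1.
  rewrite ?natrX ?rmorphM /=; move: (l%:R ^+ m) lm0 => y y0 /=.
  by field; rewrite b0 y0.
Qed.

Lemma ratI_res l q : prime l -> ratI l q -> exists m : nat, cong (ratI l) l%:R q m%:R.
Proof.
move=> l_pr /(ratIP _ l_pr)[a [b [lb E]]] /=.
  have [u [v]] := int_bez 1 l_pr lb; rewrite expn1 => uv.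
  have b0 : b%:R != 0 :> rat by rewrite pnatr_eq0; apply: contraNneq lb => ->; rewrite dvdn0.
  have l0 : (0 < l)%N := prime_gt0 l_pr.
  exists `|((a * u) %% l)%Z|%N; exists (((a * u) %/ l)%Z%:~R + (a * v)%:~R / b%:R).
    by apply: (subringD (ratI_sub l_pr)); [exact: ratI_int|exact: ratI_div].
  have mE : (`|((a * u) %% l)%Z|%N%:R : rat) = ((a * u) %% l)%Z%:~R.
    by rewrite pmulrn gez0_abs ?modz_ge0 // eqz_nat -lt0n.
  rewrite mE; have := congr1 (fun z : int => z%:~R : rat) (divz_eq (a * u) l).
  rewrite rmorphD rmorphM /= -[l%:~R]pmulrn => dE.
  have -> : ((a * u) %% l)%Z%:~R = (a * u)%:~R - ((a * u) %/ l)%Z%:~R * l%:R :> rat by rewrite dE addrC addKr.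
  have := congr1 (fun z : int => z%:~R : rat) uv; rewrite rmorphD !rmorphM /= -!pmulrn => uv'.
  apply: (mulIf b0); rewrite E ?rmorphM /=.
  transitivity (a%:~R * (u%:~R * b%:R + v%:~R * l%:R) : rat); first by rewrite uv' mulr1.
  by field; exact: b0.
Qed.

Lemma ratI_unit l q : prime l -> ratI l q -> ~ cong (ratI l) l%:R q 0 -> ratI l q^-1.
Proof.
move=> l_pr /(ratIP _ l_pr)[a [b [lb E]]] /= nc; apply/(ratIP _ l_pr).
  have b0 : b%:R != 0 :> rat by rewrite pnatr_eq0; apply: contraNneq lb => ->; rewrite dvdn0.
  exists (Num.sg a * b%:Z), `|a|%N; split.
    apply/negP => la; apply: nc; have /dvdzP[c cE] : (l %| a)%Z by [].
    exists (c%:~R / b%:R); first exact: ratI_div.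
    by rewrite add0r; apply: (mulIf b0); rewrite E cE rmorphM /= -pmulrn; field; exact: b0.
  have a0 : a != 0.
    apply/eqP => a0; apply: nc; exists 0; first exact: (subring0 (ratI_sub l_pr)).
    by rewrite mulr0 addr0; apply/eqP; have /eqP := E; rewrite a0 mulf_eq0 (negPf b0) orbF.
  have q0 : q != 0 by apply: contraNneq a0 => q0; move/eqP: E; rewrite q0 mul0r eq_sym intr_eq0.
  apply: (mulfI q0); rewrite mulrA mulfV // mul1r rmorphM /= mulrCA -pmulrn E -rmorphM /= -normrEsg.
  by rewrite -abszE pmulrn.
Qed.

Lemma ratI_den l q : prime l -> exists m, ratI l (l%:R ^+ m * q).
Proof.
move=> l_pr; have [m [b [lb E]]] := rat_split q l_pr.
  exists m; apply/(ratIP _ l_pr); exists (numq q), b; split=> //.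
  by rewrite -E natrM natrX mulrCA mulrA.
Qed.

Lemma ratI_sep l q : prime l -> (forall m, exists2 z, ratI l z & q = l%:R ^+ m * z) -> q = 0.
Proof.
move=> l_pr h; apply/eqP; apply: contraT => q0.
  have n0 : (0 < `|numq q|)%N by rewrite absz_gt0 numq_eq0.
  (* The exponent is the absolute value of the numerator itself: a nonzero integer [k] is smaller in
     absolute value than [l ^ |k|]. *)
  have [z /(ratIP _ l_pr)[a [b [lb E]]] Ez] := h `|numq q|%N.
  have E' : numq q * b%:Z = (l ^ `|numq q|)%N%:Z * a * denq q.
    apply: (@intr_inj rat); rewrite !rmorphM /= -[(l ^ _)%N%:~R]pmulrn natrX -E numqE {1}Ez -pmulrn; ring.
  have : (l ^ `|numq q| %| `|numq q| * b)%N.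
    by rewrite -[X in (_ %| _ * X)%N]/`|b%:Z|%N -abszM E' !abszM -mulnA dvdn_mulr.
  rewrite Gauss_dvdl; last by rewrite coprime_pexpl // prime_coprime.
  by move/(dvdn_leq n0); rewrite leqNgt ltn_expl // prime_gt1.
Qed.

Lemma ratI_ninv l : prime l -> ~ ratI l l%:R^-1.
Proof.
move=> l_pr /(ratIP _ l_pr)[a [b [lb E]]].
  have l0 : l%:R != 0 :> rat by rewrite pnatr_eq0 -lt0n prime_gt0.
  case/negP: lb; have : b%:Z = a * l%:Z.
    by apply: (@intr_inj rat); rewrite rmorphM /= -E -!pmulrn mulrAC mulVf // mul1r.
  by move/(congr1 absz); rewrite abszM /= => ->; apply: dvdn_mull.
Qed.

Lemma rat_arith p : prime p -> arith p int_to_rat.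
Proof.
move=> p_pr.
refine (@Arith p int rat int_to_rat {l : nat | prime l} val (exist _ p p_pr) (fun l => ratI (val l))
  (fun l => valP l) erefl val_inj (fun l => ratI_sub (valP l)) _ intr_inj _ _ _
  (fun l q => ratI_res (valP l)) (fun l q => ratI_unit (valP l)) (fun l q => ratI_den q (valP l))
  (fun l q => ratI_sep (valP l)) (fun l => ratI_ninv (valP l))).
- by move=> m; rewrite pnatr_eq0.
- move=> q; split=> [h|[a ->] l]; last exact: (ratI_int a (valP l)).
  by apply: ratI_glob => l l_pr; exact: (h (exist _ l l_pr)).
- move=> q; exists (pmap insub (primes `|denq q|)) => l.
  rewrite mem_pmap_sub mem_primes => h; apply: contra h => ->.
  by rewrite (valP l) absz_gt0 denq_neq0.
- move=> [l l_pr] q t; have [q' h1 h2] := ratI_approx q t l_pr; exists q' => // -[l' l'_pr] nl.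
  by apply: h1 => //; apply: contra nl => /eqP e; apply/eqP/val_inj.
Qed.
End RationalArith.

Section PadicArith.
Import Order.TTheory Num.Theory.
Local Open Scope quotient_scope.
Variables (p : nat) (p_pr : prime p).
Local Notation Zp := (padic_int p_pr).
Local Notation Qp := (padic p_pr).
Local Notation q n := ((p ^ n)%N : int).
Local Notation rem := (@padic_rem p p_pr).
Local Notation F := (padic_int_to_padic p_pr).

Lemma remD (x y : Zp) n : rem (x + y) n = ((rem x n + rem y n)%R %% q n)%Z. Proof. by []. Qed.
Lemma remM (x y : Zp) n : rem (x * y) n = ((rem x n * rem y n)%R %% q n)%Z. Proof. by []. Qed.
Lemma rem_nat m n : rem (m%:R : Zp) n = ((m : int) %% q n)%Z.
Proof.
elim: m => [|m IH]; first by rewrite padic_rem0 mod0z.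
by rewrite mulrS remD IH [rem 1 n]/((1 : int) %% q n)%Z modzDml modzDmr -intS.
Qed.
Let p0 : (p : int) != 0. Proof. by rewrite eqz_nat -lt0n prime_gt0. Qed.

Lemma rem1_mod (x : Zp) n : rem x 1 = (rem x n.+1 %% p)%Z.
Proof. by rewrite -(padic_remK x 1) (padic_modD x n 1) addn1 expn1. Qed.

Lemma padic_div (x : Zp) : rem x 1 = 0 -> exists z, x = p%:R * z.
Proof.
move=> x1; have dv n : (p %| rem x n.+1)%Z by apply/dvdz_mod0P; rewrite -rem1_mod.
pose t n := (rem x n.+1 %/ p)%Z.
have tE n : rem x n.+1 = t n * p by rewrite /t divzK.
have ht n : (t n %% q n)%Z = (t n.+1 %% q n)%Z.
  apply/eqP; rewrite eqz_mod_dvd; have /eqP := padic_mod x n.+1.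
  rewrite eqz_mod_dvd !tE -mulrBl => /dvdzP[k kE]; apply/dvdzP; exists k.
  by apply: (mulIf p0); rewrite kE expnSr PoszM mulrA.
exists (padic_mk p_pr ht); apply: padicP => n.
rewrite remM rem_nat modzMml [rem (padic_mk _ _) n]/(t n %% q n)%Z modzMmr mulrC -tE.
exact: padic_remP.
Qed.

(** Inverses modulo the powers of [p] are chosen independently by Bezout and are compatible because
    inverses modulo [p ^ n] are unique. *)
Lemma padic_inv_ex (x : Zp) : rem x 1 <> 0 -> exists y, x * y = 1.
Proof.
move=> x1; have ex n : exists u : int, exists a : int, u * rem x n = 1 + a * q n.
  case: n => [|n]; first by exists 0, (-1); rewrite mul0r expn0 mulr1 subrr.
  have [u [v E]] := Bezoutz (rem x n.+1) (q n.+1).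
  have c1 : gcdz (rem x n.+1) (q n.+1) = 1.
    congr Posz; apply/eqP; change (coprime `|rem x n.+1| (p ^ n.+1)).
    rewrite coprime_pexpr // coprime_sym prime_coprime //; apply/negP => pd; apply: x1.
    by rewrite (rem1_mod x n); apply/dvdz_mod0P.
  by exists u, (- v); rewrite -c1 -E mulNr addrK.
pose u n := projT1 (cid (ex n)).
have hu n : exists a : int, u n * rem x n = 1 + a * q n by rewrite /u; case: cid.
have hs n : (u n %% q n)%Z = (u n.+1 %% q n)%Z.
  have [a Ea] := hu n; have [b Eb] := hu n.+1.
  have /eqP := padic_mod x n; rewrite eqz_mod_dvd => /dvdzP[c Ec].
  apply/eqP; rewrite eqz_mod_dvd; apply/dvdzP; exists (- u n * u n.+1 * c - u n * b * p + u n.+1 * a).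
  have -> : u n - u n.+1 = u n * (u n.+1 * rem x n.+1 - b * q n.+1) - u n.+1 * (u n * rem x n - a * q n).
    by rewrite Ea Eb; ring.
  have -> : rem x n.+1 = rem x n - c * q n by rewrite -Ec; ring.
  by rewrite expnSr PoszM; ring.
exists (padic_mk p_pr hs); apply: padicP => n.
rewrite remM [rem (padic_mk _ _) n]/(u n %% q n)%Z modzMmr mulrC.
by have [a ->] := hu n; rewrite addrC modzMDl.
Qed.

Lemma padic_val (x : Zp) : x != 0 -> exists m u u', x = p%:R ^+ m * u /\ u * u' = 1.
Proof.
move=> x0; have [k xk] : exists k, rem x k <> 0.
  apply: contrapT => h; case/eqP: x0; apply: padicP => k; rewrite padic_rem0.
  by apply: contrapT => xk; apply: h; exists k.
elim: k x {x0} xk => [|k IH] x xk.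
  by case: xk; rewrite -padic_remK expn0 modz1.
have [x1|x1] := pselect (rem x 1 = 0); last first.
  by have [y xy] := padic_inv_ex x1; exists 0%N, x, y; rewrite mul1r.
have [z zE] := padic_div x1.
have [|m [u [u' [E uu']]]] := IH z.
  move=> zk; apply: xk; rewrite zE remM rem_nat modzMml; apply/dvdz_mod0P.
  have : (rem z k.+1 %% q k)%Z = 0 by rewrite -(padic_mod z k) padic_remK.
  by move/dvdz_mod0P/dvdzP=> [c ->]; rewrite mulrCA expnS PoszM dvdz_mull.
by exists m.+1, u, u'; rewrite zE E exprS mulrA.
Qed.

Lemma padic_frac (x : Qp) : exists a b, b != 0 /\ x = F a / F b.
Proof.
elim/quotW: x => x; exists (fraction.frac x).1, (fraction.frac x).2.
have d0 := denom_ratioP x; split=> //.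
have d1 : F (fraction.frac x).2 != 0 by rewrite tofrac_eq0.
apply: (mulIf d1); rewrite mulfVK //.
have : FracField.mul (\pi_(FracField.type _) x) (FracField.tofrac (fraction.frac x).2) =
    FracField.tofrac (fraction.frac x).1.
  rewrite !piE; apply/eqmodP; rewrite /= FracField.equivfE /FracField.mulf.
  by rewrite !numden_Ratio ?mulf_neq0 ?oner_eq0 // !mulr1 mulrC.
by [].
Qed.

Definition padicI (x : Qp) : Prop := exists a, x = F a.

Lemma padicI_sub : subring_pred padicI.
Proof.
split; first by exists 1; rewrite rmorph1.
  by move=> _ _ [a ->] [b ->]; exists (a - b); rewrite rmorphB.
by move=> _ _ [a ->] [b ->]; exists (a * b); rewrite rmorphM.
Qed.

Lemma padic_tofrac_inj : injective F.
Proof. by move=> x y /eqP; rewrite tofrac_eq => /eqP. Qed.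

Lemma padicI_cong (a b : Zp) : cong padicI p%:R (F a) (F b) <-> rem (a - b) 1 = 0.
Proof.
split=> [[_ [z ->] E]|/padic_div[z zE]].
  have -> : a - b = p%:R * z.
    by apply: padic_tofrac_inj; rewrite rmorphB rmorphM rmorph_nat E addrC addKr.
  by rewrite remM rem_nat expn1 modzz mul0r mod0z.
exists (F z); first by exists z.
by rewrite -(rmorph_nat F) -rmorphM -zE rmorphB addrC subrK.
Qed.

Lemma padic_char0 n : n.+1%:R != 0 :> Qp.
Proof.
rewrite -(rmorph_nat F) tofrac_eq0; apply/eqP => /(congr1 (fun x => rem x n.+1)).
rewrite rem_nat padic_rem0 modz_small //; apply/andP; split=> //.
by rewrite ltz_nat ltn_expl // prime_gt1.
Qed.

Lemma padicI_res x : padicI x -> exists m : nat, cong padicI p%:R x m%:R.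
Proof.
move=> [a ->]; exists `|rem a 1|%N.
have -> : (`|rem a 1|%N%:R : Qp) = F `|rem a 1|%N%:R by rewrite rmorph_nat.
apply: (proj2 (padicI_cong a `|rem a 1|%N%:R)).
have r0 : (0 <= rem a 1)%R by rewrite -padic_remK modz_ge0 // expn1.
rewrite -[a - _]/(a + - _) remD.
have -> : rem (- (`|rem a 1|%:R : Zp)) 1 = ((- rem `|rem a 1|%:R 1)%R %% q 1)%Z by [].
by rewrite modzDmr rem_nat gez0_abs // padic_remK subrr mod0z.
Qed.

Lemma padicI_unit x : padicI x -> ~ cong padicI p%:R x 0 -> padicI x^-1.
Proof.
move=> [a ->] nc; have a1 : rem a 1 <> 0.
  move=> a1; apply: nc; have := proj2 (padicI_cong a 0); rewrite rmorph0 subr0; exact.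
have [y ay] := padic_inv_ex a1; exists y.
have Fa : F a * F y = 1 by rewrite -rmorphM ay rmorph1.
have Fa0 : F a != 0 by apply/eqP => a0; have /eqP := Fa; rewrite a0 mul0r eq_sym oner_eq0.
by apply: (mulfI Fa0); rewrite mulfV.
Qed.

Lemma padic_p_neq0 : p%:R != 0 :> Qp.
Proof. by have := padic_char0 p.-1; rewrite (prednK (prime_gt0 p_pr)). Qed.

Lemma mulf_div_cancel (K : fieldType) (x y z : K) : y != 0 -> y * (x / (y * z)) = x / z.
Proof. by move=> y0; rewrite invfM mulrCA mulVKf. Qed.

Lemma padicI_den x : exists m, padicI (p%:R ^+ m * x).
Proof.
have [a [b [b0 ->]]] := padic_frac x.
have [m [u [u' [-> uu']]]] := padic_val b0; exists m, (a * u').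
have u0 : F u * F u' = 1 by rewrite -rmorphM uu' rmorph1.
have Fu0 : F u != 0 by apply/eqP => h; have /eqP := u0; rewrite h mul0r eq_sym oner_eq0.
have pF0 : p%:R ^+ m != 0 :> Qp by rewrite expf_neq0 // padic_p_neq0.
have -> : F (p%:R ^+ m * u) = p%:R ^+ m * F u by rewrite (rmorphM F) -natrX rmorph_nat natrX.
have -> : F (a * u') = F a * F u' by exact: rmorphM.
have uV : (F u)^-1 = F u' by apply: (mulfI Fu0); rewrite mulfV.
rewrite -uV; exact: (mulf_div_cancel _ _ pF0).
Qed.

Lemma padicI_sep x : (forall m, exists2 z, padicI z & x = p%:R ^+ m * z) -> x = 0.
Proof.
move=> h; have [_ [a ->] xE] := h 0%N; rewrite mul1r in xE; rewrite xE in h *.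
suff -> : a = 0 by rewrite rmorph0.
apply: padicP => m; rewrite padic_rem0; have [_ [z ->] E] := h m.
have -> : a = (p ^ m)%N%:R * z.
  by apply: padic_tofrac_inj; rewrite E rmorphM rmorph_nat natrX.
by rewrite remM rem_nat modzz mul0r mod0z.
Qed.

Lemma padicI_ninv : ~ padicI p%:R^-1.
Proof.
move=> [a E]; have : (1 : Zp) = p%:R * a.
  by apply: padic_tofrac_inj; rewrite rmorphM rmorph_nat -E mulfV ?rmorph1 // padic_p_neq0.
move/(congr1 (fun x => rem x 1)); rewrite remM rem_nat expn1 modzz mul0r mod0z.
have r1 : rem (1%N%:R : Zp) 1 = 0 -> False.
  by rewrite rem_nat expn1 modz_small //= ltz_nat prime_gt1.
exact: r1.
Qed.

(** There is one prime and [ar_I] is the ring of [p]-adic integers itself, so the approximation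
    axiom holds trivially with the element approximating itself. *)
Lemma padic_arith : arith p F.
Proof.
refine (@Arith p Zp Qp F unit (fun=> p) tt (fun=> padicI) (fun=> p_pr) erefl _ (fun=> padicI_sub)
  padic_char0 padic_tofrac_inj _ _ _ (fun=> padicI_res) (fun=> padicI_unit) (fun=> padicI_den)
  (fun=> padicI_sep) (fun=> padicI_ninv)).
- by move=> [] [].
- by move=> x; split=> [/(_ tt)//|h _].
- by move=> x; exists [:: tt] => -[].
- move=> [] x t; exists x => [[]//|]; exists 0; last by rewrite mulr0 addr0.
  exact: (subring0 padicI_sub).
Qed.
End PadicArith.

Theorem theorem3p1 (p : nat) (p_pr : prime p) (p_odd : odd p)
    (gT : finGroupType) (n : nat) (cardG : #|gT| = (p ^ n)%N)
    (ntG : (1 < #|gT|)%N) :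
  (* (i) *)
  (exists2 e : nat, is_exponent (DT (f := int_to_rat) (gT := gT)) e
     & (p.-1 %| e)%N /\ (e %| (p.-1 * #|gT|) %/ p)%N)
  /\
  (* (ii) *)
  (exists2 e : nat, is_exponent (DT_ker (f := int_to_rat) (gT := gT)) e
     & (e %| #|gT| %/ p)%N)
  /\
  (* (iii) *)
  (exists2 e : nat,
     is_exponent (DT (f := padic_int_to_padic p_pr) (gT := gT)) e
     & (p.-1 %| e)%N /\ (e %| (p.-1 * #|gT|) %/ p)%N)
  /\
  (exists2 e : nat,
     is_exponent (DT_ker (f := padic_int_to_padic p_pr) (gT := gT)) e
     & (e %| #|gT| %/ p)%N).
Proof.
have [h1 h2] := arith_exponents (rat_arith p_pr) p_odd cardG ntG.
have [h3 h4] := arith_exponents (padic_arith p_pr) p_odd cardG ntG.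
by split=> //; split=> //; split.
Qed.
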